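(* Let $n\geq 2$ and let $d_1,\dots,d_n$ be positive integers with $\sum_{i=1}^n 1/d_i<1$. Let $s>0$ and let $a_1,\dots,a_{n-1}\in\mathbb{C}$ satisfy $|a_1|=(d_{\max}^2 s)^{1/d_1}$ and $|a_i|=s^{1/d_i}|a_{i-1}|$ for $2\le i\le n-1$ (arguments of the $a_i$ arbitrary). If $s>0$ is small enough, then the Julia set of $P_{d_1,\dots,d_n}$ is a Cantor set of circles, $1$ is a parabolic fixed point of $P_{d_1,\dots,d_n}$ with multiplier $1$, and $P_{d_1,\dots,d_n}$ has exactly one parabolic fixed point.
   Context: $d_{\max}:=\max\{d_1,\dots,d_n\}$ and $D_i:=d_i+d_{i+1}$ for $1\le i\le n-1$. Define $C_n=\sum_{i=1}^{n-1}\frac{(-1)^{i-1}D_i a_i^{D_i}}{1-a_i^{D_i}}$, $B_n=\frac{C_n}{1+C_n}$, $A_n=\frac{1}{1+C_n}\prod_{i=1}^{n-1}(1-a_i^{D_i})^{(-1)^i}$, and $P_{d_1,\dots,d_n}(z)=A_n\frac{d_1 z^{(-1)^{n-1}d_n}}{(d_1-1)z^{d_1}+1}\prod_{i=1}^{n-1}(z^{D_i}-a_i^{D_i})^{(-1)^{i-1}}+B_n$. A subset of $\widehat{\mathbb{C}}$ is a Cantor set of circles if it is homeomorphic to $\mathcal{C}\times\mathbb{S}^1$, where $\mathcal{C}$ is the middle-third Cantor set and $\mathbb{S}^1$ the unit circle. *)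

(* Defs.v *)
(* classical reals. Complex numbers are modelled as R*R,
   the Riemann sphere as option Cx (None = infinity) with the chordal metric. *)
From Stdlib Require Import Reals Lra Lia ClassicalEpsilon.
Open Scope R_scope.

Definition Cx : Type := (R * R)%type.
Definition Cx0 : Cx := (0, 0).
Definition Cx1 : Cx := (1, 0).
Definition RtoC (x : R) : Cx := (x, 0).
Definition Cadd (z w : Cx) : Cx := (fst z + fst w, snd z + snd w).
Definition Copp (z : Cx) : Cx := (- fst z, - snd z).
Definition Csub (z w : Cx) : Cx := Cadd z (Copp w).
Definition Cmul (z w : Cx) : Cx :=
  (fst z * fst w - snd z * snd w, fst z * snd w + snd z * fst w).
Definition Cinv (z : Cx) : Cx :=
  let r := fst z * fst z + snd z * snd z in (fst z / r, - snd z / r).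
Definition Cdiv (z w : Cx) : Cx := Cmul z (Cinv w).
Fixpoint Cpow (z : Cx) (k : nat) : Cx :=
  match k with O => Cx1 | S k' => Cmul z (Cpow z k') end.
Definition Cnorm (z : Cx) : R := sqrt (fst z * fst z + snd z * snd z).

Definition Cpow_sign (b : bool) (z : Cx) (k : nat) : Cx :=
  if b then Cpow z k else Cinv (Cpow z k).

Fixpoint Csum (f : nat -> Cx) (m : nat) : Cx :=
  match m with O => Cx0 | S m' => Cadd (Csum f m') (f (S m')) end.
Fixpoint Cprod (f : nat -> Cx) (m : nat) : Cx :=
  match m with O => Cx1 | S m' => Cmul (Cprod f m') (f (S m')) end.

Fixpoint dmax (d : nat -> nat) (n : nat) : nat :=
  match n with O => O | S n' => Nat.max (dmax d n') (d (S n')) end.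

Definition DD (d : nat -> nat) (i : nat) : nat := (d i + d (S i))%nat.

Definition sign_pos (k : nat) : bool := Nat.even k.

Definition Cn (n : nat) (d : nat -> nat) (a : nat -> Cx) : Cx :=
  Csum (fun i =>
    let t := Cdiv (Cmul (RtoC (INR (DD d i))) (Cpow (a i) (DD d i)))
                  (Csub Cx1 (Cpow (a i) (DD d i))) in
    if sign_pos (i - 1) then t else Copp t) (n - 1).
Definition Bn (n : nat) (d : nat -> nat) (a : nat -> Cx) : Cx :=
  Cdiv (Cn n d a) (Cadd Cx1 (Cn n d a)).
Definition An (n : nat) (d : nat -> nat) (a : nat -> Cx) : Cx :=
  Cmul (Cinv (Cadd Cx1 (Cn n d a)))
       (Cprod (fun i => Cpow_sign (sign_pos i) (Csub Cx1 (Cpow (a i) (DD d i))) 1)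
              (n - 1)).

(** The rational function P_{d_1,...,d_n} as a formula on Cx
    (garbage values at its finitely many poles; the genuine map on the
     Riemann sphere is obtained below by taking limits). *)
Definition Pformula (n : nat) (d : nat -> nat) (a : nat -> Cx) (z : Cx) : Cx :=
  Cadd
   (Cmul (An n d a)
     (Cmul
       (Cdiv (Cmul (RtoC (INR (d 1%nat))) (Cpow_sign (sign_pos (n - 1)) z (d n)))
             (Cadd (Cmul (RtoC (INR (d 1%nat) - 1)) (Cpow z (d 1%nat))) Cx1))
       (Cprod (fun i => Cpow_sign (sign_pos (i - 1))
                          (Csub (Cpow z (DD d i)) (Cpow (a i) (DD d i))) 1)
              (n - 1))))
   (Bn n d a).

Definition Chat : Type := option Cx.
Definition dchord (p q : Chat) : R :=
  match p, q with
  | Some z, Some w =>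
      2 * Cnorm (Csub z w) / sqrt ((1 + Cnorm z ^ 2) * (1 + Cnorm w ^ 2))
  | Some z, None | None, Some z => 2 / sqrt (1 + Cnorm z ^ 2)
  | None, None => 0
  end.

Definition punct_lim (f : Cx -> Cx) (p q : Chat) : Prop :=
  forall eps, 0 < eps -> exists delta, 0 < delta /\
    forall u : Cx, 0 < dchord (Some u) p < delta -> dchord (Some (f u)) q < eps.

Definition ext (f : Cx -> Cx) (p : Chat) : Chat :=
  epsilon (inhabits None) (fun q => punct_lim f p q).

Definition in_fatou (F : Chat -> Chat) (p : Chat) : Prop :=
  exists delta, 0 < delta /\
    forall w, dchord w p < delta ->
      forall eps, 0 < eps -> exists eta, 0 < eta /\
        forall w', dchord w w' < eta ->
          forall k : nat, dchord (Nat.iter k F w) (Nat.iter k F w') < eps.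
Definition julia (F : Chat -> Chat) (p : Chat) : Prop := ~ in_fatou F p.

Definition cantor_set (x : R) : Prop :=
  exists b : nat -> bool,
    Un_cv (fun N => sum_f_R0 (fun k => (if b k then 2 else 0) / 3 ^ (S k)) N) x.
Definition circle (y : R * R) : Prop := fst y ^ 2 + snd y ^ 2 = 1.
Definition CxS1 (x : R * (R * R)) : Prop := cantor_set (fst x) /\ circle (snd x).
Definition d3 (x y : R * (R * R)) : R :=
  sqrt ((fst x - fst y) ^ 2 + (fst (snd x) - fst (snd y)) ^ 2
        + (snd (snd x) - snd (snd y)) ^ 2).

Definition cantor_set_of_circles (K : Chat -> Prop) : Prop :=
  exists (f : Chat -> R * (R * R)) (g : R * (R * R) -> Chat),
    (forall p, K p -> CxS1 (f p)) /\
    (forall x, CxS1 x -> K (g x)) /\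
    (forall p, K p -> g (f p) = p) /\
    (forall x, CxS1 x -> f (g x) = x) /\
    (forall p, K p -> forall eps, 0 < eps -> exists delta, 0 < delta /\
        forall p', K p' -> dchord p p' < delta -> d3 (f p) (f p') < eps) /\
    (forall x, CxS1 x -> forall eps, 0 < eps -> exists delta, 0 < delta /\
        forall x', CxS1 x' -> d3 x x' < delta -> dchord (g x) (g x') < eps).

Definition Cderiv (g : Cx -> Cx) (z l : Cx) : Prop :=
  forall eps, 0 < eps -> exists delta, 0 < delta /\
    forall h : Cx, 0 < Cnorm h < delta ->
      Cnorm (Csub (Cdiv (Csub (g (Cadd z h)) (g z)) h) l) < eps.

Definition chart_val (p : Chat) : Cx := match p with Some z => z | None => Cx0 end.
Definition Chat_inv (p : Chat) : Chat :=
  match p with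
  | None => Some Cx0
  | Some z => if Req_EM_T (Cnorm z) 0 then None else Some (Cinv z)
  end.

(** multiplier of F at p (in the chart z at finite points, 1/z at infinity) *)
Definition is_multiplier (F : Chat -> Chat) (p : Chat) (lam : Cx) : Prop :=
  match p with
  | Some z => Cderiv (fun u => chart_val (F (Some u))) z lam
  | None => Cderiv (fun u => chart_val (Chat_inv (F (Chat_inv (Some u))))) Cx0 lam
  end.

Definition is_parabolic_fixed (F : Chat -> Chat) (p : Chat) : Prop :=
  F p = p /\ exists lam, is_multiplier F p lam /\
    exists m : nat, (1 <= m)%nat /\ Cpow lam m = Cx1.

(* Main.v *)
Require Import Defs.
From Stdlib Require Import Reals ZArith Lra Lia Psatz Classical ClassicalEpsilon FunctionalExtensionality.
From Coquelicot Require Import Coquelicot.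
Open Scope R_scope.

(** Write [d = d_1], [w = 1 / z], [C = C_n] and [y' = (1 + C) P(z) - C].  Then [y' = R(w) / Q(w)] with
    [Q(w) = (w^d + d - 1) / d] and [R] a perturbation of [1] that satisfies [R(w) = 1 + C (1 - w) + O((1 - w)^2)];
    the constants [A_n], [B_n], [C_n] are chosen for that.  In the coordinate [u = z / (z - 1)] the map is therefore
    close to the translation by [(d - 1) / 2] at infinity, so [1] is parabolic with multiplier [1], and a region
    [Re u + max (|Im u| - M) 0 > 3 / 5] is mapped into itself and attracted to [1].

    The complement of that region is cut by the circles [|z| = |a_i|] and a small disc around [0], which is mapped
    to the basin of [1] ([n] even) or contracted into itself ([n] odd), into an annulus [A] that contains [n] essential
    subannuli mapped onto [A] by [P].  On the [i]-th one [P] is close to a monomial of degree [d_i] up to sign; there is room for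
    all of them when [s] is small since [sum 1 / d_i < 1].  The inverse branches are found, in the coordinate [log z], as
    fixed points of contractions.  They contract a weighted metric by [1 + k |1 - w|], and [1 / |1 - w|] grows at most
    linearly along backward orbits, so that the divergence of the harmonic series makes all long compositions shrink.

    Hence the points that never leave [A] are coded by a word in [n] letters and an angle, which gives a homeomorphism
    with the product of the Cantor set and the circle; all other points are in the Fatou set. *)

(** * Complex arithmetic *)

(** The branches do not contract uniformly: [1] is fixed with multiplier [1] and belongs to the
    limit set, so no exponential rate exists. Near [1] the logarithmic derivative of [P] is
    [1 - (d - 1) (1 - w)] to first order; its modulus exceeds [1] to first order only where
    [Re (1 - w)] is negative and comparable to [|1 - w|]. The complement of a half-plane
    [Re u > const] comes arbitrarily close to the direction in which this gain vanishes. The term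
    [max (|Im u| - M) 0] opens the half-plane to a wider sector, still invariant, whose complement
    avoids that direction. The threshold is [3 / 5] because [Re u = 1 / 2] on [|z| = 1] and the
    perturbation [R] needs some room. The factor [dmax ^ 2] in [|a_1|] gives the dominating
    monomials the modulus [d_1 dmax ^ 2] on all circles of poles; such a circle then contributes at
    most [3 / 4] to a logarithmic derivative whose main term is a degree of modulus at least [2]. An
    auxiliary [del] is fixed by the degrees alone, and [s] is chosen after it. On the logarithmic
    lift the coverings are nearly linear, so the angle of a coded point is a limit of imaginary
    parts divided by degrees. *)

Lemma Rmult_le_both (a A b B : R) : 0 <= a <= A -> 0 <= b <= B -> a * b <= A * B.
Proof. intros Ha Hb. apply Rmult_le_compat; lra. Qed.

Lemma Cnorm_Cmod (z : C) : Cnorm z = Cmod z.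
Proof. unfold Cnorm, Cmod. f_equal. ring. Qed.

Lemma Defs_Cinv (z : C) : Defs.Cinv z = (/ z)%C.
Proof. unfold Defs.Cinv, Cinv. simpl. f_equal; f_equal; f_equal; ring. Qed.

Lemma Defs_Cpow (z : C) (k : nat) : Defs.Cpow z k = (z ^ k)%C.
Proof. induction k as [|k IH]; [reflexivity|]. rewrite Cpow_S, <- IH. reflexivity. Qed.

Lemma Defs_Cdiv (z w : C) : Defs.Cdiv z w = (z / w)%C.
Proof. unfold Defs.Cdiv. rewrite Defs_Cinv. reflexivity. Qed.

Lemma Cinv_0 : (/ 0)%C = 0%C.
Proof. unfold Cinv; simpl; unfold RtoC; f_equal; unfold Rdiv; ring. Qed.

Lemma Ceq_components (z w : C) : fst z = fst w -> snd z = snd w -> z = w.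
Proof. destruct z, w; simpl; congruence. Qed.

Lemma Cmod_sqr (z : C) : Cmod z * Cmod z = fst z * fst z + snd z * snd z.
Proof. unfold Cmod. rewrite sqrt_sqrt; [ring|]. nra. Qed.

Lemma fst_le_Cmod (z : C) : Rabs (fst z) <= Cmod z.
Proof. eapply Rle_trans; [|apply Rmax_Cmod]. apply Rmax_l. Qed.

Lemma snd_le_Cmod (z : C) : Rabs (snd z) <= Cmod z.
Proof. eapply Rle_trans; [|apply Rmax_Cmod]. apply Rmax_r. Qed.

Lemma Cmod_le_sum (z : C) : Cmod z <= Rabs (fst z) + Rabs (snd z).
Proof.
  apply Rsqr_incr_0_var; unfold Rsqr.
  - rewrite Cmod_sqr. generalize (Rabs_pos (fst z)) (Rabs_pos (snd z)).
    assert (H1 : Rabs (fst z) * Rabs (fst z) = fst z * fst z) by (rewrite <- Rabs_mult; apply Rabs_pos_eq; nra).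
    assert (H2 : Rabs (snd z) * Rabs (snd z) = snd z * snd z) by (rewrite <- Rabs_mult; apply Rabs_pos_eq; nra).
    nra.
  - generalize (Rabs_pos (fst z)) (Rabs_pos (snd z)); lra.
Qed.

Lemma Cmod_sub_sym (z w : C) : Cmod (z - w) = Cmod (w - z).
Proof. replace (z - w)%C with (- (w - z))%C by ring. apply Cmod_opp. Qed.

Lemma Cmod_tri_sub (z w : C) : Cmod (z - w) <= Cmod z + Cmod w.
Proof. rewrite <- (Cmod_opp w). apply Cmod_triangle. Qed.

Lemma Cmod_sub_ge (z w : C) : Cmod z - Cmod w <= Cmod (z - w).
Proof. generalize (Cmod_triangle (z - w) w). replace (z - w + w)%C with z by ring. lra. Qed.

Lemma Cmod_add_ge (z w : C) : Cmod z - Cmod w <= Cmod (z + w).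
Proof. generalize (Cmod_triangle (z + w) (- w)). replace (z + w + - w)%C with z by ring. rewrite Cmod_opp. lra. Qed.

Lemma Cmod_tri3 (x y z : C) : Cmod (x - z) <= Cmod (x - y) + Cmod (y - z).
Proof. replace (x - z)%C with ((x - y) + (y - z))%C by ring. apply Cmod_triangle. Qed.

Lemma Cmod_pos_neq (z : C) : 0 < Cmod z -> z <> 0%C.
Proof. intros H E. rewrite E, Cmod_0 in H. lra. Qed.

Lemma Cmod_RtoC_pos (r : R) : 0 <= r -> Cmod (RtoC r) = r.
Proof. intros H. rewrite Cmod_R. apply Rabs_pos_eq, H. Qed.

Lemma Csub_eq_0 (z w : C) : Cmod (z - w) = 0 -> z = w.
Proof. intros H. apply Cmod_eq_0 in H. replace z with (z - w + w)%C by ring. rewrite H. ring. Qed.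

Lemma C_eq_of_small (z w : C) : (forall e, 0 < e -> Cmod (z - w) <= e) -> z = w.
Proof.
  intros H. apply Csub_eq_0. generalize (Cmod_ge_0 (z - w)); intros P.
  destruct (Req_dec (Cmod (z - w)) 0) as [E|E]; [exact E|].
  specialize (H (Cmod (z - w) / 2)). lra.
Qed.

Definition conv (u : nat -> C) (l : C) : Prop :=
  forall e, 0 < e -> exists N, forall k, (N <= k)%nat -> Cmod (u k - l) < e.

Lemma conv_components (u : nat -> C) (l : C) :
  Un_cv (fun k => fst (u k)) (fst l) -> Un_cv (fun k => snd (u k)) (snd l) -> conv u l.
Proof.
  intros H1 H2 e He. destruct (H1 (e/2)) as [N1 HN1]; [lra|]. destruct (H2 (e/2)) as [N2 HN2]; [lra|].
  exists (Nat.max N1 N2). intros k Hk.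
  specialize (HN1 k ltac:(lia)). specialize (HN2 k ltac:(lia)). unfold Rdist in *.
  eapply Rle_lt_trans; [apply Cmod_le_sum|]. simpl. unfold Rminus in *. lra.
Qed.

Lemma conv_unique (u : nat -> C) (l l' : C) : conv u l -> conv u l' -> l = l'.
Proof.
  intros H H'. apply C_eq_of_small. intros e He.
  destruct (H (e/2)) as [N1 H1]; [lra|]. destruct (H' (e/2)) as [N2 H2]; [lra|].
  specialize (H1 (Nat.max N1 N2) ltac:(lia)). specialize (H2 (Nat.max N1 N2) ltac:(lia)).
  generalize (Cmod_tri3 l (u (Nat.max N1 N2)) l'). rewrite (Cmod_sub_sym l (u _)). lra.
Qed.

Lemma C_complete (u : nat -> C) :
  (forall e, 0 < e -> exists N, forall j k, (N <= j)%nat -> (N <= k)%nat -> Cmod (u j - u k) < e) ->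
  exists l, conv u l.
Proof.
  intros H.
  destruct (Rcomplete.R_complete (fun k => fst (u k))) as [a Ha].
  { intros e He. destruct (H e He) as [N HN]. exists N. intros j k Hj Hk. unfold Rdist.
    eapply Rle_lt_trans; [|apply (HN j k); lia]. apply (fst_le_Cmod (u j - u k)). }
  destruct (Rcomplete.R_complete (fun k => snd (u k))) as [b Hb].
  { intros e He. destruct (H e He) as [N HN]. exists N. intros j k Hj Hk. unfold Rdist.
    eapply Rle_lt_trans; [|apply (HN j k); lia]. apply (snd_le_Cmod (u j - u k)). }
  exists (a, b). apply conv_components; assumption.
Qed.

Definition cclosed (S : C -> Prop) : Prop :=
  forall u l, (forall k, S (u k)) -> conv u l -> S l.

Lemma pow_small (q e : R) : 0 <= q < 1 -> 0 < e -> exists N, forall k, (N <= k)%nat -> q ^ k < e.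
Proof.
  intros Hq He. destruct (pow_lt_1_zero q ltac:(rewrite Rabs_pos_eq; lra) e He) as [N HN].
  exists N. intros k Hk. specialize (HN k Hk). rewrite Rabs_pos_eq in HN; [exact HN|]. apply pow_le; lra.
Qed.

Lemma contraction_fixed_point (S : C -> Prop) (T : C -> C) (q : R) (x0 : C) :
  0 <= q < 1 -> cclosed S -> S x0 -> (forall x, S x -> S (T x)) ->
  (forall x y, S x -> S y -> Cmod (T x - T y) <= q * Cmod (x - y)) ->
  exists x, S x /\ T x = x.
Proof.
  intros Hq Hc H0 HT HL.
  set (u := fun k => Nat.iter k T x0).
  assert (Su : forall k, S (u k)) by (induction k; simpl; auto).
  set (D := Cmod (T x0 - x0)).
  assert (HD : 0 <= D) by apply Cmod_ge_0.
  assert (Hs : forall k, Cmod (u (Datatypes.S k) - u k) <= q ^ k * D).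
  { induction k as [|k IH]; [simpl; unfold D; lra|].
    change (u (Datatypes.S (Datatypes.S k))) with (T (u (Datatypes.S k))).
    change (u (Datatypes.S k)) with (T (u k)) at 2.
    eapply Rle_trans; [apply HL; auto|]. simpl (q ^ _).
    generalize (Rmult_le_compat_l q _ _ (proj1 Hq) IH). nra. }
  (* The exact geometric sum, with its factor [1 - q ^ m], is what lets the induction on [m]
     close. *)
  assert (Hm : forall m k, Cmod (u (k + m)%nat - u k) <= q ^ k * D / (1 - q) * (1 - q ^ m)).
  { induction m as [|m IH]; intros k.
    - rewrite Nat.add_0_r. replace (u k - u k)%C with (RtoC 0) by ring. rewrite Cmod_0. simpl. lra.
    - eapply Rle_trans; [apply (Cmod_tri3 _ (u (k + m)%nat))|].
      replace (k + Datatypes.S m)%nat with (Datatypes.S (k + m)) by lia.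
      generalize (Hs (k + m)%nat) (IH k). rewrite pow_add. simpl (q ^ Datatypes.S m).
      intros A B. eapply Rle_trans; [apply Rplus_le_compat; eassumption|].
      right. field. lra. }
  destruct (C_complete u) as [l Hl].
  { intros e He.
    destruct (pow_small q (e * (1 - q) / (2 * (D + 1))) Hq) as [N HN].
    { apply Rdiv_lt_0_compat; [apply Rmult_lt_0_compat|]; lra. }
    assert (HN' : forall m, Cmod (u (N + m)%nat - u N) < e / 2).
    { intros m. eapply Rle_lt_trans; [apply Hm|]. specialize (HN N (Nat.le_refl N)).
      assert (Hqm : 0 <= q ^ m <= 1).
      { split; [apply pow_le; lra|]. rewrite <- (pow1 m). apply pow_incr. lra. }
      assert (HqN : 0 <= q ^ N) by (apply pow_le; lra).
      assert (E : q ^ N * (D + 1) / (1 - q) < e / 2).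
      { apply (Rmult_lt_reg_r ((1 - q) / (D + 1))); [apply Rdiv_lt_0_compat; lra|].
        replace (q ^ N * (D + 1) / (1 - q) * ((1 - q) / (D + 1))) with (q ^ N) by (field; lra).
        replace (e / 2 * ((1 - q) / (D + 1))) with (e * (1 - q) / (2 * (D + 1))) by (field; lra). exact HN. }
      eapply Rle_lt_trans; [|exact E].
      assert (P : 0 <= q ^ N * D / (1 - q)).
      { apply Rmult_le_pos; [apply Rmult_le_pos; lra|]. left. apply Rinv_0_lt_compat. lra. }
      assert (P2 : q ^ N * D / (1 - q) <= q ^ N * (D + 1) / (1 - q)).
      { unfold Rdiv. apply Rmult_le_compat_r; [left; apply Rinv_0_lt_compat; lra|]. nra. }
      nra. }
    exists N. intros j k Hj Hk.
    generalize (HN' (j - N)%nat) (HN' (k - N)%nat).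
    replace (N + (j - N))%nat with j by lia. replace (N + (k - N))%nat with k by lia.
    generalize (Cmod_tri3 (u j) (u N) (u k)). rewrite (Cmod_sub_sym (u N)). lra. }
  exists l. assert (Sl : S l) by (apply (Hc u); auto). split; [exact Sl|].
  apply (conv_unique (fun k => u (Datatypes.S k))).
  - intros e He. destruct (Hl e He) as [N HN]. exists N. intros k Hk.
    eapply Rle_lt_trans; [apply (HL (u k) l); auto|]. specialize (HN k Hk).
    generalize (Cmod_ge_0 (u k - l)). nra.
  - intros e He. destruct (Hl e He) as [N HN]. exists N. intros k Hk. apply HN. lia.
Qed.

(** * Exponential and logarithm *)

Definition cexp (z : C) : C := (exp (fst z) * cos (snd z), exp (fst z) * sin (snd z)).

Lemma cexp_add (z w : C) : cexp (z + w) = (cexp z * cexp w)%C.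
Proof.
  unfold cexp, Cplus, Cmult. simpl. rewrite exp_plus, cos_plus, sin_plus. f_equal; ring.
Qed.

Lemma cexp_0 : cexp 0 = 1%C.
Proof. unfold cexp; simpl. rewrite exp_0, cos_0, sin_0. unfold RtoC. f_equal; ring. Qed.

Lemma Cmod_cexp (z : C) : Cmod (cexp z) = exp (fst z).
Proof.
  unfold Cmod, cexp; simpl fst; simpl snd.
  replace ((exp (fst z) * cos (snd z)) ^ 2 + (exp (fst z) * sin (snd z)) ^ 2)
    with (exp (fst z) ^ 2 * (Rsqr (sin (snd z)) + Rsqr (cos (snd z)))) by (unfold Rsqr; ring).
  rewrite sin2_cos2, Rmult_1_r. rewrite <- Rsqr_pow2. apply sqrt_Rsqr. left. apply exp_pos.
Qed.

Lemma cexp_neq_0 (z : C) : cexp z <> 0%C.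
Proof. apply Cmod_pos_neq. rewrite Cmod_cexp. apply exp_pos. Qed.

Lemma cexp_opp (z : C) : cexp (- z) = (/ cexp z)%C.
Proof.
  assert (H : (cexp z * cexp (- z) = 1)%C) by (rewrite <- cexp_add; replace (z + - z)%C with (RtoC 0) by ring; apply cexp_0).
  replace (cexp (- z)) with (/ cexp z * (cexp z * cexp (- z)))%C; [rewrite H; ring|].
  field. apply cexp_neq_0.
Qed.

Lemma cexp_sub (z w : C) : cexp (z - w) = (cexp z / cexp w)%C.
Proof. unfold Cminus. rewrite cexp_add, cexp_opp. reflexivity. Qed.

Lemma cexp_nat (k : nat) (z : C) : cexp (INR k * z) = (cexp z ^ k)%C.
Proof.
  induction k as [|k IH].
  - simpl INR. replace (RtoC 0 * z)%C with (RtoC 0) by ring. rewrite cexp_0. reflexivity.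
  - rewrite S_INR, RtoC_plus, Cpow_S, <- IH, <- cexp_add. f_equal. ring.
Qed.

Definition tpi (m : Z) : C := (0, 2 * PI * IZR m).

Lemma cexp_tpi (m : Z) : cexp (tpi m) = 1%C.
Proof.
  unfold cexp, tpi; simpl. rewrite exp_0.
  assert (H : cos (2 * PI * IZR m) = 1 /\ sin (2 * PI * IZR m) = 0).
  { assert (Hn : forall k : nat, cos (2 * PI * INR k) = 1 /\ sin (2 * PI * INR k) = 0).
    { intros k. generalize (cos_period 0 k) (sin_period 0 k). rewrite cos_0, sin_0.
      replace (0 + 2 * INR k * PI) with (2 * PI * INR k) by ring. auto. }
    destruct m as [|p|p].
    - rewrite Rmult_0_r, cos_0, sin_0. lra.
    - replace (IZR (Z.pos p)) with (INR (Pos.to_nat p)) by (rewrite INR_IZR_INZ, positive_nat_Z; reflexivity). apply Hn.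
    - replace (2 * PI * IZR (Z.neg p)) with (- (2 * PI * INR (Pos.to_nat p))).
      + rewrite cos_neg, sin_neg. destruct (Hn (Pos.to_nat p)). lra.
      + rewrite INR_IZR_INZ, positive_nat_Z. change (Z.neg p) with (- Z.pos p)%Z. rewrite opp_IZR. ring. }
  destruct H as [-> ->]. unfold RtoC. f_equal; ring.
Qed.

Lemma cexp_add_tpi (z : C) (m : Z) : cexp (z + tpi m) = cexp z.
Proof. rewrite cexp_add, cexp_tpi. ring. Qed.

Lemma polar (x y : R) : x * x + y * y = 1 -> exists t, -PI <= t <= PI /\ cos t = x /\ sin t = y.
Proof.
  intros H. assert (Hx : -1 <= x <= 1) by nra.
  generalize (acos_bound x) PI_RGT_0; intros Hb HP.
  assert (Hs : sin (acos x) = Rabs y).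
  { rewrite sin_acos by exact Hx. replace (1 - x²) with (y²) by (unfold Rsqr; lra). apply sqrt_Rsqr_abs. }
  destruct (Rle_dec 0 y) as [Hy|Hy].
  - exists (acos x). rewrite cos_acos, Hs by exact Hx. rewrite Rabs_pos_eq by exact Hy. repeat split; lra.
  - exists (- acos x). rewrite cos_neg, sin_neg, cos_acos, Hs by exact Hx. rewrite Rabs_left by lra. repeat split; lra.
Qed.

Lemma cexp_surj_arg (z : C) : z <> 0%C -> exists x, cexp x = z /\ Rabs (snd x) <= PI.
Proof.
  intros Hz. assert (Hm : 0 < Cmod z) by (apply Cmod_gt_0; exact Hz).
  destruct (polar (fst z / Cmod z) (snd z / Cmod z)) as [t [Ht [Hc Hs]]].
  { replace (fst z / Cmod z * (fst z / Cmod z) + snd z / Cmod z * (snd z / Cmod z))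
      with ((fst z * fst z + snd z * snd z) / (Cmod z * Cmod z)) by (field; lra).
    rewrite <- Cmod_sqr. field. lra. }
  exists (ln (Cmod z), t). split; [|apply Rabs_le; exact Ht]. unfold cexp; simpl. rewrite exp_ln, Hc, Hs by exact Hm.
  destruct z as [x y]. simpl. f_equal; field; simpl in Hm; lra.
Qed.

Lemma cexp_surj (z : C) : z <> 0%C -> exists x, cexp x = z.
Proof. intros Hz. destruct (cexp_surj_arg z Hz) as [x [E _]]. exists x. exact E. Qed.

Lemma cos_sin_eq (a b : R) : cos a = cos b -> sin a = sin b -> exists m : Z, a = b + 2 * PI * IZR m.
Proof.
  intros Hc Hs.
  assert (H1 : cos (a - b) = 1).
  { rewrite cos_minus, Hc, Hs. generalize (sin2_cos2 b). unfold Rsqr. lra. }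
  assert (H2 : sin ((a - b) / 2) = 0).
  { replace (a - b) with (2 * ((a - b) / 2)) in H1 by field. rewrite cos_2a_sin in H1.
    nra. }
  apply sin_eq_0_0 in H2. destruct H2 as [m Hm]. exists m. lra.
Qed.

Lemma cexp_eq (x y : C) : cexp x = cexp y -> exists m, x = (y + tpi m)%C.
Proof.
  intros H. assert (Hf : fst x = fst y).
  { apply exp_inv. rewrite <- !Cmod_cexp, H. reflexivity. }
  unfold cexp in H. rewrite Hf in H. injection H as H1 H2.
  generalize (exp_pos (fst y)); intros Hp.
  apply Rmult_eq_reg_l in H1; [|lra]. apply Rmult_eq_reg_l in H2; [|lra].
  destruct (cos_sin_eq _ _ H1 H2) as [m Hm]. exists m.
  apply Ceq_components; unfold tpi; simpl; lra.
Qed.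

(** The principal logarithm on the right half-plane only; elsewhere the second component is no
    argument. All correction factors whose logarithm is taken below have positive real part. *)
Definition clog (z : C) : C := (ln (Cmod z), atan (snd z / fst z)).

Lemma cexp_clog (z : C) : 0 < fst z -> cexp (clog z) = z.
Proof.
  intros H. assert (Hm : 0 < Cmod z) by (generalize (fst_le_Cmod z); rewrite Rabs_pos_eq; lra).
  assert (Hq : Cmod z = fst z * sqrt (1 + (snd z / fst z)²)).
  { rewrite <- (sqrt_Rsqr (fst z)) at 1 by lra. rewrite <- sqrt_mult.
    - unfold Cmod. f_equal. unfold Rsqr. field. lra.
    - apply Rle_0_sqr.
    - generalize (Rle_0_sqr (snd z / fst z)). lra. }
  assert (Hs : 0 < sqrt (1 + (snd z / fst z)²)) by (apply sqrt_lt_R0; generalize (Rle_0_sqr (snd z / fst z)); lra).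
  unfold cexp, clog; simpl. rewrite exp_ln, cos_atan, sin_atan by exact Hm. rewrite Hq.
  apply Ceq_components; simpl; field; lra.
Qed.

(** Holds at every point because [atan] is bounded; it limits how far a correction factor can shift
    the angle of an inverse branch. *)
Lemma clog_Im_bound (z : C) : Rabs (snd (clog z)) <= 2.
Proof.
  unfold clog; simpl. generalize (atan_bound (snd z / fst z)) PI_4. intros H1 H2.
  apply Rabs_le. lra.
Qed.

(** * Complex derivatives relative to a set *)

(** The form without a quotient allows [y = x] and composes easily. The increment is confined to [D]
    because an inverse branch is known only on a closed subset of the lift; [ctrue] gives the
    ordinary derivative. *)
Definition cdiff (D : C -> Prop) (f : C -> C) (x l : C) : Prop :=
  forall e, 0 < e -> exists del, 0 < del /\
    forall y, D y -> Cmod (y - x) < del -> Cmod (f y - f x - l * (y - x)) <= e * Cmod (y - x).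

Definition ccont (D : C -> Prop) (f : C -> C) (x : C) : Prop :=
  forall e, 0 < e -> exists del, 0 < del /\
    forall y, D y -> Cmod (y - x) < del -> Cmod (f y - f x) < e.

Definition ctrue (_ : C) : Prop := True.

Lemma cdiff_ccont D f x l : cdiff D f x l -> ccont D f x.
Proof.
  intros H e He. destruct (H 1 Rlt_0_1) as [del [Hd HH]].
  assert (Hl : 0 <= Cmod l) by apply Cmod_ge_0.
  exists (Rmin del (e / (Cmod l + 2))). split.
  { apply Rmin_pos; [exact Hd|]. apply Rdiv_lt_0_compat; lra. }
  intros y Dy Hy. assert (H1 := Rlt_le_trans _ _ _ Hy (Rmin_l _ _)). assert (H2 := Rlt_le_trans _ _ _ Hy (Rmin_r _ _)).
  specialize (HH y Dy H1). rewrite Rmult_1_l in HH.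
  replace (f y - f x)%C with ((f y - f x - l * (y - x)) + l * (y - x))%C by ring.
  eapply Rle_lt_trans; [apply Cmod_triangle|]. rewrite Cmod_mult.
  apply (Rmult_lt_compat_r (Cmod l + 2)) in H2; [|lra].
  replace (e / (Cmod l + 2) * (Cmod l + 2)) with e in H2 by (field; lra).
  generalize (Cmod_ge_0 (y - x)). nra.
Qed.

Lemma ccont_const D k x : ccont D (fun _ => k) x.
Proof. intros e He. exists 1. split; [lra|]. intros. replace (k - k)%C with (RtoC 0) by ring. rewrite Cmod_0; lra. Qed.

Lemma ccont_id D x : ccont D (fun z => z) x.
Proof. intros e He. exists e. split; auto. Qed.

Lemma ccont_add D f g x : ccont D f x -> ccont D g x -> ccont D (fun z => (f z + g z)%C) x.
Proof.
  intros H1 H2 e He. destruct (H1 (e/2)) as [a [Ha HA]]; [lra|]. destruct (H2 (e/2)) as [b [Hb HB]]; [lra|].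
  exists (Rmin a b). split; [apply Rmin_pos; auto|]. intros y Dy Hy.
  specialize (HA y Dy (Rlt_le_trans _ _ _ Hy (Rmin_l _ _))). specialize (HB y Dy (Rlt_le_trans _ _ _ Hy (Rmin_r _ _))).
  replace (f y + g y - (f x + g x))%C with ((f y - f x) + (g y - g x))%C by ring.
  eapply Rle_lt_trans; [apply Cmod_triangle|]. lra.
Qed.

Lemma ccont_mul D f g x : ccont D f x -> ccont D g x -> ccont D (fun z => (f z * g z)%C) x.
Proof.
  intros H1 H2 e He.
  set (A := Cmod (f x) + Cmod (g x) + 1). assert (HA0 : 0 < A) by (unfold A; generalize (Cmod_ge_0 (f x)) (Cmod_ge_0 (g x)); lra).
  destruct (H1 (Rmin 1 (e / (2 * A)))) as [a [Ha HA]]; [apply Rmin_pos; [lra|apply Rdiv_lt_0_compat; lra]|].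
  destruct (H2 (e / (2 * A))) as [b [Hb HB]]; [apply Rdiv_lt_0_compat; lra|].
  exists (Rmin a b). split; [apply Rmin_pos; auto|]. intros y Dy Hy.
  specialize (HA y Dy (Rlt_le_trans _ _ _ Hy (Rmin_l _ _))). specialize (HB y Dy (Rlt_le_trans _ _ _ Hy (Rmin_r _ _))).
  assert (HA1 := Rlt_le_trans _ _ _ HA (Rmin_l _ _)). assert (HA2 := Rlt_le_trans _ _ _ HA (Rmin_r _ _)).
  replace (f y * g y - f x * g x)%C with ((f y - f x) * (g y - g x) + (f y - f x) * g x + f x * (g y - g x))%C by ring.
  eapply Rle_lt_trans; [eapply Rle_trans; [apply Cmod_triangle|]; apply Rplus_le_compat_r; apply Cmod_triangle|].
  rewrite !Cmod_mult.
  assert (E : e = 2 * A * (e / (2 * A))) by (field; lra).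
  set (q := e / (2 * A)) in *.
  generalize (Cmod_ge_0 (f y - f x)) (Cmod_ge_0 (g y - g x)) (Cmod_ge_0 (f x)) (Cmod_ge_0 (g x)). intros.
  unfold A in *. nra.
Qed.

Lemma ccont_inv D f x : ccont D f x -> f x <> 0%C -> ccont D (fun z => (/ f z)%C) x.
Proof.
  intros H Hn e He. assert (Hp : 0 < Cmod (f x)) by (apply Cmod_gt_0; exact Hn).
  set (m := Cmod (f x)) in *.
  destruct (H (Rmin (m / 2) (e * (m * m) / 2))) as [a [Ha HA]].
  { apply Rmin_pos; [lra|]. apply Rdiv_lt_0_compat; [apply Rmult_lt_0_compat; nra|lra]. }
  exists a. split; [exact Ha|]. intros y Dy Hy. specialize (HA y Dy Hy).
  assert (H1 := Rlt_le_trans _ _ _ HA (Rmin_l _ _)). assert (H2 := Rlt_le_trans _ _ _ HA (Rmin_r _ _)).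
  assert (Hy2 : m / 2 < Cmod (f y)). { generalize (Cmod_sub_ge (f x) (f y)). rewrite Cmod_sub_sym. fold m. lra. }
  assert (Hny : f y <> 0%C) by (apply Cmod_pos_neq; lra).
  replace (/ f y - / f x)%C with (- (f y - f x) / (f y * f x))%C by (field; auto).
  rewrite Cmod_div by (apply Cmult_neq_0; auto). rewrite Cmod_opp, Cmod_mult.
  apply (Rmult_lt_reg_r (Cmod (f y) * m)); [nra|].
  unfold Rdiv. rewrite Rmult_assoc, Rinv_l, Rmult_1_r by nra.
  assert (e * (m * m) / 2 < e * (Cmod (f y) * m)).
  { replace (e * (m * m) / 2) with (e * m * (m / 2)) by field. replace (e * (Cmod (f y) * m)) with (e * m * Cmod (f y)) by ring.
    apply Rmult_lt_compat_l; nra. }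
  lra.
Qed.

Lemma ccont_pow D f x k : ccont D f x -> ccont D (fun z => (f z ^ k)%C) x.
Proof.
  intros H. induction k as [|k IH]; simpl; [apply ccont_const|].
  apply (ccont_mul D f (fun z => (f z ^ k)%C)); auto.
Qed.

Lemma ccont_ext D f g x : (forall z, f z = g z) -> ccont D f x -> ccont D g x.
Proof. intros H F e He. destruct (F e He) as [a [Ha HA]]. exists a. split; auto. intros. rewrite <- !H. auto. Qed.

Lemma cdiff_const D k x : cdiff D (fun _ => k) x 0%C.
Proof.
  intros e He. exists 1. split; [lra|]. intros y _ _.
  replace (k - k - 0 * (y - x))%C with (RtoC 0) by ring. rewrite Cmod_0. generalize (Cmod_ge_0 (y - x)). nra.
Qed.

Lemma cdiff_id D x : cdiff D (fun z => z) x 1%C.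
Proof.
  intros e He. exists 1. split; [lra|]. intros y _ _.
  replace (y - x - 1 * (y - x))%C with (RtoC 0) by ring. rewrite Cmod_0. generalize (Cmod_ge_0 (y - x)). nra.
Qed.

Lemma cdiff_add D f g x l m : cdiff D f x l -> cdiff D g x m -> cdiff D (fun z => (f z + g z)%C) x (l + m)%C.
Proof.
  intros H1 H2 e He. destruct (H1 (e/2)) as [a [Ha HA]]; [lra|]. destruct (H2 (e/2)) as [b [Hb HB]]; [lra|].
  exists (Rmin a b). split; [apply Rmin_pos; auto|]. intros y Dy Hy.
  specialize (HA y Dy (Rlt_le_trans _ _ _ Hy (Rmin_l _ _))). specialize (HB y Dy (Rlt_le_trans _ _ _ Hy (Rmin_r _ _))).
  replace (f y + g y - (f x + g x) - (l + m) * (y - x))%C with ((f y - f x - l * (y - x)) + (g y - g x - m * (y - x)))%C by ring.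
  eapply Rle_trans; [apply Cmod_triangle|]. lra.
Qed.

Lemma cdiff_ext D f g x l m : (forall z, f z = g z) -> l = m -> cdiff D f x l -> cdiff D g x m.
Proof. intros H -> F e He. destruct (F e He) as [a [Ha HA]]. exists a. split; auto. intros. rewrite <- !H. auto. Qed.

Lemma cdiff_comp (D E : C -> Prop) f g x l m :
  (forall y, D y -> E (g y)) -> cdiff D g x m -> cdiff E f (g x) l -> cdiff D (fun z => f (g z)) x (l * m)%C.
Proof.
  intros HDE Hg Hf e He.
  assert (Hl : 0 <= Cmod l) by apply Cmod_ge_0. assert (Hm : 0 <= Cmod m) by apply Cmod_ge_0.
  set (A := Cmod l + Cmod m + 2).
  set (e1 := Rmin 1 (e / (2 * A))).
  assert (He1 : 0 < e1) by (apply Rmin_pos; [lra|apply Rdiv_lt_0_compat; unfold A; lra]).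
  assert (E1 : e1 <= 1) by apply Rmin_l.
  assert (E2 : e1 * (2 * A) <= e).
  { apply (Rmult_le_reg_r (/ (2 * A))); [apply Rinv_0_lt_compat; unfold A; lra|].
    rewrite Rmult_assoc, Rinv_r, Rmult_1_r by (unfold A; lra). apply Rmin_r. }
  destruct (Hf e1 He1) as [a [Ha HA]].
  destruct (Hg e1 He1) as [b [Hb HB]].
  destruct (cdiff_ccont _ _ _ _ Hg a Ha) as [c [Hc HC]].
  exists (Rmin b c). split; [apply Rmin_pos; auto|]. intros y Dy Hy.
  specialize (HB y Dy (Rlt_le_trans _ _ _ Hy (Rmin_l _ _))). specialize (HC y Dy (Rlt_le_trans _ _ _ Hy (Rmin_r _ _))).
  specialize (HA (g y) (HDE y Dy) HC).
  assert (Hgy : Cmod (g y - g x) <= (1 + Cmod m) * Cmod (y - x)).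
  { replace (g y - g x)%C with ((g y - g x - m * (y - x)) + m * (y - x))%C by ring.
    eapply Rle_trans; [apply Cmod_triangle|]. rewrite Cmod_mult. generalize (Cmod_ge_0 (y - x)); nra. }
  replace (f (g y) - f (g x) - l * m * (y - x))%C
    with ((f (g y) - f (g x) - l * (g y - g x)) + l * (g y - g x - m * (y - x)))%C by ring.
  eapply Rle_trans; [apply Cmod_triangle|]. rewrite Cmod_mult.
  generalize (Cmod_ge_0 (y - x)) (Cmod_ge_0 (g y - g x)). intros P1 P2.
  unfold A in *. nra.
Qed.

Lemma cdiff_mul D f g x l m :
  cdiff D f x l -> cdiff D g x m -> cdiff D (fun z => (f z * g z)%C) x (l * g x + f x * m)%C.
Proof.
  intros Hf Hg e He.
  set (A := Cmod l + Cmod (f x) + Cmod (g x) + 2).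
  assert (HA0 : 2 <= A) by (unfold A; generalize (Cmod_ge_0 (f x)) (Cmod_ge_0 (g x)) (Cmod_ge_0 l); lra).
  set (e1 := e / (3 * A)). assert (He1 : 0 < e1) by (apply Rdiv_lt_0_compat; lra).
  assert (E1 : e = 3 * A * e1) by (unfold e1; field; lra).
  destruct (Hf e1 He1) as [a [Ha HA]]. destruct (Hg e1 He1) as [b [Hb HB]].
  destruct (cdiff_ccont _ _ _ _ Hg (Rmin 1 e1)) as [c [Hc HC]]; [apply Rmin_pos; lra|].
  exists (Rmin a (Rmin b c)). split; [repeat apply Rmin_pos; auto|]. intros y Dy Hy.
  assert (H1 := Rlt_le_trans _ _ _ Hy (Rmin_l _ _)). assert (H2 := Rlt_le_trans _ _ _ Hy (Rmin_r _ _)).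
  specialize (HA y Dy H1). specialize (HB y Dy (Rlt_le_trans _ _ _ H2 (Rmin_l _ _))).
  specialize (HC y Dy (Rlt_le_trans _ _ _ H2 (Rmin_r _ _))).
  assert (C1 := Rlt_le_trans _ _ _ HC (Rmin_l _ _)). assert (C2 := Rlt_le_trans _ _ _ HC (Rmin_r _ _)).
  replace (f y * g y - f x * g x - (l * g x + f x * m) * (y - x))%C
    with ((f y - f x - l * (y - x)) * (g y - g x) + (f y - f x - l * (y - x)) * g x
          + (l * (y - x) * (g y - g x) + f x * (g y - g x - m * (y - x))))%C by ring.
  eapply Rle_trans; [eapply Rle_trans; [apply Cmod_triangle|]; apply Rplus_le_compat; apply Cmod_triangle|].
  rewrite !Cmod_mult.
  generalize (Cmod_ge_0 (y - x)) (Cmod_ge_0 (g y - g x)) (Cmod_ge_0 (f x)) (Cmod_ge_0 (g x)) (Cmod_ge_0 l)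
   (Cmod_ge_0 (f y - f x - l * (y - x))) (Cmod_ge_0 (g y - g x - m * (y - x))).
  set (h := Cmod (y - x)) in *. set (p := Cmod (f y - f x - l * (y - x))) in *. set (q := Cmod (g y - g x - m * (y - x))) in *.
  set (k := Cmod (g y - g x)) in *. intros.
  assert (Cmod l * h * k <= Cmod l * h * e1) by (apply Rmult_le_compat_l; nra).
  rewrite E1. unfold A.
  nra.
Qed.

Lemma cdiff_inv_id (D : C -> Prop) (x : C) : x <> 0%C -> cdiff D (fun z => (/ z)%C) x (- / (x * x))%C.
Proof.
  intros Hn e He. assert (Hp : 0 < Cmod x) by (apply Cmod_gt_0; exact Hn). set (m := Cmod x) in *.
  exists (Rmin (m / 2) (e * (m * m * m) / 2)). split.
  { apply Rmin_pos; [lra|]. repeat apply Rmult_lt_0_compat; try nra. }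
  intros y _ Hy. assert (H1 := Rlt_le_trans _ _ _ Hy (Rmin_l _ _)). assert (H2 := Rlt_le_trans _ _ _ Hy (Rmin_r _ _)).
  assert (Hy2 : m / 2 < Cmod y). { generalize (Cmod_sub_ge x y). rewrite Cmod_sub_sym. fold m. lra. }
  assert (Hny : y <> 0%C) by (apply Cmod_pos_neq; lra).
  replace (/ y - / x - - / (x * x) * (y - x))%C with ((y - x) * ((y - x) / (x * x * y)))%C by (field; auto).
  rewrite Cmod_mult, (Cmod_div (y - x)) by (repeat apply Cmult_neq_0; auto). rewrite !Cmod_mult.
  rewrite Rmult_comm. apply Rmult_le_compat_r; [apply Cmod_ge_0|].
  apply (Rmult_le_reg_r (m * m * Cmod y)); [repeat apply Rmult_lt_0_compat; lra|].
  unfold Rdiv. rewrite Rmult_assoc, Rinv_l, Rmult_1_r by (assert (0 < m * m * Cmod y) by (repeat apply Rmult_lt_0_compat; lra); lra).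
  assert (e * (m * m * m) / 2 <= e * (m * m * Cmod y)).
  { replace (e * (m * m * m) / 2) with (e * (m * m) * (m / 2)) by field. replace (e * (m * m * Cmod y)) with (e * (m * m) * Cmod y) by ring. apply Rmult_le_compat_l; nra. }
  lra.
Qed.

Lemma cdiff_inv D f x l : cdiff D f x l -> f x <> 0%C -> cdiff D (fun z => (/ f z)%C) x (- l / (f x * f x))%C.
Proof.
  intros H Hn. eapply cdiff_ext; [reflexivity| |].
  2: apply (cdiff_comp D ctrue (fun z => (/ z)%C) f x); [intros; exact I|exact H|apply cdiff_inv_id; exact Hn].
  field. auto.
Qed.

Lemma cdiff_pow D k x : cdiff D (fun z => (z ^ k)%C) x (INR k * x ^ (k - 1))%C.
Proof.
  induction k as [|k IH].
  - eapply cdiff_ext; [reflexivity| |apply (cdiff_const D 1%C)]. simpl. ring.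
  - eapply cdiff_ext; [intros; rewrite Cpow_S; reflexivity| |apply (cdiff_mul D (fun z => z) (fun z => (z ^ k)%C) x); [apply cdiff_id|apply IH]].
    replace (S k - 1)%nat with k by lia. rewrite S_INR, RtoC_plus.
    destruct k as [|k]; [simpl; ring|]. replace (S k - 1)%nat with k by lia. simpl. ring.
Qed.

Lemma exp_taylor1 : forall e, 0 < e -> exists del, 0 < del /\ forall h, Rabs h < del -> Rabs (exp h - 1 - h) <= e * Rabs h.
Proof.
  intros e He. assert (H := derivable_pt_lim_exp 0). rewrite exp_0 in H.
  destruct (H e He) as [d Hd]. exists d. split; [apply cond_pos|]. intros h Hh.
  destruct (Req_dec h 0) as [->|Hn]. { rewrite exp_0, Rminus_diag, Rminus_0_r, Rabs_R0. lra. }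
  specialize (Hd h Hn Hh). rewrite Rplus_0_l, exp_0 in Hd.
  replace (exp h - 1 - h) with (((exp h - 1) / h - 1) * h) by (field; exact Hn).
  rewrite Rabs_mult. apply Rmult_le_compat_r; [apply Rabs_pos|]. lra.
Qed.

Lemma sin_taylor1 : forall e, 0 < e -> exists del, 0 < del /\ forall h, Rabs h < del -> Rabs (sin h - h) <= e * Rabs h.
Proof.
  intros e He. assert (H := derivable_pt_lim_sin 0). rewrite cos_0 in H.
  destruct (H e He) as [d Hd]. exists d. split; [apply cond_pos|]. intros h Hh.
  destruct (Req_dec h 0) as [->|Hn]. { rewrite sin_0, Rminus_0_r, Rabs_R0. lra. }
  specialize (Hd h Hn Hh). rewrite Rplus_0_l, sin_0 in Hd.
  replace (sin h - h) with (((sin h - 0) / h - 1) * h) by (field; exact Hn).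
  rewrite Rabs_mult. apply Rmult_le_compat_r; [apply Rabs_pos|]. lra.
Qed.

Lemma cos_taylor1 : forall e, 0 < e -> exists del, 0 < del /\ forall h, Rabs h < del -> Rabs (cos h - 1) <= e * Rabs h.
Proof.
  intros e He. assert (H := derivable_pt_lim_cos 0). rewrite sin_0 in H.
  destruct (H e He) as [d Hd]. exists d. split; [apply cond_pos|]. intros h Hh.
  destruct (Req_dec h 0) as [->|Hn]. { rewrite cos_0, Rminus_diag, Rabs_R0. lra. }
  specialize (Hd h Hn Hh). rewrite Rplus_0_l, cos_0 in Hd.
  replace (cos h - 1) with (((cos h - 1) / h - - 0) * h) by (field; exact Hn).
  rewrite Rabs_mult. apply Rmult_le_compat_r; [apply Rabs_pos|]. lra.
Qed.

(** The addition formula reduces the claim to the origin, where the real first-order expansions of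
    [exp], [cos] and [sin] give the two components. *)
Lemma cdiff_cexp D x : cdiff D cexp x (cexp x).
Proof.
  assert (H0 : forall e, 0 < e -> exists del, 0 < del /\ forall h, Cmod h < del -> Cmod (cexp h - 1 - h) <= e * Cmod h).
  { intros e He.
    (* The two components together cost at most nine times [e1 m], so [e / 20] leaves room. *)
    set (e1 := Rmin 1 (e / 20)). assert (He1 : 0 < e1) by (apply Rmin_pos; lra).
    assert (e1 <= 1) by apply Rmin_l. assert (e1 <= e / 20) by apply Rmin_r.
    destruct (exp_taylor1 e1 He1) as [a [Ha HA]]. destruct (sin_taylor1 e1 He1) as [b [Hb HB]].
    destruct (cos_taylor1 e1 He1) as [c [Hc HC]].
    exists (Rmin e1 (Rmin a (Rmin b c))). split; [repeat apply Rmin_pos; auto; lra|].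
    intros h Hh. assert (H1 := Rlt_le_trans _ _ _ Hh (Rmin_l _ _)). assert (H2 := Rlt_le_trans _ _ _ Hh (Rmin_r _ _)).
    assert (H3 := Rlt_le_trans _ _ _ H2 (Rmin_l _ _)). assert (H4 := Rlt_le_trans _ _ _ H2 (Rmin_r _ _)).
    assert (H5 := Rlt_le_trans _ _ _ H4 (Rmin_l _ _)). assert (H6 := Rlt_le_trans _ _ _ H4 (Rmin_r _ _)).
    generalize (fst_le_Cmod h) (snd_le_Cmod h). intros F G.
    specialize (HA (fst h) ltac:(lra)). specialize (HB (snd h) ltac:(lra)). specialize (HC (snd h) ltac:(lra)).
    set (p := fst h) in *. set (q := snd h) in *. set (m := Cmod h) in *.
    eapply Rle_trans; [apply Cmod_le_sum|]. unfold cexp; simpl. fold p q.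
    replace (exp p * cos q + - (1) + - p) with ((exp p - 1 - p) * (cos q - 1) + (exp p - 1 - p) + (1 + p) * (cos q - 1)) by ring.
    replace (exp p * sin q + - 0 + - q) with ((exp p - 1 - p) * (sin q - q) + (exp p - 1 - p) * q + (1 + p) * (sin q - q) + p * q) by ring.
    set (X := exp p - 1 - p) in *. set (Y := cos q - 1) in *. set (Z := sin q - q) in *.
    assert (Hm0 : 0 <= m) by apply Cmod_ge_0.
    assert (bX : Rabs X <= e1 * m) by (eapply Rle_trans; [exact HA|]; apply Rmult_le_compat_l; lra). assert (bY : Rabs Y <= e1 * m) by (eapply Rle_trans; [exact HC|]; apply Rmult_le_compat_l; lra). assert (bZ : Rabs Z <= e1 * m) by (eapply Rle_trans; [exact HB|]; apply Rmult_le_compat_l; lra).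
    assert (b1p : Rabs (1 + p) <= 2) by (eapply Rle_trans; [apply Rabs_triang|]; rewrite Rabs_R1; lra).
    assert (em1 : 0 <= e1 * m <= 1) by nra.
    assert (T1 : Rabs (X * Y + X + (1 + p) * Y) <= 4 * (e1 * m)).
    { eapply Rle_trans; [apply Rabs_triang|]. eapply Rle_trans; [apply Rplus_le_compat_r, Rabs_triang|].
      rewrite !Rabs_mult. generalize (Rabs_pos X) (Rabs_pos Y). intros.
      assert (Rabs X * Rabs Y <= e1 * m * 1) by (apply Rmult_le_both; lra).
      assert (Rabs (1 + p) * Rabs Y <= 2 * (e1 * m)) by (apply Rmult_le_both; [split; [apply Rabs_pos|]|]; lra). lra. }
    assert (T2 : Rabs (X * Z + X * q + (1 + p) * Z + p * q) <= 5 * (e1 * m)).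
    { eapply Rle_trans; [apply Rabs_triang|]. eapply Rle_trans; [apply Rplus_le_compat_r, Rabs_triang|].
      eapply Rle_trans; [apply Rplus_le_compat_r, Rplus_le_compat_r, Rabs_triang|].
      rewrite !Rabs_mult. generalize (Rabs_pos X) (Rabs_pos Z) (Rabs_pos q) (Rabs_pos p). intros.
      assert (Rabs X * Rabs Z <= e1 * m * 1) by (apply Rmult_le_both; lra).
      assert (Rabs (1 + p) * Rabs Z <= 2 * (e1 * m)) by (apply Rmult_le_both; [split; [apply Rabs_pos|]|]; lra).
      assert (Rabs X * Rabs q <= e1 * m * 1) by (apply Rmult_le_both; lra).
      assert (Rabs p * Rabs q <= e1 * m) by (apply Rmult_le_both; lra). lra. }
    assert (e1 * m <= e / 20 * m) by (apply Rmult_le_compat_r; lra). lra. }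
  intros e He. assert (Hp := exp_pos (fst x)).
  destruct (H0 (e / exp (fst x))) as [del [Hd HH]]; [apply Rdiv_lt_0_compat; auto|].
  exists del. split; [exact Hd|]. intros y _ Hy. specialize (HH _ Hy).
  replace y with (x + (y - x))%C at 1 by ring. rewrite cexp_add.
  replace (cexp x * cexp (y - x) - cexp x - cexp x * (y - x))%C with (cexp x * (cexp (y - x) - 1 - (y - x)))%C by ring.
  rewrite Cmod_mult, Cmod_cexp.
  apply (Rmult_le_compat_l (exp (fst x))) in HH; [|lra].
  replace (exp (fst x) * (e / exp (fst x) * Cmod (y - x))) with (e * Cmod (y - x)) in HH by (field; lra). exact HH.
Qed.

Definition seg (x y : C) (t : R) : C := (x + t * (y - x))%C.

Lemma seg_0 x y : seg x y 0 = x. Proof. unfold seg. ring. Qed.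
Lemma seg_1 x y : seg x y 1 = y. Proof. unfold seg. ring. Qed.
Lemma seg_diff x y t s : (seg x y t - seg x y s)%C = ((t - s)%R * (y - x))%C.
Proof. unfold seg. rewrite RtoC_minus. ring. Qed.

Lemma Re_conj_mul_le (a b : C) : Rabs (fst a * fst b + snd a * snd b) <= Cmod a * Cmod b.
Proof.
  replace (fst a * fst b + snd a * snd b) with (fst (Cconj a * b)%C) by (simpl; ring).
  eapply Rle_trans; [apply fst_le_Cmod|]. rewrite Cmod_mult, Cmod_conj. lra.
Qed.

(** The real mean value theorem is applied to the scalar product of [f (seg x y t)] with the fixed
    vector [f y - f x]. Clamping the parameter to [[0, 1]] makes this function continuous on the
    whole line although nothing is known beyond the segment. *)
Lemma mean_value (D : C -> Prop) (f : C -> C) (df : R -> C) (x y : C) (M : R) :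
  (forall t, 0 <= t <= 1 -> D (seg x y t)) ->
  (forall t, 0 <= t <= 1 -> cdiff D f (seg x y t) (df t)) ->
  (forall t, 0 <= t <= 1 -> Cmod (df t) <= M) ->
  Cmod (f y - f x) <= M * Cmod (y - x).
Proof.
  intros HD Hdf HM.
  set (del := (f y - f x)%C). set (cl := fun t => Rmax 0 (Rmin t 1)).
  assert (Hcl : forall t, 0 <= cl t <= 1).
  { intros t. unfold cl. split; [apply Rmax_l|]. apply Rmax_lub; [lra|apply Rmin_r]. }
  assert (Hcl1 : forall t s, Rabs (cl t - cl s) <= Rabs (t - s)).
  { intros t s. unfold cl, Rmax, Rmin. repeat destruct Rle_dec; unfold Rabs; repeat destruct Rcase_abs; lra. }
  assert (Hcl2 : forall t, 0 <= t <= 1 -> cl t = t).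
  { intros t Ht. unfold cl. rewrite Rmin_left by lra. apply Rmax_right. lra. }
  set (g := fun t => let v := f (seg x y (cl t)) in fst del * fst v + snd del * snd v).
  set (dg := fun t => let v := (df t * (y - x))%C in fst del * fst v + snd del * snd v).
  assert (Hg : forall t s, g t - g s = fst del * fst (f (seg x y (cl t)) - f (seg x y (cl s)))%C
                          + snd del * snd (f (seg x y (cl t)) - f (seg x y (cl s)))%C).
  { intros. unfold g. simpl. ring. }
  assert (Hk : 0 <= Cmod (y - x)) by apply Cmod_ge_0. assert (Hdl : 0 <= Cmod del) by apply Cmod_ge_0.
  destruct (MVT_gen g 0 1 dg) as [c [Hc Heq]].
  - intros t Ht. rewrite Rmin_left, Rmax_right in Ht by lra.
    apply is_derive_Reals. intros e He.
    set (e1 := e / (2 * (Cmod del + 1) * (Cmod (y - x) + 1))).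
    assert (He1 : 0 < e1) by (unfold e1; apply Rdiv_lt_0_compat; [lra|]; apply Rmult_lt_0_compat; lra).
    assert (E1 : Cmod del * (e1 * Cmod (y - x)) < e).
    { apply Rle_lt_trans with ((Cmod del + 1) * (e1 * (Cmod (y - x) + 1))).
      - apply Rmult_le_compat; [lra|apply Rmult_le_pos; lra|lra|apply Rmult_le_compat_l; lra].
      - unfold e1. replace ((Cmod del + 1) * (e / (2 * (Cmod del + 1) * (Cmod (y - x) + 1)) * (Cmod (y - x) + 1))) with (e / 2) by (field; lra). lra. }
    destruct (Hdf t ltac:(lra) e1 He1) as [d1 [Hd1 HH]].
    assert (Hpos : 0 < Rmin (Rmin t (1 - t)) (d1 / (Cmod (y - x) + 1))).
    { repeat apply Rmin_pos; try lra. apply Rdiv_lt_0_compat; lra. }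
    exists (mkposreal _ Hpos). intros h Hh Hh2. simpl in Hh2.
    assert (B1 := Rlt_le_trans _ _ _ Hh2 (Rmin_l _ _)). assert (B2 := Rlt_le_trans _ _ _ Hh2 (Rmin_r _ _)).
    assert (B3 := Rlt_le_trans _ _ _ B1 (Rmin_l _ _)). assert (B4 := Rlt_le_trans _ _ _ B1 (Rmin_r _ _)).
    apply Rabs_def2 in B3. apply Rabs_def2 in B4.
    assert (Hth : 0 <= t + h <= 1) by lra.
    specialize (HH (seg x y (t + h)) (HD _ Hth)).
    rewrite seg_diff in HH. replace (t + h - t) with h in HH by ring. rewrite Cmod_mult, Cmod_R in HH.
    assert (B5 : Rabs h * Cmod (y - x) < d1).
    { apply (Rmult_lt_compat_r (Cmod (y - x) + 1)) in B2; [|lra].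
      replace (d1 / (Cmod (y - x) + 1) * (Cmod (y - x) + 1)) with d1 in B2 by (field; lra).
      generalize (Rabs_pos h). nra. }
    specialize (HH B5).
    rewrite Hg, !Hcl2 by lra.
    match goal with |- Rabs (?A / h - ?B) < e => replace (A / h - B) with ((A - B * h) / h) by (field; exact Hh) end.
    rewrite Rabs_div by exact Hh. apply (Rmult_lt_reg_r (Rabs h)); [apply Rabs_pos_lt; exact Hh|].
    unfold Rdiv. rewrite Rmult_assoc, Rinv_l, Rmult_1_r by (apply Rabs_no_R0; exact Hh).
    eapply Rle_lt_trans; [|apply Rmult_lt_compat_r; [apply Rabs_pos_lt; exact Hh|exact E1]].
    set (v := (f (seg x y (t + h)) - f (seg x y t) - df t * (h * (y - x)))%C) in *.
    match goal with |- Rabs ?A <= _ => replace A with (fst del * fst v + snd del * snd v) by (unfold v, dg; simpl; ring) end.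
    eapply Rle_trans; [apply Re_conj_mul_le|]. rewrite Rmult_assoc. apply Rmult_le_compat_l; [lra|].
    eapply Rle_trans; [exact HH|]. lra.
  - intros t _. intros e He.
    destruct (cdiff_ccont _ _ _ _ (Hdf (cl t) (Hcl t)) (e / (Cmod del + 1))) as [d1 [Hd1 HH]]; [apply Rdiv_lt_0_compat; lra|].
    exists (d1 / (Cmod (y - x) + 1)). split; [apply Rdiv_lt_0_compat; lra|].
    intros t' [_ Ht']. change (Rabs (t' - t) < d1 / (Cmod (y - x) + 1)) in Ht'. change (Rabs (g t' - g t) < e).
    specialize (HH (seg x y (cl t')) (HD _ (Hcl _))). rewrite seg_diff, Cmod_mult, Cmod_R in HH.
    assert (B : Rabs (cl t' - cl t) * Cmod (y - x) < d1).
    { apply (Rmult_lt_compat_r (Cmod (y - x) + 1)) in Ht'; [|lra].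
      replace (d1 / (Cmod (y - x) + 1) * (Cmod (y - x) + 1)) with d1 in Ht' by (field; lra).
      generalize (Hcl1 t' t) (Rabs_pos (cl t' - cl t)). nra. }
    specialize (HH B). rewrite Hg. eapply Rle_lt_trans; [apply Re_conj_mul_le|].
    apply (Rmult_lt_compat_r (Cmod del + 1)) in HH; [|lra].
    replace (e / (Cmod del + 1) * (Cmod del + 1)) with e in HH by (field; lra).
    generalize (Cmod_ge_0 (f (seg x y (cl t')) - f (seg x y (cl t)))). nra.
  - rewrite Rmin_left, Rmax_right in Hc by lra.
    rewrite Hg, !Hcl2, seg_0, seg_1 in Heq by lra. fold del in Heq.
    assert (Heq2 : Cmod del * Cmod del = dg c) by (rewrite Cmod_sqr; lra).
    assert (Hdg : dg c <= Cmod del * (M * Cmod (y - x))).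
    { unfold dg. eapply Rle_trans; [apply Rle_abs|]. eapply Rle_trans; [apply Re_conj_mul_le|].
      apply Rmult_le_compat_l; [lra|]. rewrite Cmod_mult. apply Rmult_le_compat_r; [lra|]. apply HM. exact Hc. }
    destruct (Req_dec (Cmod del) 0) as [E|E].
    + rewrite E. assert (0 <= M) by (eapply Rle_trans; [apply (Cmod_ge_0 (df 0))|apply HM; lra]). nra.
    + nra.
Qed.

(** * Coding the limit set of a system of lifted inverse branches *)

Definition shiftn (k : nat) (om : nat -> nat) : nat -> nat := fun j => om (k + j)%nat.

Fixpoint wcomp (G : nat -> C -> C) (k : nat) (om : nat -> nat) (x : C) : C :=
  match k with O => x | S k' => G (om 0%nat) (wcomp G k' (shiftn 1 om) x) end.

Fixpoint wdeg (e : nat -> Z) (k : nat) (om : nat -> nat) : Z :=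
  match k with O => 1%Z | S k' => (e (om 0%nat) * wdeg e k' (shiftn 1 om))%Z end.

Definition word (n : nat) (om : nat -> nat) : Prop := forall k, (om k < n)%nat.

Lemma word_shiftn n k om : word n om -> word n (shiftn k om).
Proof. intros H j. apply H. Qed.

Lemma shiftn_shiftn j k om : shiftn j (shiftn k om) = shiftn (j + k) om.
Proof. apply functional_extensionality; intros i. unfold shiftn. f_equal. lia. Qed.

Lemma wcomp_add G k m om x : wcomp G (k + m) om x = wcomp G k om (wcomp G m (shiftn k om) x).
Proof.
  revert om. induction k as [|k IH]; intros om; [reflexivity|]. simpl. rewrite IH, shiftn_shiftn.
  replace (k + 1)%nat with (S k) by lia. reflexivity.
Qed.

Lemma wcomp_S_r G k om x : wcomp G (S k) om x = wcomp G k om (G (om k) x).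
Proof.
  replace (S k) with (k + 1)%nat by lia. rewrite wcomp_add. simpl. unfold shiftn. rewrite Nat.add_0_r. reflexivity.
Qed.

Lemma wdeg_add e k m om : wdeg e (k + m) om = (wdeg e k om * wdeg e m (shiftn k om))%Z.
Proof.
  revert om. induction k as [|k IH]; intros om; [rewrite Z.mul_1_l; reflexivity|]. simpl. rewrite IH, shiftn_shiftn.
  replace (k + 1)%nat with (S k) by lia. ring.
Qed.

Lemma wcomp_ext G k om om' x : (forall j, (j < k)%nat -> om j = om' j) -> wcomp G k om x = wcomp G k om' x.
Proof.
  revert om om'. induction k as [|k IH]; intros om om' H; [reflexivity|]. simpl.
  rewrite (H 0%nat) by lia. f_equal. apply IH. intros j Hj. unfold shiftn. apply H. lia.
Qed.

Lemma wdeg_ext e k om om' : (forall j, (j < k)%nat -> om j = om' j) -> wdeg e k om = wdeg e k om'.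
Proof.
  revert om om'. induction k as [|k IH]; intros om om' H; [reflexivity|]. simpl.
  rewrite (H 0%nat) by lia. f_equal. apply IH. intros j Hj. unfold shiftn. apply H. lia.
Qed.

(** No rate is asked for: with a parabolic point it is not exponential. The bound [K] is there
    because the lift of an annulus has infinite diameter, while only points with bounded difference
    of angles are ever compared. *)
Definition uniformly_shrinking (X : C -> Prop) (G : nat -> C -> C) (n : nat) : Prop :=
  forall K eps, 0 < eps -> exists N, forall k om x y, (N <= k)%nat -> word n om -> X x -> X y ->
    Cmod (x - y) <= K -> Cmod (wcomp G k om x - wcomp G k om y) <= eps.

(** [X] is the logarithmic lift of an annulus and [G i] the lift of the inverse of [F] on the
    [i]-th subannulus, whose covering degree (with sign) is [e i]. *)
Record lifted_branches (X : C -> Prop) (n : nat) (G : nat -> C -> C) (e : nat -> Z) (F : C -> C)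
    (bd be Rb Em rho : R) : Prop := {
  lb_n : (2 <= n)%nat;
  lb_closed : cclosed X;
  lb_period : forall x m, X x -> X (x + tpi m)%C;
  lb_base : forall t, X (be, t);
  lb_Re : forall x, X x -> Rabs (fst x) <= Rb;
  lb_maps : forall i x, (i < n)%nat -> X x -> X (G i x);
  lb_cont : forall i x, (i < n)%nat -> X x -> ccont X (G i) x;
  lb_inj : forall i x y, (i < n)%nat -> X x -> X y -> G i x = G i y -> x = y;
  lb_equiv : forall i x m, (i < n)%nat -> X x -> G i (x + tpi (e i * m))%C = (G i x + tpi m)%C;
  lb_dev : forall i x, (i < n)%nat -> X x -> Rabs (snd (G i x) - snd x / IZR (e i)) <= bd;
  lb_deg : forall i, (i < n)%nat -> 2 <= Rabs (IZR (e i)) <= Em;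
  lb_sep : 0 < rho /\ forall i j x y, (i < n)%nat -> (j < n)%nat -> X x -> X y ->
     Cmod (cexp (G i x) - cexp (G j y)) < rho -> i = j;
  lb_F : forall i x, (i < n)%nat -> X x -> F (cexp (G i x)) = cexp x;
  lb_Fcont : forall i x, (i < n)%nat -> X x -> ccont ctrue F (cexp (G i x));
  lb_shrink : uniformly_shrinking X G n
}.
Arguments lb_n {X n G e F bd be Rb Em rho}.
Arguments lb_closed {X n G e F bd be Rb Em rho}.
Arguments lb_period {X n G e F bd be Rb Em rho}.
Arguments lb_base {X n G e F bd be Rb Em rho}.
Arguments lb_Re {X n G e F bd be Rb Em rho}.
Arguments lb_maps {X n G e F bd be Rb Em rho}.
Arguments lb_cont {X n G e F bd be Rb Em rho}.
Arguments lb_inj {X n G e F bd be Rb Em rho}.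
Arguments lb_equiv {X n G e F bd be Rb Em rho}.
Arguments lb_dev {X n G e F bd be Rb Em rho}.
Arguments lb_deg {X n G e F bd be Rb Em rho}.
Arguments lb_sep {X n G e F bd be Rb Em rho}.
Arguments lb_F {X n G e F bd be Rb Em rho}.
Arguments lb_Fcont {X n G e F bd be Rb Em rho}.
Arguments lb_shrink {X n G e F bd be Rb Em rho}.

Section Coding.
Variables (X : C -> Prop) (n : nat) (G : nat -> C -> C) (e : nat -> Z) (F : C -> C) (bd be Rb Em rho : R).
Hypothesis H : lifted_branches X n G e F bd be Rb Em rho.

Lemma wcomp_X k om x : word n om -> X x -> X (wcomp G k om x).
Proof.
  revert om. induction k as [|k IH]; intros om Hw Hx; [exact Hx|].
  simpl. apply (lb_maps H); [apply Hw|]. apply IH; [apply word_shiftn|]; assumption.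
Qed.

Lemma ccont_seq (D : C -> Prop) f (l : C) (u : nat -> C) : ccont D f l -> (forall k, D (u k)) -> conv u l -> conv (fun k => f (u k)) (f l).
Proof.
  intros Hf HD Hu eps He. destruct (Hf eps He) as [del [Hd HH]]. destruct (Hu del Hd) as [N HN].
  exists N. intros k Hk. apply HH; auto.
Qed.

Lemma wcomp_conv k om u l : word n om -> (forall j, X (u j)) -> X l -> conv u l ->
  conv (fun j => wcomp G k om (u j)) (wcomp G k om l).
Proof.
  revert om. induction k as [|k IH]; intros om Hw Hu Hl Hc; [exact Hc|]. simpl.
  apply (ccont_seq X (G (om 0%nat))).
  - apply (lb_cont H); [apply Hw|]. apply wcomp_X; [apply word_shiftn|]; auto.
  - intros j. apply wcomp_X; [apply word_shiftn|]; auto.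
  - apply IH; auto. apply word_shiftn; auto.
Qed.

Lemma bd_pos : 0 <= bd.
Proof.
  eapply Rle_trans; [apply Rabs_pos|]. apply (lb_dev H 0%nat (be, 0)).
  - generalize (lb_n H); lia.
  - apply (lb_base H).
Qed.

Lemma wdeg_ge k om : word n om -> 2 ^ k <= Rabs (IZR (wdeg e k om)) <= Em ^ k.
Proof.
  revert om. induction k as [|k IH]; intros om Hw; [simpl; rewrite Rabs_R1; lra|].
  simpl wdeg. rewrite mult_IZR, Rabs_mult. simpl.
  specialize (IH (shiftn 1 om) (word_shiftn _ _ _ Hw)).
  assert (D := lb_deg H (om 0%nat) (Hw 0%nat)).
  assert (0 < 2 ^ k) by (apply pow_lt; lra).
  split; apply Rmult_le_compat; lra.
Qed.

Lemma wdeg_neq_0 k om : word n om -> IZR (wdeg e k om) <> 0.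
Proof.
  intros Hw E. generalize (wdeg_ge k om Hw). rewrite E, Rabs_R0. assert (0 < 2 ^ k) by (apply pow_lt; lra). lra.
Qed.

(** Each step divides the deviation accumulated so far by a degree of modulus at least [2], so the
    errors [bd] add up to at most [2 bd]. *)
Lemma wcomp_dev k om x : word n om -> X x -> Rabs (snd (wcomp G k om x) - snd x / IZR (wdeg e k om)) <= 2 * bd.
Proof.
  revert om. induction k as [|k IH]; intros om Hw Hx.
  - simpl. replace (snd x - snd x / 1) with 0 by field. rewrite Rabs_R0. generalize bd_pos; lra.
  - assert (Hw' := word_shiftn n 1 om Hw). specialize (IH _ Hw' Hx).
    assert (Hxk : X (wcomp G k (shiftn 1 om) x)) by (apply wcomp_X; auto).
    assert (D := lb_dev H _ _ (Hw 0%nat) Hxk).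
    assert (E := lb_deg H (om 0%nat) (Hw 0%nat)).
    assert (E0 : IZR (e (om 0%nat)) <> 0) by (intros Q; rewrite Q, Rabs_R0 in E; lra).
    assert (W0 := wdeg_neq_0 k _ Hw'). simpl. rewrite mult_IZR.
    set (v := wcomp G k (shiftn 1 om) x) in *. set (a := IZR (e (om 0%nat))) in *. set (b := IZR (wdeg e k (shiftn 1 om))) in *.
    replace (snd (G (om 0%nat) v) - snd x / (a * b)) with ((snd (G (om 0%nat) v) - snd v / a) + (snd v - snd x / b) / a) by (field; auto).
    eapply Rle_trans; [apply Rabs_triang|]. rewrite Rabs_div by exact E0.
    assert (Rabs (snd v - snd x / b) / Rabs a <= bd).
    { apply (Rmult_le_reg_r (Rabs a)); [lra|]. unfold Rdiv. rewrite Rmult_assoc, Rinv_l, Rmult_1_r by lra. generalize bd_pos; nra. }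
    lra.
Qed.

Definition wdiam : R := 2 * Rb + 6 * bd + 1.

Lemma X_close x y : X x -> X y -> Rabs (snd x - snd y) <= 6 * bd + 1 -> Cmod (x - y) <= wdiam.
Proof.
  intros Hx Hy Hd. eapply Rle_trans; [apply Cmod_le_sum|]. simpl. unfold wdiam.
  assert (A := lb_Re H _ Hx). assert (B := lb_Re H _ Hy).
  generalize (Rabs_triang (fst x) (- fst y)). rewrite Rabs_Ropp. unfold Rminus in Hd. lra.
Qed.

(** The angle [x] is carried forward [k] levels linearly, by multiplication with the covering
    degree, and the point of the base line at that height is pulled back. By [wcomp_dev] the result
    stays within [2 bd] of the height [x]; the limit is the point with code [om] and asymptotic
    angle [x]. *)
Definition approx (om : nat -> nat) (x : R) (k : nat) : C := wcomp G k om (be, IZR (wdeg e k om) * x).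

Lemma approx_X om x k : word n om -> X (approx om x k).
Proof. intros Hw. apply wcomp_X; [exact Hw|]. apply (lb_base H). Qed.

Lemma approx_shift om x k m : approx om x (k + m) = wcomp G k om (approx (shiftn k om) (IZR (wdeg e k om) * x) m).
Proof.
  unfold approx. rewrite wcomp_add, wdeg_add, mult_IZR. f_equal. f_equal. f_equal. ring.
Qed.

Lemma approx_Im om x k : word n om -> Rabs (snd (approx om x k) - x) <= 2 * bd.
Proof.
  intros Hw. assert (A := wcomp_dev k om (be, IZR (wdeg e k om) * x) Hw (lb_base H _)).
  simpl snd in A. replace (IZR (wdeg e k om) * x / IZR (wdeg e k om)) with x in A by (field; apply wdeg_neq_0; exact Hw).
  exact A.
Qed.

(** A later approximation is the image under the first [N] branches of an approximation for the
    shifted word, which lies at bounded distance from the base point of level [N]; shrinking does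
    the rest. *)
Lemma approx_cauchy om x : word n om -> exists l, conv (approx om x) l.
Proof.
  intros Hw. apply C_complete. intros eps He.
  destruct (lb_shrink H wdiam (eps / 3)) as [N HN]; [lra|].
  assert (A : forall j, (N <= j)%nat -> Cmod (approx om x j - approx om x N) <= eps / 3).
  { intros j Hj. replace j with (N + (j - N))%nat by lia. rewrite approx_shift.
    unfold approx at 2. apply HN; auto.
    - apply approx_X, word_shiftn, Hw.
    - apply (lb_base H).
    - apply X_close; [apply approx_X, word_shiftn, Hw|apply (lb_base H)|].
      simpl snd at 2. eapply Rle_trans; [apply approx_Im, word_shiftn, Hw|]. generalize bd_pos; lra. }
  exists N. intros j k Hj Hk. generalize (A j Hj) (A k Hk) (Cmod_tri3 (approx om x j) (approx om x N) (approx om x k)).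
  rewrite (Cmod_sub_sym (approx om x N)). lra.
Qed.

Definition limpt (om : nat -> nat) (x : R) : C := epsilon (inhabits (RtoC 0)) (conv (approx om x)).

Lemma limpt_conv om x : word n om -> conv (approx om x) (limpt om x).
Proof. intros Hw. unfold limpt. apply epsilon_spec, approx_cauchy, Hw. Qed.

Lemma limpt_X om x : word n om -> X (limpt om x).
Proof.
  intros Hw. apply (lb_closed H (approx om x)); [intros; apply approx_X, Hw|apply limpt_conv, Hw].
Qed.

Lemma limpt_rec k om x : word n om -> limpt om x = wcomp G k om (limpt (shiftn k om) (IZR (wdeg e k om) * x)).
Proof.
  intros Hw. apply (conv_unique (fun m => approx om x (k + m))).
  - intros eps He. destruct (limpt_conv om x Hw eps He) as [N HN]. exists N. intros m Hm. apply HN. lia.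
  - assert (A : conv (fun m => wcomp G k om (approx (shiftn k om) (IZR (wdeg e k om) * x) m))
                (wcomp G k om (limpt (shiftn k om) (IZR (wdeg e k om) * x)))).
    { apply wcomp_conv; auto.
      - intros. apply approx_X, word_shiftn, Hw.
      - apply limpt_X, word_shiftn, Hw.
      - apply limpt_conv, word_shiftn, Hw. }
    intros eps He. destruct (A eps He) as [N HN]. exists N. intros m Hm. rewrite approx_shift. apply HN, Hm.
Qed.

Lemma limpt_Im om x : word n om -> Rabs (snd (limpt om x) - x) <= 2 * bd.
Proof.
  intros Hw. apply Rnot_lt_le. intros Hlt.
  destruct (limpt_conv om x Hw (Rabs (snd (limpt om x) - x) - 2 * bd)) as [N HN]; [lra|].
  specialize (HN N (Nat.le_refl N)). assert (A := approx_Im om x N Hw).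
  assert (B := snd_le_Cmod (approx om x N - limpt om x)). simpl in B.
  generalize (Rabs_triang (snd (approx om x N) - x) (- (snd (approx om x N) + - snd (limpt om x)))).
  rewrite Rabs_Ropp. replace (snd (approx om x N) - x + - (snd (approx om x N) + - snd (limpt om x))) with (snd (limpt om x) - x) by ring.
  lra.
Qed.

Lemma wcomp_equiv k om x m : word n om -> X x -> wcomp G k om (x + tpi (wdeg e k om * m))%C = (wcomp G k om x + tpi m)%C.
Proof.
  revert om m. induction k as [|k IH]; intros om m Hw Hx.
  - simpl wdeg. rewrite Z.mul_1_l. reflexivity.
  - simpl. replace (e (om 0%nat) * wdeg e k (shiftn 1 om) * m)%Z with (wdeg e k (shiftn 1 om) * (e (om 0%nat) * m))%Z by ring.
    rewrite IH; [|apply word_shiftn|]; auto. apply (lb_equiv H); [apply Hw|].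
    apply wcomp_X; auto. apply word_shiftn; auto.
Qed.

Lemma limpt_period om x m : word n om -> limpt om (x + 2 * PI * IZR m) = (limpt om x + tpi m)%C.
Proof.
  intros Hw. apply (conv_unique (approx om (x + 2 * PI * IZR m))); [apply limpt_conv, Hw|].
  intros eps He. destruct (limpt_conv om x Hw eps He) as [N HN]. exists N. intros k Hk.
  unfold approx. replace (be, IZR (wdeg e k om) * (x + 2 * PI * IZR m)) with ((be, (IZR (wdeg e k om) * x)%R) + tpi (wdeg e k om * m))%C.
  - rewrite wcomp_equiv; [|exact Hw|apply (lb_base H)].
    replace (wcomp G k om (be, (IZR (wdeg e k om) * x)%R) + tpi m - (limpt om x + tpi m))%C
      with (wcomp G k om (be, (IZR (wdeg e k om) * x)%R) - limpt om x)%C by ring.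
    apply (HN k Hk).
  - unfold tpi, Cplus; simpl. rewrite mult_IZR. f_equal; ring.
Qed.

(** Both points are images under the same [N] branches, and their arguments lie at bounded distance
    because [N] levels multiply the difference of angles by at most [Em ^ N]. *)
Lemma limpt_uniform eps : 0 < eps -> exists N, forall om om' x x', word n om -> word n om' ->
  (forall j, (j < N)%nat -> om j = om' j) -> Em ^ N * Rabs (x - x') <= 1 -> Cmod (limpt om x - limpt om' x') <= eps.
Proof.
  intros He. destruct (lb_shrink H wdiam eps He) as [N HN]. exists N.
  intros om om' x x' Hw Hw' Hag Hx. rewrite (limpt_rec N om x Hw), (limpt_rec N om' x' Hw').
  rewrite <- (wcomp_ext G N om om' _ Hag), <- (wdeg_ext e N om om' Hag).
  assert (W := word_shiftn n N om Hw). assert (W' := word_shiftn n N om' Hw').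
  apply HN; auto; [apply limpt_X; auto|apply limpt_X; auto|].
  apply X_close; [apply limpt_X; auto|apply limpt_X; auto|].
  set (D := IZR (wdeg e N om)).
  assert (A := limpt_Im (shiftn N om) (D * x) W). assert (B := limpt_Im (shiftn N om') (D * x') W').
  assert (Q : Rabs (D * x - D * x') <= 1).
  { rewrite <- Rmult_minus_distr_l, Rabs_mult. eapply Rle_trans; [|exact Hx].
    apply Rmult_le_compat_r; [apply Rabs_pos|]. apply wdeg_ge, Hw. }
  set (p := snd (limpt (shiftn N om) (D * x))) in *. set (q := snd (limpt (shiftn N om') (D * x'))) in *.
  apply Rabs_le_between in A. apply Rabs_le_between in B. apply Rabs_le_between in Q. apply Rabs_le. generalize bd_pos. lra.
Qed.

(** Membership is witnessed by a whole lifted orbit, so that letters and angles can be read off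
    without choosing logarithms again. *)
Definition limset (z : C) : Prop :=
  exists om xi, word n om /\ (forall k, X (xi k)) /\ (forall k, xi k = G (om k) (xi (S k))) /\ z = cexp (xi 0%nat).

Lemma orbit_wcomp om (xi : nat -> C) k : (forall j, xi j = G (om j) (xi (S j))) -> xi 0%nat = wcomp G k om (xi k).
Proof.
  intros Hx. induction k as [|k IH]; [reflexivity|]. rewrite wcomp_S_r, <- Hx. exact IH.
Qed.

Lemma limpt_limset om x : word n om -> limset (cexp (limpt om x)).
Proof.
  intros Hw. exists om, (fun k => limpt (shiftn k om) (IZR (wdeg e k om) * x)). split; [exact Hw|]. split; [|split].
  - intros k. apply limpt_X, word_shiftn, Hw.
  - intros k. rewrite (limpt_rec 1 (shiftn k om)) by (apply word_shiftn, Hw). simpl wcomp.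
    unfold shiftn at 1. rewrite Nat.add_0_r, shiftn_shiftn. simpl (1 + k)%nat.
    replace (wdeg e (S k) om) with (wdeg e k om * wdeg e 1 (shiftn k om))%Z by (rewrite <- wdeg_add; f_equal; lia).
    match goal with |- G _ (limpt _ ?a) = G _ (limpt _ ?b) =>
      replace b with a; [reflexivity|simpl wdeg; rewrite ?mult_IZR; ring] end.
  - simpl. rewrite Rmult_1_l. reflexivity.
Qed.

Lemma half_pow_conv (c : R) (eps : R) : 0 <= c -> 0 < eps -> exists N, forall k, (N <= k)%nat -> c / 2 ^ k < eps.
Proof.
  intros Hc He. destruct (pow_small (/ 2) (eps / (c + 1)) ltac:(lra)) as [N HN]; [apply Rdiv_lt_0_compat; lra|].
  exists N. intros k Hk. specialize (HN k Hk). rewrite pow_inv in HN.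
  apply (Rmult_lt_compat_l (c + 1)) in HN; [|lra]. replace ((c + 1) * (eps / (c + 1))) with eps in HN by (field; lra).
  unfold Rdiv. nra.
Qed.

(** The heights along the orbit divided by the degrees form a Cauchy sequence; its limit [x] is the
    angle. At every level the orbit point and the point coded by the shifted word and the multiplied
    angle then lie at bounded distance, so shrinking forces the two points at level [0] to agree. *)
Lemma limset_limpt z : limset z -> exists om x, word n om /\ z = cexp (limpt om x).
Proof.
  intros [om [xi [Hw [HX [Hrec Hz]]]]].
  set (v := fun k => snd (xi k) / IZR (wdeg e k om)).
  (* the angle of z is the limit of v *)
  assert (Hstep : forall k j, Rabs (v k - v (k + j)%nat) <= 2 * bd / 2 ^ k).
  { intros k j. assert (E : xi k = wcomp G j (shiftn k om) (xi (k + j)%nat)).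
    { assert (E0 := orbit_wcomp (shiftn k om) (fun i => xi (k + i)%nat) j). simpl in E0.
      rewrite Nat.add_0_r in E0. apply E0. intros i. rewrite (Hrec (k + i)%nat). rewrite Nat.add_succ_r. reflexivity. }
    assert (A := wcomp_dev j (shiftn k om) (xi (k + j)%nat) (word_shiftn _ _ _ Hw) (HX _)). rewrite <- E in A.
    unfold v. rewrite wdeg_add, mult_IZR.
    assert (D := wdeg_ge k om Hw). assert (D0 := wdeg_neq_0 k om Hw). assert (D1 := wdeg_neq_0 j _ (word_shiftn _ k _ Hw)).
    replace (snd (xi k) / IZR (wdeg e k om) - snd (xi (k + j)%nat) / (IZR (wdeg e k om) * IZR (wdeg e j (shiftn k om))))
      with ((snd (xi k) - snd (xi (k + j)%nat) / IZR (wdeg e j (shiftn k om))) / IZR (wdeg e k om)) by (field; auto).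
    rewrite Rabs_div by exact D0. assert (P2 : 0 < 2 ^ k) by (apply pow_lt; lra).
    unfold Rdiv. apply Rmult_le_compat; [apply Rabs_pos|left; apply Rinv_0_lt_compat; lra|exact A|apply Rinv_le_contravar; lra]. }
  destruct (Rcomplete.R_complete v) as [x Hx].
  { intros eps He. destruct (half_pow_conv (2 * bd) (eps / 2)) as [N HN]; [generalize bd_pos; lra|lra|].
    exists N. intros j k Hj Hk. unfold Rdist. specialize (HN N (Nat.le_refl N)).
    assert (A := Hstep N (j - N)%nat). assert (B := Hstep N (k - N)%nat).
    replace (N + (j - N))%nat with j in A by lia. replace (N + (k - N))%nat with k in B by lia.
    apply Rabs_def1; apply Rabs_le_between in A; apply Rabs_le_between in B; lra. }
  exists om, x. split; [exact Hw|]. rewrite Hz. f_equal.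
  assert (Hlim : forall k, Rabs (v k - x) <= 2 * bd / 2 ^ k).
  { intros k. apply Rnot_lt_le. intros Hlt. destruct (Hx (Rabs (v k - x) - 2 * bd / 2 ^ k)) as [N HN]; [lra|].
    specialize (HN (k + N)%nat ltac:(lia)). unfold Rdist in HN. assert (A := Hstep k N).
    generalize (Rabs_triang (v k - v (k + N)%nat) (v (k + N)%nat - x)).
    replace (v k - v (k + N)%nat + (v (k + N)%nat - x)) with (v k - x) by ring. lra. }
  apply C_eq_of_small. intros eps He.
  destruct (lb_shrink H (wdiam + Rabs (2 * bd * Em)) eps He) as [N HN].
  rewrite (orbit_wcomp om xi N Hrec), (limpt_rec N om x Hw).
  assert (W := word_shiftn n N om Hw).
  apply HN; auto; [apply limpt_X; auto|].
  assert (C0 : Rabs (snd (xi N) - IZR (wdeg e N om) * x) <= 2 * bd).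
  { (* shift the base level to N, where the error bound is 2 bd *)
    set (vN := fun k => snd (xi (N + k)%nat) / IZR (wdeg e k (shiftn N om))).
    assert (A : forall k, Rabs (snd (xi N) - vN k) <= 2 * bd).
    { intros k. assert (E : xi N = wcomp G k (shiftn N om) (xi (N + k)%nat)).
      { assert (E0 := orbit_wcomp (shiftn N om) (fun i => xi (N + i)%nat) k). simpl in E0.
        rewrite Nat.add_0_r in E0. apply E0. intros i. rewrite (Hrec (N + i)%nat). rewrite Nat.add_succ_r. reflexivity. }
      assert (B := wcomp_dev k (shiftn N om) (xi (N + k)%nat) W (HX _)). rewrite <- E in B. exact B. }
    assert (EV : forall k, vN k = IZR (wdeg e N om) * v (N + k)%nat).
    { intros k. unfold vN, v. rewrite wdeg_add, mult_IZR. field. split; apply wdeg_neq_0; auto. }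
    apply Rnot_lt_le. intros Hlt. set (D := IZR (wdeg e N om)) in *.
    destruct (Hx ((Rabs (snd (xi N) - D * x) - 2 * bd) / (Rabs D + 1))) as [M HM].
    { apply Rdiv_lt_0_compat; [lra|]. generalize (Rabs_pos D); lra. }
    specialize (HM (N + M)%nat ltac:(lia)). unfold Rdist in HM. specialize (A M). rewrite EV in A.
    apply (Rmult_lt_compat_r (Rabs D + 1)) in HM; [|generalize (Rabs_pos D); lra].
    replace ((Rabs (snd (xi N) - D * x) - 2 * bd) / (Rabs D + 1) * (Rabs D + 1)) with (Rabs (snd (xi N) - D * x) - 2 * bd) in HM
      by (field; generalize (Rabs_pos D); lra).
    assert (T := Rabs_triang (snd (xi N) - D * v (N + M)%nat) (D * (v (N + M)%nat - x))).
    replace (snd (xi N) - D * v (N + M)%nat + D * (v (N + M)%nat - x)) with (snd (xi N) - D * x) in T by ring.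
    rewrite Rabs_mult in T. generalize (Rabs_pos (v (N + M)%nat - x)) (Rabs_pos D). nra. }
  assert (C1 := limpt_Im (shiftn N om) (IZR (wdeg e N om) * x) W).
  apply Rle_trans with wdiam; [|generalize (Rabs_pos (2 * bd * Em)); lra].
  apply X_close; [apply HX|apply limpt_X; auto|].
  apply Rabs_le_between in C0. apply Rabs_le_between in C1. apply Rabs_le. generalize bd_pos. lra.
Qed.

Lemma limpt_F om x : word n om -> F (cexp (limpt om x)) = cexp (limpt (shiftn 1 om) (IZR (e (om 0%nat)) * x)).
Proof.
  intros Hw. rewrite (limpt_rec 1 om x Hw). simpl wcomp. simpl wdeg. rewrite Z.mul_1_r.
  apply (lb_F H); [apply Hw|]. apply limpt_X, word_shiftn, Hw.
Qed.

Lemma limpt_letter om x : word n om ->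
  exists y, X y /\ cexp (limpt om x) = cexp (G (om 0%nat) y).
Proof.
  intros Hw. exists (limpt (shiftn 1 om) (IZR (wdeg e 1 om) * x)). split; [apply limpt_X, word_shiftn, Hw|].
  rewrite (limpt_rec 1 om x Hw) at 1. reflexivity.
Qed.

(** The first letter is determined by the separation of the images of the branches, and [F] shifts
    the word. *)
Lemma limpt_code_inj om om' x x' : word n om -> word n om' -> cexp (limpt om x) = cexp (limpt om' x') -> forall k, om k = om' k.
Proof.
  intros Hw Hw' E k. revert om om' x x' Hw Hw' E. induction k as [|k IH]; intros om om' x x' Hw Hw' E.
  - destruct (limpt_letter om x Hw) as [y [Hy Ey]]. destruct (limpt_letter om' x' Hw') as [y' [Hy' Ey']].
    destruct (lb_sep H) as [Hr Hs]. apply (Hs _ _ y y'); auto.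
    rewrite <- Ey, <- Ey', E. replace (cexp (limpt om' x') - cexp (limpt om' x'))%C with (RtoC 0) by ring. rewrite Cmod_0. exact Hr.
  - apply (IH (shiftn 1 om) (shiftn 1 om') (IZR (e (om 0%nat)) * x) (IZR (e (om' 0%nat)) * x')).
    + apply word_shiftn, Hw.
    + apply word_shiftn, Hw'.
    + rewrite <- !limpt_F by assumption. rewrite E. reflexivity.
Qed.

Lemma wcomp_inj k om x y : word n om -> X x -> X y -> wcomp G k om x = wcomp G k om y -> x = y.
Proof.
  revert om. induction k as [|k IH]; intros om Hw Hx Hy E; [exact E|]. simpl in E.
  apply (lb_inj H) in E; [|apply Hw| |].
  - apply (IH (shiftn 1 om)); auto. apply word_shiftn, Hw.
  - apply wcomp_X; auto. apply word_shiftn, Hw.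
  - apply wcomp_X; auto. apply word_shiftn, Hw.
Qed.

(** Injectivity of the branches carries the equality to level [k], where the angles differ by the
    degree times [x - x2]. This difference stays below [4 bd], while the degree is at least
    [2 ^ k]. *)
Lemma limpt_angle_inj om x x' : word n om -> cexp (limpt om x) = cexp (limpt om x') -> exists m : Z, x = x' + 2 * PI * IZR m.
Proof.
  intros Hw E. apply cexp_eq in E. destruct E as [m Hm]. exists m. rewrite <- limpt_period in Hm by exact Hw.
  set (x2 := x' + 2 * PI * IZR m) in *.
  assert (Hb : forall k, Rabs (x - x2) <= 4 * bd / 2 ^ k).
  { intros k. rewrite (limpt_rec k om x Hw), (limpt_rec k om x2 Hw) in Hm.
    assert (W := word_shiftn n k om Hw).
    apply wcomp_inj in Hm; auto; [|apply limpt_X; auto|apply limpt_X; auto].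
    assert (A := limpt_Im (shiftn k om) (IZR (wdeg e k om) * x) W). assert (B := limpt_Im (shiftn k om) (IZR (wdeg e k om) * x2) W).
    rewrite Hm in A. set (p := snd (limpt (shiftn k om) (IZR (wdeg e k om) * x2))) in *.
    assert (Q : Rabs (IZR (wdeg e k om) * (x - x2)) <= 4 * bd).
    { apply Rabs_le_between in A. apply Rabs_le_between in B. apply Rabs_le. lra. }
    rewrite Rabs_mult in Q. assert (D := wdeg_ge k om Hw). assert (P2 : 0 < 2 ^ k) by (apply pow_lt; lra).
    apply (Rmult_le_reg_l (2 ^ k)); [exact P2|]. replace (2 ^ k * (4 * bd / 2 ^ k)) with (4 * bd) by (field; lra).
    generalize (Rabs_pos (x - x2)). nra. }
  destruct (Req_dec x x2) as [Q|Q]; [exact Q|].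
  assert (P : 0 < Rabs (x - x2)) by (apply Rabs_pos_lt; lra).
  destruct (half_pow_conv (4 * bd) (Rabs (x - x2)) ltac:(generalize bd_pos; lra) P) as [N HN].
  specialize (HN N (Nat.le_refl N)). specialize (Hb N). lra.
Qed.

(** Closeness below [rho] fixes the first letter, and continuity of [F] passes closeness on to the
    next point of the orbit. *)
Lemma letters_continuous N om x : word n om -> exists del, 0 < del /\ forall om' x', word n om' ->
  Cmod (cexp (limpt om' x') - cexp (limpt om x)) < del -> forall j, (j < N)%nat -> om j = om' j.
Proof.
  revert om x. induction N as [|N IH]; intros om x Hw.
  { exists 1. split; [lra|]. intros; lia. }
  destruct (IH (shiftn 1 om) (IZR (e (om 0%nat)) * x) (word_shiftn _ _ _ Hw)) as [d1 [Hd1 H1]].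
  destruct (lb_sep H) as [Hr Hs].
  destruct (limpt_letter om x Hw) as [y [Hy Ey]].
  destruct (lb_Fcont H (om 0%nat) y (Hw 0%nat) Hy d1 Hd1) as [d2 [Hd2 H2]].
  exists (Rmin rho d2). split; [apply Rmin_pos; auto|]. intros om' x' Hw' Hc j Hj.
  assert (C1 := Rlt_le_trans _ _ _ Hc (Rmin_l _ _)). assert (C2 := Rlt_le_trans _ _ _ Hc (Rmin_r _ _)).
  destruct j as [|j].
  - destruct (limpt_letter om' x' Hw') as [y' [Hy' Ey']]. apply (Hs _ _ y y'); auto. rewrite Cmod_sub_sym, <- Ey, <- Ey'. exact C1.
  - apply (H1 (shiftn 1 om') (IZR (e (om' 0%nat)) * x') (word_shiftn _ _ _ Hw')); [|lia].
    rewrite <- !limpt_F by assumption. rewrite Ey in C2 |- *. apply H2; [exact I|exact C2].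
Qed.

Lemma ccont_cexp D x : ccont D cexp x.
Proof. apply (cdiff_ccont D cexp x (cexp x)). apply cdiff_cexp. Qed.

Definition circ (x : R) : R * R := (cos x, sin x).
Definition dcirc (x y : R) : R := Rabs (cos x - cos y) + Rabs (sin x - sin y).

Lemma dcirc_continuous y eps : 0 < eps -> exists del, 0 < del /\ forall x, Rabs (x - y) < del -> dcirc x y < eps.
Proof.
  intros He. destruct (continuity_cos y (eps/2)) as [a [Ha HA]]; [lra|]. destruct (continuity_sin y (eps/2)) as [b [Hb HB]]; [lra|].
  exists (Rmin a b). split; [apply Rmin_pos; auto|]. intros x Hx. unfold dcirc.
  destruct (Req_dec x y) as [->|Hn]. { rewrite !Rminus_diag, Rabs_R0. lra. }
  assert (A : Rabs (cos x - cos y) < eps / 2).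
  { apply (HA x). split; [split; [exact I|auto]|]. exact (Rlt_le_trans _ _ _ Hx (Rmin_l _ _)). }
  assert (B : Rabs (sin x - sin y) < eps / 2).
  { apply (HB x). split; [split; [exact I|auto]|]. exact (Rlt_le_trans _ _ _ Hx (Rmin_r _ _)). }
  lra.
Qed.

Lemma angle_mod (x : R) : exists y, -PI <= y <= PI /\ exists m : Z, x = y + 2 * PI * IZR m.
Proof.
  destruct (polar (cos x) (sin x)) as [t [Ht [Hc Hs]]]; [generalize (sin2_cos2 x); unfold Rsqr; lra|].
  exists t. split; [exact Ht|]. apply cos_sin_eq; auto.
Qed.

Lemma dcirc_shift x y m : dcirc (x + 2 * PI * IZR m) y = dcirc x y.
Proof.
  assert (E : cos (x + 2 * PI * IZR m) = cos x /\ sin (x + 2 * PI * IZR m) = sin x).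
  { assert (Q := cexp_add_tpi (0, x) m). unfold cexp, tpi, Cplus in Q. simpl in Q. rewrite Rplus_0_l, exp_0, !Rmult_1_l in Q.
    injection Q as Q1 Q2. auto. }
  unfold dcirc. destruct E as [-> ->]. reflexivity.
Qed.

Lemma Em_pos : 2 <= Em.
Proof.
  assert (D := lb_deg H 0%nat). assert (N := lb_n H).
  specialize (D ltac:(lia)). lra.
Qed.

(** Compactness of the circle: a sequence of counterexamples sharing more and more letters with [om]
    has a limit angle [t], which codes the same point as [x] and therefore equals it modulo [2 PI];
    but [dcirc] would stay at least [eps]. *)
Lemma angle_continuous om x eps : word n om -> 0 < eps -> exists del, 0 < del /\ forall om' x', word n om' ->
  Cmod (cexp (limpt om' x') - cexp (limpt om x)) < del -> dcirc x' x < eps.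
Proof.
  intros Hw He. apply NNPP. intros Hno.
  assert (Hseq : forall k : nat, exists q : (nat -> nat) * R, word n (fst q) /\ -PI <= snd q <= PI /\
     (forall j, (j < k)%nat -> om j = fst q j) /\ Cmod (cexp (limpt (fst q) (snd q)) - cexp (limpt om x)) < / INR (S k) /\ eps <= dcirc (snd q) x).
  { intros k. destruct (letters_continuous k om x Hw) as [d1 [Hd1 H1]].
    assert (Hk : 0 < / INR (S k)) by (apply Rinv_0_lt_compat, lt_0_INR; lia).
    apply NNPP. intros Hn. apply Hno. exists (Rmin d1 (/ INR (S k))). split; [apply Rmin_pos; auto|].
    intros om' x' Hw' Hc. apply Rnot_le_lt. intros Hle. apply Hn.
    destruct (angle_mod x') as [t [Ht [m Em']]]. exists (om', t). simpl.
    assert (El : cexp (limpt om' t) = cexp (limpt om' x')) by (rewrite Em', limpt_period, cexp_add_tpi; auto).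
    split; [exact Hw'|]. split; [exact Ht|]. split; [|split].
    - apply (H1 om' x'); auto. exact (Rlt_le_trans _ _ _ Hc (Rmin_l _ _)).
    - rewrite El. exact (Rlt_le_trans _ _ _ Hc (Rmin_r _ _)).
    - rewrite Em', dcirc_shift in Hle. exact Hle. }
  set (q := fun k => epsilon (inhabits (om, 0)) (fun q => word n (fst q) /\ -PI <= snd q <= PI /\
     (forall j, (j < k)%nat -> om j = fst q j) /\ Cmod (cexp (limpt (fst q) (snd q)) - cexp (limpt om x)) < / INR (S k) /\ eps <= dcirc (snd q) x)).
  assert (Hq : forall k, word n (fst (q k)) /\ -PI <= snd (q k) <= PI /\
     (forall j, (j < k)%nat -> om j = fst (q k) j) /\ Cmod (cexp (limpt (fst (q k)) (snd (q k))) - cexp (limpt om x)) < / INR (S k) /\ eps <= dcirc (snd (q k)) x).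
  { intros k. unfold q. apply epsilon_spec, Hseq. }
  destruct (Bolzano_Weierstrass (fun k => snd (q k)) (fun c => -PI <= c <= PI)) as [t Ht].
  { apply compact_P3. }
  { intros k. apply (Hq k). }
  assert (Ex : cexp (limpt om t) = cexp (limpt om x)).
  { apply C_eq_of_small. intros eta Heta.
    destruct (ccont_cexp ctrue (limpt om t) (eta / 2)) as [d1 [Hd1 H1]]; [lra|].
    destruct (limpt_uniform (d1 / 2)) as [N HN]; [lra|].
    assert (PN : 0 < Em ^ N) by (apply pow_lt; generalize Em_pos; lra).
    destruct (archimed_cor1 (eta / 2)) as [M [HM HM0]]; [lra|].
    destruct (Ht (fun c => Rabs (c - t) < / Em ^ N) (N + M)%nat) as [p [Hp1 Hp2]].
    { exists (mkposreal _ (Rinv_0_lt_compat _ PN)). intros c Hc. exact Hc. }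
    destruct (Hq p) as [A1 [A2 [A3 [A4 A5]]]].
    assert (B1 : Cmod (limpt (fst (q p)) (snd (q p)) - limpt om t) < d1).
    { apply Rle_lt_trans with (d1 / 2); [|lra]. rewrite Cmod_sub_sym. apply HN; auto.
      - intros j Hj. apply A3. lia.
      - rewrite Rabs_minus_sym. apply (Rmult_le_reg_l (/ Em ^ N)); [apply Rinv_0_lt_compat; exact PN|].
        rewrite <- Rmult_assoc, Rinv_l, Rmult_1_l, Rmult_1_r by lra. left. exact Hp2. }
    specialize (H1 _ I B1).
    assert (B2 : / INR (S p) <= / INR M).
    { apply Rinv_le_contravar; [apply lt_0_INR; lia|]. apply le_INR. lia. }
    generalize (Cmod_tri3 (cexp (limpt om t)) (cexp (limpt (fst (q p)) (snd (q p)))) (cexp (limpt om x))).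
    rewrite (Cmod_sub_sym (cexp (limpt om t)) (cexp (limpt (fst (q p)) (snd (q p))))). lra. }
  destruct (limpt_angle_inj om t x Hw Ex) as [m Hm].
  destruct (dcirc_continuous t eps He) as [d1 [Hd1 H1]].
  destruct (Ht (fun c => Rabs (c - t) < d1) 0%nat) as [p [Hp1 Hp2]].
  { exists (mkposreal _ Hd1). intros c Hc. exact Hc. }
  destruct (Hq p) as [_ [_ [_ [_ A5]]]]. specialize (H1 _ Hp2).
  assert (E : dcirc (snd (q p)) t = dcirc (snd (q p)) x).
  { assert (E1 : dcirc (snd (q p)) t = dcirc t (snd (q p))) by (unfold dcirc; rewrite (Rabs_minus_sym (cos _)), (Rabs_minus_sym (sin _)); reflexivity).
    rewrite E1, Hm, dcirc_shift. unfold dcirc. rewrite (Rabs_minus_sym (cos _)), (Rabs_minus_sym (sin _)). reflexivity. }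
  lra.
Qed.
End Coding.

(** * Shrinking in the presence of a parabolic point *)

Fixpoint wprod (kap a b : R) (k : nat) : R :=
  match k with O => 1 | S k' => wprod kap a b k' * (1 + kap / (a + b * INR (S k'))) end.

(** The product is at least [1] plus the sum of the [kap / (a + b j)], and
    [ln (p + b) - ln p <= b / p] bounds each term of this harmonic sum from below by a difference of
    logarithms. *)
Lemma wprod_ge kap a b k : 0 < kap -> 0 < a -> 0 < b ->
  1 + kap / b * (ln (a + b * INR (S k)) - ln (a + b)) <= wprod kap a b k.
Proof.
  intros Hk Ha Hb. induction k as [|k IH].
  - simpl. rewrite Rmult_1_r, Rminus_diag. lra.
  - cbn [wprod]. set (p := a + b * INR (S k)) in *.
    assert (Hp : 0 < p) by (unfold p; generalize (pos_INR (S k)); nra).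
    replace (a + b * INR (S (S k))) with (p + b) by (unfold p; rewrite (S_INR (S k)); ring).
    assert (Hl : ln (p + b) - ln p <= b / p).
    { rewrite <- ln_div by lra. replace ((p + b) / p) with (1 + b / p) by (field; lra).
      assert (0 < b / p) by (apply Rdiv_lt_0_compat; lra).
      left. apply exp_lt_inv. rewrite exp_ln by lra. apply exp_ineq1. lra. }
    assert (H1 : 1 <= wprod kap a b k).
    { eapply Rle_trans; [|exact IH].
      assert (ln (a + b) <= ln p).
      { apply ln_le; [lra|]. unfold p. rewrite S_INR. generalize (pos_INR k). nra. }
      assert (0 < kap / b) by (apply Rdiv_lt_0_compat; lra). nra. }
    assert (H2 : kap / b * (ln (p + b) - ln p) <= kap / p).
    { replace (kap / p) with (kap / b * (b / p)) by (field; lra). apply Rmult_le_compat_l; [|exact Hl].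
      left. apply Rdiv_lt_0_compat; lra. }
    assert (0 < kap / p) by (apply Rdiv_lt_0_compat; lra).
    nra.
Qed.

Lemma wprod_unbounded kap a b A : 0 < kap -> 0 < a -> 0 < b -> exists N, forall k, (N <= k)%nat -> A <= wprod kap a b k.
Proof.
  intros Hk Ha Hb. set (L := b / kap * Rabs A + ln (a + b)).
  destruct (INR_unbounded (exp L / b)) as [N HN]. exists N. intros k Hk2.
  eapply Rle_trans; [|apply wprod_ge; auto].
  assert (Hl : L <= ln (a + b * INR (S k))).
  { rewrite <- (ln_exp L). apply ln_le; [apply exp_pos|].
    assert (INR N <= INR (S k)) by (apply le_INR; lia).
    assert (exp L < b * INR N).
    { apply (Rmult_lt_compat_l b) in HN; [|lra]. replace (b * (exp L / b)) with (exp L) in HN by (field; lra). exact HN. }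
    nra. }
  assert (0 < kap / b) by (apply Rdiv_lt_0_compat; lra).
  assert (kap / b * (b / kap * Rabs A) <= kap / b * (ln (a + b * INR (S k)) - ln (a + b))) by (apply Rmult_le_compat_l; unfold L in Hl; lra).
  replace (kap / b * (b / kap * Rabs A)) with (Rabs A) in * by (field; lra).
  generalize (Rle_abs A). lra.
Qed.

Section Shrink.
Variables (X : C -> Prop) (n : nat) (G : nat -> C -> C) (g : nat -> C -> C) (wt de : C -> R) (kap B0 be Rb r0 : R).
Hypothesis Hkap : 0 < kap.
Hypothesis HB0 : 0 < B0.
Hypothesis Hmaps : forall i x, (i < n)%nat -> X x -> X (G i x).
Hypothesis Hdiff : forall i x, (i < n)%nat -> X x -> cdiff X (G i) x (g i x).
Hypothesis Hwt : forall x, 1 <= wt x <= 2.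
Hypothesis Hde : forall x, 0 <= de x.
(** Here [g i] is the derivative of a branch, [wt] the density of the adapted metric, and [de]
    measures the distance to the parabolic point. The gain vanishes with [de]; the next hypothesis
    says how slowly [de] decreases under backward iteration, as if [1 / de] were moved by
    translations. *)
Hypothesis Hexp : forall i x, (i < n)%nat -> X x -> Cmod (g i x) * wt (G i x) * (1 + kap * de (G i x)) <= wt x.
Hypothesis Hgrow : forall i x, (i < n)%nat -> X x -> 0 < de x -> 0 < de (G i x) /\ / de (G i x) <= / de x + B0.
Hypothesis Hpath : forall x t, X x -> 0 <= t <= 1 -> X (seg x (be, snd x) t).
Hypothesis Hpath_de : forall r, 0 < r -> exists r', 0 < r' /\ forall x t, X x -> 0 <= t <= 1 ->
  r <= Cmod (seg x (be, snd x) t - x) -> r' <= de (seg x (be, snd x) t).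
Hypothesis Hline : forall t, X (be, t).
Hypothesis Hr0 : 0 < r0.
Hypothesis Hline_de : forall t, r0 <= de (be, t).
Hypothesis HRe : forall x, X x -> Rabs (fst x) <= Rb.

Fixpoint wderiv (k : nat) (om : nat -> nat) (x : C) : C :=
  match k with
  | O => 1%C
  | S k' => (g (om 0%nat) (wcomp G k' (shiftn 1 om) x) * wderiv k' (shiftn 1 om) x)%C
  end.

Lemma wcomp_stays k om x : word n om -> X x -> X (wcomp G k om x).
Proof.
  revert om. induction k as [|k IH]; intros om Hw Hx; [exact Hx|].
  simpl. apply Hmaps; [apply Hw|]. apply IH; [apply word_shiftn|]; assumption.
Qed.

Lemma wderiv_correct k om x : word n om -> X x -> cdiff X (wcomp G k om) x (wderiv k om x).
Proof.
  revert om. induction k as [|k IH]; intros om Hw Hx; [apply cdiff_id|]. simpl.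
  apply (cdiff_comp X X (G (om 0%nat)) (wcomp G k (shiftn 1 om)) x).
  - intros y Hy. apply wcomp_stays; auto. apply word_shiftn, Hw.
  - apply IH; auto. apply word_shiftn, Hw.
  - apply Hdiff; [apply Hw|]. apply wcomp_stays; auto. apply word_shiftn, Hw.
Qed.

Lemma wderiv_bound k om x : word n om -> X x -> Cmod (wderiv k om x) * wt (wcomp G k om x) <= wt x.
Proof.
  revert om. induction k as [|k IH]; intros om Hw Hx; [simpl; rewrite Cmod_1; lra|].
  simpl. rewrite Cmod_mult. assert (Hw' := word_shiftn n 1 om Hw). specialize (IH _ Hw' Hx).
  set (y := wcomp G k (shiftn 1 om) x) in *. assert (Hy : X y) by (apply wcomp_stays; auto).
  assert (E := Hexp (om 0%nat) y (Hw 0%nat) Hy). assert (D := Hde (G (om 0%nat) y)). assert (W := Hwt (G (om 0%nat) y)).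
  set (a := Cmod (g (om 0%nat) y)) in *. set (b := Cmod (wderiv k (shiftn 1 om) x)) in *. set (v := wt (G (om 0%nat) y)) in *.
  assert (0 <= a) by apply Cmod_ge_0. assert (0 <= b) by apply Cmod_ge_0.
  assert (0 <= kap * de (G (om 0%nat) y)) by nra.
  assert (a * v <= wt y). { assert (0 <= a * v) by nra. nra. }
  assert (b * (a * v) <= b * wt y) by (apply Rmult_le_compat_l; lra). lra.
Qed.

(** Since [1 / de] grows by at most [B0] per branch, the gain of the [k]-th branch is at least the
    [k]-th factor of [wprod], and these factors multiply along the chain rule. *)
Lemma wderiv_bound_far k om x r : word n om -> X x -> 0 < r <= de x ->
  Cmod (wderiv k om x) * wt (wcomp G k om x) * wprod kap (/ r) B0 k <= wt x /\
  0 < de (wcomp G k om x) /\ / de (wcomp G k om x) <= / r + B0 * INR k.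
Proof.
  intros Hw Hx Hr. revert om Hw. induction k as [|k IH]; intros om Hw.
  - simpl. rewrite Cmod_1. split; [lra|]. split; [lra|]. rewrite Rmult_0_r, Rplus_0_r. apply Rinv_le_contravar; lra.
  - assert (Hw' := word_shiftn n 1 om Hw). destruct (IH _ Hw') as [I1 [I2 I3]]. cbn [wcomp wderiv wprod]. rewrite Cmod_mult.
    set (y := wcomp G k (shiftn 1 om) x) in *. assert (Hy : X y) by (apply wcomp_stays; auto).
    assert (E := Hexp (om 0%nat) y (Hw 0%nat) Hy). destruct (Hgrow (om 0%nat) y (Hw 0%nat) Hy I2) as [D1 D2].
    assert (W := Hwt (G (om 0%nat) y)).
    assert (D3 : / de (G (om 0%nat) y) <= / r + B0 * INR (S k)) by (rewrite S_INR; lra).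
    split; [|split; auto].
    set (a := Cmod (g (om 0%nat) y)) in *. set (b := Cmod (wderiv k (shiftn 1 om) x)) in *. set (v := wt (G (om 0%nat) y)) in *.
    assert (0 <= a) by apply Cmod_ge_0. assert (0 <= b) by apply Cmod_ge_0.
    assert (Hq : 0 < / r + B0 * INR (S k)).
    { assert (0 < / r) by (apply Rinv_0_lt_compat; lra). generalize (pos_INR (S k)). nra. }
    assert (D4 : kap / (/ r + B0 * INR (S k)) <= kap * de (G (om 0%nat) y)).
    { unfold Rdiv. apply Rmult_le_compat_l; [lra|]. rewrite <- (Rinv_inv (de (G (om 0%nat) y))).
      apply Rinv_le_contravar; [apply Rinv_0_lt_compat; exact D1|exact D3]. }
    set (P := wprod kap (/ r) B0 k) in *. set (c := kap / (/ r + B0 * INR (S k))) in *.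
    assert (HP : 0 <= P).
    { unfold P. clear -Hkap HB0 Hr. induction k as [|k IH]; [simpl; lra|]. cbn [wprod]. apply Rmult_le_pos; [exact IH|].
      assert (0 < / r) by (apply Rinv_0_lt_compat; lra). assert (0 < / r + B0 * INR (S k)) by (generalize (pos_INR (S k)); nra).
      assert (0 < kap / (/ r + B0 * INR (S k))) by (apply Rdiv_lt_0_compat; lra). lra. }
    assert (S1 : a * v * (1 + c) <= wt y).
    { eapply Rle_trans; [|exact E]. apply Rmult_le_compat_l; [nra|]. lra. }
    replace (a * b * v * (P * (1 + c))) with (b * P * (a * v * (1 + c))) by ring.
    eapply Rle_trans; [apply Rmult_le_compat_l; [nra|exact S1]|]. lra.
Qed.

Lemma segment_contract k om x y M : word n om -> (forall t, 0 <= t <= 1 -> X (seg x y t)) ->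
  (forall t, 0 <= t <= 1 -> Cmod (wderiv k om (seg x y t)) <= M) ->
  Cmod (wcomp G k om y - wcomp G k om x) <= M * Cmod (y - x).
Proof.
  intros Hw HX HM. apply (mean_value X (wcomp G k om) (fun t => wderiv k om (seg x y t))); auto.
  intros t Ht. apply wderiv_correct; auto.
Qed.

Lemma wderiv_le_2 k om x : word n om -> X x -> Cmod (wderiv k om x) <= 2.
Proof.
  intros Hw Hx. assert (A := wderiv_bound k om x Hw Hx). assert (B := Hwt x). assert (D := Hwt (wcomp G k om x)).
  generalize (Cmod_ge_0 (wderiv k om x)). nra.
Qed.

Lemma wderiv_small r eta : 0 < r -> 0 < eta -> exists N, forall k om x, (N <= k)%nat -> word n om -> X x -> r <= de x ->
  Cmod (wderiv k om x) <= eta.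
Proof.
  intros Hr He. destruct (wprod_unbounded kap (/ r) B0 (2 / eta) Hkap (Rinv_0_lt_compat _ Hr) HB0) as [N HN].
  exists N. intros k om x Hk Hw Hx Hd. specialize (HN k Hk).
  destruct (wderiv_bound_far k om x r Hw Hx (conj Hr Hd)) as [A _].
  assert (B := Hwt x). assert (D := Hwt (wcomp G k om x)). assert (Q := Cmod_ge_0 (wderiv k om x)).
  set (q := Cmod (wderiv k om x)) in *. set (P := wprod kap (/ r) B0 k) in *.
  assert (P0 : 0 < 2 / eta) by (apply Rdiv_lt_0_compat; lra).
  assert (q * (2 / eta) <= 2).
  { eapply Rle_trans; [|apply (Rle_trans _ _ _ A); lra].
    apply Rmult_le_compat; [lra|lra| |exact HN]. nra. }
  apply (Rmult_le_reg_r (2 / eta)); [exact P0|]. replace (eta * (2 / eta)) with 2 by (field; lra). exact H.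
Qed.

(** The horizontal segment to the base line is cut at distance [eps / 4] from [x]. The short piece
    is at most doubled by any composition; on the rest [de] is bounded below, so the derivatives
    become uniformly small. *)
Lemma horizontal_shrink eps : 0 < eps -> exists N, forall k om x, (N <= k)%nat -> word n om -> X x ->
  Cmod (wcomp G k om (be, snd x) - wcomp G k om x) <= eps.
Proof.
  intros He. set (r := eps / 4). assert (Hr : 0 < r) by (unfold r; lra).
  destruct (Hpath_de r Hr) as [r' [Hr' HP]].
  assert (HRb : 0 <= Rb) by (eapply Rle_trans; [apply Rabs_pos|apply (HRe (be, 0)); apply Hline]).
  destruct (wderiv_small r' (eps / (2 * (2 * Rb + 1))) Hr') as [N HN]; [apply Rdiv_lt_0_compat; lra|].
  exists N. intros k om x Hk Hw Hx.
  set (b := ((be, snd x) : C)) in *.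
  assert (Hlen : Cmod (b - x) <= 2 * Rb).
  { eapply Rle_trans; [apply Cmod_le_sum|]. simpl. replace (snd x + - snd x) with 0 by ring. rewrite Rabs_R0.
    assert (A := HRe x Hx). assert (B := HRe b (Hline _)). simpl in B. generalize (Rabs_triang be (- fst x)). rewrite Rabs_Ropp. lra. }
  destruct (Rle_lt_dec (Cmod (b - x)) r) as [Hs|Hl].
  - assert (A : Cmod (wcomp G k om b - wcomp G k om x) <= 2 * Cmod (b - x)).
    { apply (segment_contract k om x b 2 Hw); intros t Ht; [|apply wderiv_le_2; auto]; apply Hpath; auto. }
    unfold r in Hs. lra.
  - set (t0 := r / Cmod (b - x)). assert (Ht0 : 0 < t0 < 1).
    { unfold t0. split; [apply Rdiv_lt_0_compat; lra|]. apply (Rmult_lt_reg_r (Cmod (b - x))); [lra|].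
      unfold Rdiv. rewrite Rmult_assoc, Rinv_l, Rmult_1_r by lra. lra. }
    set (x1 := seg x b t0).
    assert (Hx1 : Cmod (x1 - x) = r).
    { unfold x1, seg. replace (x + t0 * (b - x) - x)%C with (t0 * (b - x))%C by ring. rewrite Cmod_mult, Cmod_RtoC_pos by lra.
      unfold t0. field. lra. }
    assert (S1 : forall t, seg x x1 t = seg x b (t * t0)).
    { intros t. unfold x1, seg. rewrite RtoC_mult. ring. }
    assert (S2 : forall t, seg x1 b t = seg x b (t0 + t * (1 - t0))).
    { intros t. unfold x1, seg. rewrite RtoC_plus, RtoC_mult, RtoC_minus. ring. }
    assert (A1 : Cmod (wcomp G k om x1 - wcomp G k om x) <= 2 * Cmod (x1 - x)).
    { apply (segment_contract k om x x1 2 Hw).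
      - intros t Ht. rewrite S1. apply Hpath; auto. nra.
      - intros t Ht. rewrite S1. apply wderiv_le_2; auto. apply Hpath; auto. nra. }
    assert (A2 : Cmod (wcomp G k om b - wcomp G k om x1) <= eps / (2 * (2 * Rb + 1)) * Cmod (b - x1)).
    { apply (segment_contract k om x1 b _ Hw).
      - intros t Ht. rewrite S2. apply Hpath; auto. nra.
      - intros t Ht. rewrite S2. assert (Ht' : 0 <= t0 + t * (1 - t0) <= 1) by nra.
        apply HN; auto. apply HP; auto.
        fold b. rewrite <- (seg_0 x b) at 2. rewrite seg_diff, Rminus_0_r.
        rewrite Cmod_mult, Cmod_RtoC_pos by lra. replace r with (t0 * Cmod (b - x)) by (unfold t0; field; lra).
        apply Rmult_le_compat_r; [lra|nra]. }
    assert (A3 : Cmod (b - x1) <= 2 * Rb).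
    { unfold x1, seg. replace (b - (x + t0 * (b - x)))%C with ((1 - t0)%R * (b - x))%C by (rewrite RtoC_minus; ring).
      rewrite Cmod_mult, Cmod_RtoC_pos by lra. nra. }
    assert (A4 : eps / (2 * (2 * Rb + 1)) * Cmod (b - x1) <= eps / 2).
    { replace (eps / 2) with (eps / (2 * (2 * Rb + 1)) * (2 * Rb + 1)) by (field; lra).
      apply Rmult_le_compat_l; [left; apply Rdiv_lt_0_compat; lra|lra]. }
    generalize (Cmod_tri3 (wcomp G k om b) (wcomp G k om x1) (wcomp G k om x)). unfold r in *. lra.
Qed.

(** Two points are joined through the base line: two horizontal segments, and a vertical one on
    which [de] is at least [r0]. *)
Lemma branches_shrink : uniformly_shrinking X G n.
Proof.
  intros K eps He.
  destruct (horizontal_shrink (eps / 3)) as [N1 H1]; [lra|].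
  destruct (wderiv_small r0 (eps / (3 * (Rabs K + 1))) Hr0) as [N2 H2].
  { apply Rdiv_lt_0_compat; [lra|]. generalize (Rabs_pos K); lra. }
  exists (Nat.max N1 N2). intros k om x y Hk Hw Hx Hy Hxy.
  assert (A1 := H1 k om x ltac:(lia) Hw Hx). assert (A2 := H1 k om y ltac:(lia) Hw Hy).
  set (bx := ((be, snd x) : C)) in *. set (by_ := ((be, snd y) : C)) in *.
  assert (Sg : forall t, seg by_ bx t = (be, snd y + t * (snd x - snd y))).
  { intros t. unfold seg, by_, bx. apply Ceq_components; simpl; ring. }
  assert (A3 : Cmod (wcomp G k om bx - wcomp G k om by_) <= eps / (3 * (Rabs K + 1)) * Cmod (bx - by_)).
  { apply (segment_contract k om by_ bx _ Hw).
    - intros t _. rewrite Sg. apply Hline.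
    - intros t _. rewrite Sg. apply H2; auto. lia. }
  assert (A4 : Cmod (bx - by_) <= Rabs K + 1).
  { eapply Rle_trans; [apply Cmod_le_sum|]. simpl. replace (be + - be) with 0 by ring. rewrite Rabs_R0.
    assert (B := snd_le_Cmod (x - y)). simpl in B. generalize (Rle_abs K). lra. }
  assert (A5 : eps / (3 * (Rabs K + 1)) * Cmod (bx - by_) <= eps / 3).
  { replace (eps / 3) with (eps / (3 * (Rabs K + 1)) * (Rabs K + 1)) by (field; generalize (Rabs_pos K); lra).
    apply Rmult_le_compat_l; [|exact A4]. left. apply Rdiv_lt_0_compat; [lra|]. generalize (Rabs_pos K); lra. }
  assert (T1 := Cmod_tri3 (wcomp G k om x) (wcomp G k om bx) (wcomp G k om y)).
  assert (T2 := Cmod_tri3 (wcomp G k om bx) (wcomp G k om by_) (wcomp G k om y)).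
  rewrite (Cmod_sub_sym (wcomp G k om x) (wcomp G k om bx)) in T1. lra.
Qed.
End Shrink.

(** * The chordal metric *)

(* Pins the implicit type, so that [rewrite] never has to identify [option C] with [option Cx]. *)
Notation Fin := (@Some Cx).

Definition norm3 (c : C) (r : R) : R := Cmod (Cmod c, r).

Lemma norm3_triangle c r c' r' : norm3 (c + c') (r + r') <= norm3 c r + norm3 c' r'.
Proof.
  apply Rle_trans with (Cmod ((Cmod c, r) + (Cmod c', r'))%C); [|apply Cmod_triangle].
  unfold norm3. unfold Cmod at 1 3. apply sqrt_le_1_alt. simpl fst. simpl snd.
  generalize (Cmod_triangle c c') (Cmod_ge_0 (c + c')) . intros A B.
  assert (Cmod (c + c') ^ 2 <= (Cmod c + Cmod c') ^ 2) by (apply pow_incr; lra). lra.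
Qed.

Definition stereoC (p : Chat) : C := match p with Some z => (2 / (1 + Cmod z ^ 2) * fst z, 2 / (1 + Cmod z ^ 2) * snd z) | None => (0, 0) end.
Definition stereoR (p : Chat) : R := match p with Some z => (Cmod z ^ 2 - 1) / (1 + Cmod z ^ 2) | None => 1 end.

Lemma one_plus_sq_pos (x : R) : 0 < 1 + x ^ 2.
Proof. nra. Qed.

Lemma Cmod_pow2 (z : C) : Cmod z ^ 2 = fst z ^ 2 + snd z ^ 2.
Proof. generalize (Cmod_sqr z). nra. Qed.

Lemma sqrt_eq_of_sq (a b : R) : 0 <= b -> a = b * b -> sqrt a = b.
Proof. intros H ->. apply sqrt_square, H. Qed.

Lemma dchord_ge_0 p q : 0 <= dchord p q.
Proof.
  assert (S : forall x, 0 < x -> 0 < sqrt x) by (intros; apply sqrt_lt_R0; lra).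
  destruct p as [z|], q as [w|]; unfold dchord; rewrite ?Cnorm_Cmod; try lra.
  - apply Rmult_le_pos; [|left; apply Rinv_0_lt_compat, S, Rmult_lt_0_compat; apply one_plus_sq_pos].
    generalize (Cmod_ge_0 (Csub z w)); lra.
  - left. apply Rdiv_lt_0_compat; [lra|]. apply S, one_plus_sq_pos.
  - left. apply Rdiv_lt_0_compat; [lra|]. apply S, one_plus_sq_pos.
Qed.

Lemma dchord_sq_Fin (z w : C) : dchord (Fin z) (Fin w) * dchord (Fin z) (Fin w) =
  4 * Cmod (z - w) ^ 2 / ((1 + Cmod z ^ 2) * (1 + Cmod w ^ 2)).
Proof.
  unfold dchord. rewrite !Cnorm_Cmod. change (Csub z w) with (z - w)%C.
  assert (P : 0 < (1 + Cmod z ^ 2) * (1 + Cmod w ^ 2)) by (apply Rmult_lt_0_compat; apply one_plus_sq_pos).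
  assert (Q := sqrt_lt_R0 _ P). assert (E := sqrt_sqrt _ (Rlt_le _ _ P)).
  set (s := sqrt ((1 + Cmod z ^ 2) * (1 + Cmod w ^ 2))) in *. rewrite <- E. field. lra.
Qed.

Lemma dchord_sq_None (z : C) : dchord (Fin z) None * dchord (Fin z) None = 4 / (1 + Cmod z ^ 2).
Proof.
  unfold dchord. rewrite !Cnorm_Cmod.
  assert (P := one_plus_sq_pos (Cmod z)).
  assert (Q := sqrt_lt_R0 _ P). assert (E := sqrt_sqrt _ (Rlt_le _ _ P)).
  set (s := sqrt (1 + Cmod z ^ 2)) in *. rewrite <- E. field. lra.
Qed.

Lemma dchord_sym p q : dchord p q = dchord q p.
Proof.
  destruct p as [z|], q as [w|]; unfold dchord; try reflexivity. rewrite !Cnorm_Cmod.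
  change (Csub z w) with (z - w)%C. change (Csub w z) with (w - z)%C. rewrite Cmod_sub_sym, (Rmult_comm (1 + _)). reflexivity.
Qed.

(** [stereoC] and [stereoR] are the coordinates of stereographic projection onto the unit sphere of
    3-space, so the triangle inequality becomes that of the Euclidean norm. *)
Lemma dchord_norm3 p q : dchord p q = norm3 (stereoC p - stereoC q) (stereoR p - stereoR q).
Proof.
  symmetry. unfold norm3. unfold Cmod at 1. apply sqrt_eq_of_sq; [apply dchord_ge_0|]. simpl fst; simpl snd.
  rewrite Cmod_pow2.
  destruct p as [z|], q as [w|].
  - rewrite dchord_sq_Fin. unfold stereoC, stereoR. simpl. rewrite !Rmult_1_r.
    assert (E1 := Cmod_sqr z). assert (E2 := Cmod_sqr w). rewrite E1, E2, (Cmod_sqr (z - w)). simpl. generalize (Rle_0_sqr (fst z)) (Rle_0_sqr (snd z)) (Rle_0_sqr (fst w)) (Rle_0_sqr (snd w)). unfold Rsqr. intros.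
    field. lra.
  - rewrite dchord_sq_None. simpl. rewrite !Rmult_1_r, !(Cmod_sqr z).
    generalize (Rle_0_sqr (fst z)) (Rle_0_sqr (snd z)). unfold Rsqr. intros. field. lra.
  - rewrite dchord_sym, dchord_sq_None. simpl. rewrite !Rmult_1_r, !(Cmod_sqr w).
    generalize (Rle_0_sqr (fst w)) (Rle_0_sqr (snd w)). unfold Rsqr. intros. field. lra.
  - simpl. ring.
Qed.

Lemma dchord_tri p q r : dchord p r <= dchord p q + dchord q r.
Proof.
  rewrite !dchord_norm3.
  replace (stereoC p - stereoC r)%C with ((stereoC p - stereoC q) + (stereoC q - stereoC r))%C by ring.
  replace (stereoR p - stereoR r) with ((stereoR p - stereoR q) + (stereoR q - stereoR r)) by ring.
  apply norm3_triangle.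
Qed.

Lemma dchord_refl p : dchord p p = 0.
Proof.
  destruct p as [z|]; [|reflexivity].
  assert (E := dchord_sq_Fin z z). replace (z - z)%C with (RtoC 0) in E by ring. rewrite Cmod_0 in E.
  nra.
Qed.

Lemma dchord_eq_0 p q : dchord p q = 0 -> p = q.
Proof.
  intros H. destruct p as [z|], q as [w|]; try reflexivity.
  - assert (E := dchord_sq_Fin z w). rewrite H in E. f_equal. apply Csub_eq_0.
    assert (Q : 4 * Cmod (z - w) ^ 2 = 0).
    { replace (4 * Cmod (z - w) ^ 2) with (4 * Cmod (z - w) ^ 2 / ((1 + Cmod z ^ 2) * (1 + Cmod w ^ 2)) * ((1 + Cmod z ^ 2) * (1 + Cmod w ^ 2))).
      - rewrite <- E. ring.
      - field. generalize (one_plus_sq_pos (Cmod z)) (one_plus_sq_pos (Cmod w)); lra. }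
    nra.
  - exfalso. assert (E := dchord_sq_None z). rewrite H in E.
    assert (0 < 4 / (1 + Cmod z ^ 2)) by (apply Rdiv_lt_0_compat; [lra|apply one_plus_sq_pos]). lra.
  - exfalso. rewrite dchord_sym in H. assert (E := dchord_sq_None w). rewrite H in E.
    assert (0 < 4 / (1 + Cmod w ^ 2)) by (apply Rdiv_lt_0_compat; [lra|apply one_plus_sq_pos]). lra.
Qed.

Lemma sq_le_le (a b : R) : 0 <= b -> a * a <= b * b -> a <= b.
Proof. intros H1 H2. apply Rnot_lt_le. intros H3. nra. Qed.

Lemma dchord_le (z w : C) : dchord (Fin z) (Fin w) <= 2 * Cmod (z - w).
Proof.
  apply sq_le_le; [generalize (Cmod_ge_0 (z - w)); lra|]. rewrite dchord_sq_Fin.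
  assert (P : 1 <= (1 + Cmod z ^ 2) * (1 + Cmod w ^ 2)).
  { nra. }
  apply (Rmult_le_reg_r ((1 + Cmod z ^ 2) * (1 + Cmod w ^ 2))); [lra|].
  unfold Rdiv. rewrite Rmult_assoc, Rinv_l, Rmult_1_r by lra.
  nra.
Qed.

Lemma dchord_ge (M : R) (z w : C) : Cmod z <= M -> Cmod w <= M -> Cmod (z - w) <= (1 + M ^ 2) / 2 * dchord (Fin z) (Fin w).
Proof.
  intros Hz Hw. assert (Z0 := Cmod_ge_0 z). assert (W0 := Cmod_ge_0 w).
  apply sq_le_le; [apply Rmult_le_pos; [nra|apply dchord_ge_0]|].
  replace ((1 + M ^ 2) / 2 * dchord (Fin z) (Fin w) * ((1 + M ^ 2) / 2 * dchord (Fin z) (Fin w)))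
    with ((1 + M ^ 2) * (1 + M ^ 2) / 4 * (dchord (Fin z) (Fin w) * dchord (Fin z) (Fin w))) by field.
  rewrite dchord_sq_Fin.
  assert (A : Cmod z ^ 2 <= M ^ 2) by (apply pow_incr; lra). assert (B : Cmod w ^ 2 <= M ^ 2) by (apply pow_incr; lra).
  assert (P := one_plus_sq_pos (Cmod z)). assert (Q := one_plus_sq_pos (Cmod w)).
  set (a := 1 + Cmod z ^ 2) in *. set (b := 1 + Cmod w ^ 2) in *. set (c := 1 + M ^ 2).
  apply (Rmult_le_reg_r (a * b)); [nra|].
  replace (c * c / 4 * (4 * Cmod (z - w) ^ 2 / (a * b)) * (a * b)) with (c * c * Cmod (z - w) ^ 2) by (field; lra).
  assert (a * b <= c * c) by (apply Rmult_le_compat; unfold a, b, c in *; lra).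
  replace (Cmod (z - w) * Cmod (z - w) * (a * b)) with (a * b * Cmod (z - w) ^ 2) by ring.
  apply Rmult_le_compat_r; [nra|lra].
Qed.

Lemma dchord_near_finite (z : C) eps : 0 < eps -> exists del, 0 < del /\
  forall q, dchord (Fin z) q < del -> exists w, q = Fin w /\ Cmod (w - z) < eps.
Proof.
  intros He. set (M := Cmod z + 1). assert (Z0 := Cmod_ge_0 z).
  (* the points outside the disc of radius M are at chordal distance at least del from z *)
  exists (Rmin (2 * eps / (1 + M ^ 2)) (2 / (1 + M ^ 2))). split.
  { apply Rmin_pos; apply Rdiv_lt_0_compat; nra. }
  intros q Hq. assert (H1 := Rlt_le_trans _ _ _ Hq (Rmin_l _ _)). assert (H2 := Rlt_le_trans _ _ _ Hq (Rmin_r _ _)).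
  assert (Mp : 0 < 1 + M ^ 2) by apply one_plus_sq_pos.
  assert (H3 : dchord (Fin z) q * dchord (Fin z) q < 4 / ((1 + M ^ 2) * (1 + M ^ 2))).
  { replace (4 / ((1 + M ^ 2) * (1 + M ^ 2))) with (2 / (1 + M ^ 2) * (2 / (1 + M ^ 2))) by (field; lra).
    apply Rmult_le_0_lt_compat; auto using dchord_ge_0. }
  destruct q as [w|].
  - exists w. split; [reflexivity|].
    assert (Hw : Cmod w <= M).
    { apply Rnot_lt_le. intros Hw. rewrite dchord_sq_Fin in H3.
      assert (D : Cmod w - Cmod z <= Cmod (z - w)) by (rewrite Cmod_sub_sym; apply Cmod_sub_ge).
      assert (P := one_plus_sq_pos (Cmod z)). assert (Q := one_plus_sq_pos (Cmod w)).
      apply (Rmult_lt_compat_r ((1 + Cmod z ^ 2) * (1 + Cmod w ^ 2) * ((1 + M ^ 2) * (1 + M ^ 2)))) in H3; [|repeat apply Rmult_lt_0_compat; assumption].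
      replace (4 * Cmod (z - w) ^ 2 / ((1 + Cmod z ^ 2) * (1 + Cmod w ^ 2)) * ((1 + Cmod z ^ 2) * (1 + Cmod w ^ 2) * ((1 + M ^ 2) * (1 + M ^ 2))))
        with (4 * Cmod (z - w) ^ 2 * ((1 + M ^ 2) * (1 + M ^ 2))) in H3 by (field; lra).
      replace (4 / ((1 + M ^ 2) * (1 + M ^ 2)) * ((1 + Cmod z ^ 2) * (1 + Cmod w ^ 2) * ((1 + M ^ 2) * (1 + M ^ 2))))
        with (4 * ((1 + Cmod z ^ 2) * (1 + Cmod w ^ 2))) in H3 by (field; lra).
      (* with t = |w| - |z| >= 1 this reads 1 + |w|^2 <= t^2 (1 + M^2) *)
      set (t := Cmod w - Cmod z) in *. assert (Ht : 1 <= t) by (unfold t, M in *; lra).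
      replace (Cmod w) with (Cmod z + t) in H3 by (unfold t; ring). unfold M in *. set (a := Cmod z) in *.
      assert (K1 : 1 + (a + t) ^ 2 <= t ^ 2 * (1 + (a + 1) ^ 2)).
      { assert (0 <= a * (t - 1)) by nra. nra. }
      assert (K4 : t ^ 2 * ((1 + (a + 1) ^ 2) * (1 + (a + 1) ^ 2)) <= Cmod (z - w) ^ 2 * ((1 + (a + 1) ^ 2) * (1 + (a + 1) ^ 2)))
        by (apply Rmult_le_compat_r; nra).
      nra. }
    rewrite Cmod_sub_sym. eapply Rle_lt_trans; [apply (dchord_ge M); [unfold M; lra|exact Hw]|].
    apply (Rmult_lt_compat_l ((1 + M ^ 2) / 2)) in H1; [|lra].
    replace ((1 + M ^ 2) / 2 * (2 * eps / (1 + M ^ 2))) with eps in H1 by (field; lra). exact H1.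
  - exfalso. rewrite dchord_sq_None in H3.
    assert (A : 1 + Cmod z ^ 2 <= (1 + M ^ 2) * (1 + M ^ 2)) by (unfold M; nra).
    assert (4 / ((1 + M ^ 2) * (1 + M ^ 2)) <= 4 / (1 + Cmod z ^ 2)).
    { apply Rmult_le_compat_l; [lra|]. apply Rinv_le_contravar; [apply one_plus_sq_pos|exact A]. }
    lra.
Qed.

Lemma Chat_inv_Fin (z : C) : z <> 0%C -> Chat_inv (Fin z) = Fin (/ z)%C.
Proof.
  intros H. unfold Chat_inv. destruct Req_EM_T as [E|E].
  - exfalso. apply H. apply Cmod_eq_0. rewrite <- Cnorm_Cmod. exact E.
  - rewrite Defs_Cinv. reflexivity.
Qed.

Lemma Chat_inv_0 : Chat_inv (Fin (RtoC 0)) = None.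
Proof.
  unfold Chat_inv. destruct Req_EM_T as [E|E]; [reflexivity|]. exfalso. apply E. rewrite Cnorm_Cmod. apply Cmod_0.
Qed.

Lemma Cinv_neq_0 (z : C) : z <> 0%C -> (/ z)%C <> 0%C.
Proof. intros H. apply Cmod_pos_neq. rewrite Cmod_inv by exact H. apply Rinv_0_lt_compat, Cmod_gt_0, H. Qed.

Lemma Cinv_inv (z : C) : z <> 0%C -> (/ / z)%C = z.
Proof. intros H. field. exact H. Qed.

Lemma Chat_inv_inv p : Chat_inv (Chat_inv p) = p.
Proof.
  destruct p as [z|].
  - destruct (Ceq_dec z 0) as [->|Hz]; [rewrite Chat_inv_0; reflexivity|].
    rewrite !Chat_inv_Fin by auto using Cinv_neq_0. rewrite Cinv_inv by auto. reflexivity.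
  - simpl. apply Chat_inv_0.
Qed.

Lemma Chat_inv_isometry p q : dchord (Chat_inv p) (Chat_inv q) = dchord p q.
Proof.
  assert (K : forall a b, 0 <= a -> 0 <= b -> a * a = b * b -> a = b) by (intros; nra).
  apply K; try apply dchord_ge_0.
  assert (N : forall z : C, z <> 0%C -> dchord (Fin (/ z)%C) None * dchord (Fin (/ z)%C) None = dchord (Fin z) (Fin (RtoC 0)) * dchord (Fin z) (Fin (RtoC 0))).
  { intros z Hz. rewrite dchord_sq_None, dchord_sq_Fin. replace (z - 0)%C with z by ring. rewrite Cmod_0, Cmod_inv by exact Hz.
    assert (0 < Cmod z) by (apply Cmod_gt_0, Hz). field. repeat split; nra. }
  assert (N' : forall z : C, z <> 0%C -> dchord (Fin (/ z)%C) (Fin (RtoC 0)) * dchord (Fin (/ z)%C) (Fin (RtoC 0)) = dchord (Fin z) None * dchord (Fin z) None).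
  { intros z Hz. rewrite <- (Cinv_inv z Hz) at 3 4. rewrite N by apply Cinv_neq_0, Hz. reflexivity. }
  assert (Z0 : Chat_inv None = Fin (RtoC 0)) by reflexivity.
  destruct p as [z|], q as [w|].
  - destruct (Ceq_dec z 0) as [->|Hz]; destruct (Ceq_dec w 0) as [->|Hw]; rewrite ?Chat_inv_0, ?Chat_inv_Fin by assumption.
    + rewrite !dchord_refl. reflexivity.
    + rewrite (dchord_sym None), (dchord_sym (Fin (RtoC 0))). apply N, Hw.
    + apply N, Hz.
    + rewrite !dchord_sq_Fin. replace (/ z - / w)%C with ((w - z) / (z * w))%C by (field; auto).
      rewrite Cmod_div by (apply Cmult_neq_0; auto). rewrite Cmod_mult, !Cmod_inv by assumption. rewrite (Cmod_sub_sym w z).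
      assert (0 < Cmod z) by (apply Cmod_gt_0, Hz). assert (0 < Cmod w) by (apply Cmod_gt_0, Hw). field. repeat split; nra.
  - rewrite Z0. destruct (Ceq_dec z 0) as [->|Hz]; rewrite ?Chat_inv_0, ?Chat_inv_Fin by assumption.
    + rewrite (dchord_sym None). reflexivity.
    + apply N', Hz.
  - rewrite Z0. rewrite !(dchord_sym _ (Chat_inv (Fin w))), !(dchord_sym _ (Fin w)). destruct (Ceq_dec w 0) as [->|Hw]; rewrite ?Chat_inv_0, ?Chat_inv_Fin by assumption.
    + rewrite (dchord_sym None). reflexivity.
    + apply N', Hw.
  - rewrite !Z0, dchord_refl. reflexivity.
Qed.

(** * Limits in homogeneous coordinates and the extension of a map to the sphere *)

(** The point [[a : b]] of the projective line. *)
Definition hom (a b : C) : Chat := if Ceq_dec b 0 then None else Fin (a / b)%C.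

Lemma hom_Fin (a b : C) : b <> 0%C -> hom a b = Fin (a / b)%C.
Proof. intros H. unfold hom. destruct Ceq_dec; [contradiction|reflexivity]. Qed.

(** The chordal distance is twice the sine of the angle between two complex lines, that is
    [2 |a e - b c|] over the product of the norms. Poles and finite values are treated alike. *)
Lemma dchord_hom_sq (a b c e : C) : (a <> 0 \/ b <> 0)%C -> (c <> 0 \/ e <> 0)%C ->
  dchord (hom a b) (hom c e) * dchord (hom a b) (hom c e)
  = 4 * Cmod (a * e - b * c) ^ 2 / ((Cmod a ^ 2 + Cmod b ^ 2) * (Cmod c ^ 2 + Cmod e ^ 2)).
Proof.
  intros H1 H2. unfold hom. destruct (Ceq_dec b 0) as [->|Hb]; destruct (Ceq_dec e 0) as [->|He].
  - simpl. replace (a * 0 - 0 * c)%C with (RtoC 0) by ring. rewrite Cmod_0. unfold Rdiv. ring.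
  - rewrite dchord_sym, dchord_sq_None. rewrite Cmod_div by exact He. replace (a * e - 0 * c)%C with (a * e)%C by ring.
    rewrite Cmod_mult, Cmod_0. destruct H1 as [H1|H1]; [|congruence].
    assert (0 < Cmod a) by (apply Cmod_gt_0, H1). assert (0 < Cmod e) by (apply Cmod_gt_0, He).
    field. repeat split; nra.
  - rewrite dchord_sq_None. rewrite Cmod_div by exact Hb. replace (a * 0 - b * c)%C with (- (b * c))%C by ring.
    rewrite Cmod_opp, Cmod_mult, Cmod_0. destruct H2 as [H2|H2]; [|congruence].
    assert (0 < Cmod c) by (apply Cmod_gt_0, H2). assert (0 < Cmod b) by (apply Cmod_gt_0, Hb).
    field. repeat split; nra.
  - rewrite dchord_sq_Fin. replace (a / b - c / e)%C with ((a * e - b * c) / (b * e))%C by (field; auto).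
    rewrite !Cmod_div by (try apply Cmult_neq_0; auto). rewrite Cmod_mult.
    assert (0 < Cmod b) by (apply Cmod_gt_0, Hb). assert (0 < Cmod e) by (apply Cmod_gt_0, He).
    field. repeat split; nra.
Qed.

(** Only the cross product of [(N u, D u)] and [(a, b)] has to tend to [0] while the norms stay
    bounded below, so a pole at [z0] needs no separate argument. *)
Lemma punct_lim_hom (f N D : C -> C) (z0 : C) (r : R) :
  ccont ctrue N z0 -> ccont ctrue D z0 -> (N z0 <> 0 \/ D z0 <> 0)%C -> 0 < r ->
  (forall u, 0 < Cmod (u - z0) < r -> D u <> 0%C /\ f u = (N u / D u)%C) ->
  punct_lim f (Fin z0) (hom (N z0) (D z0)).
Proof.
  intros HN HD H0 Hr Hf eps He.
  set (a := N z0) in *. set (b := D z0) in *.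
  assert (Hab : 0 < Cmod a + Cmod b).
  { generalize (Cmod_ge_0 a) (Cmod_ge_0 b). destruct H0 as [H0|H0]; apply Cmod_gt_0 in H0; lra. }
  set (m := Cmod a + Cmod b) in *.
  set (e1 := Rmin (m / 8) (eps * m / 16)). assert (He1 : 0 < e1) by (apply Rmin_pos; nra).
  assert (E1 : e1 <= m / 8) by apply Rmin_l. assert (E2 : e1 <= eps * m / 16) by apply Rmin_r.
  destruct (HN e1 He1) as [d1 [Hd1 H1]]. destruct (HD e1 He1) as [d2 [Hd2 H2]].
  destruct (dchord_near_finite z0 (Rmin r (Rmin d1 d2))) as [del [Hdel Hnear]]; [repeat apply Rmin_pos; auto|].
  exists del. split; [exact Hdel|]. intros u [Hu1 Hu2]. rewrite dchord_sym in Hu2.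
  destruct (Hnear _ Hu2) as [w [Hw Hwz]]. injection Hw as <-.
  assert (B1 := Rlt_le_trans _ _ _ Hwz (Rmin_l _ _)). assert (B2 := Rlt_le_trans _ _ _ Hwz (Rmin_r _ _)).
  specialize (H1 u I (Rlt_le_trans _ _ _ B2 (Rmin_l _ _))). specialize (H2 u I (Rlt_le_trans _ _ _ B2 (Rmin_r _ _))).
  assert (Hpos : 0 < Cmod (u - z0)).
  { destruct (Rle_lt_or_eq_dec _ _ (Cmod_ge_0 (u - z0))) as [P|P]; [exact P|]. exfalso. symmetry in P. apply Csub_eq_0 in P. rewrite P, dchord_refl in Hu1. lra. }
  destruct (Hf u (conj Hpos B1)) as [F1 F2]. rewrite F2, <- hom_Fin by exact F1.
  fold a in H1. fold b in H2.
  assert (N1 : Cmod a - e1 <= Cmod (N u)). { generalize (Cmod_sub_ge a (N u)). rewrite Cmod_sub_sym. lra. }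
  assert (N2 : Cmod b - e1 <= Cmod (D u)). { generalize (Cmod_sub_ge b (D u)). rewrite Cmod_sub_sym. lra. }
  apply Rle_lt_trans with (eps / 2); [|lra]. apply sq_le_le; [lra|]. rewrite dchord_hom_sq by auto.
  assert (X : Cmod (N u * b - D u * a) <= e1 * m).
  { replace (N u * b - D u * a)%C with ((N u - a) * b - (D u - b) * a)%C by ring.
    eapply Rle_trans; [apply Cmod_tri_sub|]. rewrite !Cmod_mult. unfold m. generalize (Cmod_ge_0 a) (Cmod_ge_0 b). nra. }
  assert (Y1 : m * m / 2 <= Cmod a ^ 2 + Cmod b ^ 2) by (unfold m; generalize (Rle_0_sqr (Cmod a - Cmod b)); unfold Rsqr; intros; lra).
  assert (Y2 : m * m / 4 <= Cmod (N u) ^ 2 + Cmod (D u) ^ 2).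
  { assert (Q : m * 3 / 4 <= Cmod (N u) + Cmod (D u)) by (unfold m in *; lra).
    assert (Q2 : (m * 3 / 4) * (m * 3 / 4) <= (Cmod (N u) + Cmod (D u)) * (Cmod (N u) + Cmod (D u))) by (apply Rmult_le_compat; lra).
    generalize (Rle_0_sqr (Cmod (N u) - Cmod (D u))) (Rle_0_sqr m). unfold Rsqr. intros. lra. }
  assert (mm : 0 < m * m) by nra.
  set (A := Cmod a ^ 2 + Cmod b ^ 2) in *. set (B := Cmod (N u) ^ 2 + Cmod (D u) ^ 2) in *.
  assert (P : 0 < B * A) by (apply Rmult_lt_0_compat; lra).
  apply (Rmult_le_reg_r (B * A)); [exact P|].
  unfold Rdiv. rewrite Rmult_assoc, Rinv_l, Rmult_1_r by lra.
  assert (V : Cmod (N u * b - D u * a) ^ 2 <= (eps * m / 16 * m) ^ 2).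
  { apply pow_incr. split; [apply Cmod_ge_0|]. eapply Rle_trans; [exact X|]. apply Rmult_le_compat_r; lra. }
  assert (W : eps * eps * ((m * m / 4) * (m * m / 2)) <= eps * eps * (B * A)) by (apply Rmult_le_compat_l; nra).
  replace ((eps * m / 16 * m) ^ 2) with (eps * eps * (m * m * (m * m)) / 256) in V by field.
  assert (0 < eps * eps * (m * m * (m * m))) by (repeat apply Rmult_lt_0_compat; lra).
  lra.
Qed.

Lemma dchord_punctured_exists p eps : 0 < eps -> exists u : C, 0 < dchord (Fin u) p < eps.
Proof.
  intros He. destruct p as [z|].
  - exists (z + RtoC (Rmin 1 (eps / 4)))%C. assert (P : 0 < Rmin 1 (eps / 4)) by (apply Rmin_pos; lra).
    assert (Hd : Cmod (z + RtoC (Rmin 1 (eps / 4)) - z) = Rmin 1 (eps / 4)).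
    { replace (z + RtoC (Rmin 1 (eps / 4)) - z)%C with (RtoC (Rmin 1 (eps / 4))) by ring. apply Cmod_RtoC_pos; lra. }
    split.
    + destruct (Rle_lt_or_eq_dec _ _ (dchord_ge_0 (Fin (z + RtoC (Rmin 1 (eps / 4)))%C) (Fin z))) as [Q|Q]; [exact Q|].
      symmetry in Q. apply dchord_eq_0 in Q. injection Q as Q. rewrite Q in Hd. replace (z - z)%C with (RtoC 0) in Hd by ring. rewrite Cmod_0 in Hd. lra.
    + eapply Rle_lt_trans; [apply dchord_le|]. rewrite Hd. generalize (Rmin_r 1 (eps / 4)). lra.
  - exists (RtoC (4 / eps)). assert (P : 0 < 4 / eps) by (apply Rdiv_lt_0_compat; lra). split.
    + destruct (Rle_lt_or_eq_dec _ _ (dchord_ge_0 (Fin (RtoC (4 / eps))) None)) as [Q|Q]; [exact Q|].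
      symmetry in Q. apply dchord_eq_0 in Q. discriminate.
    + apply Rle_lt_trans with (eps / 2); [|lra]. apply sq_le_le; [lra|]. rewrite dchord_sq_None, Cmod_RtoC_pos by lra.
      apply (Rmult_le_reg_r (1 + (4 / eps) ^ 2)); [apply one_plus_sq_pos|]. unfold Rdiv at 1. rewrite Rmult_assoc, Rinv_l, Rmult_1_r by (generalize (one_plus_sq_pos (4 / eps)); lra).
      replace (eps / 2 * (eps / 2) * (1 + (4 / eps) ^ 2)) with (eps * eps / 4 + 4) by (field; lra).
      assert (0 < eps * eps) by nra. lra.
Qed.

Lemma punct_lim_unique f p q q' : punct_lim f p q -> punct_lim f p q' -> q = q'.
Proof.
  intros H H'. apply dchord_eq_0. destruct (Rle_lt_or_eq_dec _ _ (dchord_ge_0 q q')) as [P|P]; [|symmetry; exact P]. exfalso.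
  destruct (H (dchord q q' / 2)) as [d1 [Hd1 H1]]; [lra|]. destruct (H' (dchord q q' / 2)) as [d2 [Hd2 H2]]; [lra|].
  destruct (dchord_punctured_exists p (Rmin d1 d2)) as [u [Hu1 Hu2]]; [apply Rmin_pos; auto|].
  specialize (H1 u (conj Hu1 (Rlt_le_trans _ _ _ Hu2 (Rmin_l _ _)))). specialize (H2 u (conj Hu1 (Rlt_le_trans _ _ _ Hu2 (Rmin_r _ _)))).
  generalize (dchord_tri q (Fin (f u)) q'). rewrite (dchord_sym q (Fin (f u))). lra.
Qed.

Lemma ext_eq f p q : punct_lim f p q -> ext f p = q.
Proof.
  intros H. apply (punct_lim_unique f p); [|exact H]. unfold ext. apply epsilon_spec. exists q. exact H.
Qed.

Lemma punct_lim_inv (f : C -> C) (w0 : C) q : punct_lim (fun w => f (/ w)%C) (Fin w0) q -> punct_lim f (Chat_inv (Fin w0)) q.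
Proof.
  intros H eps He. destruct (H eps He) as [d [Hd HH]].
  assert (P : 0 < dchord None (Fin w0)).
  { destruct (Rle_lt_or_eq_dec _ _ (dchord_ge_0 None (Fin w0))) as [Q|Q]; [exact Q|]. symmetry in Q. apply dchord_eq_0 in Q. discriminate. }
  exists (Rmin d (dchord None (Fin w0))). split; [apply Rmin_pos; auto|]. intros u [Hu1 Hu2].
  assert (B1 := Rlt_le_trans _ _ _ Hu2 (Rmin_l _ _)). assert (B2 := Rlt_le_trans _ _ _ Hu2 (Rmin_r _ _)).
  assert (E : dchord (Fin u) (Chat_inv (Fin w0)) = dchord (Chat_inv (Fin u)) (Fin w0)).
  { rewrite <- (Chat_inv_isometry (Fin u)), Chat_inv_inv. reflexivity. }
  rewrite E in *. destruct (Ceq_dec u 0) as [->|Hu].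
  - rewrite Chat_inv_0 in B2. lra.
  - rewrite Chat_inv_Fin in * by exact Hu. specialize (HH (/ u)%C (conj Hu1 B1)). rewrite Cinv_inv in HH by exact Hu. exact HH.
Qed.

Definition schart (F : Chat -> Chat) : Prop :=
  forall p eps, 0 < eps -> exists del, 0 < del /\ forall p', dchord p p' < del -> dchord (F p) (F p') < eps.

(** The value at [p'] is itself a limit; it is replaced by the value of the formula at a finite
    point [u] that is close to [p'] and still different from [p]. *)
Lemma ext_continuous f : (forall p, exists q, punct_lim f p q) -> schart (ext f).
Proof.
  intros Hex p eps He. assert (Hl : forall p, punct_lim f p (ext f p)) by (intros p'; destruct (Hex p') as [q Hq]; rewrite (ext_eq _ _ _ Hq); exact Hq).
  destruct (Hl p (eps / 2)) as [d [Hd HH]]; [lra|]. exists d. split; [exact Hd|]. intros p' Hp'.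
  destruct (Rle_lt_or_eq_dec _ _ (dchord_ge_0 p p')) as [P|P].
  - destruct (Hl p' (eps / 2)) as [d' [Hd' HH']]; [lra|].
    destruct (dchord_punctured_exists p' (Rmin d' (Rmin (d - dchord p p') (dchord p p')))) as [u [Hu1 Hu2]]; [repeat apply Rmin_pos; lra|].
    assert (B1 := Rlt_le_trans _ _ _ Hu2 (Rmin_l _ _)). assert (B2 := Rlt_le_trans _ _ _ Hu2 (Rmin_r _ _)).
    assert (B3 := Rlt_le_trans _ _ _ B2 (Rmin_l _ _)). assert (B4 := Rlt_le_trans _ _ _ B2 (Rmin_r _ _)).
    specialize (HH' u (conj Hu1 B1)).
    assert (T1 := dchord_tri (Fin u) p' p). assert (T2 := dchord_tri p (Fin u) p'). rewrite (dchord_sym p' p) in T1. rewrite (dchord_sym p (Fin u)) in T2.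
    specialize (HH u ltac:(split; lra)).
    assert (T3 := dchord_tri (ext f p) (Fin (f u)) (ext f p')). rewrite (dchord_sym (ext f p) (Fin (f u))) in T3. lra.
  - symmetry in P. apply dchord_eq_0 in P. subst. rewrite dchord_refl. exact He.
Qed.

(** * Criteria for membership in the Fatou set *)

Definition stable_at (F : Chat -> Chat) (p : Chat) : Prop :=
  forall eps, 0 < eps -> exists eta, 0 < eta /\ forall p', dchord p p' < eta ->
    forall k : nat, dchord (Nat.iter k F p) (Nat.iter k F p') < eps.

Definition sopen (U : Chat -> Prop) : Prop :=
  forall p, U p -> exists del, 0 < del /\ forall p', dchord p p' < del -> U p'.

Lemma iter_continuous F N : schart F -> forall p eps, 0 < eps -> exists del, 0 < del /\ forall p', dchord p p' < del ->
  forall k, (k <= N)%nat -> dchord (Nat.iter k F p) (Nat.iter k F p') < eps.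
Proof.
  intros HF. induction N as [|N IH]; intros p eps He.
  - exists eps. split; [exact He|]. intros p' Hp k Hk. replace k with 0%nat by lia. exact Hp.
  - destruct (HF (Nat.iter N F p) eps He) as [d1 [Hd1 H1]].
    destruct (IH p (Rmin eps d1)) as [d2 [Hd2 H2]]; [apply Rmin_pos; auto|].
    exists d2. split; [exact Hd2|]. intros p' Hp k Hk. destruct (Nat.eq_dec k (S N)) as [->|Hn].
    + simpl. apply H1. eapply Rlt_le_trans; [apply H2; auto|]. apply Rmin_r.
    + eapply Rlt_le_trans; [apply H2; auto; lia|]. apply Rmin_l.
Qed.

Lemma iter_add {A} (F : A -> A) k m p : Nat.iter (k + m) F p = Nat.iter k F (Nat.iter m F p).
Proof. induction k as [|k IH]; [reflexivity|]. simpl. rewrite IH. reflexivity. Qed.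

(** [in_fatou] asks for stability at all points near [p], which is why stability is demanded on an
    open set [U]; the first [m] iterates are handled by continuity. *)
Lemma fatou_of_stable F U m p : schart F -> sopen U -> (forall q, U q -> stable_at F q) -> U (Nat.iter m F p) -> in_fatou F p.
Proof.
  intros HF HU Hst Hp. destruct (HU _ Hp) as [d1 [Hd1 H1]].
  destruct (iter_continuous F m HF p d1 Hd1) as [d2 [Hd2 H2]].
  exists d2. split; [exact Hd2|]. intros w Hw eps He. rewrite dchord_sym in Hw.
  assert (HwU : U (Nat.iter m F w)) by (apply H1, H2; auto).
  destruct (Hst _ HwU eps He) as [e1 [He1 HE1]].
  destruct (iter_continuous F m HF w (Rmin eps e1)) as [d3 [Hd3 H3]]; [apply Rmin_pos; auto|].
  exists d3. split; [exact Hd3|]. intros w' Hw' k. specialize (H3 w' Hw').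
  destruct (Nat.le_gt_cases k m) as [Hk|Hk].
  - eapply Rlt_le_trans; [apply H3; exact Hk|]. apply Rmin_l.
  - replace k with ((k - m) + m)%nat by lia. rewrite !iter_add. apply HE1. eapply Rlt_le_trans; [apply H3; lia|]. apply Rmin_r.
Qed.

(** From time [N] on both orbits are within [eps / 2] of [q0]; the finitely many earlier times are
    covered by continuity. *)
Lemma stable_of_attraction F U q0 : schart F -> sopen U ->
  (forall eps, 0 < eps -> exists N, forall p k, U p -> (N <= k)%nat -> dchord (Nat.iter k F p) q0 < eps) ->
  forall p, U p -> stable_at F p.
Proof.
  intros HF HU Hatt p Hp eps He. destruct (Hatt (eps / 2)) as [N HN]; [lra|].
  destruct (HU p Hp) as [d1 [Hd1 H1]]. destruct (iter_continuous F N HF p eps He) as [d2 [Hd2 H2]].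
  exists (Rmin d1 d2). split; [apply Rmin_pos; auto|]. intros p' Hp' k.
  destruct (Nat.le_gt_cases k N) as [Hk|Hk].
  - apply H2; auto. exact (Rlt_le_trans _ _ _ Hp' (Rmin_r _ _)).
  - assert (Up' : U p') by (apply H1; exact (Rlt_le_trans _ _ _ Hp' (Rmin_l _ _))).
    assert (A := HN p k Hp ltac:(lia)). assert (B := HN p' k Up' ltac:(lia)).
    generalize (dchord_tri (Nat.iter k F p) q0 (Nat.iter k F p')). rewrite (dchord_sym q0). lra.
Qed.

(** * Words and the middle-third Cantor set *)

Definition tdigit (b : nat -> bool) (k : nat) : R := (if b k then 2 else 0) / 3 ^ (S k).

Lemma pow3_pos k : 0 < / 3 ^ k.
Proof. apply Rinv_0_lt_compat, pow_lt. lra. Qed.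

Lemma pow3_S k : / 3 ^ (S k) = / 3 ^ k / 3.
Proof. simpl. field. apply pow_nonzero. lra. Qed.

Lemma tdigit_bound b k : 0 <= tdigit b k <= 2 * / 3 ^ (S k).
Proof. unfold tdigit, Rdiv. generalize (pow3_pos (S k)). destruct (b k); lra. Qed.

Lemma tsum_agree b b' m N : (forall k, (k < m)%nat -> b k = b' k) -> (N < m)%nat -> sum_f_R0 (tdigit b) N = sum_f_R0 (tdigit b') N.
Proof.
  intros H HN. apply sum_eq. intros i Hi. unfold tdigit. rewrite H by lia. reflexivity.
Qed.

Lemma tsum_close b b' m j : (forall k, (k < m)%nat -> b k = b' k) ->
  Rabs (sum_f_R0 (tdigit b) (m + j) - sum_f_R0 (tdigit b') (m + j)) <= / 3 ^ m - / 3 ^ (S (m + j)).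
Proof.
  intros H. induction j as [|j IH].
  - rewrite Nat.add_0_r. assert (B := tdigit_bound b m). assert (B' := tdigit_bound b' m). rewrite pow3_S in *.
    destruct m as [|m].
    + simpl sum_f_R0. apply Rabs_le. lra.
    + simpl sum_f_R0. rewrite (tsum_agree b b' (S m) m H) by lia. apply Rabs_le. lra.
  - replace (m + S j)%nat with (S (m + j)) by lia. simpl sum_f_R0.
    assert (B := tdigit_bound b (S (m + j))). assert (B' := tdigit_bound b' (S (m + j))). rewrite (pow3_S (S (m + j))) in *.
    apply Rabs_le_between in IH. apply Rabs_le. lra.
Qed.

Lemma tsum_ub b N : sum_f_R0 (tdigit b) N <= 1 - / 3 ^ (S N).
Proof.
  assert (A := tsum_close b (fun _ => false) 0 N ltac:(intros; lia)). change (0 + N)%nat with N in A.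
  replace (sum_f_R0 (tdigit (fun _ => false)) N) with 0 in A.
  - apply Rabs_le_between in A. rewrite pow_O, Rinv_1 in A. lra.
  - clear. induction N as [|N IH]; simpl; [unfold tdigit; field|]. rewrite <- IH. unfold tdigit, Rdiv. rewrite Rmult_0_l. ring.
Qed.

Lemma tsum_cv b : exists l, Un_cv (sum_f_R0 (tdigit b)) l.
Proof.
  destruct (growing_cv (sum_f_R0 (tdigit b))) as [l Hl].
  - intros N. simpl. generalize (tdigit_bound b (S N)). lra.
  - exists 1. intros x [N ->]. generalize (tsum_ub b N) (pow3_pos (S N)). lra.
  - exists l. exact Hl.
Qed.

Definition tval (b : nat -> bool) : R := epsilon (inhabits 0) (Un_cv (sum_f_R0 (tdigit b))).

Lemma tval_cv b : Un_cv (sum_f_R0 (tdigit b)) (tval b).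
Proof. unfold tval. apply epsilon_spec, tsum_cv. Qed.

Lemma tval_cantor b : cantor_set (tval b).
Proof. exists b. apply tval_cv. Qed.

Lemma cantor_tval x : cantor_set x -> exists b, x = tval b.
Proof. intros [b Hb]. exists b. apply (UL_sequence (sum_f_R0 (tdigit b))); [exact Hb|apply tval_cv]. Qed.

Lemma tval_agree b b' m : (forall k, (k < m)%nat -> b k = b' k) -> Rabs (tval b - tval b') <= / 3 ^ m.
Proof.
  intros H. apply Rnot_lt_le. intros Hlt.
  set (e := (Rabs (tval b - tval b') - / 3 ^ m) / 2).
  destruct (tval_cv b e) as [N1 H1]; [unfold e; lra|]. destruct (tval_cv b' e) as [N2 H2]; [unfold e; lra|].
  specialize (H1 (m + (N1 + N2))%nat ltac:(lia)). specialize (H2 (m + (N1 + N2))%nat ltac:(lia)). unfold Rdist in *.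
  assert (A := tsum_close b b' m (N1 + N2) H). assert (P := pow3_pos (S (m + (N1 + N2)))).
  set (p := sum_f_R0 (tdigit b) (m + (N1 + N2))) in *. set (q := sum_f_R0 (tdigit b') (m + (N1 + N2))) in *.
  assert (T := Rabs_triang (- (p - tval b)) ((p - q) + (q - tval b'))).
  assert (T2 := Rabs_triang (p - q) (q - tval b')). rewrite Rabs_Ropp in T.
  replace (- (p - tval b) + (p - q + (q - tval b'))) with (tval b - tval b') in T by ring.
  unfold e in *. lra.
Qed.

(** Deleting the digit [m] of [b] lowers its value by [2 / 3 ^ (m + 1)]. The result agrees with [b']
    up to and including that digit, hence is within [1 / 3 ^ (m + 1)] of [tval b']. *)
Lemma tval_differ b b' m : (forall k, (k < m)%nat -> b k = b' k) -> b m = true -> b' m = false -> / 3 ^ (S m) <= tval b - tval b'.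
Proof.
  intros H Hb Hb'.
  set (c := fun k => if Nat.eq_dec k m then false else b k).
  assert (A : Rabs (tval c - tval b') <= / 3 ^ S m).
  { apply tval_agree. intros k Hk. unfold c. destruct Nat.eq_dec as [->|Hn]; [auto|]. apply H. lia. }
  assert (E : tval b = tval c + 2 * / 3 ^ S m).
  { apply (UL_sequence (sum_f_R0 (tdigit b))); [apply tval_cv|].
    intros eps He. destruct (tval_cv c eps He) as [N HN]. exists (N + m)%nat. intros k Hk. specialize (HN k ltac:(lia)).
    unfold Rdist in *.
    assert (Q : forall j, (j < m)%nat -> sum_f_R0 (tdigit b) j = sum_f_R0 (tdigit c) j).
    { intros j Hj. apply sum_eq. intros i Hi. unfold tdigit, c. destruct Nat.eq_dec; [lia|reflexivity]. }
    assert (Q2 : forall j, sum_f_R0 (tdigit b) (m + j) = sum_f_R0 (tdigit c) (m + j) + 2 * / 3 ^ S m).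
    { assert (D : tdigit b m = tdigit c m + 2 * / 3 ^ S m).
      { unfold tdigit, c. rewrite Hb. destruct Nat.eq_dec; [|lia]. unfold Rdiv. ring. }
      induction j as [|j IH].
      - rewrite Nat.add_0_r. destruct m as [|m']; simpl sum_f_R0; [exact D|]. rewrite (Q m') by lia. rewrite D. ring.
      - replace (m + S j)%nat with (S (m + j)) by lia. simpl sum_f_R0. rewrite IH.
        replace (tdigit b (S (m + j))) with (tdigit c (S (m + j))); [ring|]. unfold tdigit, c. destruct Nat.eq_dec; [lia|reflexivity]. }
    replace k with (m + (k - m))%nat in * by lia. rewrite Q2.
    replace (sum_f_R0 (tdigit c) (m + (k - m)) + 2 * / 3 ^ S m - (tval c + 2 * / 3 ^ S m)) with (sum_f_R0 (tdigit c) (m + (k - m)) - tval c) by ring.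
    exact HN. }
  apply Rabs_le_between in A. lra.
Qed.

Lemma tval_near b b' M : Rabs (tval b - tval b') < / 3 ^ M -> forall k, (k < M)%nat -> b k = b' k.
Proof.
  intros H k. induction k as [k IH] using lt_wf_ind. intros Hk.
  assert (Hag : forall j, (j < k)%nat -> b j = b' j) by (intros j Hj; apply IH; lia).
  assert (L : / 3 ^ M <= / 3 ^ S k) by (apply Rinv_le_contravar; [apply pow_lt; lra|apply Rle_pow; [lra|lia]]).
  apply Rabs_def2 in H. destruct (b k) eqn:E1, (b' k) eqn:E2; try reflexivity; exfalso.
  - generalize (tval_differ b b' k Hag E1 E2). lra.
  - generalize (tval_differ b' b k ltac:(intros; symmetry; auto) E2 E1). lra.
Qed.

Lemma tval_inj b b' : tval b = tval b' -> b = b'.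
Proof.
  intros E. apply functional_extensionality. intros k. apply (tval_near b b' (S k)); [|lia].
  rewrite E, Rminus_diag, Rabs_R0. apply pow3_pos.
Qed.

(* The letter [i] is encoded as [true^i false], except the last one, [n - 1], encoded as [true^(n-1)]. *)
Definition wlen (n i : nat) : nat := if (i <? n - 1)%nat then S i else (n - 1)%nat.

(** The recursion drops a whole codeword at a time, so it is not structural in [m]; codewords have
    at least one bit, hence [S m] units of fuel suffice for the bit [m]. *)
Fixpoint encf (n fuel : nat) (om : nat -> nat) (m : nat) : bool :=
  match fuel with
  | O => false
  | S f => if (m <? om 0%nat)%nat then true
           else if (m <? wlen n (om 0%nat))%nat then false
           else encf n f (shiftn 1 om) (m - wlen n (om 0%nat))
  end.
Definition enc (n : nat) (om : nat -> nat) (m : nat) : bool := encf n (S m) om m.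

Fixpoint lead (k : nat) (b : nat -> bool) : nat :=
  match k with O => O | S k' => if b 0%nat then S (lead k' (fun j => b (S j))) else O end.

Fixpoint dec (n k : nat) (b : nat -> bool) : nat :=
  match k with
  | O => lead (n - 1) b
  | S k' => dec n k' (fun j => b (wlen n (lead (n - 1) b) + j)%nat)
  end.

Section Words.
Variable n : nat.
Hypothesis Hn : (2 <= n)%nat.

Lemma wlen_pos i : (1 <= wlen n i)%nat.
Proof. unfold wlen. destruct (Nat.ltb_spec i (n - 1)); lia. Qed.

Lemma wlen_le i : (wlen n i <= n)%nat.
Proof. unfold wlen. destruct (Nat.ltb_spec i (n - 1)); lia. Qed.

Lemma encf_fuel f f' om m : (m < f)%nat -> (m < f')%nat -> encf n f om m = encf n f' om m.
Proof.
  revert f' om m. induction f as [|f IH]; intros f' om m H H'; [lia|]. destruct f' as [|f']; [lia|]. simpl.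
  destruct (m <? om 0%nat)%nat; [reflexivity|]. destruct (Nat.ltb_spec m (wlen n (om 0%nat))); [reflexivity|].
  assert (W := wlen_pos (om 0%nat)). apply IH; lia.
Qed.

Lemma enc_unfold om m : enc n om m = if (m <? om 0%nat)%nat then true
  else if (m <? wlen n (om 0%nat))%nat then false else enc n (shiftn 1 om) (m - wlen n (om 0%nat)).
Proof.
  unfold enc at 1. cbn [encf]. destruct (m <? om 0%nat)%nat; [reflexivity|]. destruct (Nat.ltb_spec m (wlen n (om 0%nat))); [reflexivity|].
  assert (W := wlen_pos (om 0%nat)). unfold enc. apply encf_fuel; lia.
Qed.

Lemma lead_ext k b b' : (forall j, (j < k)%nat -> b j = b' j) -> lead k b = lead k b'.
Proof.
  revert b b'. induction k as [|k IH]; intros b b' H; [reflexivity|]. simpl. rewrite (H 0%nat) by lia.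
  destruct (b' 0%nat); [|reflexivity]. f_equal. apply IH. intros j Hj. apply H. lia.
Qed.

Lemma lead_le k b : (lead k b <= k)%nat.
Proof. revert b. induction k as [|k IH]; intros b; [simpl; lia|]. simpl. destruct (b 0%nat); [|lia]. specialize (IH (fun j => b (S j))). lia. Qed.

Lemma lead_spec k b : (forall j, (j < lead k b)%nat -> b j = true) /\ ((lead k b < k)%nat -> b (lead k b) = false).
Proof.
  revert b. induction k as [|k IH]; intros b; simpl; [split; intros; lia|].
  destruct (b 0%nat) eqn:E; [|split; [intros; lia|auto]].
  destruct (IH (fun j => b (S j))) as [I1 I2]. split.
  - intros [|j] Hj; [exact E|]. apply (I1 j). lia.
  - intros Hj. apply I2. lia.
Qed.

Lemma lead_unique k b i : (i <= k)%nat -> (forall j, (j < i)%nat -> b j = true) -> ((i < k)%nat -> b i = false) -> lead k b = i.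
Proof.
  intros H1 H2 H3. destruct (lead_spec k b) as [L1 L2]. assert (L3 := lead_le k b).
  destruct (Nat.lt_trichotomy (lead k b) i) as [Q|[Q|Q]]; [exfalso|exact Q|exfalso].
  - specialize (H2 _ Q). rewrite L2 in H2 by lia. discriminate.
  - specialize (L1 _ Q). rewrite H3 in L1 by lia. discriminate.
Qed.

Lemma dec_word b : word n (fun k => dec n k b).
Proof.
  intros k. revert b. induction k as [|k IH]; intros b; simpl.
  - generalize (lead_le (n - 1) b). lia.
  - apply IH.
Qed.

Lemma lead_enc om : (om 0%nat < n)%nat -> lead (n - 1) (enc n om) = om 0%nat.
Proof.
  intros H. apply lead_unique; [lia| |].
  - intros j Hj. rewrite enc_unfold. destruct (Nat.ltb_spec j (om 0%nat)); [reflexivity|lia].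
  - intros Hl. rewrite enc_unfold, Nat.ltb_irrefl. unfold wlen at 1. destruct (Nat.ltb_spec (om 0%nat) (n - 1)); [|lia].
    destruct (Nat.ltb_spec (om 0%nat) (S (om 0%nat))); [reflexivity|lia].
Qed.

Lemma dec_enc om : word n om -> (fun k => dec n k (enc n om)) = om.
Proof.
  intros Hw. apply functional_extensionality. intros k. revert om Hw. induction k as [|k IH]; intros om Hw; simpl.
  - apply lead_enc, Hw.
  - rewrite lead_enc by apply Hw.
    replace (fun j => enc n om (wlen n (om 0%nat) + j)) with (enc n (shiftn 1 om)).
    + rewrite (IH _ (word_shiftn n 1 om Hw)). reflexivity.
    + apply functional_extensionality. intros j. rewrite (enc_unfold om).
      assert (Q : (om 0%nat <= wlen n (om 0%nat))%nat).
      { unfold wlen. generalize (Hw 0%nat). destruct (Nat.ltb_spec (om 0%nat) (n - 1)); lia. }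
      destruct (Nat.ltb_spec (wlen n (om 0%nat) + j) (om 0%nat)); [lia|].
      destruct (Nat.ltb_spec (wlen n (om 0%nat) + j) (wlen n (om 0%nat))); [lia|]. f_equal. lia.
Qed.

(** The codewords form a complete prefix code: every bit sequence begins with exactly one of them.
    Hence infinite words in [n] letters and infinite bit sequences correspond bijectively. *)
Lemma enc_dec b : enc n (fun k => dec n k b) = b.
Proof.
  apply functional_extensionality. intros m. revert b. induction m as [m IH] using lt_wf_ind. intros b.
  rewrite enc_unfold. simpl dec. set (i := lead (n - 1) b). destruct (lead_spec (n - 1) b) as [L1 L2].
  destruct (Nat.ltb_spec m i) as [A|A]; [symmetry; apply L1, A|].
  destruct (Nat.ltb_spec m (wlen n i)) as [B|B].
  - unfold wlen in B. destruct (Nat.ltb_spec i (n - 1)); [|lia]. replace m with i by lia. symmetry. apply L2. lia.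
  - assert (W := wlen_pos i). specialize (IH (m - wlen n i)%nat ltac:(lia) (fun j => b (wlen n i + j)%nat)).
    cbv beta in IH. replace (wlen n i + (m - wlen n i))%nat with m in IH by lia. exact IH.
Qed.

Lemma enc_agree N om om' : (forall j, (j < N)%nat -> om j = om' j) -> forall m, (m < N)%nat -> enc n om m = enc n om' m.
Proof.
  revert om om'. induction N as [|N IH]; intros om om' H m Hm; [lia|].
  rewrite (enc_unfold om m), (enc_unfold om' m), (H 0%nat) by lia. destruct (m <? om' 0%nat)%nat; [reflexivity|].
  destruct (Nat.ltb_spec m (wlen n (om' 0%nat))); [reflexivity|]. assert (W := wlen_pos (om' 0%nat)).
  apply IH; [|lia]. intros j Hj. unfold shiftn. apply H. lia.
Qed.

(** A codeword has at most [n] bits, so [N n] bits contain the first [N] letters. *)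
Lemma dec_agree N b b' : (forall j, (j < N * n)%nat -> b j = b' j) -> forall k, (k < N)%nat -> dec n k b = dec n k b'.
Proof.
  revert b b'. induction N as [|N IH]; intros b b' H k Hk; [lia|].
  assert (E : lead (n - 1) b = lead (n - 1) b') by (apply lead_ext; intros j Hj; apply H; simpl; lia).
  destruct k as [|k]; simpl; [exact E|]. rewrite E. apply IH; [|lia]. intros j Hj. apply H. generalize (wlen_le (lead (n - 1) b')). simpl. lia.
Qed.
End Words.

(** [1 - cos (t - t0)] is half the squared chord, and [a ^ 2 + b ^ 2 <= a + b] once both differences
    of coordinates are at most [1]. Monotonicity of [cos] on [[0, PI]] turns this into a bound for
    the reduced angle. *)
Lemma near_angle (t0 eps : R) : 0 < eps -> exists del, 0 < del /\ forall t, dcirc t t0 < del -> exists m : Z, Rabs (t - t0 - 2 * PI * IZR m) < eps.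
Proof.
  intros He. set (e := Rmin eps 1). assert (e0 : 0 < e) by (apply Rmin_pos; lra). assert (e1 : e <= 1) by apply Rmin_r.
  assert (P2 := PI2_1).
  assert (Hc : cos e < 1). { rewrite <- cos_0. apply cos_decreasing_1; lra. }
  exists (Rmin 1 (1 - cos e)). split; [apply Rmin_pos; lra|]. intros t Ht.
  assert (B1 := Rlt_le_trans _ _ _ Ht (Rmin_l _ _)). assert (B2 := Rlt_le_trans _ _ _ Ht (Rmin_r _ _)).
  destruct (angle_mod (t - t0)) as [s [Hs [m Hm]]]. exists m.
  assert (Ec : cos (t - t0) = cos s).
  { rewrite Hm. assert (Q := cexp_add_tpi (0, s) m). unfold cexp, tpi, Cplus in Q. simpl in Q. rewrite Rplus_0_l, exp_0, !Rmult_1_l in Q.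
    injection Q as Q1 Q2. exact Q1. }
  assert (Hcs : cos e < cos s).
  { rewrite <- Ec, cos_minus. unfold dcirc in B1, B2. assert (T1 := sin2_cos2 t). assert (T2 := sin2_cos2 t0). unfold Rsqr in T1, T2.
    assert (A1 := Rabs_pos (cos t - cos t0)). assert (A2 := Rabs_pos (sin t - sin t0)).
    assert (S1 : Rabs (cos t - cos t0) * Rabs (cos t - cos t0) = (cos t - cos t0) * (cos t - cos t0)) by (rewrite <- Rabs_mult; apply Rabs_pos_eq, Rle_0_sqr).
    assert (S2 : Rabs (sin t - sin t0) * Rabs (sin t - sin t0) = (sin t - sin t0) * (sin t - sin t0)) by (rewrite <- Rabs_mult; apply Rabs_pos_eq, Rle_0_sqr).
    set (a := Rabs (cos t - cos t0)) in *. set (b := Rabs (sin t - sin t0)) in *.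
    assert (a * a + b * b <= a + b) by nra. lra. }
  replace (t - t0 - 2 * PI * IZR m) with s by lra.
  apply Rlt_le_trans with e; [|apply Rmin_l]. apply Rnot_le_lt. intros Hle.
  assert (cos (Rabs s) <= cos e).
  { destruct (Req_dec (Rabs s) e) as [->|Hne]; [lra|]. assert (As : Rabs s <= PI) by (apply Rabs_le; lra). left. apply cos_decreasing_1; lra. }
  assert (cos (Rabs s) = cos s) by (unfold Rabs; destruct Rcase_abs; [apply cos_neg|reflexivity]). lra.
Qed.

(** * The homeomorphism between the coded set and the model *)

Section Homeo.
Variables (X : C -> Prop) (n : nat) (G : nat -> C -> C) (e : nat -> Z) (F : C -> C) (bd be Rb Em rho : R).
Hypothesis H : lifted_branches X n G e F bd be Rb Em rho.

Let lim := limpt G e be.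

Definition code_of (p : Chat) : (nat -> nat) * R :=
  epsilon (inhabits ((fun _ => 0%nat), 0)) (fun q => word n (fst q) /\ p = Fin (cexp (limpt G e be (fst q) (snd q)))).
Definition to_model (p : Chat) : R * (R * R) := (tval (enc n (fst (code_of p))), circ (snd (code_of p))).
Definition bits_of (c : R) : nat -> bool := epsilon (inhabits (fun _ => true)) (fun b => c = tval b).
Definition angle_of (y : R * R) : R := epsilon (inhabits 0) (fun t => y = circ t).
Definition of_model (x : R * (R * R)) : Chat :=
  Fin (cexp (limpt G e be (fun k => dec n k (bits_of (fst x))) (angle_of (snd x)))).

Lemma bits_of_tval b : bits_of (tval b) = b.
Proof. symmetry. apply tval_inj. unfold bits_of. apply (epsilon_spec (inhabits (fun _ => true)) (fun b' => tval b = tval b')). exists b. reflexivity. Qed.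

Lemma angle_of_spec y : circle y -> y = circ (angle_of y).
Proof.
  intros Hy. unfold angle_of. apply (epsilon_spec (inhabits 0) (fun t => y = circ t)).
  destruct (polar (fst y) (snd y)) as [t [_ [Hc Hs]]]; [unfold circle in Hy; lra|]. exists t. unfold circ. rewrite Hc, Hs. destruct y; reflexivity.
Qed.

Lemma circ_circle t : circle (circ t).
Proof. unfold circle, circ. simpl. generalize (sin2_cos2 t). unfold Rsqr. lra. Qed.

Lemma d3_le x y : d3 x y <= Rabs (fst x - fst y) + (Rabs (fst (snd x) - fst (snd y)) + Rabs (snd (snd x) - snd (snd y))).
Proof.
  unfold d3. set (a := fst x - fst y). set (b := fst (snd x) - fst (snd y)). set (c := snd (snd x) - snd (snd y)).
  apply sq_le_le; [generalize (Rabs_pos a) (Rabs_pos b) (Rabs_pos c); lra|]. rewrite sqrt_sqrt by nra.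
  assert (S : forall r, Rabs r * Rabs r = r ^ 2) by (intros r; rewrite <- Rabs_mult; rewrite Rabs_pos_eq; nra).
  generalize (Rabs_pos a) (Rabs_pos b) (Rabs_pos c) (S a) (S b) (S c). nra.
Qed.

Lemma d3_ge x y : Rabs (fst x - fst y) <= d3 x y /\ Rabs (fst (snd x) - fst (snd y)) <= d3 x y /\ Rabs (snd (snd x) - snd (snd y)) <= d3 x y.
Proof.
  unfold d3. set (a := fst x - fst y). set (b := fst (snd x) - fst (snd y)). set (c := snd (snd x) - snd (snd y)).
  assert (S : forall r, Rabs r * Rabs r = r ^ 2) by (intros r; rewrite <- Rabs_mult; rewrite Rabs_pos_eq; nra).
  assert (P := sqrt_pos (a ^ 2 + b ^ 2 + c ^ 2)).
  repeat split; (apply sq_le_le; [exact P|]; rewrite sqrt_sqrt by nra; rewrite S; nra).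
Qed.

Lemma Fin_inj (z w : C) : Fin z = Fin w -> z = w.
Proof. intros E. injection E. auto. Qed.

(** A point goes to the Cantor number of its encoded word and to its angle on the circle. The choice
    operators fix an angle only modulo [2 PI], which [limpt_period] makes harmless. Continuity into
    the model comes from [letters_continuous] and [angle_continuous], continuity out of it from
    [limpt_uniform]. *)
Theorem limset_cantor_circles : cantor_set_of_circles (fun p => exists z, p = Fin z /\ limset X n G z).
Proof.
  assert (Hn := lb_n H).
  assert (Hcode : forall p, (exists z, p = Fin z /\ limset X n G z) -> word n (fst (code_of p)) /\ p = Fin (cexp (lim (fst (code_of p)) (snd (code_of p))))).
  { intros p [z [-> Hz]]. unfold code_of, lim.
    apply (epsilon_spec (inhabits ((fun _ => 0%nat), 0)) (fun q => word n (fst q) /\ Fin z = Fin (cexp (limpt G e be (fst q) (snd q))))).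
    destruct (limset_limpt X n G e F bd be Rb Em rho H z Hz) as [om [x [Hw ->]]]. exists (om, x). auto. }
  assert (Hlim : forall om x, word n om -> exists z, Fin (cexp (lim om x)) = Fin z /\ limset X n G z).
  { intros om x Hw. eexists. split; [reflexivity|]. apply (limpt_limset X n G e F bd be Rb Em rho H); auto. }
  exists to_model, of_model. repeat split.
  - intros. apply tval_cantor.
  - intros. apply circ_circle.
  - intros x [Hx1 Hx2]. apply Hlim, dec_word, Hn.
  - intros p Hp. destruct (Hcode p Hp) as [Hw Hpz]. unfold of_model, to_model. simpl. rewrite bits_of_tval, dec_enc by auto.
    transitivity (Fin (cexp (lim (fst (code_of p)) (snd (code_of p))))); [|symmetry; exact Hpz]. f_equal.
    assert (E := angle_of_spec _ (circ_circle (snd (code_of p)))). unfold circ in E at 1 2. injection E as E1 E2.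
    symmetry in E1, E2. destruct (cos_sin_eq _ _ E1 E2) as [m Hm].
    unfold lim. rewrite Hm, (limpt_period X n G e F bd be Rb Em rho H) by exact Hw. apply cexp_add_tpi.
  - intros [c y] [Hc Hy]. simpl in Hc, Hy. destruct (cantor_tval c Hc) as [b ->].
    unfold of_model. simpl. rewrite bits_of_tval. set (t := angle_of y).
    set (om := fun k => dec n k b). assert (Hw : word n om) by (apply dec_word, Hn).
    destruct (Hcode _ (Hlim om t Hw)) as [Hw' E]. apply Fin_inj in E. unfold to_model.
    change (limpt G e be om t) with (lim om t). set (q := code_of (Fin (cexp (lim om t)))) in *.
    assert (Eo : fst q = om).
    { apply functional_extensionality. intros k. symmetry. exact (limpt_code_inj X n G e F bd be Rb Em rho H om (fst q) t (snd q) Hw Hw' E k). }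
    rewrite Eo in E. destruct (limpt_angle_inj X n G e F bd be Rb Em rho H om t (snd q) Hw E) as [m Hm].
    rewrite Eo. unfold om at 1. rewrite enc_dec by exact Hn. f_equal.
    rewrite (angle_of_spec y Hy). fold t. rewrite Hm. unfold circ.
    assert (Q := cexp_add_tpi (0, snd q) m). unfold cexp, tpi, Cplus in Q. simpl in Q. rewrite Rplus_0_l, exp_0, !Rmult_1_l in Q.
    injection Q as Q1 Q2. rewrite Q1, Q2. reflexivity.
  - intros p Hp eps He. destruct (Hcode p Hp) as [Hw Hpz]. set (om := fst (code_of p)) in *. set (x := snd (code_of p)) in *.
    destruct (pow_small (/ 3) (eps / 2) ltac:(lra)) as [N HN]; [lra|]. specialize (HN N (Nat.le_refl N)). rewrite pow_inv in HN.
    destruct (letters_continuous X n G e F bd be Rb Em rho H N om x Hw) as [d1 [Hd1 H1]].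
    destruct (angle_continuous X n G e F bd be Rb Em rho H om x (eps / 2) Hw) as [d2 [Hd2 H2]]; [lra|].
    destruct (dchord_near_finite (cexp (lim om x)) (Rmin d1 d2)) as [del [Hdel Hnear]]; [apply Rmin_pos; auto|].
    exists del. split; [exact Hdel|]. intros p' Hp' Hd. destruct (Hcode p' Hp') as [Hw' Hpz'].
    rewrite Hpz in Hd. destruct (Hnear _ Hd) as [w [Ew Hcl]]. assert (Ew2 : w = cexp (lim (fst (code_of p')) (snd (code_of p')))) by (apply Fin_inj; rewrite <- Ew; exact Hpz').
    rewrite Ew2 in Hcl. set (om' := fst (code_of p')) in *. set (x' := snd (code_of p')) in *.
    specialize (H1 om' x' Hw' (Rlt_le_trans _ _ _ Hcl (Rmin_l _ _))). specialize (H2 om' x' Hw' (Rlt_le_trans _ _ _ Hcl (Rmin_r _ _))).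
    eapply Rle_lt_trans; [apply d3_le|]. unfold to_model. simpl. fold om om' x x'.
    assert (A := tval_agree (enc n om) (enc n om') N (enc_agree n Hn N om om' H1)).
    unfold dcirc in H2. rewrite (Rabs_minus_sym (cos x)), (Rabs_minus_sym (sin x)). lra.
  - intros [c y] [Hc Hy] eps He. simpl in Hc, Hy. destruct (cantor_tval c Hc) as [b ->].
    set (om := fun k => dec n k b). assert (Hw : word n om) by (apply dec_word, Hn). set (t := angle_of y).
    destruct (ccont_cexp ctrue (lim om t) (eps / 2)) as [d1 [Hd1 H1]]; [lra|].
    destruct (limpt_uniform X n G e F bd be Rb Em rho H (d1 / 2)) as [N HN]; [lra|].
    assert (HE := Em_pos X n G e F bd be Rb Em rho H).
    assert (PE : 0 < Em ^ N) by (apply pow_lt; lra).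
    destruct (near_angle t (/ Em ^ N)) as [d2 [Hd2 H2]]; [apply Rinv_0_lt_compat, PE|].
    exists (Rmin (/ 3 ^ (N * n)) (d2 / 2)). split; [apply Rmin_pos; [apply pow3_pos|lra]|].
    intros [c' y'] [Hc' Hy'] Hd. simpl in Hc', Hy'. destruct (cantor_tval c' Hc') as [b' ->].
    assert (B1 := Rlt_le_trans _ _ _ Hd (Rmin_l _ _)). assert (B2 := Rlt_le_trans _ _ _ Hd (Rmin_r _ _)).
    destruct (d3_ge (tval b, y) (tval b', y')) as [D1 [D2 D3]]. simpl in D1, D2, D3.
    assert (Hbits := tval_near b b' (N * n) (Rle_lt_trans _ _ _ D1 B1)).
    unfold of_model. cbn [fst snd]. rewrite !bits_of_tval. fold om t. set (om' := fun k => dec n k b'). set (t' := angle_of y').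
    assert (Hw' : word n om') by (apply dec_word, Hn).
    assert (Hag : forall j, (j < N)%nat -> om j = om' j) by (intros j Hj; apply (dec_agree n Hn N b b'); auto).
    assert (Hdc : dcirc t' t < d2).
    { unfold dcirc. assert (Y1 := angle_of_spec y Hy). assert (Y2 := angle_of_spec y' Hy'). fold t in Y1. fold t' in Y2.
      assert (Y3 := f_equal fst Y1). assert (Y4 := f_equal snd Y1). assert (Y5 := f_equal fst Y2). assert (Y6 := f_equal snd Y2). unfold circ in Y3, Y4, Y5, Y6. simpl in Y3, Y4, Y5, Y6.
      rewrite <- Y3, <- Y4, <- Y5, <- Y6. rewrite (Rabs_minus_sym (fst y')), (Rabs_minus_sym (snd y')). lra. }
    destruct (H2 t' Hdc) as [m Hm].
    (* The chosen angles of neighbouring points of the circle can differ by full turns, so the angle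
       is first moved next to [t]. *)
    set (t2 := t' - 2 * PI * IZR m).
    assert (Et : cexp (limpt G e be om' t') = cexp (lim om' t2)).
    { replace t' with (t2 + 2 * PI * IZR m) by (unfold t2; ring). unfold lim.
      rewrite (limpt_period X n G e F bd be Rb Em rho H) by exact Hw'. apply cexp_add_tpi. }
    rewrite Et. change (limpt G e be om t) with (lim om t). rewrite dchord_sym. eapply Rle_lt_trans; [apply dchord_le|].
    assert (Q : Cmod (lim om' t2 - lim om t) < d1).
    { apply Rle_lt_trans with (d1 / 2); [|lra]. rewrite Cmod_sub_sym. apply HN; auto.
      apply (Rmult_le_reg_l (/ Em ^ N)); [apply Rinv_0_lt_compat; exact PE|].
      rewrite <- Rmult_assoc, Rinv_l, Rmult_1_l, Rmult_1_r by lra. rewrite Rabs_minus_sym. left.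
      replace (t2 - t) with (t' - t - 2 * PI * IZR m) by (unfold t2; ring). exact Hm. }
    specialize (H1 _ I Q). lra.
Qed.
End Homeo.

(** * Pointwise estimates near the parabolic basin *)

Lemma Cmod_mult_le (x y : C) a b : Cmod x <= a -> Cmod y <= b -> Cmod (x * y) <= a * b.
Proof. intros. rewrite Cmod_mult. apply Rmult_le_compat; auto using Cmod_ge_0. Qed.

Lemma Cmod_add_le (x y : C) a b : Cmod x <= a -> Cmod y <= b -> Cmod (x + y) <= a + b.
Proof. intros. eapply Rle_trans; [apply Cmod_triangle|]. lra. Qed.

Lemma Cmod_sub_le (x y : C) a b : Cmod x <= a -> Cmod y <= b -> Cmod (x - y) <= a + b.
Proof. intros. eapply Rle_trans; [apply Cmod_tri_sub|]. lra. Qed.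

Lemma Cmod_div_le (x y : C) a b : Cmod x <= a -> 0 < b <= Cmod y -> Cmod (x / y) <= a / b.
Proof.
  intros Hx Hy. assert (y <> 0%C) by (apply Cmod_pos_neq; lra). rewrite Cmod_div by assumption.
  unfold Rdiv. apply Rmult_le_compat; [apply Cmod_ge_0|left; apply Rinv_0_lt_compat; lra|exact Hx|apply Rinv_le_contravar; lra].
Qed.

Lemma Cmod_INR k : Cmod (RtoC (INR k)) = INR k.
Proof. apply Cmod_RtoC_pos, pos_INR. Qed.

Lemma pow_taylor2 (k : nat) : exists B, 0 <= B /\ forall w, Cmod (1 - w) <= 2 ->
  Cmod (w ^ k - 1 + INR k * (1 - w)) <= B * Cmod (1 - w) ^ 2.
Proof.
  induction k as [|k [B [HB IH]]].
  - exists 0. split; [lra|]. intros w Hw. replace (w ^ 0 - 1 + RtoC (INR 0) * (1 - w))%C with (RtoC 0) by (simpl; ring). rewrite Cmod_0. lra.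
  - exists (3 * B + INR k). split; [generalize (pos_INR k); lra|]. intros w Hw. specialize (IH w Hw).
    set (e := (1 - w)%C) in *.
    replace (w ^ S k - 1 + RtoC (INR (S k)) * e)%C with (w * (w ^ k - 1 + INR k * e) + INR k * (e * e))%C
      by (rewrite S_INR, RtoC_plus; unfold e; simpl; ring).
    assert (Hw3 : Cmod w <= 3). { replace w with (1 - e)%C by (unfold e; ring). replace 3 with (1 + 2) by ring. apply Cmod_sub_le; [rewrite Cmod_1; lra|exact Hw]. }
    eapply Rle_trans; [apply Cmod_add_le; apply Cmod_mult_le; [exact Hw3|exact IH|rewrite Cmod_INR; apply Rle_refl|rewrite Cmod_mult; apply Rle_refl]|].
    right. ring.
Qed.

Lemma pow_taylor3 (k : nat) : exists B, 0 <= B /\ forall w, Cmod (1 - w) <= 2 ->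
  Cmod (w ^ k - 1 + INR k * (1 - w) - (INR k * (INR k - 1) / 2)%R * ((1 - w) * (1 - w))) <= B * Cmod (1 - w) ^ 3.
Proof.
  induction k as [|k [B [HB IH]]].
  - exists 0. split; [lra|]. intros w Hw. replace (INR 0 * (INR 0 - 1) / 2) with 0 by (simpl; field).
    replace (w ^ 0 - 1 + RtoC (INR 0) * (1 - w) - RtoC 0 * ((1 - w) * (1 - w)))%C with (RtoC 0) by (simpl; ring). rewrite Cmod_0. lra.
  - exists (3 * B + Rabs (INR k * (INR k - 1) / 2)). split; [generalize (Rabs_pos (INR k * (INR k - 1) / 2)); lra|]. intros w Hw. specialize (IH w Hw).
    set (e := (1 - w)%C) in *. set (c := INR k * (INR k - 1) / 2) in *.
    replace (INR (S k) * (INR (S k) - 1) / 2) with (c + INR k) by (unfold c; rewrite S_INR; field).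
    replace (w ^ S k - 1 + RtoC (INR (S k)) * e - (c + INR k)%R * (e * e))%C
      with (w * (w ^ k - 1 + INR k * e - c * (e * e)) - c * (e * e * e))%C
      by (rewrite S_INR, !RtoC_plus; unfold e; simpl; ring).
    assert (Hw3 : Cmod w <= 3). { replace w with (1 - e)%C by (unfold e; ring). replace 3 with (1 + 2) by ring. apply Cmod_sub_le; [rewrite Cmod_1; lra|exact Hw]. }
    eapply Rle_trans; [apply Cmod_sub_le; apply Cmod_mult_le; [exact Hw3|exact IH|rewrite Cmod_R; apply Rle_refl|rewrite !Cmod_mult; apply Rle_refl]|].
    right. ring.
Qed.

Definition Qw (d : nat) (w : C) : C := ((w ^ d + (INR d - 1)%R) / INR d)%C.

Lemma INR_neq_0 d : (2 <= d)%nat -> RtoC (INR d) <> 0%C.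
Proof. intros H. apply Cmod_pos_neq. rewrite Cmod_INR. apply lt_0_INR. lia. Qed.

Lemma INR_ge_2 d : (2 <= d)%nat -> 2 <= INR d.
Proof. intros H. apply (le_INR 2). exact H. Qed.

Lemma Qw_eq d w : (2 <= d)%nat -> (1 - Qw d w)%C = ((1 - w ^ d) / INR d)%C.
Proof. intros H. unfold Qw. rewrite RtoC_minus. field. apply INR_neq_0, H. Qed.

Lemma Qw_taylor (d : nat) : (2 <= d)%nat -> exists B, 1 <= B /\ forall w, Cmod (1 - w) <= 2 ->
  Cmod ((1 - Qw d w) - (1 - w)) <= B * Cmod (1 - w) ^ 2 /\
  Cmod ((1 - Qw d w) - (1 - w) + ((INR d - 1) / 2)%R * ((1 - w) * (1 - w))) <= B * Cmod (1 - w) ^ 3.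
Proof.
  intros Hd. destruct (pow_taylor2 d) as [B2 [HB2 H2]]. destruct (pow_taylor3 d) as [B3 [HB3 H3]].
  exists (B2 + B3 + 1). split; [lra|]. intros w Hw. specialize (H2 w Hw). specialize (H3 w Hw).
  rewrite Qw_eq by exact Hd. assert (N := INR_neq_0 d Hd). assert (G := INR_ge_2 d Hd).
  set (e := (1 - w)%C) in *. assert (E0 := Cmod_ge_0 e).
  assert (K : forall x : C, Cmod (x / INR d) <= Cmod x).
  { intros x. rewrite Cmod_div by exact N. rewrite Cmod_INR. apply (Rmult_le_reg_r (INR d)); [lra|]. unfold Rdiv. rewrite Rmult_assoc, Rinv_l, Rmult_1_r by lra.
    generalize (Cmod_ge_0 x). nra. }
  split.
  - replace ((1 - w ^ d) / INR d - e)%C with (- ((w ^ d - 1 + INR d * e) / INR d))%C by (field; exact N).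
    rewrite Cmod_opp. eapply Rle_trans; [apply K|]. eapply Rle_trans; [exact H2|]. apply Rmult_le_compat_r; nra.
  - replace ((1 - w ^ d) / INR d - e + ((INR d - 1) / 2)%R * (e * e))%C
      with (- ((w ^ d - 1 + INR d * e - (INR d * (INR d - 1) / 2)%R * (e * e)) / INR d))%C.
    + rewrite Cmod_opp. eapply Rle_trans; [apply K|]. eapply Rle_trans; [exact H3|]. apply Rmult_le_compat_r; [apply pow_le; lra|lra].
    + rewrite !RtoC_div, !RtoC_mult, !RtoC_minus by lra. field. exact N.
Qed.

(** At [w = 1] the value [1] and the derivative [- C0] of the perturbing factor are exact; smallness
    concerns only [C0] and the second-order remainder. This exactness makes the fixed point
    parabolic rather than nearly so. *)
Definition pert (del : R) (w C0 r : C) : Prop :=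
  Cmod C0 <= del /\ Cmod (r - 1 - C0 * (1 - w)) <= del * Cmod (1 - w) ^ 2.

Lemma pert_mono del del' w C0 r : del <= del' -> pert del w C0 r -> pert del' w C0 r.
Proof.
  intros H [H1 H2]. split; [lra|]. eapply Rle_trans; [exact H2|]. apply Rmult_le_compat_r; [|exact H]. generalize (Cmod_ge_0 (1 - w)). nra.
Qed.

(** With [e = 1 - w] and [c = (d - 1) / 2], the numerator is [1 + C0] and the denominator
    [(1 + C0) e - c e ^ 2], up to smaller terms. The quotient is therefore [1 / e + c] up to an
    error that is small with [C0] and [e]. *)
Lemma asymptotic_translation (d : nat) : (2 <= d)%nat -> exists M1 del, 400 <= M1 /\ 0 < del /\ forall w C0 r,
  pert del w C0 r -> w <> 1%C -> Cmod (1 - w) <= / M1 ->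
  (r - Qw d w <> 0)%C /\
  Cmod ((r + C0 * Qw d w) / (r - Qw d w) - / (1 - w) - ((INR d - 1) / 2)%R) <= / 10.
Proof.
  intros Hd. destruct (Qw_taylor d Hd) as [B [HB HQ]]. assert (G := INR_ge_2 d Hd).
  (* [K] dominates the products of the degree with the Taylor constant, so every error term becomes
     a fixed small multiple once [e] and [del] are at most [1 / (40 K)]. *)
  set (K := (INR d + 3) * (B + 1)). assert (HK : 10 <= K) by (unfold K; nra).
  exists (40 * K), (/ (40 * K)). split; [lra|]. split; [apply Rinv_0_lt_compat; lra|].
  intros w C0 r [HC Hr] Hw1 Hw. set (del := / (40 * K)) in *.
  assert (HKd : K * del = / 40) by (unfold del; field; lra).
  destruct (HQ w) as [Q2 Q3]. { eapply Rle_trans; [exact Hw|]. nra. }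
  set (e := (1 - w)%C) in *. set (q := (1 - Qw d w)%C) in *. set (c := (INR d - 1) / 2) in *.
  assert (EQ : Qw d w = (1 - q)%C) by (unfold q; ring). rewrite EQ.
  assert (He : e <> 0%C). { intros E. apply Hw1. replace w with (1 - e)%C by (unfold e; ring). rewrite E. ring. }
  assert (h0 : 0 < Cmod e) by (apply Cmod_gt_0, He). set (h := Cmod e) in *.
  assert (del1 : del <= / 400) by (unfold del; apply Rinv_le_contravar; lra).
  set (rho := (r - 1 - C0 * e)%C) in *. assert (Er : r = (1 + C0 * e + rho)%C) by (unfold rho; ring).
  set (e2 := (q - e)%C) in *. set (e3 := (q - e + c * (e * e))%C) in *.
  assert (Hc : 0 <= c <= INR d / 2) by (unfold c; lra).
  assert (Hh1 : h ^ 2 = h * h) by ring. assert (Hh2 : h ^ 3 = h * h * h) by ring.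
  assert (hh : 0 < h * h) by nra.
  assert (BK : B <= K / 5) by (unfold K; nra).
  (* the denominator is (1 + C0) e^2 up to smaller terms *)
  set (den := (e * (r - (1 - q)))%C).
  assert (Eden : den = (e * e + C0 * (e * e) + e * e2 + e * rho)%C) by (unfold den, e2; rewrite Er; ring).
  assert (Dden : h * h / 2 <= Cmod den).
  { assert (A : Cmod (C0 * (e * e) + (e * e2 + e * rho)) <= del * (h * h) + (h * (B * h ^ 2) + h * (del * h ^ 2))).
    { apply Cmod_add_le; [|apply Cmod_add_le]; apply Cmod_mult_le; try assumption; try (apply Rle_refl). rewrite Cmod_mult. apply Rle_refl. }
    assert (A2 := Cmod_add_ge (e * e) (C0 * (e * e) + (e * e2 + e * rho))). rewrite Cmod_mult in A2. fold h in A2.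
    replace (e * e + (C0 * (e * e) + (e * e2 + e * rho)))%C with den in A2 by (rewrite Eden; ring).
    assert (h * B <= / 100). { apply Rle_trans with (del * (K / 5)); [apply Rmult_le_compat; lra|]. lra. }
    rewrite Hh1 in A. replace (del * (h * h) + (h * (B * (h * h)) + h * (del * (h * h)))) with ((del + h * B + h * del) * (h * h)) in A by ring.
    assert (h * del <= / 100) by (apply Rle_trans with (del * del); nra).
    assert ((del + h * B + h * del) * (h * h) <= / 2 * (h * h)) by (apply Rmult_le_compat_r; lra). lra. }
  assert (Nden : den <> 0%C) by (apply Cmod_pos_neq; lra).
  assert (Nr : (r - (1 - q))%C <> 0%C). { intros E. apply Nden. unfold den. rewrite E. ring. }
  split; [exact Nr|].
  (* What remains of the numerator after subtracting [1 / e + c]. The quadratic part of [Q] has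
     cancelled into [e3], so each summand is of second order in [e] with a further small factor. *)
  set (num := (C0 * e * (- e2) - e3 + rho * (e - 1) - c * (C0 * (e * e) + e * e2 + e * rho))%C).
  replace ((r + C0 * (1 - q)) / (r - (1 - q)) - / e - c)%C with (num / den)%C.
  2: { assert (E1 : (num = e * (r + C0 * (1 - q)) - (r - (1 - q)) - c * den)%C).
       { unfold num, den, e2, e3. rewrite Er. ring. }
       rewrite E1. unfold den. field. split; assumption. }
  assert (Dnum : Cmod num <= (2 * K * del) * (h * h)).
  { assert (A : Cmod num <= ((del * h * (B * h ^ 2) + B * h ^ 3) + del * h ^ 2 * (h + 1)) + c * (del * (h * h) + h * (B * h ^ 2) + h * (del * h ^ 2))).
    { unfold num. apply Cmod_sub_le; [apply Cmod_add_le; [apply Cmod_sub_le; [|exact Q3]|]|].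
      - apply Cmod_mult_le; [apply Cmod_mult_le; [exact HC|apply Rle_refl]|rewrite Cmod_opp; exact Q2].
      - apply Cmod_mult_le; [exact Hr|]. apply Cmod_sub_le; [apply Rle_refl|rewrite Cmod_1; apply Rle_refl].
      - apply Cmod_mult_le; [rewrite Cmod_RtoC_pos; lra|]. apply Cmod_add_le; [apply Cmod_add_le|].
        + apply Cmod_mult_le; [exact HC|]. rewrite Cmod_mult. apply Rle_refl.
        + apply Cmod_mult_le; [apply Rle_refl|exact Q2].
        + apply Cmod_mult_le; [apply Rle_refl|exact Hr]. }
    eapply Rle_trans; [exact A|]. rewrite Hh1, Hh2.
    replace (del * h * (B * (h * h)) + B * (h * h * h) + del * (h * h) * (h + 1) + c * (del * (h * h) + h * (B * (h * h)) + h * (del * (h * h))))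
      with ((del * h * B + B * h + del * (h + 1) + c * (del + h * B + h * del)) * (h * h)) by ring.
    apply Rmult_le_compat_r; [lra|].
    assert (P1 : B * h <= B * del) by (apply Rmult_le_compat_l; lra).
    assert (P2 : del * h * B <= B * del). { replace (del * h * B) with (B * del * h) by ring. nra. }
    assert (P3 : c * (del + h * B + h * del) <= INR d / 2 * (del + del * B + del)).
    { apply Rmult_le_compat; [lra|nra|lra|]. nra. }
    unfold K. assert (0 <= INR d * (del * B)) by (assert (0 <= del * B) by nra; nra). nra. }
  replace (/ 10) with ((2 * K * del) * (h * h) / (h * h / 2)).
  - apply Cmod_div_le; [exact Dnum|lra].
  - replace (2 * K * del) with (2 * (K * del)) by ring. rewrite HKd. field. lra.
Qed.

Fixpoint rsum (x : R) (k : nat) : R := match k with O => 0 | S k' => rsum x k' + x ^ k' end.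
Fixpoint csum (w : C) (k : nat) : C := match k with O => 0%C | S k' => (csum w k' + w ^ k')%C end.

Lemma csum_geom w k : ((1 - w) * csum w k = 1 - w ^ k)%C.
Proof. induction k as [|k IH]; simpl; [ring|]. rewrite Cmult_plus_distr_l, IH. ring. Qed.

Lemma rsum_geom x k : (1 - x) * rsum x k = 1 - x ^ k.
Proof. induction k as [|k IH]; simpl; [ring|]. rewrite Rmult_plus_distr_l, IH. ring. Qed.

Lemma csum_le w k : Cmod (csum w k) <= rsum (Cmod w) k.
Proof.
  induction k as [|k IH]; simpl; [rewrite Cmod_0; lra|]. eapply Rle_trans; [apply Cmod_triangle|]. rewrite Cmod_pow. lra.
Qed.

Lemma rsum_cauchy_schwarz x k : rsum x k * rsum x k <= INR k * rsum (x * x) k.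
Proof.
  assert (A : forall y, 2 * rsum x k * y <= rsum (x * x) k + INR k * (y * y)).
  { intros y. induction k as [|k IH]; [simpl; lra|]. rewrite S_INR. simpl rsum. rewrite Rpow_mult_distr. generalize (Rle_0_sqr (x ^ k - y)). unfold Rsqr. lra. }
  induction k as [|k IH]; [simpl; lra|]. rewrite S_INR. simpl rsum.
  assert (B : 2 * rsum x k * x ^ k <= rsum (x * x) k + INR k * (x ^ k * x ^ k)).
  { clear A. generalize (x ^ k). intros y. clear IH. induction k as [|k IH]; [simpl; lra|]. rewrite S_INR. simpl rsum. rewrite Rpow_mult_distr. generalize (Rle_0_sqr (x ^ k - y)). unfold Rsqr. lra. }
  assert (IH' : rsum x k * rsum x k <= INR k * rsum (x * x) k).
  { apply IH. intros y. clear. induction k as [|k IH]; [simpl; lra|]. rewrite S_INR. simpl rsum. rewrite Rpow_mult_distr. generalize (Rle_0_sqr (x ^ k - y)). unfold Rsqr. lra. }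
  rewrite Rpow_mult_distr. lra.
Qed.

Lemma Re_inv_1_sub (w : C) : (w <> 1)%C -> fst (/ (1 - w))%C = / 2 + (1 - Cmod w * Cmod w) / (2 * (Cmod (1 - w) * Cmod (1 - w))).
Proof.
  intros H. assert (P : 0 < Cmod (1 - w)). { apply Cmod_gt_0. intros E. apply H. replace w with (1 - (1 - w))%C by ring. rewrite E. ring. }
  assert (E : Cmod (1 - w) * Cmod (1 - w) = (1 - fst w) * (1 - fst w) + snd w * snd w) by (rewrite Cmod_sqr; simpl; ring).
  assert (P2 : 0 < (1 - fst w) * (1 - fst w) + snd w * snd w) by (rewrite <- E; nra).
  rewrite E, Cmod_sqr. unfold Cinv. simpl. field. lra.
Qed.

(* Poisson kernels: [Re (1/(1-w)) - 1/2] is half the Poisson kernel, and the inequality is Cauchy-Schwarz for [1 + w + ... + w^(d-1)]. *)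
Lemma Re_parabolic_gain (d : nat) (w : C) : (2 <= d)%nat -> Cmod w <= 1 -> (w ^ d <> 1)%C ->
  fst (/ (1 - w))%C + (INR d - 1) / 2 <= fst (/ (1 - Qw d w))%C.
Proof.
  intros Hd Hw Hwd. assert (N := INR_neq_0 d Hd).
  assert (Hw1 : (w <> 1)%C). { intros ->. apply Hwd. apply Cpow_1_l. }
  assert (Hn : (1 - w ^ d <> 0)%C). { intros E. apply Hwd. replace (w ^ d)%C with (1 - (1 - w ^ d))%C by ring. rewrite E. ring. }
  assert (E1 : fst (/ (1 - Qw d w))%C = INR d * fst (/ (1 - w ^ d))%C).
  { rewrite Qw_eq by exact Hd. replace (/ ((1 - w ^ d) / INR d))%C with (INR d * / (1 - w ^ d))%C by (field; auto). rewrite <- re_scal_l. reflexivity. }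
  rewrite E1, !Re_inv_1_sub by assumption. rewrite Cmod_pow.
  assert (P1 : 0 < Cmod (1 - w)). { apply Cmod_gt_0. intros E. apply Hw1. replace w with (1 - (1 - w))%C by ring. rewrite E. ring. }
  assert (P2 : 0 < Cmod (1 - w ^ d)) by (apply Cmod_gt_0; exact Hn).
  set (x := Cmod w) in *. assert (x0 : 0 <= x) by apply Cmod_ge_0.
  assert (GS := csum_geom w d). apply (f_equal Cmod) in GS. rewrite Cmod_mult in GS.
  assert (S1 : Cmod (csum w d) * Cmod (csum w d) <= INR d * rsum (x * x) d).
  { eapply Rle_trans; [|apply rsum_cauchy_schwarz]. apply Rmult_le_compat; auto using Cmod_ge_0; apply csum_le. }
  assert (GR := rsum_geom (x * x) d). rewrite Rpow_mult_distr in GR.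
  set (a := Cmod (1 - w)) in *. set (b := Cmod (1 - w ^ d)) in *. set (c := Cmod (csum w d)) in *. set (t := rsum (x * x) d) in *.
  rewrite <- GR. assert (c0 : 0 < c) by (unfold c in *; generalize (Cmod_ge_0 (csum w d)); nra).
  rewrite <- GS.
  assert (K : (1 - x * x) / (2 * (a * a)) <= INR d * ((1 - x * x) * t / (2 * (a * c * (a * c))))).
  { replace (INR d * ((1 - x * x) * t / (2 * (a * c * (a * c))))) with ((1 - x * x) / (2 * (a * a)) * (INR d * t / (c * c))) by (field; split; lra).
    rewrite <- (Rmult_1_r ((1 - x * x) / (2 * (a * a)))) at 1. apply Rmult_le_compat_l.
    - apply Rmult_le_pos; [nra|]. left. apply Rinv_0_lt_compat. nra.
    - apply (Rmult_le_reg_r (c * c)); [nra|]. unfold Rdiv. rewrite (Rmult_assoc _ (/ (c * c))), Rinv_l, Rmult_1_r by nra. lra. }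
  lra.
Qed.

(** On the bounded part [|u| <= M] the unperturbed map gains [(d - 1) / 2] in real part by
    [Re_parabolic_gain]. The condition [Re u >= 3 / 5] keeps [|w|] a definite amount below [1], so
    [1 - Q] stays away from [0] and a small perturbation costs at most [1 / 10]. *)
Lemma bounded_translation (d : nat) (M : R) : (2 <= d)%nat -> 1 <= M -> exists del, 0 < del /\ forall w C0 r,
  pert del w C0 r -> w <> 1%C -> 3 / 5 <= fst (/ (1 - w))%C -> Cmod (/ (1 - w)) <= M ->
  (r - Qw d w <> 0)%C /\
  fst (/ (1 - w))%C + (INR d - 1) / 2 - / 10 <= fst ((r + C0 * Qw d w) / (r - Qw d w))%C.
Proof.
  intros Hd HM. assert (N := INR_neq_0 d Hd). assert (G := INR_ge_2 d Hd).
  (* A lower bound of [|1 - Q|]: from [3 / 5 - 1 / 2 = 1 / 10] one gets [1 - |w| ^ 2 >= |1 - w| ^ 2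
     / 5 >= 1 / (5 M ^ 2)], and [1 - Q = (1 - w ^ d) / d]. *)
  set (c0 := / (5 * (M * M) * INR d)). assert (Hden : 10 <= 5 * (M * M) * INR d) by (assert (1 <= M * M) by nra; nra).
  assert (Hc0 : 0 < c0) by (apply Rinv_0_lt_compat; lra). assert (Hc1 : c0 <= / 10) by (apply Rinv_le_contravar; lra).
  exists (c0 * c0 / 140). split; [nra|]. intros w C0 r [HC Hr] Hw1 HRe Hu.
  set (del := c0 * c0 / 140) in *. assert (Hdel : 0 < del <= / 1000) by (unfold del; nra).
  set (e := (1 - w)%C) in *.
  assert (He : e <> 0%C). { intros E. apply Hw1. replace w with (1 - e)%C by (unfold e; ring). rewrite E. ring. }
  assert (h0 : 0 < Cmod e) by (apply Cmod_gt_0, He). rewrite Cmod_inv in Hu by exact He.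
  assert (HR := Re_inv_1_sub w Hw1). fold e in HR. rewrite HR in HRe.
  set (h := Cmod e) in *. set (x := Cmod w) in *. assert (x0 : 0 <= x) by apply Cmod_ge_0.
  assert (A1 : h * h / 5 <= 1 - x * x).
  { assert (Q : / 10 <= (1 - x * x) / (2 * (h * h))) by lra. apply (Rmult_le_compat_r (2 * (h * h))) in Q; [|nra].
    unfold Rdiv in Q. rewrite (Rmult_assoc _ (/ _)), Rinv_l, Rmult_1_r in Q by nra. lra. }
  assert (hM : / M <= h). { rewrite <- (Rinv_inv h). apply Rinv_le_contravar; [apply Rinv_0_lt_compat; exact h0|exact Hu]. }
  assert (iM : 0 < / M) by (apply Rinv_0_lt_compat; lra).
  assert (A2 : / (5 * (M * M)) <= 1 - x * x).
  { eapply Rle_trans; [|exact A1]. replace (/ (5 * (M * M))) with (/ M * / M / 5) by (field; lra). assert (/ M * / M <= h * h) by (apply Rmult_le_compat; lra). lra. }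
  assert (x1 : x <= 1). { nra. }
  assert (xd : x ^ d <= x * x).
  { replace (x * x) with (x ^ 2) by ring. destruct d as [|[|k]]; try lia. replace (S (S k)) with (2 + k)%nat by lia. rewrite pow_add.
    assert (0 <= x ^ k <= 1). { split; [apply pow_le; lra|]. rewrite <- (pow1 k). apply pow_incr. lra. } nra. }
  assert (hq : c0 <= Cmod (1 - Qw d w)).
  { rewrite Qw_eq by exact Hd. rewrite Cmod_div by exact N. rewrite Cmod_INR.
    assert (B : 1 - x ^ d <= Cmod (1 - w ^ d)). { generalize (Cmod_sub_ge 1 (w ^ d)). rewrite Cmod_1, Cmod_pow. fold x. lra. }
    unfold c0. replace (/ (5 * (M * M) * INR d)) with (/ (5 * (M * M)) / INR d) by (field; split; lra).
    apply Rmult_le_compat_r; [left; apply Rinv_0_lt_compat; lra|]. lra. }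
  assert (Nwd : (w ^ d <> 1)%C).
  { intros E. rewrite Qw_eq, E in hq by exact Hd. replace ((1 - 1) / INR d)%C with (RtoC 0) in hq by (field; exact N). rewrite Cmod_0 in hq. lra. }
  assert (Gain := Re_parabolic_gain d w Hd x1 Nwd). fold e in Gain.
  set (q := (1 - Qw d w)%C) in *. assert (EQ : Qw d w = (1 - q)%C) by (unfold q; ring). rewrite EQ.
  assert (h2 : h <= 2). { unfold h, e. replace 2 with (1 + 1) by ring. apply Cmod_sub_le; [rewrite Cmod_1; lra|exact x1]. }
  assert (q1 : Cmod q <= 1).
  { unfold q. rewrite Qw_eq by exact Hd. rewrite Cmod_div by exact N. rewrite Cmod_INR. apply (Rmult_le_reg_r (INR d)); [lra|]. unfold Rdiv. rewrite Rmult_assoc, Rinv_l, Rmult_1_r by lra.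
    eapply Rle_trans; [apply Cmod_tri_sub|]. rewrite Cmod_1, Cmod_pow. fold x. assert (x * x <= 1) by nra. lra. }
  assert (Q2 : Cmod (1 - q) <= 1).
  { rewrite <- EQ. unfold Qw. rewrite Cmod_div by exact N. rewrite Cmod_INR. apply (Rmult_le_reg_r (INR d)); [lra|]. unfold Rdiv. rewrite Rmult_assoc, Rinv_l, Rmult_1_r by lra.
    eapply Rle_trans; [apply Cmod_triangle|]. rewrite Cmod_pow, Cmod_RtoC_pos by lra. fold x. assert (x * x <= 1) by nra. lra. }
  assert (r1 : Cmod (r - 1) <= 6 * del).
  { replace (r - 1)%C with ((r - 1 - C0 * e) + C0 * e)%C by ring.
    eapply Rle_trans; [apply Cmod_add_le; [exact Hr|apply Cmod_mult_le; [exact HC|exact h2]]|]. assert (h ^ 2 <= 4) by nra. assert (del * h ^ 2 <= del * 4) by (apply Rmult_le_compat_l; lra). lra. }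
  assert (dc : 6 * del <= c0 / 2) by (unfold del; nra).
  assert (D1 : c0 / 2 <= Cmod (r - (1 - q))).
  { replace (r - (1 - q))%C with (q + (r - 1))%C by ring. generalize (Cmod_add_ge q (r - 1)). lra. }
  assert (Nr : (r - (1 - q) <> 0)%C) by (apply Cmod_pos_neq; lra).
  assert (Nq : q <> 0%C) by (apply Cmod_pos_neq; lra).
  split; [exact Nr|].
  assert (Ediff : ((r + C0 * (1 - q)) / (r - (1 - q)) - / q = (1 - q) * (C0 * q - (r - 1)) / (q * (r - (1 - q))))%C) by (field; auto).
  assert (Bd : Cmod ((r + C0 * (1 - q)) / (r - (1 - q)) - / q) <= / 10).
  { rewrite Ediff. replace (/ 10) with (1 * (del * 1 + 6 * del) / (c0 * (c0 / 2))) by (unfold del; field; lra).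
    apply Cmod_div_le.
    - apply Cmod_mult_le; [exact Q2|]. apply Cmod_sub_le; [apply Cmod_mult_le; assumption|exact r1].
    - rewrite Cmod_mult. split; [nra|]. apply Rmult_le_compat; lra. }
  assert (Z := fst_le_Cmod ((r + C0 * (1 - q)) / (r - (1 - q)) - / q)). apply Rabs_le_between in Z.
  change (fst ((r + C0 * (1 - q)) / (r - (1 - q)) - / q)%C) with (fst ((r + C0 * (1 - q)) / (r - (1 - q)))%C + - fst (/ q)%C) in Z.
  lra.
Qed.

Definition phi (M : R) (u : C) : R := fst u + Rmax (Rabs (snd u) - M) 0.

Lemma phi_shift M u v t : 0 <= t -> Cmod (v - u - t) <= / 10 -> phi M u + t - / 5 <= phi M v.
Proof.
  intros Ht H. assert (A := fst_le_Cmod (v - u - t)). assert (B := snd_le_Cmod (v - u - t)). simpl in A, B.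
  apply Rabs_le_between in A. apply Rabs_le_between in B. unfold phi.
  assert (C1 : Rabs (snd u) - / 10 <= Rabs (snd v)). { unfold Rabs. repeat destruct Rcase_abs; lra. }
  assert (D : Rmax (Rabs (snd u) - M) 0 - / 10 <= Rmax (Rabs (snd v) - M) 0). { unfold Rmax. repeat destruct Rle_dec; lra. }
  lra.
Qed.

Lemma phi_ge_Re M u : fst u <= phi M u.
Proof. unfold phi. generalize (Rmax_r (Rabs (snd u) - M) 0). lra. Qed.

(** If [|u| >= M1] the map is within [1 / 10] of the translation, which costs at most [1 / 5] in
    [phi]; if [|u| < M1] the second summand of [phi] vanishes at [u] and only the real part matters.
    Since [(d - 1) / 2 >= 1 / 2], a gain of [1 / 4] remains in both cases. *)
Theorem basin_trap (d : nat) : (2 <= d)%nat -> exists M1 del, 400 <= M1 /\ 0 < del /\ forall w C0 r,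
  pert del w C0 r -> w <> 1%C -> 3 / 5 <= phi M1 (/ (1 - w)) ->
  (r - Qw d w <> 0)%C /\ phi M1 (/ (1 - w)) + / 4 <= phi M1 ((r + C0 * Qw d w) / (r - Qw d w)).
Proof.
  intros Hd. destruct (asymptotic_translation d Hd) as [M1 [del1 [HM1 [Hdel1 HA]]]].
  destruct (bounded_translation d M1 Hd ltac:(lra)) as [del2 [Hdel2 HB]]. assert (G := INR_ge_2 d Hd).
  exists M1, (Rmin del1 del2). split; [exact HM1|]. split; [apply Rmin_pos; auto|]. intros w C0 r Hp Hw1 Hphi.
  assert (He : (1 - w <> 0)%C). { intros E. apply Hw1. replace w with (1 - (1 - w))%C by ring. rewrite E. ring. }
  destruct (Rle_lt_dec M1 (Cmod (/ (1 - w)))) as [Hl|Hs].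
  - destruct (HA w C0 r (pert_mono _ _ _ _ _ (Rmin_l _ _) Hp) Hw1) as [N E].
    { rewrite Cmod_inv in Hl by exact He. rewrite <- (Rinv_inv (Cmod (1 - w))). apply Rinv_le_contravar; [lra|exact Hl]. }
    split; [exact N|]. assert (S := phi_shift M1 _ _ ((INR d - 1) / 2) ltac:(lra) E). lra.
  - assert (HRe : phi M1 (/ (1 - w)) = fst (/ (1 - w))%C).
    { unfold phi. rewrite Rmax_right; [ring|]. generalize (snd_le_Cmod (/ (1 - w))). lra. }
    rewrite HRe in *. destruct (HB w C0 r (pert_mono _ _ _ _ _ (Rmin_r _ _) Hp) Hw1 Hphi) as [N E]; [lra|].
    split; [exact N|]. generalize (phi_ge_Re M1 ((r + C0 * Qw d w) / (r - Qw d w))%C). lra.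
Qed.

(** * The complement of the trapping region *)

(* The two inequalities say [phi M (z / (z - 1)) <= 3 / 5] cleared of denominators, so that [z = 1] is included. *)
Definition outer (M : R) (z : C) : Prop :=
  fst z * fst z + snd z * snd z - fst z <= 3 / 5 * ((fst z - 1) * (fst z - 1) + snd z * snd z) /\
  fst z * fst z + snd z * snd z - fst z + Rabs (snd z) <= (3 / 5 + M) * ((fst z - 1) * (fst z - 1) + snd z * snd z).

Lemma u_components (z : C) : z <> 1%C -> let n := (fst z - 1) * (fst z - 1) + snd z * snd z in
  0 < n /\ fst (z / (z - 1))%C = (fst z * fst z + snd z * snd z - fst z) / n /\ snd (z / (z - 1))%C = - snd z / n.
Proof.
  intros H n. assert (P : 0 < n).
  { assert (Q : 0 < Cmod (z - 1)). { apply Cmod_gt_0. intros E. apply H. replace z with (z - 1 + 1)%C by ring. rewrite E. ring. }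
    assert (E := Cmod_sqr (z - 1)). simpl in E. unfold n. nra. }
  split; [exact P|]. unfold Cdiv, Cmult, Cinv. simpl. unfold n in *.
  replace ((fst z + - (1)) * ((fst z + - (1)) * 1) + (snd z + - 0) * ((snd z + - 0) * 1)) with ((fst z - 1) * (fst z - 1) + snd z * snd z) by ring.
  split; field; lra.
Qed.

Lemma outer_phi (M : R) (z : C) : 0 <= M -> z <> 1%C -> (outer M z <-> phi M (z / (z - 1)) <= 3 / 5).
Proof.
  intros HM H. destruct (u_components z H) as [P [E1 E2]]. set (n := (fst z - 1) * (fst z - 1) + snd z * snd z) in *.
  unfold phi. rewrite E1, E2. rewrite Rabs_div, Rabs_Ropp, (Rabs_pos_eq n) by lra. unfold outer. fold n.
  set (a := fst z * fst z + snd z * snd z - fst z). set (b := Rabs (snd z)).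
  assert (K : forall x y, x / n <= y <-> x <= y * n).
  { intros x y. split; intros Q.
    - apply (Rmult_le_compat_r n) in Q; [|lra]. unfold Rdiv in Q. rewrite Rmult_assoc, Rinv_l, Rmult_1_r in Q by lra. exact Q.
    - apply (Rmult_le_reg_r n); [exact P|]. unfold Rdiv. rewrite Rmult_assoc, Rinv_l, Rmult_1_r by lra. exact Q. }
  assert (S : (a + b) / n = a / n + b / n) by (field; lra).
  rewrite <- !K, S. unfold Rmax. destruct Rle_dec; lra.
Qed.

Lemma outer_one M : outer M 1%C.
Proof. unfold outer. simpl. rewrite Rabs_R0. lra. Qed.

Lemma outer_bounds (M : R) (z : C) : outer M z -> Cmod z <= 3 / 2 /\ fst z <= 1.
Proof.
  intros [H _]. assert (Hx : -3 / 2 <= fst z <= 1) by nra. split; [|lra].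
  assert (E := Cmod_sqr z). nra.
Qed.

Lemma outer_small (M : R) (z : C) : 10 <= M -> Cmod z <= / 2 -> outer M z.
Proof.
  intros HM H. assert (E := Cmod_sqr z). assert (A := fst_le_Cmod z). assert (B := snd_le_Cmod z).
  apply Rabs_le_between in A. unfold outer. split; [nra|].
  nra.
Qed.

(** In the coordinate [log z] this keeps the horizontal segments from a point to the base line
    inside the domain of the branches. *)
Lemma outer_star (M : R) (z : C) (t : R) : 10 <= M -> outer M z -> 0 <= t <= 1 -> outer M (t * z)%C.
Proof.
  intros HM [H1 H2] Ht.
  assert (Ef : fst (t * z)%C = t * fst z) by (simpl; ring). assert (Es : snd (t * z)%C = t * snd z) by (simpl; ring).
  unfold outer. rewrite Ef, Es, Rabs_mult, (Rabs_pos_eq t) by lra.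
  assert (SQ : snd z * snd z = Rabs (snd z) * Rabs (snd z)) by (rewrite <- Rabs_mult; symmetry; apply Rabs_pos_eq; nra).
  set (x := fst z) in *. set (b := Rabs (snd z)) in *.
  set (r2 := x * x + snd z * snd z) in *. assert (r0 : 0 <= r2) by (unfold r2; nra).
  assert (H1' : 2 * r2 + x <= 3) by (unfold r2 in *; lra).
  replace (t * x * (t * x) + t * snd z * (t * snd z)) with (t * t * r2) by (unfold r2; ring).
  replace ((t * x - 1) * (t * x - 1) + t * snd z * (t * snd z)) with (t * t * r2 - 2 * (t * x) + 1) by (unfold r2; ring).
  assert (H2' : r2 - x + b <= (3 / 5 + M) * (r2 - 2 * x + 1)).
  { replace (r2 - 2 * x + 1) with ((x - 1) * (x - 1) + snd z * snd z) by (unfold r2; ring). exact H2. }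
  split.
  { assert (t * t * r2 <= t * r2) by (apply Rmult_le_compat_r; nra). assert (t * (2 * r2 + x) <= t * 3) by (apply Rmult_le_compat_l; lra). lra. }
  set (Hh := 3 / 5 + M) in *. assert (HH : 10 <= Hh) by (unfold Hh; lra).
  apply Rnot_lt_le. intros Hlt. destruct (Req_dec t 0) as [->|Ht0]; [nra|]. destruct (Req_dec t 1) as [->|Ht1]; [nra|].
  (* the left minus right side is a concave quadratic h in t with h(t) > 0 >= h(1) *)
  assert (L : (2 * Hh - 1) * x + b < (Hh - 1) * r2 * (1 + t)).
  { apply Rnot_le_lt. intros Q. nra. }
  assert (A1 : Hh < (Hh - 1) * (t * r2)).
  { nra. }
  assert (A2 : 2 * Hh < (2 * Hh - 1) * x + b).
  { apply (Rmult_lt_reg_l t); [lra|].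
    assert (t * (2 * Hh) <= Hh + t * Hh) by nra.
    assert (Hh + t * Hh < Hh + t * ((Hh - 1) * (t * r2))) by (apply Rplus_lt_compat_l, Rmult_lt_compat_l; lra).
    lra. }
  assert (A3 : Hh < (Hh - 1) * r2). { lra. }
  assert (x2 : x * x <= r2) by (unfold r2; nra). assert (b2 : b * b <= r2) by (unfold r2; nra).
  assert (r3 : r2 <= 9 / 4). { apply Rnot_lt_le. intros Q. nra. }
  assert (b3 : b <= 2) by nra. nra.
Qed.

(** For large [u] the condition [phi <= 3 / 5] bounds [Re u + |Im u|], so [u] lies in a sector
    around the negative axis, and so does [1 - 1 / z = 1 / u]. In this sector the expansion at [1]
    has a gain of first order. *)
Lemma outer_sector (M : R) (z : C) : 10 <= M -> outer M z -> z <> 1%C -> 5 * (M + 1) <= Cmod (z / (z - 1)) ->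
  z <> 0%C /\ fst (1 - / z)%C <= - (Cmod (1 - / z) / 3).
Proof.
  intros HM Ho Hz Hu.
  assert (Z0 : z <> 0%C). { intros E. rewrite E in Hu. replace (0 / (0 - 1))%C with (RtoC 0) in Hu; [rewrite Cmod_0 in Hu; lra|]. unfold Cdiv. ring. }
  split; [exact Z0|].
  assert (N : (z - 1 <> 0)%C). { intros E. apply Hz. replace z with (z - 1 + 1)%C by ring. rewrite E. ring. }
  set (u := (z / (z - 1))%C) in *. assert (Eu : (1 - / z = / u)%C) by (unfold u; field; auto).
  assert (Hphi : phi M u <= 3 / 5) by (apply outer_phi; auto; lra).
  assert (P1 : fst u + Rabs (snd u) <= 3 / 5 + M). { unfold phi in Hphi. generalize (Rmax_l (Rabs (snd u) - M) 0). lra. }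
  assert (E := Cmod_sqr u). assert (B0 := Rabs_pos (snd u)).
  assert (SQ : snd u * snd u = Rabs (snd u) * Rabs (snd u)) by (rewrite <- Rabs_mult; symmetry; apply Rabs_pos_eq; nra).
  set (m := Cmod u) in *.
  assert (S1 : fst u <= - Rabs (snd u) / 2).
  { apply Rnot_lt_le. intros Q.
    assert (Rabs (fst u) <= 3 / 5 + M) by (apply Rabs_le; lra).
    assert (fst u * fst u <= (3 / 5 + M) * (3 / 5 + M)).
    { replace (fst u * fst u) with (Rabs (fst u) * Rabs (fst u)) by (rewrite <- Rabs_mult; apply Rabs_pos_eq; nra). apply Rmult_le_compat; auto using Rabs_pos. }
    nra. }
  assert (S2 : m <= - (3 * fst u)). { apply Rnot_lt_le. intros Q. nra. }
  assert (Nu : u <> 0%C) by (apply Cmod_pos_neq; fold m; lra).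
  rewrite Eu, Cmod_inv by exact Nu. fold m. change (fst (/ u)%C) with (fst u / (fst u ^ 2 + snd u ^ 2)).
  replace (fst u ^ 2 + snd u ^ 2) with (m * m) by (rewrite E; ring).
  apply (Rmult_le_reg_r (m * m)); [nra|]. replace (fst u / (m * m) * (m * m)) with (fst u) by (field; lra).
  replace (- (/ m / 3) * (m * m)) with (- m / 3) by (field; lra). lra.
Qed.

(** * Lower bounds for the logarithmic derivative on the outermost annulus *)

(** The quantity is the logarithmic derivative [z P' / P], whose expansion at [w = 1] is
    [1 - (d - 1) (1 - w)]. The sector condition turns the linear term into a gain of at least
    [|1 - w| / 3], of which the errors take at most [|1 - w| / 20]. *)
Lemma near_parabolic_expansion (d : nat) : (2 <= d)%nat -> exists M5 del, 1 <= M5 /\ 0 < del /\ forall w C0 r th,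
  pert del w C0 r -> Cmod (th - C0) <= del * Cmod (1 - w) -> Cmod (1 - w) <= / M5 ->
  fst (1 - w)%C <= - (Cmod (1 - w) / 3) ->
  1 + Cmod (1 - w) / 8 <= Cmod (r / (r + C0 * Qw d w) * (INR d + th - (INR d - 1)%R / Qw d w)).
Proof.
  intros Hd. destruct (Qw_taylor d Hd) as [B [HB HQ]]. assert (G := INR_ge_2 d Hd).
  set (K := 80 * INR d * B). assert (HK : 160 <= K) by (unfold K; nra).
  exists (20 * K), (/ (20 * K)). split; [lra|]. split; [apply Rinv_0_lt_compat; lra|].
  intros w C0 r th [HC Hr] Hth Hw Hsec. set (del := / (20 * K)) in *.
  assert (HKd : K * del = / 20) by (unfold del; field; lra).
  assert (del1 : del <= / 1600) by (unfold del; apply Rinv_le_contravar; lra).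
  destruct (HQ w) as [Q2 _]; [lra|].
  set (e := (1 - w)%C) in *. set (q := (1 - Qw d w)%C) in *. assert (EQ : Qw d w = (1 - q)%C) by (unfold q; ring). rewrite EQ.
  set (h := Cmod e) in *. assert (h0 : 0 <= h) by apply Cmod_ge_0.
  assert (Hh1 : h ^ 2 = h * h) by ring. rewrite Hh1 in *.
  assert (BK : B <= K / 80) by (unfold K; nra).
  assert (Bh : B * h <= / 1600). { apply Rle_trans with (K / 80 * del); [apply Rmult_le_compat; lra|]. lra. }
  set (rho := (r - 1 - C0 * e)%C) in *. set (e2 := (q - e)%C) in *.
  assert (E2 : Cmod e2 <= B * h * h) by lra. assert (hh : B * h * h <= h) by nra.
  assert (q2 : Cmod q <= 2 * h). { replace q with (e + e2)%C by (unfold e2; ring). eapply Rle_trans; [apply Cmod_add_le; [apply Rle_refl|exact E2]|]. fold h. lra. }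
  assert (rho1 : Cmod rho <= del * h) by (eapply Rle_trans; [exact Hr|]; nra).
  assert (r1 : Cmod (r - 1) <= 2 * (del * h)).
  { replace (r - 1)%C with (C0 * e + rho)%C by (unfold rho; ring). eapply Rle_trans; [apply Cmod_add_le; [apply Cmod_mult_le; [exact HC|apply Rle_refl]|exact rho1]|]. fold h. lra. }
  assert (dh : del * h <= / 1600) by nra.
  assert (r2 : Cmod r <= 2). { replace r with (1 + (r - 1))%C by ring. eapply Rle_trans; [apply Cmod_add_le; [rewrite Cmod_1; apply Rle_refl|exact r1]|]. lra. }
  assert (rq : Cmod (r - (1 - q)) <= 3 * h). { replace (r - (1 - q))%C with ((r - 1) + q)%C by ring. eapply Rle_trans; [apply Cmod_add_le; [exact r1|exact q2]|]. nra. }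
  assert (Q1 : Cmod (1 - q) <= 2). { eapply Rle_trans; [apply Cmod_sub_le; [rewrite Cmod_1; apply Rle_refl|exact q2]|]. lra. }
  assert (Q1' : / 2 <= Cmod (1 - q)). { generalize (Cmod_sub_ge 1 q). rewrite Cmod_1. lra. }
  assert (NQ : (1 - q <> 0)%C) by (apply Cmod_pos_neq; lra).
  assert (den : / 2 <= Cmod (r + C0 * (1 - q))).
  { assert (A : Cmod ((r - 1) + C0 * (1 - q)) <= 2 * (del * h) + del * 2) by (apply Cmod_add_le; [exact r1|apply Cmod_mult_le; assumption]).
    generalize (Cmod_add_ge 1 ((r - 1) + C0 * (1 - q))). rewrite Cmod_1.
    replace (1 + ((r - 1) + C0 * (1 - q)))%C with (r + C0 * (1 - q))%C by ring. lra. }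
  assert (Nden : (r + C0 * (1 - q) <> 0)%C) by (apply Cmod_pos_neq; lra).
  set (D := RtoC (INR d - 1)). assert (HD : Cmod D <= INR d) by (unfold D; rewrite Cmod_RtoC_pos; lra).
  assert (EI : RtoC (INR d) = (1 + D)%C) by (unfold D; rewrite RtoC_minus; ring).
  (* The remainder after the linear part [1 - D e]; every summand carries a factor comparable to [e]
     and another small one, [del] or [e] again. *)
  set (num := (r * (th - C0) + C0 * (r - (1 - q)) + D * e * (C0 * (1 - q)) - r * (D * e2) - r * (D * (q * q / (1 - q))))%C).
  assert (EL : (r / (r + C0 * (1 - q)) * (INR d + th - D / (1 - q)) = (1 - D * e) + num / (r + C0 * (1 - q)))%C).
  { unfold num, e2. rewrite EI. field. split; assumption. }
  rewrite EL.
  assert (BN : Cmod num <= K / 4 * (del + h) * h).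
  { assert (A : Cmod num <= 2 * (del * h) + del * (3 * h) + INR d * h * (del * 2) + 2 * (INR d * (B * h * h)) + 2 * (INR d * (2 * h * (2 * h) / / 2))).
    { unfold num. apply Cmod_sub_le; [apply Cmod_sub_le; [apply Cmod_add_le; [apply Cmod_add_le|]|]|].
      - apply Cmod_mult_le; assumption.
      - apply Cmod_mult_le; assumption.
      - apply Cmod_mult_le; [apply Cmod_mult_le; [exact HD|apply Rle_refl]|apply Cmod_mult_le; assumption].
      - apply Cmod_mult_le; [exact r2|apply Cmod_mult_le; assumption].
      - apply Cmod_mult_le; [exact r2|apply Cmod_mult_le; [exact HD|]]. apply Cmod_div_le; [apply Cmod_mult_le; assumption|lra]. }
    eapply Rle_trans; [exact A|].
    replace (2 * (del * h) + del * (3 * h) + INR d * h * (del * 2) + 2 * (INR d * (B * h * h)) + 2 * (INR d * (2 * h * (2 * h) / / 2)))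
      with (((5 + 2 * INR d) * del + (2 * INR d * B + 16 * INR d) * h) * h) by field.
    apply Rmult_le_compat_r; [exact h0|]. unfold K.
    assert (INR d <= INR d * B) by nra.
    assert ((5 + 2 * INR d) * del <= 20 * (INR d * B) * del) by (apply Rmult_le_compat_r; lra).
    assert ((2 * INR d * B + 16 * INR d) * h <= 20 * (INR d * B) * h) by (apply Rmult_le_compat_r; lra).
    lra. }
  assert (BN2 : Cmod (num / (r + C0 * (1 - q))) <= h / 20).
  { apply Rle_trans with (K / 4 * (del + h) * h / / 2); [apply Cmod_div_le; [exact BN|lra]|].
    replace (K / 4 * (del + h) * h / / 2) with (K * (del + h) / 2 * h) by field.
    assert (K * (del + h) <= K * (2 * del)) by (apply Rmult_le_compat_l; lra).
    assert (K * (del + h) / 2 * h <= / 20 * h) by (apply Rmult_le_compat_r; lra). lra. }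
  assert (BR : 1 + h / 3 <= Cmod (1 - D * e)).
  { assert (A := fst_le_Cmod (1 - D * e)). assert (E1 : fst (1 - D * e)%C = 1 - (INR d - 1) * fst e) by (simpl; ring). rewrite E1 in A.
    assert (h / 3 <= (INR d - 1) * - fst e) by nra. generalize (Rle_abs (1 - (INR d - 1) * fst e)). lra. }
  generalize (Cmod_add_ge (1 - D * e) (num / (r + C0 * (1 - q)))). lra.
Qed.

(** For the unperturbed map [y = d z ^ d / (1 + (d - 1) z ^ d)] the logarithmic derivative is
    [d - (d - 1) y] in terms of the image [y]. It exceeds [1] in modulus as soon as [Re y <= 1] and
    [y <> 1]. *)
Lemma Cmod_affine_ge (d : nat) (y : C) : (2 <= d)%nat -> fst y <= 1 ->
  1 + Cmod (y - 1) * Cmod (y - 1) <= Cmod (INR d - (INR d - 1)%R * y) * Cmod (INR d - (INR d - 1)%R * y).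
Proof.
  intros Hd Hy. assert (G := INR_ge_2 d Hd). rewrite !Cmod_sqr. simpl. set (x := fst y) in *. set (v := snd y). set (D := INR d) in *.
  replace ((D + - ((D - 1) * x - 0 * v)) * (D + - ((D - 1) * x - 0 * v)) + (0 + - ((D - 1) * v + 0 * x)) * (0 + - ((D - 1) * v + 0 * x)))
    with (1 + 2 * (D - 1) * (1 - x) + (D - 1) * (D - 1) * ((1 - x) * (1 - x) + v * v)) by ring.
  replace ((x + - (1)) * (x + - (1)) + (v + - 0) * (v + - 0)) with ((1 - x) * (1 - x) + v * v) by ring.
  assert (0 <= (1 - x) * (1 - x) + v * v) by nra. assert (1 <= (D - 1) * (D - 1)) by nra. nra.
Qed.

(** The perturbed logarithmic derivative on the outermost annulus, again in terms of the image [y].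
    Smallness of [C0] relative to [|y|] controls the division by [(1 + C0) y]. *)
Lemma outer_annulus_expansion (d : nat) (del : R) (y C0 r th : C) : (2 <= d)%nat -> 0 < del <= / 100 -> y <> 0%C -> Cmod y <= 3 / 2 ->
  Cmod C0 <= del -> Cmod C0 <= del * Cmod y -> Cmod (r - 1) <= del -> Cmod th <= del ->
  Cmod (INR d - (INR d - 1)%R * y) - 40 * INR d * del <=
  Cmod (((1 + C0) * y - C0) / ((1 + C0) * y) * (INR d + th - (INR d - 1)%R * ((1 + C0) * y - C0) / r)).
Proof.
  intros Hd Hdel Hy Hy2 HC HCy Hr Hth. assert (G := INR_ge_2 d Hd).
  set (D := RtoC (INR d - 1)). assert (HD : Cmod D <= INR d) by (unfold D; rewrite Cmod_RtoC_pos; lra).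
  set (y1 := ((1 + C0) * y - C0)%C).
  assert (y0 : 0 < Cmod y) by (apply Cmod_gt_0, Hy).
  assert (c1 : 99 / 100 <= Cmod (1 + C0)) by (generalize (Cmod_add_ge 1 C0); rewrite Cmod_1; lra).
  assert (r1 : 99 / 100 <= Cmod r). { generalize (Cmod_add_ge 1 (r - 1)). rewrite Cmod_1. replace (1 + (r - 1))%C with r by ring. lra. }
  assert (Nc : (1 + C0 <> 0)%C) by (apply Cmod_pos_neq; lra). assert (Nr : r <> 0%C) by (apply Cmod_pos_neq; lra).
  set (L0 := (INR d - D * y)%C). set (eta := (- (C0 / ((1 + C0) * y)))%C). set (zet := (th - D * ((y1 - y) / r + y * (- (r - 1) / r)))%C).
  assert (E : (y1 / ((1 + C0) * y) * (INR d + th - D * y1 / r) = L0 + (eta * (L0 + zet) + zet))%C).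
  { unfold eta, zet, L0, y1. field. auto. }
  rewrite E.
  assert (Be : Cmod eta <= 2 * del).
  { unfold eta. rewrite Cmod_opp. apply Rle_trans with (del * Cmod y / (/ 2 * Cmod y)).
    - apply Cmod_div_le; [exact HCy|]. rewrite Cmod_mult. split; [nra|]. apply Rmult_le_compat_r; lra.
    - right. field. lra. }
  assert (By : Cmod (y1 - y) <= 5 / 2 * del).
  { replace (y1 - y)%C with (C0 * y - C0)%C by (unfold y1; ring). eapply Rle_trans; [apply Cmod_sub_le; [apply Cmod_mult_le; [exact HC|exact Hy2]|exact HC]|]. lra. }
  assert (Bz : Cmod zet <= 9 * INR d * del).
  { assert (A : Cmod zet <= del + INR d * (5 / 2 * del / (99 / 100) + 3 / 2 * (del / (99 / 100)))).
    { unfold zet. apply Cmod_sub_le; [exact Hth|]. apply Cmod_mult_le; [exact HD|]. apply Cmod_add_le.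
      - apply Cmod_div_le; [exact By|lra].
      - apply Cmod_mult_le; [exact Hy2|]. apply Cmod_div_le; [rewrite Cmod_opp; exact Hr|lra]. }
    eapply Rle_trans; [exact A|]. assert (2 * del <= INR d * del) by nra. lra. }
  assert (BL : Cmod L0 <= 5 / 2 * INR d).
  { unfold L0. eapply Rle_trans; [apply Cmod_sub_le; [rewrite Cmod_INR; apply Rle_refl|apply Cmod_mult_le; [exact HD|exact Hy2]]|]. lra. }
  assert (BT : Cmod (eta * (L0 + zet) + zet) <= 2 * del * (5 / 2 * INR d + 9 * INR d * del) + 9 * INR d * del).
  { apply Cmod_add_le; [apply Cmod_mult_le; [exact Be|apply Cmod_add_le; assumption]|exact Bz]. }
  assert (0 < INR d * del) by nra.
  assert (2 * del * (5 / 2 * INR d + 9 * INR d * del) <= 10 * (INR d * del)) by nra.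
  generalize (Cmod_add_ge L0 (eta * (L0 + zet) + zet)). lra.
Qed.

(** * The rational map in logarithmic coordinates *)

Definition cs (b : bool) (z : C) : C := if b then z else (/ z)%C.
(** [true] stands for a plus sign in [(-1) ^ (j - 1)]; indices of annuli and circles start at [1],
    so the truncated subtraction is harmless. *)
Definition sgn (j : nat) : bool := sign_pos (j - 1).
Definition bsg (b : bool) : R := if b then 1 else -1.

Lemma Cinv_mult (x y : C) : (/ (x * y) = / x * / y)%C.
Proof.
  destruct (Ceq_dec x 0) as [->|Hx]; [rewrite Cmult_0_l, Cinv_0; ring|].
  destruct (Ceq_dec y 0) as [->|Hy]; [rewrite Cmult_0_r, Cinv_0; ring|]. field. auto.
Qed.

Lemma cs_mult b x y : cs b (x * y) = (cs b x * cs b y)%C.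
Proof. destruct b; [reflexivity|]. apply Cinv_mult. Qed.

Lemma cs_cexp b x : cs b (cexp x) = cexp (bsg b * x).
Proof.
  destruct b; simpl; [f_equal; ring|]. rewrite <- cexp_opp. f_equal. apply Ceq_components; simpl; ring.
Qed.

Lemma cs_neq_0 b (x : C) : x <> 0%C -> cs b x <> 0%C.
Proof. destruct b; [auto|]. apply Cinv_neq_0. Qed.

Lemma Cmod_cs b (x : C) : x <> 0%C -> Cmod (cs b x) = if b then Cmod x else / Cmod x.
Proof. destruct b; [reflexivity|]. apply Cmod_inv. Qed.

Lemma sgn_S j : (1 <= j)%nat -> sgn (S j) = negb (sgn j).
Proof.
  intros H. unfold sgn, sign_pos. destruct j as [|j]; [lia|]. replace (S (S j) - 1)%nat with (S j) by lia. replace (S j - 1)%nat with j by lia.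
  rewrite Nat.even_succ, <- Nat.negb_even. reflexivity.
Qed.

Definition cprod (f : nat -> C) (m : nat) : C := Defs.Cprod f m.
Definition csumf (f : nat -> C) (m : nat) : C := Defs.Csum f m.

Lemma Cprod_S f m : cprod f (S m) = (cprod f m * f (S m))%C.
Proof. reflexivity. Qed.

Lemma Csum_S f m : csumf f (S m) = (csumf f m + f (S m))%C.
Proof. reflexivity. Qed.

Lemma Cprod_ext f g m : (forall j, (1 <= j <= m)%nat -> f j = g j) -> cprod f m = cprod g m.
Proof. intros H. induction m as [|m IH]; [reflexivity|]. rewrite !Cprod_S, IH, H by (intros; try apply H; lia). reflexivity. Qed.

Lemma Csum_ext f g m : (forall j, (1 <= j <= m)%nat -> f j = g j) -> csumf f m = csumf g m.
Proof. intros H. induction m as [|m IH]; [reflexivity|]. rewrite !Csum_S, IH, H by (intros; try apply H; lia). reflexivity. Qed.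

Lemma Cprod_neq_0 (f : nat -> C) m : (forall j, (1 <= j <= m)%nat -> f j <> 0%C) -> cprod f m <> 0%C.
Proof.
  intros H. induction m as [|m IH]; [apply C1_nz|]. rewrite Cprod_S. apply Cmult_neq_0; [apply IH; intros; apply H; lia|apply H; lia].
Qed.

(** The signed covering degree [(-1) ^ (j - 1) d_j] of the map on the [j]-th annulus, which is the
    exponent of the dominating monomial. *)
Definition eset (j : nat) (d : nat -> nat) : R := bsg (sgn j) * INR (d j).

Lemma eset_step j d : (1 <= j)%nat -> eset j d - eset (S j) d = bsg (sgn j) * INR (DD d j).
Proof. intros H. unfold eset, DD. rewrite sgn_S, plus_INR by exact H. destruct (sgn j); simpl; ring. Qed.

(* On the [i]-th annulus [tt d al i j] is the one of [(z / a_j)^{D_j}] and its inverse that is less than [1] in modulus. *)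
Definition tt (d : nat -> nat) (al : nat -> C) (i j : nat) (x : C) : C :=
  if (j <? i)%nat then cexp (INR (DD d j) * (x - al j)) else cexp (INR (DD d j) * (al j - x)).

(** The logarithmic derivative, with respect to [x = log z], of the factor
    [cs (sgn j) (1 - tt d al i j x)]. *)
Definition ldl (d : nat -> nat) (al : nat -> C) (i j : nat) (x : C) : C :=
  ((if (j <? i)%nat then - (bsg (sgn j) * INR (DD d j)) else bsg (sgn j) * INR (DD d j))%R * (tt d al i j x / (1 - tt d al i j x)))%C.

Definition sprod (d : nat -> nat) (al : nat -> C) (i m : nat) (x : C) : C := cprod (fun j => cs (sgn j) (1 - tt d al i j x)%C) m.

(** On the [i]-th annulus the factors with [j < i] are dominated by [- a_j ^ D_j], the others by
    [z ^ D_j]; the former collect into the coefficient of the dominating monomial. *)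
Definition kk (d : nat -> nat) (a : nat -> C) (i m : nat) : C :=
  cprod (fun j => if (j <? i)%nat then cs (sgn j) (- a j ^ DD d j)%C else 1%C) m.

Definition NN (d : nat -> nat) (a : nat -> C) (m : nat) : C := cprod (fun j => cs (sign_pos j) (1 - a j ^ DD d j)%C) m.

Definition gfun (n : nat) (d : nat -> nat) (a : nat -> C) (z : C) : C :=
  (cs (sgn n) (z ^ d n) * cprod (fun j => cs (sgn j) (z ^ DD d j - a j ^ DD d j)%C) (n - 1))%C.

Lemma Pformula_eq n d a z : (Pformula n d a z : C) =
  ((/ (1 + Cn n d a) * NN d a (n - 1)) * (INR (d 1%nat) * gfun n d a z / ((INR (d 1%nat) - 1)%R * z ^ d 1%nat + 1)) + Cn n d a / (1 + Cn n d a))%C.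
Proof.
  unfold Pformula, An, Bn, gfun. rewrite Defs_Cdiv, (Defs_Cdiv (Cn n d a)), !Defs_Cinv.
  change (Cadd Cx1 (Cn n d a)) with (1 + Cn n d a)%C. change Cadd with Cplus. change Cmul with Cmult. change Cx1 with (RtoC 1).
  change Defs.RtoC with RtoC. rewrite (Defs_Cpow z (d 1%nat)).
  assert (P1 : Defs.Cprod (fun i => Cpow_sign (sign_pos i) (Csub (RtoC 1) (Defs.Cpow (a i) (DD d i))) 1) (n - 1) = NN d a (n - 1)).
  { apply Cprod_ext. intros j _. unfold Cpow_sign, cs. rewrite Defs_Cinv, !Defs_Cpow, Cpow_1_r. destruct (sign_pos j); reflexivity. }
  assert (P2 : Defs.Cprod (fun i => Cpow_sign (sign_pos (i - 1)) (Csub (Defs.Cpow z (DD d i)) (Defs.Cpow (a i) (DD d i))) 1) (n - 1)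
             = cprod (fun j => cs (sgn j) (z ^ DD d j - a j ^ DD d j)%C) (n - 1)).
  { apply Cprod_ext. intros j _. unfold Cpow_sign, cs, sgn. rewrite Defs_Cinv, !Defs_Cpow, Cpow_1_r. destruct (sign_pos (j - 1)); reflexivity. }
  assert (P3 : Cpow_sign (sign_pos (n - 1)) z (d n) = cs (sgn n) (z ^ d n)).
  { unfold Cpow_sign, cs, sgn. rewrite Defs_Cinv, !Defs_Cpow. destruct (sign_pos (n - 1)); reflexivity. }
  rewrite P1, P2, P3. unfold Cdiv. ring.
Qed.

Section Lift.
Variables (n : nat) (d : nat -> nat) (a al : nat -> C).
Hypothesis Hn : (2 <= n)%nat.
Hypothesis Hal : forall j, (1 <= j <= n - 1)%nat -> cexp (al j) = a j.

Lemma fac_split i j x : (1 <= j <= n - 1)%nat ->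
  (cexp x ^ DD d j - a j ^ DD d j = (if (j <? i)%nat then - a j ^ DD d j else cexp (INR (DD d j) * x)) * (1 - tt d al i j x))%C.
Proof.
  intros Hj. rewrite <- (Hal j Hj), <- !cexp_nat. unfold tt. destruct (j <? i)%nat.
  - replace (RtoC (INR (DD d j)) * (x - al j))%C with (INR (DD d j) * x - INR (DD d j) * al j)%C by ring. rewrite cexp_sub.
    field. apply cexp_neq_0.
  - replace (RtoC (INR (DD d j)) * (al j - x))%C with (INR (DD d j) * al j - INR (DD d j) * x)%C by ring. rewrite cexp_sub.
    field. apply cexp_neq_0.
Qed.

Fixpoint esum (i m : nat) : R := match m with O => 0 | S m' => esum i m' + (if (S m' <? i)%nat then 0 else bsg (sgn (S m')) * INR (DD d (S m'))) end.

Lemma esum_before i m : (m < i)%nat -> esum i m = 0.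
Proof. intros H. induction m as [|m IH]; [reflexivity|]. simpl. rewrite IH by lia. destruct (Nat.ltb_spec (S m) i); [ring|lia]. Qed.

Lemma esum_after i m : (1 <= i)%nat -> (i <= S m)%nat -> esum i m = eset i d - eset (S m) d.
Proof.
  intros Hi. induction m as [|m IH]; intros Hm.
  - replace i with 1%nat by lia. simpl. ring.
  - simpl esum. destruct (Nat.eq_dec i (S (S m))) as [->|Hne].
    + rewrite esum_before by lia. destruct (Nat.ltb_spec (S m) (S (S m))); [ring|lia].
    + rewrite IH by lia. destruct (Nat.ltb_spec (S m) i); [lia|]. generalize (eset_step (S m) d ltac:(lia)). lra.
Qed.

Lemma gprod_region i m x : (m <= n - 1)%nat ->
  cprod (fun j => cs (sgn j) (cexp x ^ DD d j - a j ^ DD d j)%C) m = (kk d a i m * cexp (esum i m * x) * sprod d al i m x)%C.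
Proof.
  intros Hm. induction m as [|m IH].
  - simpl. unfold kk, sprod; simpl. change Cx1 with (RtoC 1). replace (RtoC 0 * x)%C with (RtoC 0) by ring. rewrite cexp_0. ring.
  - rewrite Cprod_S, IH by lia. unfold kk, sprod. rewrite !Cprod_S.
    rewrite (fac_split i (S m) x) by lia. rewrite cs_mult. simpl esum. rewrite RtoC_plus, Cmult_plus_distr_r, cexp_add.
    destruct (S m <? i)%nat.
    + replace (RtoC 0 * x)%C with (RtoC 0) by ring. rewrite cexp_0. ring.
    + replace (RtoC (bsg (sgn (S m)) * INR (DD d (S m))) * x)%C with (bsg (sgn (S m)) * (INR (DD d (S m)) * x))%C by (rewrite RtoC_mult; ring).
      rewrite cs_cexp. ring.
Qed.

(** The exponents telescope by [eset_step]: the powers of [z] that dominate the factors with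
    [j >= i], together with the leading power, leave the single exponent [eset i d]. *)
Lemma gfun_region i x : (1 <= i <= n)%nat ->
  gfun n d a (cexp x) = (kk d a i (n - 1) * cexp (eset i d * x) * sprod d al i (n - 1) x)%C.
Proof.
  intros Hi. unfold gfun. rewrite (gprod_region i (n - 1)) by lia. rewrite <- cexp_nat, cs_cexp.
  rewrite esum_after by lia. replace (S (n - 1)) with n by lia.
  replace (RtoC (bsg (sgn n)) * (RtoC (INR (d n)) * x))%C with (eset n d * x)%C by (unfold eset; rewrite RtoC_mult; ring).
  rewrite RtoC_minus, <- !Cmult_assoc. rewrite (Cmult_assoc (kk d a i (n - 1))).
  replace (cexp (eset i d * x)) with (cexp (eset n d * x) * cexp ((eset i d - eset n d) * x))%C; [ring|].
  rewrite <- cexp_add. f_equal. ring.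
Qed.

(* This combination removes the additive constant of [P] and leaves a product. *)
Definition yprime (z : C) : C := ((1 + Cn n d a) * Pformula n d a z - Cn n d a)%C.

Lemma yprime_eq z : (1 + Cn n d a <> 0)%C ->
  yprime z = (NN d a (n - 1) * (INR (d 1%nat) * gfun n d a z / ((INR (d 1%nat) - 1)%R * z ^ d 1%nat + 1)))%C.
Proof.
  intros H. unfold yprime. rewrite Pformula_eq.
  set (A := (RtoC (INR (d 1%nat)) * gfun n d a z / (RtoC (INR (d 1%nat) - 1) * z ^ d 1%nat + 1))%C). field. exact H.
Qed.

Lemma Pformula_of_yprime z : (1 + Cn n d a <> 0)%C -> (Pformula n d a z : C) = ((yprime z + Cn n d a) / (1 + Cn n d a))%C.
Proof.
  intros H. unfold yprime. set (p := (Pformula n d a z : C)). set (c := (Cn n d a : C)) in *. change (p = ((1 + c) * p - c + c) / (1 + c))%C. field. exact H.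
Qed.

Lemma yprime_region i x : (1 + Cn n d a <> 0)%C -> (1 <= i <= n)%nat ->
  yprime (cexp x) = (NN d a (n - 1) * INR (d 1%nat) * kk d a i (n - 1) * cexp (eset i d * x) * sprod d al i (n - 1) x
                      / (1 + (INR (d 1%nat) - 1)%R * cexp (INR (d 1%nat) * x)))%C.
Proof.
  intros H Hi. rewrite yprime_eq by exact H. rewrite (gfun_region i) by exact Hi. rewrite <- cexp_nat.
  rewrite (Cplus_comm (RtoC (INR (d 1%nat) - 1) * _)). unfold Cdiv. ring.
Qed.

Lemma cdiff_cexp_affine (p q x : C) : cdiff ctrue (fun x => cexp (p + q * x)) x (q * cexp (p + q * x))%C.
Proof.
  assert (A : cdiff ctrue (fun x => p + q * x)%C x (0 + (0 * x + q * 1))%C).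
  { apply (cdiff_add ctrue (fun _ => p) (fun x => q * x)%C); [apply cdiff_const|].
    apply (cdiff_mul ctrue (fun _ => q) (fun x => x)); [apply cdiff_const|apply cdiff_id]. }
  assert (B := cdiff_comp ctrue ctrue cexp (fun x => p + q * x)%C x _ _ (fun _ _ => I) A (cdiff_cexp ctrue _)).
  eapply cdiff_ext; [reflexivity| |exact B]. ring.
Qed.

Lemma cdiff_tt i j x : cdiff ctrue (tt d al i j) x ((if (j <? i)%nat then INR (DD d j) else - INR (DD d j))%R * tt d al i j x)%C.
Proof.
  unfold tt. set (D := INR (DD d j)). destruct (j <? i)%nat.
  - eapply cdiff_ext; [| |apply (cdiff_cexp_affine (- (D * al j)) D x)].
    + intros z. cbv beta. f_equal. ring.
    + replace (- (D * al j) + D * x)%C with (D * (x - al j))%C by ring. reflexivity.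
  - eapply cdiff_ext; [| |apply (cdiff_cexp_affine (D * al j) (- D)%R x)].
    + intros z. cbv beta. f_equal. rewrite RtoC_opp. ring.
    + replace (D * al j + (- D)%R * x)%C with (D * (al j - x))%C by (rewrite RtoC_opp; ring). reflexivity.
Qed.

Lemma cdiff_cs b f x l : cdiff ctrue f x l -> f x <> 0%C -> cdiff ctrue (fun z => cs b (f z)) x (cs b (f x) * (bsg b * (l / f x)))%C.
Proof.
  intros H Hn0. destruct b; simpl.
  - eapply cdiff_ext; [reflexivity| |exact H]. field. exact Hn0.
  - eapply cdiff_ext; [reflexivity| |apply cdiff_inv; [exact H|exact Hn0]].
    replace (RtoC (-1)) with (- (1))%C by (apply Ceq_components; simpl; ring). field. exact Hn0.
Qed.

Lemma cdiff_sprod i m x : (forall j, (1 <= j <= m)%nat -> (1 - tt d al i j x <> 0)%C) ->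
  cdiff ctrue (sprod d al i m) x (sprod d al i m x * csumf (fun j => ldl d al i j x) m)%C.
Proof.
  intros Hnz. induction m as [|m IH].
  - eapply cdiff_ext; [reflexivity| |apply (cdiff_const ctrue 1%C)]. simpl. change Cx0 with (RtoC 0). ring.
  - eapply cdiff_ext; [reflexivity| |apply (cdiff_mul ctrue (sprod d al i m) (fun z => cs (sgn (S m)) (1 - tt d al i (S m) z)%C))].
    2: apply IH; intros; apply Hnz; lia.
    2: { apply (cdiff_cs (sgn (S m)) (fun z => (1 - tt d al i (S m) z)%C) x (- ((if (S m <? i)%nat then INR (DD d (S m)) else - INR (DD d (S m)))%R * tt d al i (S m) x))%C).
         - assert (A := cdiff_add ctrue (fun _ => 1%C) _ x _ _ (cdiff_const ctrue 1%C x)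
                         (cdiff_mul ctrue (fun _ => (- (1))%C) _ x _ _ (cdiff_const ctrue (- (1))%C x) (cdiff_tt i (S m) x))).
           refine (cdiff_ext _ _ _ _ _ _ _ _ A); [intros z; cbv beta|]; ring.
         - apply Hnz. lia. }
    unfold sprod at 3. rewrite Cprod_S, Csum_S. fold (sprod d al i m x).
    set (p := sprod d al i m x). set (q := cs (sgn (S m)) (1 - tt d al i (S m) x)).
    set (S0 := csumf (fun j => ldl d al i j x) m).
    assert (E : (RtoC (bsg (sgn (S m))) * (- ((if (S m <? i)%nat then INR (DD d (S m)) else - INR (DD d (S m)))%R * tt d al i (S m) x) / (1 - tt d al i (S m) x)) = ldl d al i (S m) x)%C).
    { unfold ldl. destruct (S m <? i)%nat; rewrite ?RtoC_opp, ?RtoC_mult; unfold Cdiv; ring. }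
    cbv beta. rewrite E. ring.
Qed.

Lemma cdiff_yprime i x : (1 + Cn n d a <> 0)%C -> (1 <= i <= n)%nat ->
  (forall j, (1 <= j <= n - 1)%nat -> (1 - tt d al i j x <> 0)%C) ->
  (1 + (INR (d 1%nat) - 1)%R * cexp (INR (d 1%nat) * x) <> 0)%C ->
  cdiff ctrue (fun x => yprime (cexp x)) x
    (yprime (cexp x) * (eset i d + csumf (fun j => ldl d al i j x) (n - 1)
       - (INR (d 1%nat) - 1)%R * INR (d 1%nat) * cexp (INR (d 1%nat) * x) / (1 + (INR (d 1%nat) - 1)%R * cexp (INR (d 1%nat) * x))))%C.
Proof.
  intros H Hi Hnz Hden.
  set (c := (NN d a (n - 1) * INR (d 1%nat) * kk d a i (n - 1))%C). set (D := RtoC (INR (d 1%nat))) in *. set (D1 := RtoC (INR (d 1%nat) - 1)) in *.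
  set (ee := RtoC (eset i d)).
  assert (A1 : cdiff ctrue (fun x => cexp (0 + ee * x)) x (ee * cexp (0 + ee * x))%C) by apply cdiff_cexp_affine.
  assert (A2 : cdiff ctrue (fun x => cexp (0 + D * x)) x (D * cexp (0 + D * x))%C) by apply cdiff_cexp_affine.
  assert (A3 := cdiff_add ctrue (fun _ => 1%C) _ x _ _ (cdiff_const ctrue 1%C x) (cdiff_mul ctrue (fun _ => D1) _ x _ _ (cdiff_const ctrue D1 x) A2)).
  assert (Hden' : (1 + D1 * cexp (0 + D * x) <> 0)%C) by (rewrite Cplus_0_l; exact Hden).
  assert (A4 := cdiff_inv ctrue _ x _ A3 Hden').
  assert (A5 := cdiff_mul ctrue _ _ x _ _ A1 (cdiff_sprod i (n - 1) x Hnz)).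
  assert (A6 := cdiff_mul ctrue _ _ x _ _ (cdiff_mul ctrue (fun _ => c) _ x _ _ (cdiff_const ctrue c x) A5) A4).
  cbv beta in A6. eapply cdiff_ext; [| |exact A6].
  - intros z. rewrite (yprime_region i z H Hi). fold D D1 ee c. rewrite !Cplus_0_l. unfold Cdiv. ring.
  - rewrite (yprime_region i x H Hi). fold D D1 ee c. rewrite !Cplus_0_l in *.
    set (S0 := csumf (fun j => ldl d al i j x) (n - 1)). field. exact Hden.
Qed.
End Lift.

(** * The perturbing factor *)

Definition rw (n : nat) (d : nat -> nat) (a : nat -> C) (w : C) : C :=
  (NN d a (n - 1) * cprod (fun j => cs (sgn j) (1 - (a j * w) ^ DD d j)%C) (n - 1))%C.

(** The logarithmic derivative of [rw] with respect to [log z], where [w = 1 / z]. *)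
Definition thw (n : nat) (d : nat -> nat) (a : nat -> C) (w : C) : C :=
  csumf (fun j => ((bsg (sgn j) * INR (DD d j))%R * ((a j * w) ^ DD d j / (1 - (a j * w) ^ DD d j)))%C) (n - 1).

(** One factor of [R], normalised to [1] at [w = 1]. Its first-order coefficient in [1 - w] is
    [b1 = D A / (1 - A)] up to sign, which is the origin of the terms of [C_n]. *)
Lemma pert_factor (D : nat) (b : bool) : exists K, 1 <= K /\ forall A w be, Cmod A <= be -> K * be <= / 2 -> Cmod (1 - w) <= 2 ->
  let x := (A * w ^ D)%C in let b1 := (INR D * (A / (1 - A)))%C in
  Cmod (cs (negb b) (1 - A) * cs b (1 - x) - 1 - bsg b * b1 * (1 - w)) <= K * be * Cmod (1 - w) ^ 2 /\
  Cmod b1 <= K * be /\ Cmod x <= K * be /\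
  Cmod (INR D * (x / (1 - x)) - b1) <= K * be * Cmod (1 - w) /\ Cmod (INR D * (x / (1 - x))) <= K * be.
Proof.
  destruct (pow_taylor2 D) as [B [HB HT]]. set (g := INR D + 2 * B + 1). assert (g1 : 1 <= g) by (unfold g; generalize (pos_INR D); lra).
  set (p3 := 3 ^ D). assert (p1 : 1 <= p3) by (unfold p3; apply pow_R1_Rle; lra).
  set (K := 16 * (g * g) * p3). assert (Hgg : g <= g * g) by nra. assert (K16 : 16 * p3 <= K) by (unfold K; nra).
  assert (Kg : 16 * (g * g) <= K) by (unfold K; nra). assert (Kgp : 16 * (g * p3) <= K) by (unfold K; nra).
  exists K. split; [lra|]. intros A w be HA HK Hw x b1.
  assert (A0 := Cmod_ge_0 A). assert (be1 : be <= / 32) by nra.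
  assert (w3 : Cmod w <= 3). { replace w with (1 - (1 - w))%C by ring. replace 3 with (1 + 2) by ring. apply Cmod_sub_le; [rewrite Cmod_1; lra|exact Hw]. }
  assert (wD : Cmod (w ^ D) <= p3). { rewrite Cmod_pow. apply pow_incr. split; [apply Cmod_ge_0|exact w3]. }
  assert (x1 : Cmod x <= be * p3) by (apply Cmod_mult_le; assumption).
  assert (bp : be * p3 <= / 32) by nra.
  assert (dA : / 2 <= Cmod (1 - A)). { generalize (Cmod_sub_ge 1 A). rewrite Cmod_1. lra. }
  assert (dx : / 2 <= Cmod (1 - x)). { generalize (Cmod_sub_ge 1 x). rewrite Cmod_1. lra. }
  assert (NA : (1 - A <> 0)%C) by (apply Cmod_pos_neq; lra). assert (Nx : (1 - x <> 0)%C) by (apply Cmod_pos_neq; lra).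
  specialize (HT w Hw). set (e := (1 - w)%C) in *. set (h := Cmod e) in *. assert (h0 : 0 <= h) by apply Cmod_ge_0.
  set (e2 := (w ^ D - 1 + INR D * e)%C) in *.
  assert (EwD : (w ^ D = 1 - INR D * e + e2)%C) by (unfold e2; ring).
  assert (DB : INR D + 2 * B <= g) by (unfold g; lra).
  assert (hsq : h ^ 2 <= 2 * h) by nra.
  assert (w1 : Cmod (1 - w ^ D) <= g * h).
  { replace (1 - w ^ D)%C with (INR D * e - e2)%C by (rewrite EwD; ring).
    eapply Rle_trans; [apply Cmod_sub_le; [apply Cmod_mult_le; [rewrite Cmod_INR; apply Rle_refl|apply Rle_refl]|exact HT]|]. fold h.
    assert (B * h ^ 2 <= B * (2 * h)) by (apply Rmult_le_compat_l; lra). assert ((INR D + 2 * B) * h <= g * h) by (apply Rmult_le_compat_r; lra). lra. }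
  set (X := (A * (1 - w ^ D) / (1 - A))%C).
  assert (X1 : Cmod X <= 2 * be * (g * h)).
  { replace (2 * be * (g * h)) with (be * (g * h) / / 2) by field. apply Cmod_div_le; [apply Cmod_mult_le; assumption|lra]. }
  assert (X2 : Cmod (X - b1 * e) <= 2 * be * (B * h ^ 2)).
  { replace (X - b1 * e)%C with (- (A * e2 / (1 - A)))%C by (unfold X, b1; rewrite EwD; field; exact NA). rewrite Cmod_opp.
    replace (2 * be * (B * h ^ 2)) with (be * (B * h ^ 2) / / 2) by field. apply Cmod_div_le; [apply Cmod_mult_le; assumption|lra]. }
  assert (Bg : B <= g * g) by (generalize (pos_INR D); unfold g in Hgg |- *; lra).
  assert (X2' : 2 * be * (B * h ^ 2) <= K * be * h ^ 2 / 2).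
  { replace (2 * be * (B * h ^ 2)) with (2 * B * (be * h ^ 2)) by ring. replace (K * be * h ^ 2 / 2) with (K / 2 * (be * h ^ 2)) by field.
    apply Rmult_le_compat_r; [|lra]. apply Rmult_le_pos; [lra|nra]. }
  assert (bh : be * h ^ 2 >= 0) by (apply Rle_ge, Rmult_le_pos; [lra|nra]).
  assert (Kbh0 : 0 <= K * (be * h ^ 2)) by (apply Rmult_le_pos; lra).
  split; [|split; [|split; [|split]]].
  - destruct b; simpl.
    + replace (/ (1 - A) * (1 - x) - 1 - RtoC 1 * b1 * e)%C with (X - b1 * e)%C by (unfold X, x; field; exact NA). lra.
    + replace (RtoC (-1)) with (- (1))%C by (apply Ceq_components; simpl; ring).
      assert (Xh : Cmod X <= / 2). { eapply Rle_trans; [exact X1|]. assert (g * h <= g * 2) by nra. nra. }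
      assert (dX : / 2 <= Cmod (1 + X)). { generalize (Cmod_add_ge 1 X). rewrite Cmod_1. lra. }
      assert (NX : (1 + X <> 0)%C) by (apply Cmod_pos_neq; lra).
      assert (EX : (1 - x = (1 - A) * (1 + X))%C) by (unfold X, x; field; exact NA).
      replace ((1 - A) * / (1 - x) - 1 - - (1) * b1 * e)%C with (- (X - b1 * e) + X * X / (1 + X))%C by (rewrite EX; field; auto).
      eapply Rle_trans; [apply Cmod_add_le; [rewrite Cmod_opp; exact X2|apply Cmod_div_le; [apply Cmod_mult_le; exact X1|split; [|exact dX]; lra]]|].
      replace (2 * be * (g * h) * (2 * be * (g * h)) / / 2) with (8 * (g * g) * be * (be * h ^ 2)) by field.
      assert (8 * (g * g) * be * (be * h ^ 2) <= K / 2 * (be * h ^ 2)). { apply Rmult_le_compat_r; [lra|]. assert (8 * (g * g) * be <= 8 * (g * g) * 1) by (apply Rmult_le_compat_l; lra). lra. }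
      lra.
  - unfold b1. apply Rle_trans with (INR D * (be / / 2)).
    + apply Cmod_mult_le; [rewrite Cmod_INR; lra|]. apply Cmod_div_le; [exact HA|lra].
    + replace (INR D * (be / / 2)) with (2 * INR D * be) by field. apply Rmult_le_compat_r; [lra|]. lra.
  - eapply Rle_trans; [exact x1|]. rewrite Rmult_comm. apply Rmult_le_compat_r; lra.
  - replace (INR D * (x / (1 - x)) - b1)%C with (INR D * (- (A * (1 - w ^ D)) / ((1 - x) * (1 - A))))%C by (unfold b1, x; field; split; [exact NA|exact Nx]).
    apply Rle_trans with (INR D * (be * (g * h) / (/ 2 * / 2))).
    + apply Cmod_mult_le; [rewrite Cmod_INR; lra|]. apply Cmod_div_le; [rewrite Cmod_opp; apply Cmod_mult_le; assumption|].
      rewrite Cmod_mult. split; [lra|]. apply Rmult_le_compat; lra.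
    + replace (INR D * (be * (g * h) / (/ 2 * / 2))) with (4 * (INR D * g) * (be * h)) by field. replace (K * be * h) with (K * (be * h)) by ring.
      apply Rmult_le_compat_r; [nra|]. assert (INR D * g <= g * g) by (apply Rmult_le_compat_r; lra). lra.
  - apply Rle_trans with (INR D * (be * p3 / / 2)).
    + apply Cmod_mult_le; [rewrite Cmod_INR; lra|]. apply Cmod_div_le; [exact x1|lra].
    + replace (INR D * (be * p3 / / 2)) with (2 * (INR D * p3) * be) by field. apply Rmult_le_compat_r; [lra|].
      assert (INR D * p3 <= g * p3) by (apply Rmult_le_compat_r; lra). lra.
Qed.

Lemma sign_pos_sgn j : (1 <= j)%nat -> sign_pos j = negb (sgn j).
Proof. intros H. rewrite <- sgn_S by exact H. unfold sgn. f_equal. lia. Qed.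

Lemma Cn_csumf n d a : (Cn n d a : C) = csumf (fun j => (bsg (sgn j) * (INR (DD d j) * (a j ^ DD d j / (1 - a j ^ DD d j))))%C) (n - 1).
Proof.
  unfold Cn. apply Csum_ext. intros j _. unfold sgn, bsg. rewrite Defs_Cdiv, Defs_Cpow. change Defs.RtoC with RtoC. change Cmul with Cmult. change (Csub Cx1) with (Cminus 1).
  destruct (sign_pos (j - 1)).
  - unfold Cdiv. change (@eq C (INR (DD d j) * a j ^ DD d j * / (1 - a j ^ DD d j)) (1 * (INR (DD d j) * (a j ^ DD d j * / (1 - a j ^ DD d j)))))%C. ring.
  - change (@eq C (- (INR (DD d j) * a j ^ DD d j / (1 - a j ^ DD d j))) (RtoC (-1) * (INR (DD d j) * (a j ^ DD d j / (1 - a j ^ DD d j)))))%C.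
    replace (RtoC (-1)) with (- (1))%C by (apply Ceq_components; simpl; ring). unfold Cdiv. ring.
Qed.

Theorem pert_product (d : nat -> nat) (m : nat) : exists K, 1 <= K /\ forall a w be,
  (forall j, (1 <= j <= m)%nat -> Cmod (a j ^ DD d j) <= be) -> 0 <= be -> K * be <= / 2 -> Cmod (1 - w) <= 2 ->
  pert (K * be) w (Cn (S m) d a) (rw (S m) d a w) /\
  Cmod (thw (S m) d a w - Cn (S m) d a) <= K * be * Cmod (1 - w) /\ Cmod (thw (S m) d a w) <= K * be /\
  (forall j, (1 <= j <= m)%nat -> Cmod ((a j * w) ^ DD d j) <= K * be).
Proof.
  induction m as [|m [K1 [HK1 IH]]].
  - exists 1. split; [lra|]. intros a w be _ Hb _ Hw. unfold pert, rw, thw, NN. rewrite Cn_csumf. simpl. unfold csumf, cprod. simpl.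
    change Cx0 with (RtoC 0). change Cx1 with (RtoC 1). change (1, 0) with (RtoC 1).
    replace (1 * 1 - 1 - 0 * (1 - w))%C with (RtoC 0) by ring. replace (0 - 0)%C with (RtoC 0) by ring. rewrite Cmod_0.
    assert (h0 := Cmod_ge_0 (1 - w)). repeat split; try nra. intros; lia.
  - destruct (pert_factor (DD d (S m)) (sgn (S m))) as [K2 [HK2 HF]].
    exists (6 * K1 + 6 * K2). split; [lra|]. intros a w be Ha Hb HK Hw.
    destruct (IH a w be) as [[I1 I2] [I3 [I4 I5]]]; [intros; apply Ha; lia|exact Hb|nra|exact Hw|].
    destruct (HF (a (S m) ^ DD d (S m))%C w be) as [F1 [F2 [F3 [F4 F5]]]]; [apply Ha; lia|nra|exact Hw|].
    set (x := (a (S m) ^ DD d (S m) * w ^ DD d (S m))%C) in *.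
    set (b1 := (INR (DD d (S m)) * (a (S m) ^ DD d (S m) / (1 - a (S m) ^ DD d (S m))))%C) in *.
    set (sg := bsg (sgn (S m))) in *.
    set (f := (cs (negb (sgn (S m))) (1 - a (S m) ^ DD d (S m)) * cs (sgn (S m)) (1 - x))%C) in *.
    assert (EC : (Cn (S (S m)) d a : C) = (Cn (S m) d a + sg * b1)%C).
    { rewrite !Cn_csumf. replace (S (S m) - 1)%nat with (S m) by lia. replace (S m - 1)%nat with m by lia. rewrite Csum_S. reflexivity. }
    assert (ER : rw (S (S m)) d a w = (rw (S m) d a w * f)%C).
    { unfold rw, NN. replace (S (S m) - 1)%nat with (S m) by lia. replace (S m - 1)%nat with m by lia. rewrite !Cprod_S.
      rewrite (sign_pos_sgn (S m)) by lia. unfold f, x. rewrite <- Cpow_mult_l. ring. }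
    assert (ET : thw (S (S m)) d a w = (thw (S m) d a w + sg * (INR (DD d (S m)) * (x / (1 - x))))%C).
    { unfold thw. replace (S (S m) - 1)%nat with (S m) by lia. replace (S m - 1)%nat with m by lia. rewrite Csum_S. unfold x. rewrite Cpow_mult_l, RtoC_mult. fold sg. ring. }
    rewrite ER, ET. unfold pert. rewrite EC.
    set (c := (Cn (S m) d a : C)) in *. set (R0 := rw (S m) d a w) in *. set (th := thw (S m) d a w) in *. set (e := (1 - w)%C) in *.
    set (h := Cmod e) in *. assert (h0 : 0 <= h) by apply Cmod_ge_0.
    assert (Sg : Cmod (RtoC sg) = 1). { unfold sg, bsg. rewrite Cmod_R. destruct (sgn (S m)); [apply Rabs_R1|]. unfold Rabs. destruct Rcase_abs; lra. }
    assert (K1b : 0 <= K1 * be <= / 2) by nra. assert (K2b : 0 <= K2 * be <= / 12) by nra.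
    assert (Sb : Cmod (sg * b1) <= K2 * be) by (rewrite Cmod_mult, Sg; lra).
    assert (h2 : 0 <= h ^ 2) by nra. assert (hh : h ^ 2 <= 2 * h) by nra.
    assert (f1 : Cmod (f - 1) <= 3 * (K2 * be) * h).
    { replace (f - 1)%C with ((f - 1 - sg * b1 * e) + sg * b1 * e)%C by ring.
      eapply Rle_trans; [apply Cmod_add_le; [exact F1|apply Cmod_mult_le; [exact Sb|apply Rle_refl]]|]. fold h. nra. }
    assert (f2 : Cmod f <= 2).
    { replace f with (1 + (f - 1))%C by ring. eapply Rle_trans; [apply Cmod_add_le; [rewrite Cmod_1; apply Rle_refl|exact f1]|]. nra. }
    split; [split|split; [|split]].
    + eapply Rle_trans; [apply Cmod_add_le; [exact I1|exact Sb]|]. nra.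
    + replace (R0 * f - 1 - (c + sg * b1) * e)%C with ((f - 1 - sg * b1 * e) + (c * e * (f - 1) + (R0 - 1 - c * e) * f))%C by ring.
      eapply Rle_trans; [apply Cmod_add_le; [exact F1|apply Cmod_add_le; [apply Cmod_mult_le; [apply Cmod_mult_le; [exact I1|apply Rle_refl]|exact f1]|apply Cmod_mult_le; [exact I2|exact f2]]]|].
      fold h. replace (K2 * be * h ^ 2 + (K1 * be * h * (3 * (K2 * be) * h) + K1 * be * h ^ 2 * 2)) with ((K2 * be + 3 * (K1 * be) * (K2 * be) + 2 * (K1 * be)) * h ^ 2) by ring.
      apply Rmult_le_compat_r; [exact h2|]. nra.
    + replace (th + sg * (INR (DD d (S m)) * (x / (1 - x))) - (c + sg * b1))%C with ((th - c) + sg * (INR (DD d (S m)) * (x / (1 - x)) - b1))%C by ring.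
      eapply Rle_trans; [apply Cmod_add_le; [exact I3|apply Cmod_mult_le; [rewrite Sg; apply Rle_refl|exact F4]]|]. nra.
    + eapply Rle_trans; [apply Cmod_add_le; [exact I4|apply Cmod_mult_le; [rewrite Sg; apply Rle_refl|exact F5]]|]. nra.
    + intros j Hj. destruct (Nat.eq_dec j (S m)) as [->|Hne].
      * rewrite Cpow_mult_l. fold x. nra.
      * eapply Rle_trans; [apply I5; lia|]. nra.
Qed.

(** * Products and sums with one exceptional term *)

Lemma cs_near_1 b (t : C) del : Cmod t <= del -> del <= / 4 -> Cmod (cs b (1 - t) - 1) <= 2 * del.
Proof.
  intros H1 H2. assert (T0 := Cmod_ge_0 t). assert (D : / 2 <= Cmod (1 - t)) by (generalize (Cmod_sub_ge 1 t); rewrite Cmod_1; lra).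
  assert (N : (1 - t <> 0)%C) by (apply Cmod_pos_neq; lra). destruct b; simpl.
  - replace (1 - t - 1)%C with (- t)%C by ring. rewrite Cmod_opp. lra.
  - replace (/ (1 - t) - 1)%C with (t / (1 - t))%C by (field; exact N). replace (2 * del) with (del / / 2) by field. apply Cmod_div_le; [exact H1|lra].
Qed.

(** On an annulus all factors but the one of a neighbouring circle are uniformly close to [1]. With
    [j0 = 0] there is no exceptional factor. *)
Lemma cprod_split (b : nat -> bool) (t : nat -> C) (j0 m : nat) (del : R) : 0 <= del -> 4 * INR m * del <= 1 ->
  (forall j, (1 <= j <= m)%nat -> j <> j0 -> Cmod (t j) <= del) ->
  exists E, Cmod (E - 1) <= 4 * INR m * del /\
    cprod (fun j => cs (b j) (1 - t j)%C) m = (E * (if andb (1 <=? j0)%nat (j0 <=? m)%nat then cs (b j0) (1 - t j0) else 1))%C.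
Proof.
  intros Hdel. induction m as [|m IH]; intros Hm Ht.
  - exists 1%C. split; [replace (1 - 1)%C with (RtoC 0) by ring; rewrite Cmod_0; simpl; lra|].
    destruct (Nat.leb_spec 1 j0); destruct (Nat.leb_spec j0 0); simpl; try lia; unfold cprod; simpl; change Cx1 with (RtoC 1); ring.
  - rewrite S_INR in Hm. assert (m0 := pos_INR m). destruct IH as [E [HE Heq]]; [nra|intros; apply Ht; lia|].
    rewrite Cprod_S, Heq. destruct (Nat.eq_dec j0 (S m)) as [->|Hne].
    + exists E. split; [rewrite S_INR; nra|].
      destruct (Nat.leb_spec 1 (S m)); [|lia]. destruct (Nat.leb_spec (S m) m); [lia|]. rewrite Nat.leb_refl. simpl. ring.
    + exists (E * cs (b (S m)) (1 - t (S m)))%C. split.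
      * assert (A := cs_near_1 (b (S m)) (t (S m)) del (Ht (S m) ltac:(lia) ltac:(auto)) ltac:(nra)).
        replace (E * cs (b (S m)) (1 - t (S m)) - 1)%C with ((E - 1) + E * (cs (b (S m)) (1 - t (S m)) - 1))%C by ring.
        assert (E2 : Cmod E <= 2). { replace E with (1 + (E - 1))%C by ring. eapply Rle_trans; [apply Cmod_add_le; [rewrite Cmod_1; apply Rle_refl|exact HE]|]. nra. }
        eapply Rle_trans; [apply Cmod_add_le; [exact HE|apply Cmod_mult_le; [exact E2|exact A]]|]. rewrite S_INR. lra.
      * replace (j0 <=? S m)%nat with (j0 <=? m)%nat; [ring|]. destruct (Nat.leb_spec j0 m); destruct (Nat.leb_spec j0 (S m)); auto; lia.
Qed.

Lemma csumf_split (f : nat -> C) (j0 m : nat) (c : R) : 0 <= c -> (forall j, (1 <= j <= m)%nat -> j <> j0 -> Cmod (f j) <= c) ->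
  Cmod (csumf f m - (if andb (1 <=? j0)%nat (j0 <=? m)%nat then f j0 else 0)) <= INR m * c.
Proof.
  intros Hc. induction m as [|m IH]; intros Hf.
  - destruct (Nat.leb_spec 1 j0); destruct (Nat.leb_spec j0 0); simpl; try lia; unfold csumf; simpl; change Cx0 with (RtoC 0);
      replace (0 - 0)%C with (RtoC 0) by ring; rewrite Cmod_0; lra.
  - specialize (IH ltac:(intros; apply Hf; lia)). rewrite Csum_S, S_INR. destruct (Nat.eq_dec j0 (S m)) as [->|Hne].
    + destruct (Nat.leb_spec 1 (S m)); [|lia]. destruct (Nat.leb_spec (S m) m); [lia|]. rewrite Nat.leb_refl. simpl in *.
      replace (csumf f m + f (S m) - f (S m))%C with (csumf f m - 0)%C by ring. lra.
    + replace (j0 <=? S m)%nat with (j0 <=? m)%nat by (destruct (Nat.leb_spec j0 m); destruct (Nat.leb_spec j0 (S m)); auto; lia).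
      set (z := if andb (1 <=? j0)%nat (j0 <=? m)%nat then f j0 else 0%C) in *.
      replace (csumf f m + f (S m) - z)%C with ((csumf f m - z) + f (S m))%C by ring.
      eapply Rle_trans; [apply Cmod_add_le; [exact IH|apply (Hf (S m)); [lia|auto]]|]. lra.
Qed.

(** * Inverse branches as fixed points *)

(** Implicit differentiation of [psi (G y) = f y]. Continuity of [G] puts [G y] into the range of
    the expansion of [psi], and [l <> 0] then bounds the increment of [G] linearly by that of
    [y]. *)
Lemma inverse_cdiff (D : C -> Prop) (psi G f : C -> C) (x l m : C) : (forall y, D y -> psi (G y) = f y) -> D x ->
  ccont D G x -> cdiff ctrue psi (G x) l -> cdiff D f x m -> l <> 0%C -> cdiff D G x (m / l)%C.
Proof.
  intros HG Dx Hc Hpsi Hf Hl e He.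
  assert (L0 : 0 < Cmod l) by (apply Cmod_gt_0, Hl). assert (M0 := Cmod_ge_0 m).
  set (L := Cmod l) in *. set (B := 2 * (Cmod m + 1) / L).
  assert (B0 : 0 < B) by (unfold B; apply Rdiv_lt_0_compat; lra).
  set (e1 := Rmin (L / 2) (e * L / (2 * (B + 1)))). set (e2 := Rmin 1 (e * L / 4)).
  assert (He1 : 0 < e1) by (apply Rmin_pos; [lra|]; apply Rdiv_lt_0_compat; nra). assert (He2 : 0 < e2) by (apply Rmin_pos; [lra|]; nra).
  assert (E1a : e1 <= L / 2) by apply Rmin_l. assert (E1b : e1 <= e * L / (2 * (B + 1))) by apply Rmin_r.
  assert (E2a : e2 <= 1) by apply Rmin_l. assert (E2b : e2 <= e * L / 4) by apply Rmin_r.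
  destruct (Hpsi e1 He1) as [d1 [Hd1 H1]]. destruct (Hf e2 He2) as [d2 [Hd2 H2]]. destruct (Hc d1 Hd1) as [d3 [Hd3 H3]].
  exists (Rmin d2 d3). split; [apply Rmin_pos; auto|]. intros y Dy Hy.
  specialize (H2 y Dy (Rlt_le_trans _ _ _ Hy (Rmin_l _ _))). specialize (H3 y Dy (Rlt_le_trans _ _ _ Hy (Rmin_r _ _))).
  specialize (H1 (G y) I H3). rewrite !HG in H1 by assumption.
  set (k := (G y - G x)%C) in *. set (h := (y - x)%C) in *.
  set (p := (f y - f x - l * k)%C) in *. set (q := (f y - f x - m * h)%C) in *.
  assert (Ek : (l * k = m * h + q - p)%C) by (unfold p, q; ring).
  assert (h0 := Cmod_ge_0 h). assert (k0 := Cmod_ge_0 k).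
  assert (Hk : Cmod k <= B * Cmod h).
  { assert (A : L * Cmod k <= Cmod m * Cmod h + e2 * Cmod h + e1 * Cmod k).
    { unfold L. rewrite <- Cmod_mult, Ek. apply Cmod_sub_le; [apply Cmod_add_le; [rewrite Cmod_mult; lra|exact H2]|exact H1]. }
    assert (A2 : L / 2 * Cmod k <= (Cmod m + 1) * Cmod h) by nra.
    unfold B. apply (Rmult_le_reg_l (L / 2)); [lra|]. replace (L / 2 * (2 * (Cmod m + 1) / L * Cmod h)) with ((Cmod m + 1) * Cmod h) by (field; lra). exact A2. }
  replace (k - m / l * h)%C with ((q - p) / l)%C by (apply (f_equal (fun z => (z / l)%C)) in Ek; replace k with (l * k / l)%C by (field; exact Hl); rewrite Ek; field; exact Hl).
  rewrite Cmod_div by exact Hl. apply (Rle_div_l _ _ L); [lra|].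
  eapply Rle_trans; [apply Cmod_sub_le; [exact H2|exact H1]|].
  assert (e2 * Cmod h <= e * L / 4 * Cmod h) by (apply Rmult_le_compat_r; lra).
  assert (e1 * Cmod k <= e * L / (2 * (B + 1)) * (B * Cmod h)) by (apply Rmult_le_compat; lra).
  assert (e * L / (2 * (B + 1)) * (B * Cmod h) <= e * L / 2 * Cmod h).
  { replace (e * L / (2 * (B + 1)) * (B * Cmod h)) with (e * L / 2 * Cmod h * (B / (B + 1))) by (field; lra).
    assert (B / (B + 1) <= 1) by (apply Rle_div_l; lra). assert (0 <= e * L / 2 * Cmod h) by nra. nra. }
  assert (0 <= e * L * Cmod h) by (apply Rmult_le_pos; nra). lra.
Qed.

Lemma ccont_clog (z : C) : 0 < fst z -> ccont ctrue clog z.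
Proof.
  intros Hz e He. assert (Hm : 0 < Cmod z) by (generalize (fst_le_Cmod z); rewrite Rabs_pos_eq; lra).
  assert (C1 := ln_continue (Cmod z) Hm). unfold continue_in, limit1_in, limit_in in C1. destruct (C1 (e / 2) ltac:(lra)) as [a1 [Ha1 H1]].
  assert (C2 : continuity_pt atan (snd z / fst z)) by (apply derivable_continuous_pt, derivable_pt_atan).
  unfold continuity_pt, continue_in, limit1_in, limit_in in C2. destruct (C2 (e / 2) ltac:(lra)) as [a2 [Ha2 H2]].
  set (d2 := Rmin (fst z / 2) (a2 * (fst z * fst z) / (4 * (Cmod z + 1)))).
  assert (Hd2 : 0 < d2) by (apply Rmin_pos; [lra|]; apply Rdiv_lt_0_compat; [apply Rmult_lt_0_compat; nra|lra]).
  exists (Rmin (Rmin (Cmod z) a1) d2). split; [repeat (first [assumption | apply Rmin_pos])|]. intros y _ Hy.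
  assert (B1 := Rlt_le_trans _ _ _ Hy (Rmin_l _ _)). assert (B2 := Rlt_le_trans _ _ _ Hy (Rmin_r _ _)).
  assert (B4 := Rlt_le_trans _ _ _ B1 (Rmin_r _ _)).
  assert (B5 := Rlt_le_trans _ _ _ B2 (Rmin_l _ _)). assert (B6 := Rlt_le_trans _ _ _ B2 (Rmin_r _ _)).
  assert (F := fst_le_Cmod (y - z)). assert (S := snd_le_Cmod (y - z)). simpl in F, S.
  assert (Fy : fst z / 2 < fst y). { apply Rabs_le_between in F. lra. }
  assert (L1 : Rabs (ln (Cmod y) - ln (Cmod z)) < e / 2).
  { destruct (Req_dec (Cmod y) (Cmod z)) as [->|Hne]; [rewrite Rminus_diag, Rabs_R0; lra|].
    assert (Hy0 : 0 < Cmod y) by (generalize (fst_le_Cmod y); rewrite Rabs_pos_eq; lra).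
    apply (H1 (Cmod y)). split; [split; [exact Hy0|auto]|].
    change (Rabs (Cmod y - Cmod z) < a1).
    assert (Q1 := Cmod_sub_ge y z). assert (Q2 := Cmod_sub_ge z y). rewrite (Cmod_sub_sym z y) in Q2. apply Rabs_def1; lra. }
  assert (L2 : Rabs (atan (snd y / fst y) - atan (snd z / fst z)) < e / 2).
  { destruct (Req_dec (snd y / fst y) (snd z / fst z)) as [->|Hne]; [rewrite Rminus_diag, Rabs_R0; lra|].
    apply (H2 (snd y / fst y)). split; [split; [exact I|auto]|].
    change (Rabs (snd y / fst y - snd z / fst z) < a2).
    replace (snd y / fst y - snd z / fst z) with (((snd y + - snd z) * fst z - snd z * (fst y + - fst z)) / (fst y * fst z)) by (field; lra).
    rewrite Rabs_div by nra. rewrite (Rabs_pos_eq (fst y * fst z)) by nra. apply Rlt_div_l; [nra|].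
    assert (Sz := snd_le_Cmod z). assert (Fz := fst_le_Cmod z). rewrite (Rabs_pos_eq (fst z)) in Fz by lra.
    eapply Rle_lt_trans; [apply Rabs_triang|]. rewrite Rabs_Ropp, !Rabs_mult, (Rabs_pos_eq (fst z)) by lra.
    set (t := Cmod (y - z)) in *. assert (t0 : 0 <= t) by apply Cmod_ge_0.
    assert (Rabs (snd z) * Rabs (fst y + - fst z) <= Cmod z * t) by (apply Rmult_le_compat; try lra; apply Rabs_pos).
    apply Rle_lt_trans with (2 * (Cmod z + 1) * t); [nra|].
    apply Rlt_le_trans with (2 * (Cmod z + 1) * (a2 * (fst z * fst z) / (4 * (Cmod z + 1)))); [apply Rmult_lt_compat_l; lra|].
    replace (2 * (Cmod z + 1) * (a2 * (fst z * fst z) / (4 * (Cmod z + 1)))) with (a2 * (fst z / 2 * fst z)) by (field; lra).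
    apply Rmult_le_compat_l; [lra|]. apply Rmult_le_compat_r; lra. }
  eapply Rle_lt_trans; [apply Cmod_le_sum|]. unfold clog. simpl. unfold Rminus in L1, L2. lra.
Qed.

Lemma cdiff_clog (z : C) : 0 < fst z -> cdiff ctrue clog z (/ z)%C.
Proof.
  intros Hz. set (D := fun y : C => 0 < fst y).
  assert (N : z <> 0%C). { intros E. rewrite E in Hz. simpl in Hz. lra. }
  assert (A : cdiff D clog z (1 / z)%C).
  { apply (inverse_cdiff D cexp clog (fun y => y) z z 1%C).
    - intros y Hy. apply cexp_clog, Hy.
    - exact Hz.
    - intros e He. destruct (ccont_clog z Hz e He) as [del [Hd HH]]. exists del. split; [exact Hd|]. intros y _ Hy. apply HH; [exact I|exact Hy].
    - eapply cdiff_ext; [reflexivity| |apply cdiff_cexp]. apply cexp_clog, Hz.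
    - apply cdiff_id.
    - exact N. }
  intros e He. destruct (A e He) as [del [Hd HH]]. exists (Rmin del (fst z)). split; [apply Rmin_pos; auto|]. intros y _ Hy.
  replace (/ z)%C with (1 / z)%C by (unfold Cdiv; ring). apply HH; [|exact (Rlt_le_trans _ _ _ Hy (Rmin_l _ _))].
  assert (B := Rlt_le_trans _ _ _ Hy (Rmin_r _ _)). assert (F := fst_le_Cmod (y - z)). simpl in F. apply Rabs_le_between in F. unfold D. lra.
Qed.

Lemma clog_lipschitz (S : C -> Prop) (W dW : C -> C) (q : R) (x y : C) :
  (forall t, 0 <= t <= 1 -> S (seg x y t)) -> (forall z, S z -> 0 < fst (W z) /\ cdiff ctrue W z (dW z) /\ Cmod (dW z / W z) <= q) ->
  Cmod (clog (W y) - clog (W x)) <= q * Cmod (y - x).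
Proof.
  intros HS HW. apply (mean_value ctrue (fun z => clog (W z)) (fun t => (/ W (seg x y t) * dW (seg x y t))%C)).
  - intros; exact I.
  - intros t Ht. destruct (HW _ (HS t Ht)) as [W1 [W2 _]]. apply (cdiff_comp ctrue ctrue clog W); [intros; exact I|exact W2|apply cdiff_clog, W1].
  - intros t Ht. destruct (HW _ (HS t Ht)) as [_ [_ W3]]. rewrite Cmult_comm. exact W3.
Qed.

Section Branch.
Variables (X S : C -> Prop) (T : C -> C -> C) (x0 : C).
Hypothesis HS0 : S x0.
Hypothesis HSc : cclosed S.
Hypothesis HT : forall x xi, X x -> S xi -> S (T x xi).
Hypothesis HL : forall x xi xi', X x -> S xi -> S xi' -> Cmod (T x xi - T x xi') <= / 2 * Cmod (xi - xi').
Hypothesis HC : forall x xi, X x -> S xi -> ccont X (fun x' => T x' xi) x.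

Definition branch (x : C) : C := epsilon (inhabits (RtoC 0)) (fun xi => S xi /\ T x xi = xi).

Lemma branch_spec x : X x -> S (branch x) /\ T x (branch x) = branch x.
Proof.
  intros Hx. unfold branch. apply epsilon_spec.
  destruct (contraction_fixed_point S (T x) (/ 2) x0) as [xi [H1 H2]]; auto; [lra|]. exists xi. auto.
Qed.

Lemma branch_unique x xi : X x -> S xi -> T x xi = xi -> branch x = xi.
Proof.
  intros Hx Hxi E. destruct (branch_spec x Hx) as [B1 B2]. apply Csub_eq_0.
  assert (A := HL x (branch x) xi Hx B1 Hxi). rewrite B2, E in A. generalize (Cmod_ge_0 (branch x - xi)). lra.
Qed.

Lemma branch_ccont x : X x -> ccont X branch x.
Proof.
  intros Hx e He. destruct (branch_spec x Hx) as [B1 B2]. destruct (HC x (branch x) Hx B1 (e / 2) ltac:(lra)) as [del [Hd HH]].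
  exists del. split; [exact Hd|]. intros y Hy Hyx. specialize (HH y Hy Hyx). destruct (branch_spec y Hy) as [D1 D2].
  assert (A := HL y (branch y) (branch x) Hy D1 B1). rewrite D2 in A. rewrite B2 in HH.
  assert (Q := Cmod_tri3 (branch y) (T y (branch x)) (branch x)). lra.
Qed.
End Branch.

Lemma ccont_comp D (f g : C -> C) x : ccont D g x -> ccont ctrue f (g x) -> ccont D (fun z => f (g z)) x.
Proof.
  intros Hg Hf e He. destruct (Hf e He) as [r [Hr Q]]. destruct (Hg r Hr) as [s [Hs Q2]]. exists s. split; [exact Hs|].
  intros y Dy Hy. apply Q; [exact I|]. apply Q2; assumption.
Qed.

Lemma ccont_sub_dom (D : C -> Prop) f x : ccont ctrue f x -> ccont D f x.
Proof. intros Hf e He. destruct (Hf e He) as [r [Hr Q]]. exists r. split; [exact Hr|]. intros y _ Hy. apply Q; [exact I|exact Hy]. Qed.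

Lemma ccont_cexp_affine D (p q x : C) : ccont D (fun y => cexp (p + q * y)) x.
Proof. apply ccont_sub_dom. eapply cdiff_ccont. apply cdiff_cexp_affine. Qed.

Lemma phi_ge_Cmod M u : 1 <= M -> 3 / 5 <= phi M u -> 3 / 5 <= Cmod u.
Proof.
  intros HM Hu. unfold phi in Hu. assert (F := fst_le_Cmod u). assert (Gf := snd_le_Cmod u). assert (F2 := Rle_abs (fst u)).
  destruct (Rle_lt_dec (Rabs (snd u)) M); [rewrite Rmax_right in Hu by lra|]; lra.
Qed.

Lemma clog_1 : clog 1 = 0%C.
Proof. unfold clog. rewrite Cmod_1, ln_1. simpl. replace (0 / 1) with 0 by field. rewrite atan_0. reflexivity. Qed.

(** Near [z0 = cexp xi] the map sending [y] to [xi + clog (y / z0)] is a local inverse of [cexp], so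
    derivatives in the logarithmic coordinate can be pushed down. *)
Lemma cdiff_of_lift (f : C -> C) (xi l : C) : cdiff ctrue (fun x => f (cexp x)) xi l -> cdiff ctrue f (cexp xi) (l / cexp xi)%C.
Proof.
  intros Hf. set (z0 := cexp xi). assert (z0n : z0 <> 0%C) by apply cexp_neq_0.
  set (g := fun y : C => (xi + clog (y * / z0))%C). assert (E1 : (z0 * / z0 = 1)%C) by (field; exact z0n).
  assert (Eg : g z0 = xi) by (unfold g; rewrite E1, clog_1; ring).
  assert (A : cdiff ctrue g z0 (0 + / (z0 * / z0) * (1 * / z0 + z0 * 0))%C).
  { apply (cdiff_add ctrue (fun _ => xi)); [apply cdiff_const|]. apply (cdiff_comp ctrue ctrue clog (fun y => (y * / z0)%C)); [intros; exact I| |].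
    - apply (cdiff_mul ctrue (fun y => y) (fun _ => (/ z0)%C)); [apply cdiff_id|apply cdiff_const].
    - apply cdiff_clog. rewrite E1. simpl. lra. }
  assert (B : cdiff ctrue (fun y => f (cexp (g y))) z0 (l * (0 + / (z0 * / z0) * (1 * / z0 + z0 * 0)))%C).
  { apply (cdiff_comp ctrue ctrue (fun x => f (cexp x)) g); [intros; exact I|exact A|rewrite Eg; exact Hf]. }
  assert (Cg : forall y, Cmod (y - z0) < Cmod z0 -> cexp (g y) = y).
  { intros y Hy. unfold g. rewrite cexp_add, cexp_clog; [fold z0; field; exact z0n|].
    assert (Q : Cmod (y * / z0 - 1) < 1).
    { replace (y * / z0 - 1)%C with ((y - z0) / z0)%C by (field; exact z0n). rewrite Cmod_div by exact z0n. apply Rlt_div_l; [apply Cmod_gt_0, z0n|lra]. }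
    assert (F := fst_le_Cmod (y * / z0 - 1)). change (fst (y * / z0 - 1)%C) with (fst (y * / z0)%C - 1) in F. apply Rabs_le_between in F. lra. }
  intros e He. destruct (B e He) as [r [Hr HB]]. exists (Rmin r (Cmod z0)). split; [apply Rmin_pos; [exact Hr|apply Cmod_gt_0, z0n]|].
  intros y _ Hy. specialize (HB y I (Rlt_le_trans _ _ _ Hy (Rmin_l _ _))). rewrite Eg, (Cg y (Rlt_le_trans _ _ _ Hy (Rmin_r _ _))) in HB.
  replace (l / z0)%C with (l * (0 + / (z0 * / z0) * (1 * / z0 + z0 * 0)))%C by (field; exact z0n). exact HB.
Qed.

Lemma ccont_real_lipschitz (g : C -> R) x : (forall z z', Rabs (g z - g z') <= Cmod (z - z')) -> ccont ctrue (fun z => RtoC (g z)) x.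
Proof.
  intros Hg e He. exists e. split; [exact He|]. intros y _ Hy. rewrite <- RtoC_minus, Cmod_R. specialize (Hg y x). lra.
Qed.

Lemma not_outer_open (M : R) (z : C) : ~ outer M z -> exists e, 0 < e /\ forall z', Cmod (z' - z) < e -> ~ outer M z'.
Proof.
  intros Hz.
  assert (c1 : ccont ctrue (fun z => RtoC (fst z)) z) by (apply (ccont_real_lipschitz fst); intros; apply (fst_le_Cmod (z0 - z'))).
  assert (c2 : ccont ctrue (fun z => RtoC (snd z)) z) by (apply (ccont_real_lipschitz snd); intros; apply (snd_le_Cmod (z0 - z'))).
  assert (c3 : ccont ctrue (fun z => RtoC (Rabs (snd z))) z).
  { apply (ccont_real_lipschitz (fun z => Rabs (snd z))). intros y y'. eapply Rle_trans; [apply Rabs_triang_inv2|]. apply (snd_le_Cmod (y - y')). }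
  set (q := fun z : C => (fst z - 1) * (fst z - 1) + snd z * snd z). set (p := fun z : C => fst z * fst z + snd z * snd z - fst z).
  assert (cq : ccont ctrue (fun z => RtoC (q z)) z).
  { assert (c4 := ccont_add ctrue _ _ z c1 (ccont_const ctrue (- (1))%C z)).
    eapply ccont_ext; [|apply (ccont_add ctrue _ _ z (ccont_mul ctrue _ _ z c4 c4) (ccont_mul ctrue _ _ z c2 c2))]. intros y. apply Ceq_components; unfold q; simpl; ring. }
  assert (cp : ccont ctrue (fun z => RtoC (p z)) z).
  { eapply ccont_ext; [|apply (ccont_add ctrue _ _ z (ccont_add ctrue _ _ z (ccont_mul ctrue _ _ z c1 c1) (ccont_mul ctrue _ _ z c2 c2)) (ccont_mul ctrue _ _ z (ccont_const ctrue (- (1))%C z) c1))].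
    intros y. apply Ceq_components; unfold p; simpl; ring. }
  assert (K : forall f : C -> R, ccont ctrue (fun z => RtoC (f z)) z -> 0 < f z -> exists e, 0 < e /\ forall z', Cmod (z' - z) < e -> 0 < f z').
  { intros f Hf Hp. destruct (Hf (f z) Hp) as [e [He Q]]. exists e. split; [exact He|]. intros z' Hz'. specialize (Q z' I Hz'). rewrite <- RtoC_minus, Cmod_R in Q. apply Rabs_def2 in Q. lra. }
  destruct (Rle_lt_dec (p z) (3 / 5 * q z)) as [L1|L1]; [destruct (Rle_lt_dec (p z + Rabs (snd z)) ((3 / 5 + M) * q z)) as [L2|L2]|].
  - exfalso. apply Hz. split; assumption.
  - destruct (K (fun z => p z + Rabs (snd z) - (3 / 5 + M) * q z)) as [e [He Q]]; [|lra|].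
    + eapply ccont_ext; [|apply (ccont_add ctrue _ _ z (ccont_add ctrue _ _ z cp c3) (ccont_mul ctrue _ _ z (ccont_const ctrue (- (3 / 5 + M)%R)%C z) cq))].
      intros y. apply Ceq_components; simpl; ring.
    + exists e. split; [exact He|]. intros z' Hz' [_ O]. specialize (Q z' Hz'). unfold p, q in Q. lra.
  - destruct (K (fun z => p z - 3 / 5 * q z)) as [e [He Q]]; [|lra|].
    + eapply ccont_ext; [|apply (ccont_add ctrue _ _ z cp (ccont_mul ctrue _ _ z (ccont_const ctrue (- (3 / 5)%R)%C z) cq))]. intros y. apply Ceq_components; simpl; ring.
    + exists e. split; [exact He|]. intros z' Hz' [O _]. specialize (Q z' Hz'). unfold p, q in Q. lra.
Qed.

(** The value at [z0] itself may vanish: the notion serves denominators, which have to be nonzero on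
    a punctured neighbourhood only. *)
Definition isolated (f : C -> C) (z0 : C) : Prop := exists r, 0 < r /\ forall u, 0 < Cmod (u - z0) < r -> f u <> 0%C.

Lemma isolated_mul f g z0 : isolated f z0 -> isolated g z0 -> isolated (fun z => (f z * g z)%C) z0.
Proof.
  intros [r [Hr Q]] [s [Hs T]]. exists (Rmin r s). split; [apply Rmin_pos; auto|]. intros u [U1 U2].
  apply Cmult_neq_0; [apply Q|apply T]; split; auto; eapply Rlt_le_trans; [exact U2|apply Rmin_l|exact U2|apply Rmin_r].
Qed.

Lemma isolated_cont f z0 : ccont ctrue f z0 -> f z0 <> 0%C -> isolated f z0.
Proof.
  intros Hc Hn. destruct (Hc (Cmod (f z0)) ltac:(apply Cmod_gt_0, Hn)) as [r [Hr Q]]. exists r. split; [exact Hr|]. intros u [_ U] E.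
  specialize (Q u I U). rewrite E, Cmod_sub_sym in Q. replace (f z0 - 0)%C with (f z0) in Q by ring. lra.
Qed.

Lemma isolated_cdiff f z0 l : cdiff ctrue f z0 l -> l <> 0%C -> isolated f z0.
Proof.
  intros Hd Hl. destruct (Ceq_dec (f z0) 0) as [E0|E0]; [|apply isolated_cont; [eapply cdiff_ccont, Hd|exact E0]].
  assert (L0 : 0 < Cmod l) by (apply Cmod_gt_0, Hl). destruct (Hd (Cmod l / 2) ltac:(lra)) as [r [Hr Q]]. exists r. split; [exact Hr|]. intros u [U1 U] E.
  specialize (Q u I U). rewrite E, E0 in Q. replace (0 - 0 - l * (u - z0))%C with (- (l * (u - z0)))%C in Q by ring. rewrite Cmod_opp, Cmod_mult in Q. nra.
Qed.

Lemma cdiff_pow_sub (k : nat) (c z : C) : cdiff ctrue (fun z => (z ^ k - c)%C) z (INR k * z ^ (k - 1))%C.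
Proof.
  eapply cdiff_ext; [| |apply (cdiff_add ctrue _ (fun _ => (- c)%C) z _ _ (cdiff_pow ctrue k z) (cdiff_const ctrue (- c)%C z))]; [intros y; cbv beta|]; ring.
Qed.

Lemma isolated_pow_sub (k : nat) (c z0 : C) : (1 <= k)%nat -> isolated (fun z => (z ^ k - c)%C) z0.
Proof.
  intros Hk. destruct (Ceq_dec z0 0) as [->|Hz].
  - destruct (Ceq_dec c 0) as [->|Hc].
    + exists 1. split; [lra|]. intros u [U _]. replace (u - 0)%C with u in U by ring. replace (u ^ k - 0)%C with (u ^ k)%C by ring. apply Cpow_nz, Cmod_pos_neq, U.
    + apply isolated_cont; [eapply cdiff_ccont, cdiff_pow_sub|]. destruct k as [|k]; [lia|]. simpl. replace (0 * 0 ^ k - c)%C with (- c)%C by ring.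
      intros E. apply Hc. replace c with (- - c)%C by ring. rewrite E. ring.
  - eapply isolated_cdiff; [apply cdiff_pow_sub|]. apply Cmult_neq_0; [|apply Cpow_nz, Hz]. apply Cmod_pos_neq. rewrite Cmod_INR. apply lt_0_INR. lia.
Qed.

Lemma ccont_cprod D (f : nat -> C -> C) m x : (forall j, (1 <= j <= m)%nat -> ccont D (f j) x) -> ccont D (fun z => cprod (fun j => f j z) m) x.
Proof.
  intros Hf. induction m as [|m IH]; [apply (ccont_const D 1%C)|].
  apply (ccont_mul D (fun z => cprod (fun j => f j z) m) (f (S m))); [apply IH; intros; apply Hf; lia|apply Hf; lia].
Qed.

Lemma isolated_cprod (f : nat -> C -> C) m x : (forall j, (1 <= j <= m)%nat -> isolated (f j) x) -> isolated (fun z => cprod (fun j => f j z) m) x.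
Proof.
  intros Hf. induction m as [|m IH]; [exists 1; split; [lra|intros; apply C1_nz]|].
  apply (isolated_mul (fun z => cprod (fun j => f j z) m) (f (S m))); [apply IH; intros; apply Hf; lia|apply Hf; lia].
Qed.

Lemma cprod_div (f g : nat -> C) m : cprod (fun j => (f j / g j)%C) m = (cprod f m / cprod g m)%C.
Proof.
  induction m as [|m IH]; [|rewrite !Cprod_S, IH; unfold Cdiv; rewrite Cinv_mult; ring].
  change (RtoC 1 = 1 / 1)%C. field.
Qed.

Lemma cs_div b (x : C) : cs b x = ((if b then x else 1) / (if b then 1 else x))%C.
Proof. destruct b; simpl; [field|unfold Cdiv; ring]. Qed.

Lemma cprod_eq_0 (f : nat -> C) m : cprod f m = 0%C -> exists j, (1 <= j <= m)%nat /\ f j = 0%C.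
Proof.
  intros E. induction m as [|m IH]; [exfalso; exact (C1_nz E)|]. rewrite Cprod_S in E.
  destruct (Ceq_dec (f (S m)) 0) as [E1|E1]; [exists (S m); split; [lia|exact E1]|].
  destruct (Ceq_dec (cprod f m) 0) as [E2|E2]; [destruct (IH E2) as [j [Hj Q]]; exists j; split; [lia|exact Q]|]. exfalso. exact (Cmult_neq_0 _ _ E2 E1 E).
Qed.

(** * Local nature of derivatives and their form in the statement *)

Lemma cdiff_local (f g : C -> C) z l s : 0 < s -> (forall u, Cmod (u - z) < s -> f u = g u) -> cdiff ctrue f z l -> cdiff ctrue g z l.
Proof.
  intros Hs E Hf e He. destruct (Hf e He) as [t [Ht Q]]. exists (Rmin t s). split; [apply Rmin_pos; auto|]. intros y _ Hy.
  rewrite <- (E y), <- (E z); [apply Q; [exact I|]| |].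
  - exact (Rlt_le_trans _ _ _ Hy (Rmin_l _ _)).
  - replace (z - z)%C with (RtoC 0) by ring. rewrite Cmod_0. exact Hs.
  - exact (Rlt_le_trans _ _ _ Hy (Rmin_r _ _)).
Qed.

Lemma cdiff_unique (f : C -> C) z l m : cdiff ctrue f z l -> cdiff ctrue f z m -> l = m.
Proof.
  intros Hl Hm. apply C_eq_of_small. intros e He. destruct (Hl (e / 2) ltac:(lra)) as [s [Hs Q]]. destruct (Hm (e / 2) ltac:(lra)) as [t [Ht T]].
  set (h := Rmin s t / 2). assert (h0 : 0 < h) by (unfold h; generalize (Rmin_pos s t Hs Ht); lra). assert (hs : h < s) by (unfold h; generalize (Rmin_l s t) (Rmin_pos s t Hs Ht); lra).
  assert (ht : h < t) by (unfold h; generalize (Rmin_r s t) (Rmin_pos s t Hs Ht); lra).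
  assert (Ey : (z + h - z)%C = RtoC h) by ring. assert (Eh : Cmod (RtoC h) = h) by (apply Cmod_RtoC_pos; lra).
  specialize (Q (z + h)%C I). specialize (T (z + h)%C I). rewrite Ey, Eh in Q, T. specialize (Q hs). specialize (T ht).
  assert (A : Cmod ((l - m) * h) <= e * h).
  { replace ((l - m) * h)%C with ((f (z + h) - f z - m * h) - (f (z + h) - f z - l * h))%C by ring. eapply Rle_trans; [apply Cmod_sub_le; [exact T|exact Q]|]. lra. }
  rewrite Cmod_mult, Eh in A. apply (Rmult_le_reg_r h); assumption.
Qed.

Lemma Cderiv_cdiff (g : C -> C) (z l : C) : Cderiv g z l <-> cdiff ctrue g z l.
Proof.
  assert (K : forall h : C, h <> 0%C -> Cnorm (Csub (Defs.Cdiv (Csub (g (Cadd z h)) (g z)) h) l) = Cmod (g (z + h)%C - g z - l * h) / Cmod h).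
  { intros h Hh. rewrite Defs_Cdiv. change (Cnorm ((g (z + h)%C - g z) / h - l)%C = Cmod (g (z + h)%C - g z - l * h) / Cmod h). rewrite Cnorm_Cmod, <- Cmod_div by exact Hh.
    f_equal. set (gz := (g (z + h)%C - g z)%C). field. exact Hh. }
  split; intros Hd e He.
  - destruct (Hd e He) as [s [Hs T]]. exists s. split; [exact Hs|]. intros y _ Hy. set (h := (y - z)%C) in *. assert (Ey : y = (z + h)%C) by (unfold h; ring).
    destruct (Ceq_dec h 0) as [E|E].
    + rewrite Ey, E. replace (z + 0)%C with z by ring. replace (g z - g z - l * 0)%C with (RtoC 0) by ring. rewrite Cmod_0. lra.
    + assert (h0 : 0 < Cmod h) by (apply Cmod_gt_0, E). specialize (T h). rewrite Cnorm_Cmod, K in T by exact E. specialize (T (conj h0 Hy)). rewrite Ey.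
      apply Rlt_div_l in T; [lra|exact h0].
  - destruct (Hd (e / 2) ltac:(lra)) as [s [Hs T]]. exists s. split; [exact Hs|]. refine (fun (h : C) Hh => _). rewrite Cnorm_Cmod in Hh. assert (E : h <> 0%C) by (apply Cmod_pos_neq; lra).
    rewrite K by exact E. specialize (T (z + h)%C I). replace (z + h - z)%C with (h : C) in T by ring. apply Rlt_div_l; [lra|]. nra.
Qed.

Lemma cantor_circles_iff (K K' : Chat -> Prop) : (forall p, K p <-> K' p) -> cantor_set_of_circles K -> cantor_set_of_circles K'.
Proof.
  intros E [f [g [A1 [A2 [A3 [A4 [A5 A6]]]]]]]. exists f, g. repeat split.
  - apply A1, E, H.
  - apply A1, E, H.
  - intros x Hx. apply E, A2, Hx.
  - intros p Hp. apply A3, E, Hp.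
  - exact A4.
  - intros p Hp e He. destruct (A5 p (proj2 (E p) Hp) e He) as [s [Hs T]]. exists s. split; [exact Hs|]. intros p' Hp'. apply T, E, Hp'.
  - exact A6.
Qed.

(** * Annuli between consecutive circles of zeros and poles *)

(** The logarithm of [d_1 dm ^ 2], the modulus that the dominating monomials take on the circles of
    poles; on the circles of zeros the modulus is smaller by the factor [s], see [lam_circle]. *)
Definition Lc (d : nat -> nat) (dm : nat) : R := ln (INR (d 1%nat)) + ln (INR dm ^ 2).
Definition LK (d : nat -> nat) (dm : nat) (l del : R) : R := Lc d dm + l + ln 4 - ln del.

(* [l] stands for [ln s], [al j] for a logarithm of [a j], and [exp (LK d dm l del)] for the radius of the inner disc. *)
Record setup (n : nat) (d : nat -> nat) (a al : nat -> C) (dm : nat) (l del : R) : Prop := {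
  su_n : (2 <= n)%nat;
  su_d : forall i, (1 <= i <= n)%nat -> (2 <= d i <= dm)%nat;
  su_dm : (3 <= dm)%nat;
  su_al : forall j, (1 <= j <= n - 1)%nat -> cexp (al j) = a j;
  su_1 : INR (d 1%nat) * fst (al 1%nat) = ln (INR dm ^ 2) + l;
  su_i : forall i, (2 <= i <= n - 1)%nat -> INR (d i) * fst (al i) = l + INR (d i) * fst (al (i - 1)%nat);
  su_del : 0 < del;
  su_del1 : 1000 * INR n * INR dm ^ 3 * del <= 1;
  su_l : l <= INR dm * ln del;
  su_s1 : fst (al 1%nat) <= ln del;
  su_4 : LK d dm l del <= ln del + fst (al (n - 1)%nat) + l / INR (d n);
  su_LK : LK d dm l del <= ln del
}.
Arguments su_n {n d a al dm l del}. Arguments su_d {n d a al dm l del}. Arguments su_dm {n d a al dm l del}. Arguments su_al {n d a al dm l del}.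
Arguments su_1 {n d a al dm l del}. Arguments su_i {n d a al dm l del}. Arguments su_del {n d a al dm l del}. Arguments su_del1 {n d a al dm l del}.
Arguments su_l {n d a al dm l del}. Arguments su_s1 {n d a al dm l del}. Arguments su_4 {n d a al dm l del}. Arguments su_LK {n d a al dm l del}.

Lemma exp_le (x y : R) : x <= y -> exp x <= exp y.
Proof. intros [H|H]; [left; apply exp_increasing, H|rewrite H; lra]. Qed.

(* [M] is the width of the basin at the parabolic point, [/ M5] the size of the neighbourhood of that point
   on which the asymptotic expansions are used. *)
Record regime (n : nat) (d : nat -> nat) (a : nat -> C) (dm : nat) (del M M5 eps : R) : Prop := {
  rg_M : 400 <= M;
  rg_M5 : 5 * (M + 1) <= M5;
  rg_basin : forall w C0 r, pert eps w C0 r -> w <> 1%C -> 3 / 5 <= phi M (/ (1 - w)) ->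
    (r - Qw (d 1%nat) w <> 0)%C /\ phi M (/ (1 - w)) + / 4 <= phi M ((r + C0 * Qw (d 1%nat) w) / (r - Qw (d 1%nat) w));
  rg_asym : forall w C0 r, pert eps w C0 r -> w <> 1%C -> Cmod (1 - w) <= / M5 ->
    (r - Qw (d 1%nat) w <> 0)%C /\
    Cmod ((r + C0 * Qw (d 1%nat) w) / (r - Qw (d 1%nat) w) - / (1 - w) - ((INR (d 1%nat) - 1) / 2)%R) <= / 10;
  rg_near : forall w C0 r th, pert eps w C0 r -> Cmod (th - C0) <= eps * Cmod (1 - w) -> Cmod (1 - w) <= / M5 ->
    fst (1 - w)%C <= - (Cmod (1 - w) / 3) ->
    1 + Cmod (1 - w) / 8 <= Cmod (r / (r + C0 * Qw (d 1%nat) w) * (INR (d 1%nat) + th - (INR (d 1%nat) - 1)%R / Qw (d 1%nat) w));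
  rg_pert : forall w, Cmod (1 - w) <= 2 -> pert eps w (Cn n d a) (rw n d a w) /\
    Cmod (thw n d a w - Cn n d a) <= eps * Cmod (1 - w) /\ (forall j, (1 <= j <= n - 1)%nat -> Cmod ((a j * w) ^ DD d j) <= / 2);
  rg_c : 40 * INR (d 1%nat) * (20 * INR n * INR dm * del) * (64 * (M5 + INR (d 1%nat)) ^ 2) <= 1
}.
Arguments rg_M {n d a dm del M M5 eps}. Arguments rg_M5 {n d a dm del M M5 eps}.
Arguments rg_basin {n d a dm del M M5 eps}. Arguments rg_asym {n d a dm del M M5 eps}. Arguments rg_near {n d a dm del M M5 eps}.
Arguments rg_pert {n d a dm del M M5 eps}. Arguments rg_c {n d a dm del M M5 eps}.

Section Dynamics.
Variables (n : nat) (d : nat -> nat) (a al : nat -> C) (dm : nat) (l del : R).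
Hypothesis H : setup n d a al dm l del.

Notation sg j := (fst (al j)).
Let D1 := INR (d 1%nat).
Let C0 : C := Cn n d a.
(** Bounds the relative error of the perturbing factor and its logarithmic derivative on the
    outermost annulus, see [outer_ring]. *)
Let e1 := 20 * INR n * INR dm * del.

Lemma dm_ge : 3 <= INR dm.
Proof. replace 3 with (INR 3) by (simpl; ring). apply le_INR, (su_dm H). Qed.

Lemma n_ge : 2 <= INR n.
Proof. apply (le_INR 2). apply (su_n H). Qed.

Lemma d_bounds i : (1 <= i <= n)%nat -> 2 <= INR (d i) <= INR dm.
Proof. intros Hi. destruct (su_d H i Hi) as [A B]. apply le_INR in A. apply le_INR in B. simpl in A. lra. Qed.

Lemma DD_bounds i : (1 <= i <= n - 1)%nat -> 4 <= INR (DD d i) <= 2 * INR dm.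
Proof. intros Hi. unfold DD. rewrite plus_INR. generalize (d_bounds i ltac:(lia)) (d_bounds (S i) ltac:(generalize (su_n H); lia)). lra. Qed.

Lemma del_small : INR n * INR dm * del <= / 9000 /\ INR n * del <= / 27000 /\ INR dm * del <= / 18000 /\ del <= / 54000 /\ INR n * INR dm ^ 2 * del <= / 3000 /\ INR n * INR dm ^ 3 * del <= / 1000.
Proof.
  assert (A := su_del1 H). assert (N := n_ge). assert (M := dm_ge).
  set (N0 := INR n) in *. set (M0 := INR dm) in *.
  assert (B : N0 * M0 ^ 3 * del <= / 1000) by lra.
  assert (B2 : N0 * M0 ^ 2 * del <= / 3000).
  { replace (N0 * M0 ^ 3 * del) with (M0 * (N0 * M0 ^ 2 * del)) in B by ring. nra. }
  assert (B1 : N0 * M0 * del <= / 9000).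
  { replace (N0 * M0 ^ 2 * del) with (M0 * (N0 * M0 * del)) in B2 by ring. nra. }
  assert (B0 : N0 * del <= / 27000).
  { replace (N0 * M0 * del) with (M0 * (N0 * del)) in B1 by ring. nra. }
  repeat split; try assumption.
  - replace (N0 * M0 * del) with (N0 * (M0 * del)) in B1 by ring. nra.
  - nra.
Qed.

Lemma ln_del_neg : ln del <= - ln 4 - 4.
Proof.
  assert (P := su_del H). destruct del_small as [_ [_ [_ [B _]]]].
  assert (E : ln (/ 54000) <= - ln 4 - 4).
  { replace (- ln 4 - 4) with (ln (/ 4 * exp (- 4))).
    - apply ln_le; [lra|]. replace (exp (- 4)) with (/ (exp 1 * exp 1 * exp 1 * exp 1)) by (rewrite <- !exp_plus, <- exp_Ropp; f_equal; ring).
      assert (Q := exp_le_3). assert (Q1 := exp_pos 1). assert (exp 1 * exp 1 * exp 1 * exp 1 <= 81) by (assert (exp 1 * exp 1 <= 9) by nra; nra).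
      apply Rle_trans with (/ 4 * / 81); [lra|]. apply Rmult_le_compat_l; [lra|]. apply Rinv_le_contravar; [|lra]. repeat apply Rmult_lt_0_compat; exact Q1.
    - rewrite ln_mult, ln_exp, ln_Rinv by (try apply exp_pos; lra). ring. }
  eapply Rle_trans; [|exact E]. apply ln_le; lra.
Qed.

Lemma ln_pos_facts : 0 < ln 2 /\ ln 4 = 2 * ln 2 /\ ln 2 <= 1.
Proof.
  assert (A : 0 < ln 2) by (rewrite <- ln_1; apply ln_increasing; lra). split; [exact A|]. split.
  - replace 4 with (2 * 2) by ring. rewrite ln_mult by lra. ring.
  - rewrite <- (ln_exp 1). apply ln_le; [lra|]. generalize (exp_ineq1 1 ltac:(lra)). lra.
Qed.

Lemma Lc_pos : exp (Lc d dm) = D1 * INR dm ^ 2 /\ 18 <= exp (Lc d dm) /\ 0 < Lc d dm.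
Proof.
  assert (A := d_bounds 1 ltac:(generalize (su_n H); lia)). assert (M := dm_ge). fold D1 in A.
  assert (E : exp (Lc d dm) = D1 * INR dm ^ 2). { unfold Lc. rewrite exp_plus, !exp_ln; [reflexivity|nra|fold D1; lra]. }
  assert (18 <= D1 * INR dm ^ 2) by (assert (9 <= INR dm ^ 2) by nra; nra).
  split; [exact E|]. rewrite E. split; [lra|]. apply exp_lt_inv. rewrite exp_0, E. lra.
Qed.

Lemma gap i : (2 <= i <= n - 1)%nat -> sg i <= sg (i - 1)%nat + ln del.
Proof.
  intros Hi. assert (A := su_i H i Hi). assert (B := d_bounds i ltac:(lia)). assert (L := su_l H). assert (N := ln_del_neg). assert (P := ln_pos_facts).
  assert (INR dm * ln del <= INR (d i) * ln del) by nra.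
  apply (Rmult_le_reg_l (INR (d i))); [lra|]. lra.
Qed.

Lemma gaps i j : (1 <= i)%nat -> (i < j)%nat -> (j <= n - 1)%nat -> sg j <= sg i + ln del.
Proof.
  intros Hi Hij Hj. induction j as [|j IH]; [lia|]. assert (Gf := gap (S j) ltac:(lia)). replace (S j - 1)%nat with j in Gf by lia.
  destruct (Nat.eq_dec i j) as [->|Hne]; [exact Gf|]. specialize (IH ltac:(lia) ltac:(lia)). generalize ln_del_neg ln_pos_facts. lra.
Qed.

Lemma sg_le j : (1 <= j <= n - 1)%nat -> sg j <= ln del.
Proof.
  intros Hj. assert (A := su_s1 H). destruct (Nat.eq_dec j 1) as [->|Hne]; [exact A|].
  generalize (gaps 1 j ltac:(lia) ltac:(lia) ltac:(lia)) ln_del_neg ln_pos_facts. lra.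
Qed.

Lemma a_neq_0 j : (1 <= j <= n - 1)%nat -> a j <> 0%C.
Proof. intros Hj. rewrite <- (su_al H j Hj). apply cexp_neq_0. Qed.

Lemma Cmod_aD j : (1 <= j <= n - 1)%nat -> Cmod (a j ^ DD d j) = exp (INR (DD d j) * sg j).
Proof.
  intros Hj. rewrite <- (su_al H j Hj), <- cexp_nat, Cmod_cexp. f_equal. simpl. unfold sg. ring.
Qed.

(** Splitting [D_j = d_j + d_(j+1)], the power [d_j] contributes at most [dm ^ 2 s] and the power
    [d_(j+1) >= 2] at most [del ^ 2]. *)
Lemma aD_small j : (1 <= j <= n - 1)%nat -> Cmod (a j ^ DD d j) <= del /\ Cmod (a j ^ DD d j) <= INR dm ^ 2 * del * del * exp l.
Proof.
  intros Hj. rewrite Cmod_aD by exact Hj. assert (B := DD_bounds j Hj). assert (Sj := sg_le j Hj). assert (N := ln_del_neg). assert (P := ln_pos_facts).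
  assert (d0 := su_del H). split.
  - apply Rle_trans with (exp (ln del)); [apply exp_le; nra|rewrite exp_ln; lra].
  - replace (INR dm ^ 2 * del * del * exp l) with (exp (ln (INR dm ^ 2) + l + 2 * ln del)).
    2: { replace (2 * ln del) with (ln del + ln del) by ring. rewrite !exp_plus, !exp_ln by nra. ring. }
    apply exp_le. unfold DD. rewrite plus_INR. assert (Bj := d_bounds (S j) ltac:(lia)).
    assert (INR (d (S j)) * sg j <= 2 * ln del) by nra.
    destruct (Nat.eq_dec j 1) as [->|Hne].
    + assert (E := su_1 H). lra.
    + assert (E := su_i H j ltac:(lia)). assert (S2 := sg_le (j - 1)%nat ltac:(lia)). assert (Bd := d_bounds j ltac:(lia)).
      assert (INR (d j) * sg (j - 1)%nat <= 0) by nra.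
      assert (0 <= ln (INR dm ^ 2)). { rewrite <- ln_1. apply ln_le; nra. } lra.
Qed.

Definition rho : R := exp (LK d dm l del).

Lemma rho_facts : 0 < rho /\ rho <= del /\ rho * del = 4 * (D1 * INR dm ^ 2) * exp l.
Proof.
  assert (d0 := su_del H). unfold rho. split; [apply exp_pos|]. split.
  - apply Rle_trans with (exp (ln del)); [apply exp_le, (su_LK H)|rewrite exp_ln; lra].
  - unfold LK. unfold Rminus. rewrite !exp_plus, exp_Ropp, !exp_ln by lra. destruct Lc_pos as [E _]. rewrite E. field. lra.
Qed.

(** The bound relative to [rho] matters because [C0] is subtracted from values whose modulus is only
    about [rho], near the inner boundary of the target annulus. *)
Lemma C0_small : Cmod C0 <= del * rho /\ Cmod C0 <= del.
Proof.
  destruct rho_facts as [R1 [R2 R3]]. destruct del_small as [S1 [S2 [S3 [S4 _]]]].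
  assert (A : Cmod C0 <= del * rho).
  { unfold C0. rewrite Cn_csumf. assert (el := exp_pos l). assert (M := dm_ge).
    set (be := INR dm ^ 2 * del * del * exp l).
    assert (be0 : 0 <= be) by (unfold be; repeat apply Rmult_le_pos; nra).
    assert (T := csumf_split (fun j => (bsg (sgn j) * (INR (DD d j) * (a j ^ DD d j / (1 - a j ^ DD d j))))%C) 0 (n - 1) (4 * INR dm * be)).
    simpl andb in T. cbv iota in T.
    assert (T' : Cmod (csumf (fun j => (bsg (sgn j) * (INR (DD d j) * (a j ^ DD d j / (1 - a j ^ DD d j))))%C) (n - 1) - 0) <= INR (n - 1) * (4 * INR dm * be)).
    { apply T; [nra|]. intros j Hj _. destruct (aD_small j Hj) as [B1 B2]. assert (DB := DD_bounds j Hj).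
      assert (Sg : Cmod (RtoC (bsg (sgn j))) = 1). { unfold bsg. rewrite Cmod_R. destruct (sgn j); [apply Rabs_R1|]. unfold Rabs. destruct Rcase_abs; lra. }
      apply Rle_trans with (1 * (2 * INR dm * (be / / 2))); [|right; field].
      apply Cmod_mult_le; [lra|]. apply Cmod_mult_le; [rewrite Cmod_INR; lra|]. apply Cmod_div_le; [exact B2|].
      split; [lra|]. generalize (Cmod_sub_ge 1 (a j ^ DD d j)). rewrite Cmod_1. lra. }
    replace (csumf (fun j => (bsg (sgn j) * (INR (DD d j) * (a j ^ DD d j / (1 - a j ^ DD d j))))%C) (n - 1) - 0)%C with (csumf (fun j => (bsg (sgn j) * (INR (DD d j) * (a j ^ DD d j / (1 - a j ^ DD d j))))%C) (n - 1)) in T' by ring.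
    eapply Rle_trans; [exact T'|]. rewrite (Rmult_comm del), R3.
    assert (Nn : INR (n - 1) <= INR n) by (apply le_INR; lia).
    assert (DB1 := d_bounds 1 ltac:(generalize (su_n H); lia)). fold D1 in DB1.
    apply Rle_trans with (INR n * (4 * INR dm * be)); [apply Rmult_le_compat_r; nra|].
    unfold be. replace (INR n * (4 * INR dm * (INR dm ^ 2 * del * del * exp l))) with (4 * (INR n * INR dm * del) * del * (INR dm ^ 2 * exp l)) by ring.
    replace (4 * (D1 * INR dm ^ 2) * exp l) with (4 * D1 * (INR dm ^ 2 * exp l)) by ring.
    apply Rmult_le_compat_r; [apply Rmult_le_pos; nra|].
    nra. }
  split; [exact A|]. nra.
Qed.

Lemma one_C0 : (1 + C0 <> 0)%C /\ 99 / 100 <= Cmod (1 + C0) <= 101 / 100.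
Proof.
  destruct C0_small as [_ A]. destruct del_small as [_ [_ [_ [B _]]]].
  assert (Q : 99 / 100 <= Cmod (1 + C0)) by (generalize (Cmod_add_ge 1 C0); rewrite Cmod_1; lra).
  split; [apply Cmod_pos_neq; lra|]. split; [exact Q|]. generalize (Cmod_triangle 1 C0). rewrite Cmod_1. lra.
Qed.

(** The logarithm of the modulus of the dominating monomial of the [i]-th annulus on the circle
    [|z| = exp s], see [Cmod_monomial]. *)
Definition lam (i : nat) (s : R) : R := ln (D1 * Cmod (kk d a i (n - 1))) + eset i d * s.

Lemma kk_step i m : (1 <= i)%nat -> kk d a (S i) m = (kk d a i m * (if (i <=? m)%nat then cs (sgn i) (- a i ^ DD d i) else 1))%C.
Proof.
  intros Hi. unfold kk. induction m as [|m IH].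
  - destruct (Nat.leb_spec i 0); [lia|]. unfold cprod; simpl. change Cx1 with (RtoC 1). ring.
  - rewrite !Cprod_S, IH. destruct (Nat.leb_spec i m); destruct (Nat.leb_spec i (S m)); try lia.
    + destruct (Nat.ltb_spec (S m) (S i)); [lia|]. destruct (Nat.ltb_spec (S m) i); [lia|]. ring.
    + replace (S m) with i by lia. rewrite Nat.ltb_irrefl. destruct (Nat.ltb_spec i (S i)); [|lia]. ring.
    + destruct (Nat.ltb_spec (S m) (S i)); [|lia]. destruct (Nat.ltb_spec (S m) i); [|lia]. ring.
Qed.

Lemma kk_1 m : kk d a 1 m = 1%C.
Proof.
  unfold kk. induction m as [|m IH]; [reflexivity|]. rewrite Cprod_S, IH. destruct (Nat.ltb_spec (S m) 1); [lia|]. ring.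
Qed.

Lemma kk_neq_0 i : kk d a i (n - 1) <> 0%C.
Proof.
  apply Cprod_neq_0. intros j Hj. destruct (j <? i)%nat; [|apply C1_nz]. apply cs_neq_0.
  apply Cmod_pos_neq. rewrite Cmod_opp, Cmod_aD by exact Hj. apply exp_pos.
Qed.

Lemma lam_exp i s : exp (lam i s) = D1 * Cmod (kk d a i (n - 1)) * exp (eset i d * s).
Proof.
  unfold lam. rewrite exp_plus, exp_ln; [reflexivity|]. assert (A := d_bounds 1 ltac:(generalize (su_n H); lia)). fold D1 in A.
  apply Rmult_lt_0_compat; [lra|]. apply Cmod_gt_0, kk_neq_0.
Qed.

Lemma lam_1 s : lam 1 s = ln D1 + D1 * s.
Proof. unfold lam. rewrite kk_1, Cmod_1, Rmult_1_r. unfold eset. simpl. fold D1. ring. Qed.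

Lemma lam_step i s : (1 <= i <= n - 1)%nat -> lam (S i) s = lam i s + bsg (sgn i) * INR (DD d i) * (sg i - s).
Proof.
  intros Hi. unfold lam. rewrite kk_step by lia. destruct (Nat.leb_spec i (n - 1)); [|lia].
  assert (A := d_bounds 1 ltac:(generalize (su_n H); lia)). fold D1 in A.
  assert (K0 : 0 < Cmod (kk d a i (n - 1))) by (apply Cmod_gt_0, kk_neq_0).
  assert (E : Cmod (cs (sgn i) (- a i ^ DD d i)) = exp (bsg (sgn i) * INR (DD d i) * sg i)).
  { assert (N : (- a i ^ DD d i <> 0)%C) by (apply Cmod_pos_neq; rewrite Cmod_opp, Cmod_aD by exact Hi; apply exp_pos).
    rewrite Cmod_cs by exact N. rewrite Cmod_opp, Cmod_aD by exact Hi. unfold bsg. destruct (sgn i); [f_equal; ring|]. rewrite <- exp_Ropp. f_equal. ring. }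
  rewrite Cmod_mult, E, <- Rmult_assoc, ln_mult, ln_exp by (try apply exp_pos; apply Rmult_lt_0_compat; lra).
  assert (S := eset_step i d ltac:(lia)). replace (eset (Datatypes.S i) d) with (eset i d - bsg (sgn i) * INR (DD d i)) by lra. ring.
Qed.

Lemma lam_diff i s t : lam i s - lam i t = bsg (sgn i) * INR (d i) * (s - t).
Proof. unfold lam, eset. ring. Qed.

(** Across the [i]-th annulus the radius changes by the factor [s ^ (1 / d_i)] and the monomial has
    degree [d_i] up to sign, so its modulus changes by [s] and [1 / s] alternately. This is the
    reason for the recursion of the [|a_i|]; the starting value comes from [|a_1|]. *)
Lemma lam_circle i : (1 <= i <= n - 1)%nat -> lam i (sg i) = Lc d dm + (if sgn i then l else 0).
Proof.
  intros Hi. induction i as [|i IH]; [lia|]. destruct (Nat.eq_dec i 0) as [->|Hne].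
  - rewrite lam_1. assert (E := su_1 H). fold D1 in E. rewrite E. unfold Lc, sgn. simpl. fold D1. ring.
  - specialize (IH ltac:(lia)). assert (A := lam_diff (S i) (sg (S i)) (sg i)). rewrite (lam_step i (sg i)) in A by lia.
    assert (E := su_i H (S i) ltac:(lia)). replace (S i - 1)%nat with i in E by lia.
    assert (E2 : INR (d (S i)) * (sg (S i) - sg i) = l) by lra. rewrite (Rmult_assoc (bsg (sgn (S i)))), E2 in A. rewrite sgn_S in * by lia.
    destruct (sgn i); unfold bsg in *; simpl negb in *; cbv iota in *; lra.
Qed.

Lemma lam_circle_S i : (1 <= i <= n - 1)%nat -> lam (S i) (sg i) = Lc d dm + (if sgn i then l else 0).
Proof. intros Hi. rewrite lam_step, <- lam_circle by exact Hi. ring. Qed.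

Definition between (i : nat) (s : R) : Prop := ((i <= n - 1)%nat -> sg i <= s) /\ ((2 <= i)%nat -> s <= sg (i - 1)%nat).

(** Of the two circles bounding the [i]-th annulus one carries poles and the other zeros. The index
    [0] or [n] means that the circle does not exist. *)
Definition pidx (i : nat) : nat := if sgn i then (i - 1)%nat else i.
Definition zidx (i : nat) : nat := if sgn i then i else (i - 1)%nat.

Lemma Cmod_tt i j x : Cmod (tt d al i j x) = if (j <? i)%nat then exp (INR (DD d j) * (fst x - sg j)) else exp (INR (DD d j) * (sg j - fst x)).
Proof. unfold tt. destruct (j <? i)%nat; rewrite Cmod_cexp; f_equal; simpl; unfold sg; ring. Qed.

Lemma tt_far i j x : (1 <= i <= n)%nat -> between i (fst x) -> (1 <= j <= n - 1)%nat -> j <> i -> j <> (i - 1)%nat -> Cmod (tt d al i j x) <= del.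
Proof.
  intros Hi [B1 B2] Hj N1 N2. rewrite Cmod_tt. assert (DB := DD_bounds j Hj). assert (d0 := su_del H). assert (N := ln_del_neg). assert (P := ln_pos_facts).
  apply Rle_trans with (exp (ln del)); [|rewrite exp_ln; lra]. destruct (Nat.ltb_spec j i) as [Hlt|Hge].
  - apply exp_le. assert (Gf := gaps j (i - 1)%nat ltac:(lia) ltac:(lia) ltac:(lia)). specialize (B2 ltac:(lia)). nra.
  - apply exp_le. assert (Gf := gaps i j ltac:(lia) ltac:(lia) ltac:(lia)). specialize (B1 ltac:(lia)). nra.
Qed.

Lemma sgn_pred i : (2 <= i)%nat -> sgn (i - 1)%nat = negb (sgn i).
Proof. intros Hi. replace i with (S (i - 1)) at 2 by lia. rewrite sgn_S, Bool.negb_involutive by lia. reflexivity. Qed.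

(** The exponent [D] of the factor exceeds the degree [d_i] of the monomial, so the modulus of the
    factor is at most the quotient of the monomial by its value on the circle. *)
Lemma tt_pole i x : (1 <= i <= n)%nat -> between i (fst x) -> (1 <= pidx i <= n - 1)%nat -> Cmod (tt d al i (pidx i) x) <= exp (lam i (fst x) - Lc d dm).
Proof.
  intros Hi [B1 B2] Hp. rewrite Cmod_tt. unfold pidx in *. destruct (sgn i) eqn:E.
  - destruct (Nat.ltb_spec (i - 1) i); [|lia]. apply exp_le. specialize (B2 ltac:(lia)).
    assert (A := lam_diff i (fst x) (sg (i - 1)%nat)). assert (A2 := lam_circle_S (i - 1)%nat Hp). replace (S (i - 1)) with i in A2 by lia.
    rewrite sgn_pred, E in A2 by lia. rewrite A2, E in A. simpl in A. assert (Bp := d_bounds (i - 1)%nat ltac:(lia)).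
    unfold DD. rewrite plus_INR. replace (S (i - 1)) with i by lia. nra.
  - destruct (Nat.ltb_spec i i); [lia|]. apply exp_le. specialize (B1 ltac:(lia)).
    assert (A := lam_diff i (fst x) (sg i)). rewrite (lam_circle i) in A by lia. rewrite E in A. simpl in A.
    assert (Bp := d_bounds (S i) ltac:(lia)). unfold DD. rewrite plus_INR. nra.
Qed.

Lemma tt_zero i x : (1 <= i <= n)%nat -> between i (fst x) -> (1 <= zidx i <= n - 1)%nat -> Cmod (tt d al i (zidx i) x) <= exp (Lc d dm + l - lam i (fst x)).
Proof.
  intros Hi [B1 B2] Hp. rewrite Cmod_tt. unfold zidx in *. destruct (sgn i) eqn:E.
  - destruct (Nat.ltb_spec i i); [lia|]. apply exp_le. specialize (B1 ltac:(lia)).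
    assert (A := lam_diff i (fst x) (sg i)). rewrite (lam_circle i) in A by lia. rewrite E in A. simpl in A.
    assert (Bp := d_bounds (S i) ltac:(lia)). unfold DD. rewrite plus_INR. nra.
  - destruct (Nat.ltb_spec (i - 1) i); [|lia]. apply exp_le. specialize (B2 ltac:(lia)).
    assert (A := lam_diff i (fst x) (sg (i - 1)%nat)). assert (A2 := lam_circle_S (i - 1)%nat Hp). replace (S (i - 1)) with i in A2 by lia.
    rewrite sgn_pred, E in A2 by lia. rewrite A2, E in A. simpl in A. assert (Bp := d_bounds (i - 1)%nat ltac:(lia)).
    unfold DD. rewrite plus_INR. replace (S (i - 1)) with i by lia. nra.
Qed.

Lemma idx_cases i j : j = i \/ j = (i - 1)%nat -> j = pidx i \/ j = zidx i.
Proof. clear. unfold pidx, zidx. destruct (sgn i); intros [-> | ->]; auto. Qed.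

Lemma between_exists s : exists i, (1 <= i <= n)%nat /\ between i s.
Proof.
  assert (Hn := su_n H).
  assert (A : forall m, (m <= n - 1)%nat -> (exists i, (1 <= i <= n)%nat /\ between i s) \/ (forall j, (1 <= j <= m)%nat -> s < sg j)).
  { induction m as [|m IH]; intros Hm; [right; intros; lia|]. destruct (IH ltac:(lia)) as [L|R]; [left; exact L|].
    destruct (Rle_lt_dec (sg (S m)) s) as [Q|Q].
    - left. exists (S m). split; [lia|]. split; [auto|]. intros Hm2. replace (S m - 1)%nat with m by lia. left. apply R. lia.
    - right. intros j Hj. destruct (Nat.eq_dec j (S m)) as [->|Hne]; [exact Q|]. apply R. lia. }
  destruct (A (n - 1)%nat (Nat.le_refl _)) as [L|R]; [exact L|]. exists n. split; [lia|]. split; [intros; lia|]. intros _. left. apply R. lia.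
Qed.

Lemma D1_bounds : 2 <= D1 <= INR dm.
Proof. apply d_bounds. generalize (su_n H). lia. Qed.

Lemma e1_small : 0 < e1 <= / 450 /\ 8 * INR n * del <= e1 / 6.
Proof.
  destruct del_small as [A _]. assert (d0 := su_del H). assert (M := dm_ge). assert (N := n_ge).
  unfold e1. split; [split; [repeat apply Rmult_lt_0_compat; lra|lra]|]. assert (0 < INR n * del) by (apply Rmult_lt_0_compat; lra). nra.
Qed.

Lemma four_n_del : 4 * INR (n - 1) * del <= 4 * INR n * del /\ 4 * INR n * del <= / 1000.
Proof.
  destruct del_small as [_ [A _]]. assert (d0 := su_del H). assert (INR (n - 1) <= INR n) by (apply le_INR; lia). split; nra.
Qed.

Lemma NN_near : Cmod (NN d a (n - 1) - 1) <= 4 * INR n * del /\ NN d a (n - 1) <> 0%C.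
Proof.
  destruct four_n_del as [F1 F2]. assert (d0 := su_del H).
  destruct (cprod_split sign_pos (fun j => (a j ^ DD d j)%C) 0 (n - 1) del) as [E [HE Heq]]; [lra|lra|intros j Hj _; apply (aD_small j Hj)|].
  simpl in Heq. assert (EN : NN d a (n - 1) = E) by (unfold NN; rewrite Heq; ring). rewrite EN. split; [lra|].
  apply Cmod_pos_neq. generalize (Cmod_add_ge 1 (E - 1)). rewrite Cmod_1. replace (1 + (E - 1))%C with E by ring. lra.
Qed.

Definition den1 (x : C) : C := (1 + (D1 - 1)%R * cexp (D1 * x))%C.

Lemma den1_near (x : C) : fst x <= ln del -> Cmod (den1 x - 1) <= INR dm * del.
Proof.
  intros Hx. unfold den1. replace (1 + (D1 - 1)%R * cexp (D1 * x) - 1)%C with ((D1 - 1)%R * cexp (D1 * x))%C by ring.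
  assert (B := D1_bounds). assert (d0 := su_del H). assert (N := ln_del_neg). assert (P := ln_pos_facts).
  apply Cmod_mult_le; [rewrite Cmod_RtoC_pos; lra|]. rewrite Cmod_cexp. apply Rle_trans with (exp (ln del)); [|rewrite exp_ln; lra].
  apply exp_le. simpl. nra.
Qed.

Lemma den1_near_lam (x : C) : lam 1 (fst x) <= LK d dm l del - ln 2 -> Cmod (den1 x - 1) <= rho / 2.
Proof.
  intros Hx. unfold den1. replace (1 + (D1 - 1)%R * cexp (D1 * x) - 1)%C with ((D1 - 1)%R * cexp (D1 * x))%C by ring.
  assert (B := D1_bounds). rewrite lam_1 in Hx.
  assert (E := exp_le _ _ Hx). unfold Rminus in E. rewrite !exp_plus, exp_Ropp, !exp_ln in E by lra. fold (rho) in E.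
  rewrite Cmod_mult, Cmod_cexp, Cmod_RtoC_pos by lra. replace (fst (D1 * x)%C) with (D1 * fst x) by (simpl; ring).
  assert (0 < exp (D1 * fst x)) by apply exp_pos. nra.
Qed.

Lemma fst_le_lndel i (x : C) : (2 <= i <= n)%nat -> between i (fst x) -> fst x <= ln del.
Proof.
  intros Hi [_ B2]. specialize (B2 ltac:(lia)). assert (S := sg_le (i - 1)%nat ltac:(lia)). lra.
Qed.

Lemma Cmod_monomial i (x : C) : Cmod (D1 * kk d a i (n - 1) * cexp (eset i d * x)) = exp (lam i (fst x)).
Proof.
  rewrite lam_exp. assert (B := D1_bounds).
  rewrite !Cmod_mult, Cmod_cexp, Cmod_RtoC_pos by lra. do 2 f_equal. simpl. ring.
Qed.

Lemma sgn_pidx i : (1 <= pidx i)%nat -> (1 <= i)%nat -> sgn (pidx i) = false.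
Proof.
  unfold pidx. destruct (sgn i) eqn:E; intros Hp Hi; [|exact E]. rewrite sgn_pred, E by lia. reflexivity.
Qed.

Lemma sgn_zidx i : (1 <= zidx i)%nat -> (1 <= i)%nat -> sgn (zidx i) = true.
Proof.
  unfold zidx. destruct (sgn i) eqn:E; intros Hp Hi; [exact E|]. rewrite sgn_pred, E by lia. reflexivity.
Qed.

Lemma Lcl : Lc d dm + l <= 2 * ln del - ln 4 /\ 2 * ln del - ln 4 <= ln del - 4.
Proof. assert (A := su_LK H). unfold LK in A. assert (N := ln_del_neg). assert (P := ln_pos_facts). lra. Qed.

Lemma exp_le_del t : t <= ln del -> exp t <= del.
Proof. intros Ht. assert (d0 := su_del H). rewrite <- (exp_ln del) by exact d0. apply exp_le. exact Ht. Qed.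

Lemma tt_nonpole_small i j (x : C) : (1 <= i <= n)%nat -> between i (fst x) -> Lc d dm + l - ln del <= lam i (fst x) ->
  (1 <= j <= n - 1)%nat -> j <> pidx i -> Cmod (tt d al i j x) <= del.
Proof.
  intros Hi Hb Hl Hj Hp.
  destruct (Nat.eq_dec j (zidx i)) as [->|Hz].
  - eapply Rle_trans; [apply tt_zero; auto|]. apply exp_le_del. lra.
  - assert (N1 : j <> i). { intros E. destruct (idx_cases i j (or_introl E)); auto. }
    assert (N2 : j <> (i - 1)%nat). { intros E. destruct (idx_cases i j (or_intror E)); auto. }
    apply tt_far; auto.
Qed.

Lemma tt_nonzero_small i j (x : C) : (1 <= i <= n)%nat -> between i (fst x) -> lam i (fst x) <= Lc d dm + ln del ->
  (1 <= j <= n - 1)%nat -> j <> zidx i -> Cmod (tt d al i j x) <= del.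
Proof.
  intros Hi Hb Hl Hj Hp.
  destruct (Nat.eq_dec j (pidx i)) as [->|Hz].
  - eapply Rle_trans; [apply tt_pole; auto|]. apply exp_le_del. lra.
  - assert (N1 : j <> i). { intros E. destruct (idx_cases i j (or_introl E)); auto. }
    assert (N2 : j <> (i - 1)%nat). { intros E. destruct (idx_cases i j (or_intror E)); auto. }
    apply tt_far; auto.
Qed.

Lemma Cmod_near_1 (z : C) e : Cmod (z - 1) <= e -> 1 - e <= Cmod z <= 1 + e.
Proof.
  intros Hz. split.
  - generalize (Cmod_add_ge 1 (z - 1)). rewrite Cmod_1. replace (1 + (z - 1))%C with z by ring. lra.
  - replace z with (1 + (z - 1))%C at 1 by ring. eapply Rle_trans; [apply Cmod_triangle|]. rewrite Cmod_1. lra.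
Qed.

(** * Where an annulus is mapped outside the target annulus *)

Lemma yprime_abs i (x : C) : (1 <= i <= n)%nat -> den1 x <> 0%C ->
  Cmod (yprime n d a (cexp x)) = Cmod (NN d a (n - 1)) * exp (lam i (fst x)) * Cmod (sprod d al i (n - 1) x) / Cmod (den1 x).
Proof.
  intros Hi Hd. destruct one_C0 as [N0 _]. rewrite (yprime_region n d a al (su_n H) (su_al H) i x N0 Hi).
  fold D1. rewrite Cmod_div by exact Hd. rewrite <- (Cmod_monomial i x). rewrite <- !Cmod_mult. do 2 f_equal. ring.
Qed.

Lemma Pformula_abs z : let y := (Pformula n d a z : C) in
  Cmod (yprime n d a z) * (99 / 100) - del <= Cmod y /\ Cmod y <= (Cmod (yprime n d a z) + del * rho) * (102 / 100).
Proof.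
  intros y. destruct one_C0 as [N0 [B1 B2]]. destruct C0_small as [S1 S2].
  assert (E : y = ((yprime n d a z + C0) / (1 + C0))%C) by (apply Pformula_of_yprime; exact N0).
  rewrite E, Cmod_div by exact N0. set (Y := yprime n d a z).
  assert (A := Cmod_add_ge Y (C0)). assert (B := Cmod_triangle Y (C0)). assert (Y0 := Cmod_ge_0 Y).
  split.
  - apply (Rmult_le_reg_r (Cmod (1 + C0))); [lra|]. unfold Rdiv. rewrite (Rmult_assoc (Cmod (Y + C0))), Rinv_l, Rmult_1_r by lra.
    destruct rho_facts as [R1 [R2 _]]. destruct del_small as [_ [_ [_ [S4 _]]]].
    assert (Cmod Y * (99 / 100) * Cmod (1 + C0) <= Cmod Y * 1) by nra. assert (del * (99 / 100) <= del * Cmod (1 + C0)) by (apply Rmult_le_compat_l; lra).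
    assert (del * rho <= del * (1 / 100)) by (apply Rmult_le_compat_l; lra). lra.
  - apply (Rmult_le_reg_r (Cmod (1 + C0))); [lra|]. unfold Rdiv. rewrite (Rmult_assoc (Cmod (Y + C0))), Rinv_l, Rmult_1_r by lra.
    nra.
Qed.

(** Let [t] be the modulus of the monomial and [c >= 18] its value on the circle of poles. The
    factor of that circle leaves at least [t / (1 + t / c) = 1 / (1 / t + 1 / c) >= 9 / 5] when
    [t >= 2]. The final [8 / 5] exceeds the radius [3 / 2] that contains [outer]. *)
Lemma zone_pole i (x : C) : (2 <= i <= n)%nat -> between i (fst x) -> ln 2 <= lam i (fst x) ->
  ((1 <= pidx i <= n - 1)%nat -> (1 - tt d al i (pidx i) x <> 0)%C) -> 8 / 5 <= Cmod (Pformula n d a (cexp x)).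
Proof.
  intros Hi Hb Hl Hnp. destruct four_n_del as [F1 F2]. assert (d0 := su_del H). destruct NN_near as [N1 N2].
  destruct del_small as [S1 [S2 [S3 [S4 _]]]]. assert (P := ln_pos_facts). destruct Lcl as [L1 L2].
  destruct (Cmod_near_1 _ _ (den1_near x (fst_le_lndel i x Hi Hb))) as [Q1 Q2].
  assert (Nd : den1 x <> 0%C) by (apply Cmod_pos_neq; lra).
  destruct (cprod_split sgn (fun j => tt d al i j x) (pidx i) (n - 1) del) as [E [HE Heq]]; [lra|lra|intros j Hj Hp; apply tt_nonpole_small; auto; [lia|lra]|].
  assert (Hs : sprod d al i (n - 1) x = (E * (if andb (1 <=? pidx i)%nat (pidx i <=? n - 1)%nat then cs (sgn (pidx i)) (1 - tt d al i (pidx i) x) else 1))%C) by exact Heq.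
  destruct (Cmod_near_1 _ _ HE) as [E1 E2]. destruct (Cmod_near_1 _ _ N1) as [M1 M2].
  set (t := exp (lam i (fst x))). assert (Ht : 2 <= t). { unfold t. rewrite <- (exp_ln 2) at 1 by lra. apply exp_le. exact Hl. }
  destruct Lc_pos as [_ [Lc1 _]]. set (c := exp (Lc d dm)) in *.
  assert (Fac : / (1 + t / c) <= Cmod (if andb (1 <=? pidx i)%nat (pidx i <=? n - 1)%nat then cs (sgn (pidx i)) (1 - tt d al i (pidx i) x) else 1%C)).
  { assert (tc : 0 < t / c) by (apply Rdiv_lt_0_compat; lra).
    destruct (Nat.leb_spec 1 (pidx i)); destruct (Nat.leb_spec (pidx i) (n - 1)); simpl;
      try (rewrite Cmod_1, <- Rinv_1; apply Rinv_le_contravar; lra).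
    rewrite sgn_pidx by lia. simpl. rewrite Cmod_inv by (apply Hnp; lia). apply Rinv_le_contravar; [apply Cmod_gt_0, Hnp; lia|].
    eapply Rle_trans; [apply Cmod_tri_sub|]. rewrite Cmod_1. apply Rplus_le_compat_l.
    eapply Rle_trans; [apply tt_pole; auto; lia|]. unfold Rminus. rewrite exp_plus, exp_Ropp. fold t c. unfold Rdiv. lra. }
  assert (Val : 9 / 5 <= t * / (1 + t / c)).
  { replace (t * / (1 + t / c)) with (/ (/ t + / c)) by (field; repeat split; nra). replace (9 / 5) with (/ (/ 2 + / 18)) by field.
    apply Rinv_le_contravar; [assert (0 < / t) by (apply Rinv_0_lt_compat; lra); assert (0 < / c) by (apply Rinv_0_lt_compat; lra); lra|].
    assert (/ t <= / 2) by (apply Rinv_le_contravar; lra). assert (/ c <= / 18) by (apply Rinv_le_contravar; lra). lra. }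
  assert (Y : 17 / 10 <= Cmod (yprime n d a (cexp x))).
  { rewrite (yprime_abs i x ltac:(lia) Nd). fold t. rewrite Hs, Cmod_mult.
    set (F := Cmod (if andb (1 <=? pidx i)%nat (pidx i <=? n - 1)%nat then cs (sgn (pidx i)) (1 - tt d al i (pidx i) x) else 1%C)) in *.
    assert (tF : 9 / 5 <= t * F) by (eapply Rle_trans; [exact Val|]; apply Rmult_le_compat_l; lra).
    apply (Rle_div_r (17 / 10)); [lra|].
    replace (Cmod (NN d a (n - 1)) * t * (Cmod E * F)) with (Cmod (NN d a (n - 1)) * Cmod E * (t * F)) by ring.
    assert (998 / 1000 <= Cmod (NN d a (n - 1)) * Cmod E) by nra.
    assert (998 / 1000 * (9 / 5) <= Cmod (NN d a (n - 1)) * Cmod E * (t * F)) by (apply Rmult_le_compat; lra). lra. }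
  destruct (Pformula_abs (cexp x)) as [Z _]. lra.
Qed.

(** The circle of zeros can at most replace the modulus [t] of the monomial by [t + v], where [v] is
    its value on that circle; here [t <= rho / 2] and [v <= del rho]. *)
Lemma zone_zero i (x : C) : (1 <= i <= n)%nat -> between i (fst x) -> lam i (fst x) <= LK d dm l del - ln 2 ->
  den1 x <> 0%C /\ (forall j, (1 <= j <= n - 1)%nat -> sgn j = false -> (1 - tt d al i j x <> 0)%C) /\
  Cmod (yprime n d a (cexp x)) <= 2 * (exp (lam i (fst x)) + exp (Lc d dm + l)) /\
  Cmod (Pformula n d a (cexp x)) <= 7 / 10 * rho.
Proof.
  intros Hi Hb Hl. destruct four_n_del as [F1 F2]. assert (d0 := su_del H). destruct NN_near as [N1 N2].
  destruct del_small as [S1 [S2 [S3 [S4 _]]]]. assert (P := ln_pos_facts). destruct Lcl as [L1 L2].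
  destruct rho_facts as [R1 [R2 _]].
  assert (Q : Cmod (den1 x - 1) <= / 1000).
  { destruct (Nat.eq_dec i 1) as [->|Hne].
    - eapply Rle_trans; [apply den1_near_lam; exact Hl|]. lra.
    - eapply Rle_trans; [apply den1_near, (fst_le_lndel i); auto; lia|]. lra. }
  destruct (Cmod_near_1 _ _ Q) as [Q1 Q2]. assert (Nd : den1 x <> 0%C) by (apply Cmod_pos_neq; lra). split; [exact Nd|].
  destruct Lc_pos as [_ [_ Lc0]].
  assert (Hsm : lam i (fst x) <= Lc d dm + ln del) by (unfold LK in Hl; lra).
  assert (Hns : forall j, (1 <= j <= n - 1)%nat -> j <> zidx i -> Cmod (tt d al i j x) <= del) by (intros; apply tt_nonzero_small; auto).
  split.
  { intros j Hj Hsj. assert (Hjz : j <> zidx i). { intros E. rewrite E, sgn_zidx in Hsj; [discriminate|lia|lia]. }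
    specialize (Hns j Hj Hjz). apply Cmod_pos_neq. generalize (Cmod_sub_ge 1 (tt d al i j x)). rewrite Cmod_1. lra. }
  destruct (cprod_split sgn (fun j => tt d al i j x) (zidx i) (n - 1) del) as [E [HE Heq]]; [lra|lra|exact Hns|].
  assert (Hs : sprod d al i (n - 1) x = (E * (if andb (1 <=? zidx i)%nat (zidx i <=? n - 1)%nat then cs (sgn (zidx i)) (1 - tt d al i (zidx i) x) else 1))%C) by exact Heq.
  destruct (Cmod_near_1 _ _ HE) as [E1 E2]. destruct (Cmod_near_1 _ _ N1) as [M1 M2].
  set (t := exp (lam i (fst x))) in *. assert (t0 : 0 < t) by apply exp_pos. set (v := exp (Lc d dm + l)) in *. assert (v0 : 0 < v) by apply exp_pos.
  set (F := Cmod (if andb (1 <=? zidx i)%nat (zidx i <=? n - 1)%nat then cs (sgn (zidx i)) (1 - tt d al i (zidx i) x) else 1%C)).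
  assert (Fac : t * F <= t + v).
  { apply Rle_trans with (t * (1 + v / t)); [|right; field; lra]. apply Rmult_le_compat_l; [lra|]. unfold F.
    assert (0 < v / t) by (apply Rdiv_lt_0_compat; lra).
    destruct (Nat.leb_spec 1 (zidx i)); destruct (Nat.leb_spec (zidx i) (n - 1)); simpl; try (rewrite Cmod_1; lra).
    rewrite sgn_zidx by lia. simpl. eapply Rle_trans; [apply Cmod_tri_sub|]. rewrite Cmod_1. apply Rplus_le_compat_l.
    eapply Rle_trans; [apply tt_zero; auto; lia|]. unfold Rminus. rewrite exp_plus, exp_Ropp. fold t v. unfold Rdiv. lra. }
  assert (Y : Cmod (yprime n d a (cexp x)) <= 11 / 10 * (t + v)).
  { rewrite (yprime_abs i x Hi Nd). fold t. rewrite Hs, Cmod_mult. fold F.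
    apply Rle_div_l; [lra|].
    replace (Cmod (NN d a (n - 1)) * t * (Cmod E * F)) with (Cmod (NN d a (n - 1)) * Cmod E * (t * F)) by ring.
    assert (Cmod (NN d a (n - 1)) * Cmod E <= 1005 / 1000) by nra.
    assert (0 <= t * F) by (apply Rmult_le_pos; [lra|apply Cmod_ge_0]).
    nra. }
  split; [lra|].
  assert (tr : t <= rho / 2).
  { unfold t. apply Rle_trans with (exp (LK d dm l del - ln 2)); [apply exp_le; exact Hl|]. unfold Rminus. rewrite exp_plus, exp_Ropp, exp_ln by lra. fold (rho). lra. }
  assert (vr : v <= del * rho).
  { unfold v. replace (del * rho) with (exp (ln del + LK d dm l del)) by (rewrite exp_plus, exp_ln by lra; reflexivity). apply exp_le. unfold LK. lra. }
  destruct (Pformula_abs (cexp x)) as [_ Z]. nra.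
Qed.

(** The part of the [i]-th annulus where the monomial has modulus between [rho / 2] and [2]; outside
    it the zone lemmas put the image off the target annulus. The first annulus has no upper bound
    because the denominator [1 + (d_1 - 1) z ^ d_1] compensates the growth of the monomial. *)
Definition strip (i : nat) (x : C) : Prop := LK d dm l del - ln 2 <= lam i (fst x) /\ (i = 1%nat \/ lam i (fst x) <= ln 2).

Lemma strip_between i (x : C) : (1 <= i <= n)%nat -> strip i x -> between i (fst x).
Proof.
  intros Hi [S1 S2]. assert (P := ln_pos_facts). assert (N := ln_del_neg).
  destruct Lc_pos as [_ [Lc1 Lc0]].
  assert (Lc2 : ln 2 < Lc d dm). { apply exp_lt_inv. rewrite exp_ln; lra. }
  assert (Bd := d_bounds i Hi). unfold LK in S1. split; intros Hj.
  - assert (A := lam_diff i (fst x) (fst (al i))). assert (E := lam_circle i ltac:(lia)). rewrite E in A.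
    destruct (sgn i) eqn:Es; unfold bsg in A.
    + apply Rnot_lt_le. intros Q. assert (INR (d i) * (fst x - fst (al i)) < 0) by nra. lra.
    + destruct S2 as [->|S2]; [discriminate|]. apply Rnot_lt_le. intros Q. assert (0 < INR (d i) * (fst (al i) - fst x)) by nra. lra.
  - assert (A := lam_diff i (fst x) (fst (al (i - 1)%nat))). assert (E := lam_circle_S (i - 1)%nat ltac:(lia)).
    replace (S (i - 1)) with i in E by lia. rewrite E in A. rewrite sgn_pred in A by lia. destruct S2 as [S2|S2]; [lia|].
    destruct (sgn i) eqn:Es; unfold bsg in A; simpl in A.
    + apply Rnot_lt_le. intros Q. assert (0 < INR (d i) * (fst x - fst (al (i - 1)%nat))) by nra. lra.
    + apply Rnot_lt_le. intros Q. assert (0 < INR (d i) * (fst x - fst (al (i - 1)%nat))) by nra. lra.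
Qed.

Lemma strip_tt i j (x : C) : (1 <= i <= n)%nat -> strip i x -> (1 <= j <= n - 1)%nat -> j <> pidx i -> Cmod (tt d al i j x) <= del.
Proof.
  intros Hi Hs Hj Hp. apply tt_nonpole_small; auto; [apply strip_between; auto|]. destruct Hs as [S1 _]. unfold LK in S1. generalize ln_pos_facts. lra.
Qed.

Lemma strip_tt_pole i (x : C) : (2 <= i <= n)%nat -> strip i x -> (1 <= pidx i <= n - 1)%nat -> Cmod (tt d al i (pidx i) x) <= 2 / (D1 * INR dm ^ 2) /\ 2 / (D1 * INR dm ^ 2) <= / 9.
Proof.
  intros Hi Hs Hp. destruct Lc_pos as [EL [Lc1 _]]. rewrite EL in Lc1. split.
  - eapply Rle_trans; [apply tt_pole; [lia|apply strip_between; auto; lia|exact Hp]|].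
    destruct Hs as [_ [S2|S2]]; [lia|]. apply Rle_trans with (exp (ln 2 - Lc d dm)); [apply exp_le; lra|].
    unfold Rminus. rewrite exp_plus, exp_Ropp, exp_ln, EL by lra. unfold Rdiv. lra.
  - replace (/ 9) with (2 / 18) by field. apply Rmult_le_compat_l; [lra|]. apply Rinv_le_contravar; lra.
Qed.

Lemma strip_tt_neq i j (x : C) : (1 <= i <= n)%nat -> strip i x -> (1 <= j <= n - 1)%nat -> Cmod (tt d al i j x) <= / 9 /\ (1 - tt d al i j x <> 0)%C.
Proof.
  intros Hi Hs Hj. destruct del_small as [_ [_ [_ [S4 _]]]].
  assert (A : Cmod (tt d al i j x) <= / 9).
  { destruct (Nat.eq_dec j (pidx i)) as [->|Hp].
    - destruct (Nat.eq_dec i 1) as [->|Hne]; [unfold pidx in Hj; simpl in Hj; lia|]. destruct (strip_tt_pole i x ltac:(lia) Hs Hj). lra.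
    - generalize (strip_tt i j x Hi Hs Hj Hp). lra. }
  split; [exact A|]. apply Cmod_pos_neq. generalize (Cmod_sub_ge 1 (tt d al i j x)). rewrite Cmod_1. lra.
Qed.

Lemma ldl_bound i j (x : C) (t : R) : (1 <= j <= n - 1)%nat -> Cmod (tt d al i j x) <= t -> t <= / 9 -> Cmod (ldl d al i j x) <= 2 * INR dm * (t * (9 / 8)).
Proof.
  intros Hj Ht Ht2. assert (B := DD_bounds j Hj). unfold ldl.
  apply Cmod_mult_le.
  - destruct (j <? i)%nat; rewrite Cmod_R, ?Rabs_Ropp, Rabs_mult, (Rabs_pos_eq (INR (DD d j))) by lra;
      (assert (Rabs (bsg (sgn j)) = 1) as -> by (unfold bsg; destruct (sgn j); unfold Rabs; destruct Rcase_abs; lra)); lra.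
  - replace (t * (9 / 8)) with (t / (8 / 9)) by field. apply Cmod_div_le; [exact Ht|]. split; [lra|]. generalize (Cmod_sub_ge 1 (tt d al i j x)). rewrite Cmod_1. lra.
Qed.

(** The outermost annulus is not bounded by a circle of poles ([pidx 1 = 0]), so no correction
    factor is exceptional and all [tt] are at most [del]. *)
Lemma outer_ring (x : C) : strip 1 x ->
  Cmod (NN d a (n - 1) * sprod d al 1 (n - 1) x - 1) <= e1 /\ Cmod (csumf (fun j => ldl d al 1 j x) (n - 1)) <= e1.
Proof.
  intros Hs. destruct four_n_del as [F1 F2]. assert (d0 := su_del H). destruct NN_near as [N1 N2]. destruct e1_small as [e1s e1b].
  assert (S : forall j, (1 <= j <= n - 1)%nat -> j <> 0%nat -> Cmod (tt d al 1 j x) <= del) by (intros j Hj Hj0; apply strip_tt; auto; lia).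
  destruct del_small as [S1 [S2 [S3 [S4 _]]]].
  split.
  - destruct (cprod_split sgn (fun j => tt d al 1 j x) 0 (n - 1) del) as [E [HE Heq]]; [lra|lra|exact S|].
    simpl in Heq. change (sprod d al 1 (n - 1) x) with (cprod (fun j => cs (sgn j) (1 - tt d al 1 j x)%C) (n - 1)). rewrite Heq, Cmult_1_r.
    replace (NN d a (n - 1) * E - 1)%C with ((NN d a (n - 1) - 1) + NN d a (n - 1) * (E - 1))%C by ring.
    destruct (Cmod_near_1 _ _ N1) as [M1 M2].
    eapply Rle_trans; [apply Cmod_add_le; [exact N1|apply Cmod_mult_le; [exact M2|exact HE]]|].
    assert ((1 + 4 * INR n * del) * (4 * INR (n - 1) * del) <= 2 * (4 * INR n * del)) by (apply Rmult_le_compat; try lra; generalize (pos_INR (n - 1)); nra). lra.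
  - assert (T := csumf_split (fun j => ldl d al 1 j x) 0 (n - 1) (2 * INR dm * (del * (9 / 8)))). simpl andb in T. cbv iota in T.
    replace (csumf (fun j => ldl d al 1 j x) (n - 1) - 0)%C with (csumf (fun j => ldl d al 1 j x) (n - 1)) in T by ring.
    assert (M := dm_ge). eapply Rle_trans; [apply T; [nra|intros j Hj Hj0; apply ldl_bound; [exact Hj|apply S; auto|lra]]|].
    unfold e1. assert (0 < INR dm * del) by nra. assert (0 <= INR (n - 1)) by apply pos_INR. nra.
Qed.

Lemma strip_fst i (x : C) : (2 <= i <= n)%nat -> strip i x -> fst x <= ln del.
Proof. intros Hi Hs. apply (fst_le_lndel i); auto. apply strip_between; auto. lia. Qed.

(** [W2] is the quotient of [yprime] by its dominating monomial, and [Lam] the logarithmic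
    derivative of [yprime] with respect to [log z]. *)
Definition W2 (i : nat) (x : C) : C := (NN d a (n - 1) * sprod d al i (n - 1) x / den1 x)%C.
Definition Lam (i : nat) (x : C) : C :=
  (eset i d + csumf (fun j => ldl d al i j x) (n - 1) - (D1 - 1)%R * D1 * cexp (D1 * x) / den1 x)%C.

Lemma strip_W2 i (x : C) : (2 <= i <= n)%nat -> strip i x -> den1 x <> 0%C /\ Cmod (W2 i x - 1) <= / 7.
Proof.
  intros Hi Hs. destruct four_n_del as [F1 F2]. assert (d0 := su_del H). destruct NN_near as [N1 N2].
  destruct del_small as [S1 [S2 [S3 [S4 _]]]].
  assert (Q := den1_near x (strip_fst i x Hi Hs)). destruct (Cmod_near_1 _ _ Q) as [Q1 Q2].
  assert (Nd : den1 x <> 0%C) by (apply Cmod_pos_neq; lra). split; [exact Nd|].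
  destruct (cprod_split sgn (fun j => tt d al i j x) (pidx i) (n - 1) del) as [E [HE Heq]]; [lra|lra|intros; apply strip_tt; auto; lia|].
  set (f := if andb (1 <=? pidx i)%nat (pidx i <=? n - 1)%nat then cs (sgn (pidx i)) (1 - tt d al i (pidx i) x) else 1%C).
  assert (Hsp : sprod d al i (n - 1) x = (E * f)%C) by exact Heq.
  assert (f1 : Cmod (f - 1) <= / 8).
  { unfold f. destruct (Nat.leb_spec 1 (pidx i)); destruct (Nat.leb_spec (pidx i) (n - 1)); simpl;
      try (replace (1 - 1)%C with (RtoC 0) by ring; rewrite Cmod_0; lra).
    rewrite sgn_pidx by lia. simpl. destruct (strip_tt_neq i (pidx i) x ltac:(lia) Hs ltac:(lia)) as [T1 T2].
    replace (/ (1 - tt d al i (pidx i) x) - 1)%C with (tt d al i (pidx i) x / (1 - tt d al i (pidx i) x))%C by (field; exact T2).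
    replace (/ 8) with (/ 9 / (8 / 9)) by field. apply Cmod_div_le; [exact T1|]. split; [lra|]. generalize (Cmod_sub_ge 1 (tt d al i (pidx i) x)). rewrite Cmod_1. lra. }
  unfold W2. rewrite Hsp.
  assert (g1 : Cmod (NN d a (n - 1) * E / den1 x - 1) <= / 100).
  { replace (NN d a (n - 1) * E / den1 x - 1)%C with (((NN d a (n - 1) - 1) * (E - 1) + (NN d a (n - 1) - 1) + (E - 1) - (den1 x - 1)) / den1 x)%C by (field; exact Nd).
    replace (/ 100) with (/ 200 / / 2) by field. apply Cmod_div_le; [|lra].
    eapply Rle_trans; [apply Cmod_sub_le; [apply Cmod_add_le; [apply Cmod_add_le; [apply Cmod_mult_le; [exact N1|exact HE]|exact N1]|exact HE]|exact Q]|].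
    assert (0 <= 4 * INR (n - 1) * del) by (generalize (pos_INR (n - 1)); nra). nra. }
  replace (NN d a (n - 1) * (E * f) / den1 x - 1)%C with ((NN d a (n - 1) * E / den1 x - 1) * (f - 1) + (NN d a (n - 1) * E / den1 x - 1) + (f - 1))%C by (field; exact Nd).
  eapply Rle_trans; [apply Cmod_add_le; [apply Cmod_add_le; [apply Cmod_mult_le; [exact g1|exact f1]|exact g1]|exact f1]|]. lra.
Qed.

(** The only term that is not small comes from the circle of poles. It is at most [2 dm (9 / 8) 2 /
    (d_1 dm ^ 2) = (9 / 2) / (d_1 dm) <= 3 / 4], as [d_1 dm >= 6]. Since [|eset i d| >= 2], at least
    [11 / 10] remains of the logarithmic derivative. *)
Lemma strip_Lam i (x : C) : (2 <= i <= n)%nat -> strip i x -> Cmod (Lam i x - eset i d) <= 9 / 10.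
Proof.
  intros Hi Hs. assert (d0 := su_del H). destruct del_small as [S1 [S2 [S3 [S4 [S5 _]]]]].
  assert (Q := den1_near x (strip_fst i x Hi Hs)). destruct (Cmod_near_1 _ _ Q) as [Q1 Q2]. assert (B := D1_bounds). assert (M := dm_ge). assert (N := n_ge).
  set (z := if andb (1 <=? pidx i)%nat (pidx i <=? n - 1)%nat then ldl d al i (pidx i) x else 0%C).
  assert (T : Cmod (csumf (fun j => ldl d al i j x) (n - 1) - z) <= INR (n - 1) * (2 * INR dm * (del * (9 / 8)))).
  { apply (csumf_split (fun j => ldl d al i j x) (pidx i)); [nra|]. intros j Hj Hp. apply ldl_bound; [exact Hj|apply strip_tt; auto; lia|lra]. }
  assert (T2 : INR (n - 1) * (2 * INR dm * (del * (9 / 8))) <= / 1000).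
  { assert (INR (n - 1) <= INR n) by (apply le_INR; lia). nra. }
  assert (z1 : Cmod z <= 3 / 4).
  { unfold z. destruct (Nat.leb_spec 1 (pidx i)); destruct (Nat.leb_spec (pidx i) (n - 1)); simpl; try (rewrite Cmod_0; lra).
    destruct (strip_tt_pole i x Hi Hs ltac:(lia)) as [T3 T4].
    eapply Rle_trans; [apply ldl_bound; [lia|exact T3|exact T4]|].
    replace (2 * INR dm * (2 / (D1 * INR dm ^ 2) * (9 / 8))) with (9 / 2 * / (D1 * INR dm)) by (field; lra).
    replace (3 / 4) with (9 / 2 * / 6) by field. apply Rmult_le_compat_l; [lra|]. apply Rinv_le_contravar; nra. }
  set (q := ((D1 - 1)%R * D1 * cexp (D1 * x) / den1 x)%C).
  assert (q1 : Cmod q <= / 100).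
  { unfold q. apply Rle_trans with (D1 * (INR dm * del) / (9 / 10)).
    - apply Cmod_div_le; [|lra]. replace ((D1 - 1)%R * D1 * cexp (D1 * x))%C with (D1 * (den1 x - 1))%C by (unfold den1; ring).
      apply Cmod_mult_le; [rewrite Cmod_RtoC_pos; lra|exact Q].
    - assert (D1 * (INR dm * del) <= INR dm * (INR dm * del)) by (apply Rmult_le_compat_r; nra). assert (0 < INR dm * (INR dm * del)) by (repeat apply Rmult_lt_0_compat; lra).
      assert (INR dm * (INR dm * del) <= INR n * INR dm ^ 2 * del) by nra. lra. }
  unfold Lam. fold q. set (S0 := csumf (fun j => ldl d al i j x) (n - 1)) in *.
  replace (eset i d + S0 - q - eset i d)%C with ((S0 - z) + z - q)%C by ring.
  eapply Rle_trans; [apply Cmod_sub_le; [apply Cmod_add_le; [exact T|exact z1]|exact q1]|]. lra.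
Qed.

(** * The inverse branches *)

Variable M : R.

Definition dom (x : C) : Prop := outer M (cexp x) /\ LK d dm l del <= fst x.

Lemma dom_tpi x m : dom x -> dom (x + tpi m).
Proof. intros [A B]. split; [rewrite cexp_add_tpi; exact A|]. simpl. lra. Qed.

Lemma dom_bounds x : dom x -> rho <= Cmod (cexp x) <= 3 / 2 /\ fst (cexp x) <= 1.
Proof.
  intros [A B]. destruct (outer_bounds M _ A) as [B1 B2]. split; [split; [|exact B1]|exact B2]. rewrite Cmod_cexp. unfold rho. apply exp_le, B.
Qed.

(** [Yp x] is the value that [yprime] must take for [P] to equal [cexp x]; [Vf x] is its quotient by
    [cexp x], close to [1] on [dom]. *)
Definition Vf (x : C) : C := (1 + C0 - C0 * cexp (- x))%C.
Definition Yp (x : C) : C := ((1 + C0) * cexp x - C0)%C.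

Lemma Yp_eq x : Yp x = (cexp x * Vf x)%C.
Proof. unfold Yp, Vf. rewrite cexp_opp. field. apply cexp_neq_0. Qed.

Lemma Vf_near x : dom x -> Cmod (Vf x - 1) <= 2 * del.
Proof.
  intros Hx. destruct (dom_bounds x Hx) as [[B1 _] _]. destruct C0_small as [S1 S2].
  destruct rho_facts as [R1 [R2 _]].
  unfold Vf. replace (1 + C0 - C0 * cexp (- x) - 1)%C with (C0 - C0 / cexp x)%C by (rewrite cexp_opp; unfold Cdiv; ring).
  replace (2 * del) with (del + del * rho / rho) by (field; lra). apply Cmod_sub_le; [exact S2|]. apply Cmod_div_le; [exact S1|lra].
Qed.

Lemma fst_near_1 (z : C) e : Cmod (z - 1) <= e -> 1 - e <= fst z.
Proof. intros Hz. assert (F := fst_le_Cmod (z - 1)). simpl in F. apply Rabs_le_between in F. lra. Qed.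

Lemma Vf_pos x : dom x -> 0 < fst (Vf x).
Proof. intros Hx. assert (A := fst_near_1 _ _ (Vf_near x Hx)). destruct del_small as [_ [_ [_ [B _]]]]. lra. Qed.

Lemma Yp_bounds x : dom x -> 99 / 100 * Cmod (cexp x) <= Cmod (Yp x) <= 101 / 100 * Cmod (cexp x).
Proof.
  intros Hx. destruct (Cmod_near_1 _ _ (Vf_near x Hx)) as [A B]. destruct del_small as [_ [_ [_ [S4 _]]]].
  rewrite Yp_eq, Cmod_mult. assert (c0 := Cmod_ge_0 (cexp x)). nra.
Qed.

Lemma Yp_fst x : dom x -> fst (Yp x) <= 1 + 3 * del.
Proof.
  intros Hx. destruct (dom_bounds x Hx) as [[_ B1] B2]. destruct C0_small as [_ S2].
  assert (A : Cmod (C0 * (cexp x - 1)) <= del * (3 / 2 + 1)) by (apply Cmod_mult_le; [exact S2|apply Cmod_sub_le; [exact B1|rewrite Cmod_1; lra]]).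
  unfold Yp. replace ((1 + C0) * cexp x - C0)%C with (cexp x + C0 * (cexp x - 1))%C by ring.
  assert (F := fst_le_Cmod (C0 * (cexp x - 1))). apply Rabs_le_between in F. change (fst (cexp x + C0 * (cexp x - 1))%C) with (fst (cexp x) + fst (C0 * (cexp x - 1))%C). lra.
Qed.

(** On the outer annulus the denominator [1 + (d_1 - 1) z^{d_1}] is solved for exactly, so [x] enters [Wf]. *)
Definition Wf (i : nat) (xi x : C) : C :=
  if (i =? 1)%nat then (NN d a (n - 1) * sprod d al 1 (n - 1) xi - ((D1 - 1) / D1)%R * Yp x)%C else W2 i xi.
Definition dWf (i : nat) (xi : C) : C :=
  if (i =? 1)%nat then (NN d a (n - 1) * (sprod d al 1 (n - 1) xi * csumf (fun j => ldl d al 1 j xi) (n - 1)))%C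
  else (W2 i xi * (Lam i xi - eset i d))%C.

Lemma e1_dm : D1 * e1 <= / 150 /\ D1 * del <= / 18000 /\ D1 * e1 * 3 <= / 50.
Proof.
  assert (B := D1_bounds). destruct del_small as [S1 [S2 [S3 [S4 [S5 S6]]]]]. assert (d0 := su_del H).
  assert (N := n_ge). assert (D1 * e1 <= 20 * (INR n * INR dm ^ 2 * del)).
  { unfold e1. replace (20 * (INR n * INR dm ^ 2 * del)) with (INR dm * (20 * INR n * INR dm * del)) by ring. apply Rmult_le_compat_r; [|lra]. repeat apply Rmult_le_pos; lra. }
  assert (D1 * del <= INR dm * del) by (apply Rmult_le_compat_r; lra). lra.
Qed.

Lemma cdiff_W2 i xi : (2 <= i <= n)%nat -> strip i xi -> cdiff ctrue (W2 i) xi (W2 i xi * (Lam i xi - eset i d))%C.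
Proof.
  intros Hi Hs. destruct (strip_W2 i xi Hi Hs) as [Nd _].
  assert (A1 : cdiff ctrue (fun x => cexp (0 + D1 * x)) xi (D1 * cexp (0 + D1 * xi))%C) by apply cdiff_cexp_affine.
  assert (A2 := cdiff_add ctrue (fun _ => 1%C) _ xi _ _ (cdiff_const ctrue 1%C xi) (cdiff_mul ctrue (fun _ => RtoC (D1 - 1)) _ xi _ _ (cdiff_const ctrue (RtoC (D1 - 1)) xi) A1)).
  assert (Nd' : (1 + (D1 - 1)%R * cexp (0 + D1 * xi) <> 0)%C) by (rewrite Cplus_0_l; exact Nd).
  assert (A3 := cdiff_inv ctrue _ xi _ A2 Nd').
  assert (A4 := cdiff_mul ctrue _ _ xi _ _ (cdiff_mul ctrue (fun _ => NN d a (n - 1)) _ xi _ _ (cdiff_const ctrue (NN d a (n - 1)) xi)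
     (cdiff_sprod n d al (su_n H) i (n - 1) xi (fun j Hj => proj2 (strip_tt_neq i j xi ltac:(lia) Hs Hj)))) A3).
  cbv beta in A4. eapply cdiff_ext; [| |exact A4].
  - intros z. unfold W2, den1. rewrite !Cplus_0_l. reflexivity.
  - unfold W2, Lam, den1 in *. rewrite !Cplus_0_l in *. set (S0 := csumf (fun j => ldl d al i j xi) (n - 1)). field. exact Nd.
Qed.

(** For [i = 1] the real part is at least [1 / (2 d_1)]: [r] is close to [1], and [Re (Yp x)]
    exceeds [1] by at most [3 del] on [dom], so that [(d_1 - 1) / d_1] times it stays below
    [1 - 1 / d_1] up to small terms. For the other annuli the factor itself is close to [1]. *)
Lemma Wf_facts i xi x : (1 <= i <= n)%nat -> strip i xi -> dom x ->
  0 < fst (Wf i xi x) /\ cdiff ctrue (fun xi => Wf i xi x) xi (dWf i xi) /\ Cmod (dWf i xi / Wf i xi x) <= 9 / 10 /\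
  (i = 1%nat \/ Cmod (Wf i xi x - 1) <= / 7) /\ (i = 1%nat -> Cmod (Wf i xi x) <= 101 / 100 + Cmod (Yp x)).
Proof.
  intros Hi Hs Hx. unfold Wf, dWf. destruct (Nat.eqb_spec i 1) as [->|Hne].
  - destruct (outer_ring xi Hs) as [O1 O2]. destruct e1_dm as [E1 [E2 E3]].
    assert (B := D1_bounds). destruct e1_small as [[E4 E5] _]. assert (d0 := su_del H).
    set (r := (NN d a (n - 1) * sprod d al 1 (n - 1) xi)%C) in *. set (S0 := csumf (fun j => ldl d al 1 j xi) (n - 1)) in *.
    assert (R1 := fst_near_1 _ _ O1). assert (Yf := Yp_fst x Hx). set (c := (D1 - 1) / D1).
    assert (c1 : 0 <= c <= 1) by (unfold c; split; [apply Rdiv_le_0_compat; lra|apply Rle_div_l; lra]).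
    assert (c2 : c = 1 - / D1) by (unfold c; field; lra).
    assert (Fw : / (2 * D1) <= fst (r - c * Yp x)%C).
    { replace (fst (r - c * Yp x)%C) with (fst r - c * fst (Yp x)) by (simpl; ring).
      assert (I : e1 + 3 * del <= / (2 * D1)).
      { apply (Rmult_le_reg_l (2 * D1)); [lra|]. rewrite Rinv_r by lra. nra. }
      replace (/ D1) with (2 * / (2 * D1)) in c2 by (field; lra). nra. }
    assert (P2 : 0 < / (2 * D1)) by (apply Rinv_0_lt_compat; lra).
    split; [lra|]. split; [|split; [|split; [auto|]]].
    + eapply cdiff_ext; [| |apply (cdiff_add ctrue (fun z => (NN d a (n - 1) * sprod d al 1 (n - 1) z)%C) (fun _ => (- (c * Yp x))%C));
        [apply (cdiff_mul ctrue (fun _ => NN d a (n - 1)) (sprod d al 1 (n - 1))); [apply cdiff_const|apply (cdiff_sprod n d al (su_n H));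
          intros j Hj; apply (strip_tt_neq 1 j xi ltac:(lia) Hs Hj)]|apply cdiff_const]].
      * intros z. cbv beta. ring.
      * fold S0. ring.
    + assert (F := fst_le_Cmod (r - c * Yp x)%C). assert (F2 := Rle_abs (fst (r - c * Yp x)%C)).
      replace (NN d a (n - 1) * (sprod d al 1 (n - 1) xi * S0))%C with (r * S0)%C by (unfold r; ring).
      apply Rle_trans with ((1 + e1) * e1 / (/ (2 * D1))); [|replace ((1 + e1) * e1 / / (2 * D1)) with (2 * (1 + e1) * (D1 * e1)) by (field; lra); nra].
      apply Cmod_div_le; [|lra]. apply Cmod_mult_le; [apply Cmod_near_1, O1|exact O2].
    + intros _. eapply Rle_trans; [apply Cmod_tri_sub|]. destruct (Cmod_near_1 _ _ O1) as [_ Q]. rewrite Cmod_mult, Cmod_RtoC_pos by lra.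
      assert (y0 := Cmod_ge_0 (Yp x)). nra.
  - assert (Hi2 : (2 <= i <= n)%nat) by lia. destruct (strip_W2 i xi Hi2 Hs) as [Nd W1]. assert (F := fst_near_1 _ _ W1).
    split; [lra|]. split; [apply cdiff_W2; auto|]. split; [|split; [auto|intros; contradiction]].
    assert (Wn : W2 i xi <> 0%C) by (intros E; rewrite E in F; simpl in F; lra).
    replace (W2 i xi * (Lam i xi - eset i d) / W2 i xi)%C with (Lam i xi - eset i d)%C by (field; exact Wn).
    apply strip_Lam; auto.
Qed.

(** A logarithm of the coefficient of the monomial; the bound on its imaginary part enters the
    deviation of the branches from linear maps of the angle. *)
Definition kap (i : nat) : C := epsilon (inhabits (RtoC 0)) (fun k => cexp k = (D1 * kk d a i (n - 1))%C /\ Rabs (snd k) <= PI).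

Lemma kap_spec i : cexp (kap i) = (D1 * kk d a i (n - 1))%C /\ Rabs (snd (kap i)) <= PI.
Proof.
  unfold kap. apply epsilon_spec. apply cexp_surj_arg. apply Cmult_neq_0; [|apply kk_neq_0].
  apply INR_neq_0. apply (su_d H). generalize (su_n H). lia.
Qed.

(** Logarithms are taken in the equation monomial times [Wf i xi x] equals [Yp x], and it is solved
    for the [xi] in the monomial. The remaining dependence on [xi] has Lipschitz constant [9 / 10];
    division by a degree of modulus at least [2] brings it below [1 / 2]. *)
Definition Tf (i : nat) (x xi : C) : C := ((x + clog (Vf x) - kap i - clog (Wf i xi x)) / eset i d)%C.

Lemma eset_abs i : (1 <= i <= n)%nat -> Rabs (eset i d) = INR (d i) /\ 2 <= Rabs (eset i d) /\ RtoC (eset i d) <> 0%C.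
Proof.
  intros Hi. assert (B := d_bounds i Hi).
  assert (E : Rabs (eset i d) = INR (d i)). { unfold eset, bsg. destruct (sgn i); rewrite Rabs_mult, (Rabs_pos_eq (INR (d i))) by lra; unfold Rabs; destruct Rcase_abs; lra. }
  split; [exact E|]. split; [lra|]. apply Cmod_pos_neq. rewrite Cmod_R. lra.
Qed.

Lemma Tf_exp i x xi : (1 <= i <= n)%nat -> strip i xi -> dom x -> (D1 * kk d a i (n - 1) * cexp (eset i d * Tf i x xi) = Yp x / Wf i xi x)%C.
Proof.
  intros Hi Hs Hx. destruct (Wf_facts i xi x Hi Hs Hx) as [W1 _]. destruct (eset_abs i Hi) as [_ [_ En]].
  unfold Tf. replace (eset i d * ((x + clog (Vf x) - kap i - clog (Wf i xi x)) / eset i d))%C with (x + clog (Vf x) - kap i - clog (Wf i xi x))%C by (field; exact En).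
  rewrite !cexp_sub, cexp_add, !cexp_clog by (try exact W1; apply Vf_pos, Hx). destruct (kap_spec i) as [Ek _]. rewrite <- Ek, Yp_eq.
  field. split; [|apply cexp_neq_0]. intros E. rewrite E in W1. simpl in W1. lra.
Qed.

(** The monomial at the new point has modulus [|Yp x| / |Wf i xi x|], where [|Yp x|] lies between
    [rho] and [3 / 2] up to one percent; both bounds of the strip leave room for this. *)
Lemma Tf_strip i x xi : (1 <= i <= n)%nat -> dom x -> strip i xi -> strip i (Tf i x xi).
Proof.
  intros Hi Hx Hs. assert (E := Cmod_monomial i (Tf i x xi)). rewrite (Tf_exp i x xi Hi Hs Hx) in E.
  destruct (Wf_facts i xi x Hi Hs Hx) as [W1 [_ [_ [W2' W3]]]]. destruct (Yp_bounds x Hx) as [Y1 Y2]. destruct (dom_bounds x Hx) as [[B1 B2] _].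
  assert (Wn : Wf i xi x <> 0%C) by (intros E0; rewrite E0 in W1; simpl in W1; lra). rewrite Cmod_div in E by exact Wn.
  assert (Wp : 0 < Cmod (Wf i xi x)) by (apply Cmod_gt_0, Wn).
  destruct rho_facts as [R1 [R2 _]]. destruct del_small as [_ [_ [_ [S4 _]]]].
  assert (Q : rho / 2 <= exp (lam i (fst (Tf i x xi)))).
  { rewrite <- E. apply (Rle_div_r (rho / 2)); [exact Wp|]. destruct (Nat.eq_dec i 1) as [Ei|Ei].
    - specialize (W3 Ei). nra.
    - destruct W2' as [W2'|W2']; [contradiction|]. destruct (Cmod_near_1 _ _ W2') as [_ W4]. nra. }
  split.
  - apply Rnot_lt_le. intros L. apply exp_increasing in L. unfold Rminus in L. rewrite exp_plus, exp_Ropp, exp_ln in L by lra. fold (rho) in L. lra.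
  - destruct (Nat.eq_dec i 1) as [Ei|Ei]; [left; exact Ei|]. right. destruct W2' as [W2'|W2']; [contradiction|]. destruct (Cmod_near_1 _ _ W2') as [W4 _].
    apply Rnot_lt_le. intros L. apply exp_increasing in L. rewrite exp_ln, <- E in L by lra. apply Rlt_div_r in L; [|exact Wp]. lra.
Qed.

Lemma strip_seg i xi xi' t : strip i xi -> strip i xi' -> 0 <= t <= 1 -> strip i (seg xi xi' t).
Proof.
  intros [A1 A2] [B1 B2] Ht.
  assert (E : lam i (fst (seg xi xi' t)) = (1 - t) * lam i (fst xi) + t * lam i (fst xi')). { unfold lam, lam, seg. simpl. ring. }
  unfold strip. rewrite E. split; [nra|]. destruct A2; [left; assumption|]. destruct B2; [left; assumption|]. right. nra.
Qed.

Lemma Tf_lipschitz i x xi xi' : (1 <= i <= n)%nat -> dom x -> strip i xi -> strip i xi' -> Cmod (Tf i x xi - Tf i x xi') <= / 2 * Cmod (xi - xi').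
Proof.
  intros Hi Hx Hs Hs'. destruct (eset_abs i Hi) as [_ [E2 En]]. unfold Tf.
  replace ((x + clog (Vf x) - kap i - clog (Wf i xi x)) / eset i d - (x + clog (Vf x) - kap i - clog (Wf i xi' x)) / eset i d)%C
    with ((clog (Wf i xi' x) - clog (Wf i xi x)) / eset i d)%C by (field; exact En).
  assert (A : Cmod (clog (Wf i xi' x) - clog (Wf i xi x)) <= 9 / 10 * Cmod (xi' - xi)).
  { apply (clog_lipschitz (strip i) (fun z => Wf i z x) (dWf i)); [intros t Ht; apply strip_seg; auto|].
    intros z Hz. destruct (Wf_facts i z x Hi Hz Hx) as [F1 [F2 [F3 _]]]. auto. }
  rewrite (Cmod_sub_sym xi). assert (c0 := Cmod_ge_0 (xi' - xi)).
  apply Rle_trans with (9 / 10 * Cmod (xi' - xi) / 2); [|lra]. apply Cmod_div_le; [exact A|]. rewrite Cmod_R. lra.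
Qed.

Lemma Tf_cont i x xi : (1 <= i <= n)%nat -> dom x -> strip i xi -> ccont dom (fun x' => Tf i x' xi) x.
Proof.
  intros Hi Hx Hs. destruct (Wf_facts i xi x Hi Hs Hx) as [W1 _].
  assert (E : ccont dom (fun y => cexp (0 + (-1)%R * y)) x) by apply ccont_cexp_affine.
  assert (E' : ccont dom (fun y => cexp (0 + 1 * y)) x) by apply ccont_cexp_affine.
  assert (CV : ccont dom Vf x).
  { eapply ccont_ext; [|apply (ccont_add dom (fun _ => (1 + C0)%C) _ x (ccont_const _ _ _) (ccont_mul dom (fun _ => (- C0)%C) _ x (ccont_const _ _ _) E))].
    intros z. unfold Vf. cbv beta. replace (0 + (-1)%R * z)%C with (- z)%C by (apply Ceq_components; simpl; ring). ring. }
  assert (CY : ccont dom Yp x).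
  { eapply ccont_ext; [|apply (ccont_add dom _ (fun _ => (- C0)%C) x (ccont_mul dom (fun _ => (1 + C0)%C) _ x (ccont_const _ _ _) E') (ccont_const _ _ _))].
    intros z. unfold Yp. cbv beta. replace (0 + 1 * z)%C with z by ring. ring. }
  assert (CW : ccont dom (fun y => Wf i xi y) x).
  { unfold Wf. destruct (i =? 1)%nat; [|apply ccont_const].
    eapply ccont_ext; [|apply (ccont_add dom (fun _ => (NN d a (n - 1) * sprod d al 1 (n - 1) xi)%C) _ x (ccont_const _ _ _)
      (ccont_mul dom (fun _ => (- ((D1 - 1) / D1)%R)%C) Yp x (ccont_const _ _ _) CY))]. intros z. cbv beta. ring. }
  assert (L1 := ccont_comp dom clog Vf x CV (ccont_clog _ (Vf_pos x Hx))).
  assert (L2 := ccont_comp dom clog (fun y => Wf i xi y) x CW (ccont_clog _ W1)).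
  eapply ccont_ext; [|apply (ccont_mul dom _ (fun _ => (/ eset i d)%C) x (ccont_add dom _ _ x (ccont_add dom (fun y => y) _ x (ccont_id _ _) L1)
     (ccont_add dom (fun _ => (- kap i)%C) _ x (ccont_const _ _ _) (ccont_mul dom (fun _ => (- (1))%C) _ x (ccont_const _ _ _) L2))) (ccont_const _ _ _))].
  intros z. unfold Tf, Cdiv. cbv beta. ring.
Qed.

Lemma conv_fst (u : nat -> C) lim (k c : R) : conv u lim -> (forall m, c <= k * fst (u m)) -> c <= k * fst lim.
Proof.
  intros Hu Hc. apply Rnot_lt_le. intros L. destruct (Hu ((c - k * fst lim) / (Rabs k + 1))) as [N HN].
  { apply Rdiv_lt_0_compat; [lra|]. generalize (Rabs_pos k). lra. }
  specialize (HN N (Nat.le_refl _)). specialize (Hc N). assert (F := fst_le_Cmod (u N - lim)). simpl in F.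
  assert (K0 := Rabs_pos k). apply Rlt_div_r in HN; [|lra].
  assert (Q : k * (fst (u N) + - fst lim) <= Rabs k * Cmod (u N - lim)).
  { eapply Rle_trans; [apply Rle_abs|]. rewrite Rabs_mult. apply Rmult_le_compat_l; assumption. }
  nra.
Qed.

Lemma strip_closed i : cclosed (strip i).
Proof.
  intros u lim Hu Hc. unfold strip, lam in *. split.
  - assert (Q := conv_fst u lim (eset i d) (LK d dm l del - ln 2 - ln (D1 * Cmod (kk d a i (n - 1)))) Hc).
    assert (K : forall m, LK d dm l del - ln 2 - ln (D1 * Cmod (kk d a i (n - 1))) <= eset i d * fst (u m)) by (intros m; destruct (Hu m) as [A _]; lra).
    specialize (Q K). lra.
  - destruct (Nat.eq_dec i 1) as [Ei|Ei]; [left; exact Ei|]. right.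
    assert (Q := conv_fst u lim (- eset i d) (ln (D1 * Cmod (kk d a i (n - 1))) - ln 2) Hc).
    assert (K : forall m, ln (D1 * Cmod (kk d a i (n - 1))) - ln 2 <= - eset i d * fst (u m)) by (intros m; destruct (Hu m) as [_ [A|A]]; [contradiction|lra]).
    specialize (Q K). lra.
Qed.

Lemma strip_inhabited i : (1 <= i <= n)%nat -> exists x, strip i x.
Proof.
  intros Hi. destruct (eset_abs i Hi) as [_ [E2 _]]. assert (E0 : eset i d <> 0) by (intros E; rewrite E, Rabs_R0 in E2; lra).
  exists ((- ln (D1 * Cmod (kk d a i (n - 1))) / eset i d, 0) : C). unfold strip, lam. simpl fst.
  replace (eset i d * (- ln (D1 * Cmod (kk d a i (n - 1))) / eset i d)) with (- ln (D1 * Cmod (kk d a i (n - 1)))) by (field; exact E0).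
  assert (A := su_LK H). assert (B := ln_del_neg). assert (P := ln_pos_facts). split; [lra|]. right. lra.
Qed.

(* Letters are counted from [0], annuli from [1]. *)
Definition Gf (i : nat) : C -> C := branch (strip (S i)) (Tf (S i)).

Lemma Gf_spec i x : (i < n)%nat -> dom x -> strip (S i) (Gf i x) /\ Tf (S i) x (Gf i x) = Gf i x.
Proof.
  intros Hi Hx. destruct (strip_inhabited (S i) ltac:(lia)) as [x0 H0]. apply (branch_spec dom (strip (S i)) (Tf (S i)) x0); auto.
  - apply strip_closed.
  - intros; apply Tf_strip; auto; lia.
  - intros; apply Tf_lipschitz; auto; lia.
Qed.

Lemma Gf_unique i x xi : (i < n)%nat -> dom x -> strip (S i) xi -> Tf (S i) x xi = xi -> Gf i x = xi.
Proof.
  intros Hi Hx Hs E. destruct (strip_inhabited (S i) ltac:(lia)) as [x0 H0]. apply (branch_unique dom (strip (S i)) (Tf (S i)) x0); auto.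
  - apply strip_closed.
  - intros; apply Tf_strip; auto; lia.
  - intros; apply Tf_lipschitz; auto; lia.
Qed.

Lemma Gf_ccont i x : (i < n)%nat -> dom x -> ccont dom (Gf i) x.
Proof.
  intros Hi Hx. destruct (strip_inhabited (S i) ltac:(lia)) as [x0 H0]. apply (branch_ccont dom (strip (S i)) (Tf (S i)) x0); auto.
  - apply strip_closed.
  - intros; apply Tf_strip; auto; lia.
  - intros; apply Tf_lipschitz; auto; lia.
  - intros; apply Tf_cont; auto; lia.
Qed.

Lemma tt_tpi i j (x : C) m : tt d al i j (x + tpi m) = tt d al i j x.
Proof.
  assert (E : cexp (x + tpi m) = cexp x) by apply cexp_add_tpi. unfold tt. destruct (j <? i)%nat; rewrite !cexp_nat, !cexp_sub, E; reflexivity.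
Qed.

Lemma sprod_tpi i k (x : C) m : sprod d al i k (x + tpi m) = sprod d al i k x.
Proof. apply Cprod_ext. intros j _. rewrite tt_tpi. reflexivity. Qed.

Lemma den1_tpi (x : C) m : den1 (x + tpi m) = den1 x.
Proof. unfold den1, D1. rewrite !cexp_nat, cexp_add_tpi. reflexivity. Qed.

Lemma Yp_tpi x m : Yp (x + tpi m) = Yp x.
Proof. unfold Yp. rewrite cexp_add_tpi. reflexivity. Qed.

Lemma Vf_tpi x m : Vf (x + tpi m) = Vf x.
Proof. unfold Vf. rewrite !cexp_opp, cexp_add_tpi. reflexivity. Qed.

Lemma Wf_tpi i xi x m k : Wf i (xi + tpi m) (x + tpi k) = Wf i xi x.
Proof. unfold Wf, W2. rewrite !sprod_tpi, den1_tpi, Yp_tpi. reflexivity. Qed.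

Definition eZ (i : nat) : Z := if sgn (S i) then Z.of_nat (d (S i)) else (- Z.of_nat (d (S i)))%Z.

Lemma eZ_eset i : IZR (eZ i) = eset (S i) d.
Proof. unfold eZ, eset, bsg. destruct (sgn (S i)); rewrite ?opp_IZR, <- INR_IZR_INZ; ring. Qed.

(** Only the linear part of [Tf] sees a translation by a period, so the translated point solves the
    translated equation, and uniqueness applies. *)
Lemma Gf_equiv i x m : (i < n)%nat -> dom x -> Gf i (x + tpi (eZ i * m)) = (Gf i x + tpi m)%C.
Proof.
  intros Hi Hx. destruct (Gf_spec i x Hi Hx) as [G1 G2]. apply Gf_unique; [exact Hi|apply dom_tpi, Hx| |].
  - unfold strip in *. simpl. rewrite Rplus_0_r. exact G1.
  - rewrite <- G2 at 2. unfold Tf. rewrite Wf_tpi, Vf_tpi. destruct (eset_abs (S i) ltac:(lia)) as [_ [_ En]].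
    assert (Et : tpi (eZ i * m) = (eset (S i) d * tpi m)%C). { unfold tpi. rewrite mult_IZR, eZ_eset. apply Ceq_components; simpl; ring. }
    rewrite Et. field. exact En.
Qed.

Lemma Gf_dev i x : (i < n)%nat -> dom x -> Rabs (snd (Gf i x) - snd x / IZR (eZ i)) <= 4.
Proof.
  intros Hi Hx. destruct (Gf_spec i x Hi Hx) as [G1 G2]. rewrite eZ_eset. destruct (eset_abs (S i) ltac:(lia)) as [_ [E2 En]].
  set (e := eset (S i) d) in *. assert (e0 : e <> 0) by (intros E; rewrite E, Rabs_R0 in E2; lra).
  rewrite <- G2. unfold Tf. fold e. set (V := clog (Vf x)). set (W := clog (Wf (S i) (Gf i x) x)).
  replace (snd ((x + V - kap (S i) - W) / e)%C - snd x / e) with ((snd V - snd (kap (S i)) - snd W) / e).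
  2: { replace ((x + V - kap (S i) - W) / e)%C with ((/ e)%R * (x + V - kap (S i) - W))%C by (rewrite RtoC_inv by exact e0; unfold Cdiv; ring). simpl. field. exact e0. }
  rewrite Rabs_div by exact e0. apply Rle_div_l; [lra|].
  assert (A1 := clog_Im_bound (Vf x)). assert (A2 := clog_Im_bound (Wf (S i) (Gf i x) x)). destruct (kap_spec (S i)) as [_ A3]. fold V in A1. fold W in A2.
  assert (PI4 := PI_4). unfold Rminus. eapply Rle_trans; [apply Rabs_triang|]. rewrite Rabs_Ropp. eapply Rle_trans; [apply Rplus_le_compat_r, Rabs_triang|]. rewrite Rabs_Ropp. lra.
Qed.

Lemma Wf_eqn i xi x : (1 <= i <= n)%nat -> strip i xi -> dom x -> den1 xi <> 0%C ->
  (Pformula n d a (cexp xi) = cexp x :> C <-> (D1 * kk d a i (n - 1) * cexp (eset i d * xi) * Wf i xi x = Yp x)%C).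
Proof.
  intros Hi Hs Hx Nd. destruct one_C0 as [N0 _].
  assert (A : (Pformula n d a (cexp xi) : C) = cexp x <-> yprime n d a (cexp xi) = Yp x).
  { rewrite (Pformula_of_yprime n d a _ N0). fold C0. unfold Yp. split; intros E.
    - rewrite <- E. field. exact N0.
    - rewrite E. field. exact N0. }
  rewrite A. rewrite (yprime_region n d a al (su_n H) (su_al H) i xi N0 Hi). fold D1. unfold Wf, W2, den1 in *.
  destruct (Nat.eqb_spec i 1) as [->|Hne].
  - rewrite kk_1. replace (eset 1 d) with D1 by (unfold eset, bsg, sgn; simpl; fold D1; ring).
    assert (B := D1_bounds). assert (Dn : RtoC D1 <> 0%C) by (apply Cmod_pos_neq; rewrite Cmod_R, Rabs_pos_eq; lra).
    rewrite RtoC_div by lra. set (E := cexp (D1 * xi)) in *. set (r := sprod d al 1 (n - 1) xi). set (Nn := NN d a (n - 1)). set (c := RtoC (D1 - 1)) in *. set (y := Yp x).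
    assert (Ec : c = (RtoC D1 - 1)%C) by (unfold c; rewrite RtoC_minus; reflexivity). rewrite Ec in *. split; intros Q.
    + rewrite <- Q. field. auto.
    + assert (Q2 : (Nn * D1 * E * r = y * (1 + (D1 - 1) * E))%C).
      { replace (Nn * D1 * E * r)%C with (D1 * 1 * E * (Nn * r - (D1 - 1) / D1 * y) + (D1 - 1) * E * y)%C by (field; exact Dn). rewrite Q. ring. }
      replace (Nn * D1 * 1 * E * r)%C with (Nn * D1 * E * r)%C by ring. rewrite Q2. field. exact Nd.
  - split; intros Q; rewrite <- Q; field; exact Nd.
Qed.

(** On the first annulus the equation was solved with its denominator cleared; a zero of the
    denominator would force [D1 F r = 0] with three nonzero factors. *)
Lemma Gf_den i x : (i < n)%nat -> dom x -> den1 (Gf i x) <> 0%C.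
Proof.
  intros Hi Hx. destruct (Gf_spec i x Hi Hx) as [G1 G2]. destruct (Nat.eq_dec i 0) as [->|Hne].
  2: { apply (strip_W2 (S i)); [lia|exact G1]. }
  assert (E := Tf_exp 1 x _ ltac:(lia) G1 Hx). rewrite G2 in E. destruct (Wf_facts 1 _ x ltac:(lia) G1 Hx) as [W1 _].
  assert (Wn : Wf 1 (Gf 0 x) x <> 0%C) by (intros E0; rewrite E0 in W1; simpl in W1; lra).
  assert (B := D1_bounds). assert (Dn : RtoC D1 <> 0%C) by (apply Cmod_pos_neq; rewrite Cmod_R, Rabs_pos_eq; lra).
  destruct (outer_ring _ G1) as [O1 _]. destruct e1_small as [[E4 E5] _].
  destruct (Cmod_near_1 _ _ O1) as [O2 _]. intros Hd. unfold den1 in Hd.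
  rewrite kk_1 in E. replace (eset 1 d) with D1 in E by (unfold eset, bsg, sgn; simpl; fold D1; ring).
  unfold Wf in *. simpl Nat.eqb in *. cbv iota in *. set (r := (NN d a (n - 1) * sprod d al 1 (n - 1) (Gf 0 x))%C) in *. set (F := cexp (D1 * Gf 0 x)) in *. set (y := Yp x) in *.
  rewrite RtoC_div, RtoC_minus in * by lra.
  assert (E2 : (D1 * F * (r - (D1 - 1) / D1 * y) = y)%C). { replace (D1 * F)%C with (D1 * 1 * F)%C by ring. rewrite E. unfold Cdiv at 1. rewrite <- Cmult_assoc, Cinv_l by exact Wn. ring. }
  assert (E3 : (D1 * F * r = y * (1 + (D1 - 1) * F))%C). { replace (D1 * F * r)%C with (D1 * F * (r - (D1 - 1) / D1 * y) + (D1 - 1) * F * y)%C by (field; exact Dn). rewrite E2. ring. }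
  rewrite Hd, Cmult_0_r in E3. assert (rn : r <> 0%C) by (apply Cmod_pos_neq; lra).
  assert (Fn : F <> 0%C) by apply cexp_neq_0. exact (Cmult_neq_0 _ _ (Cmult_neq_0 _ _ Dn Fn) rn E3).
Qed.

Lemma Gf_inverse i x : (i < n)%nat -> dom x -> (Pformula n d a (cexp (Gf i x)) : C) = cexp x.
Proof.
  intros Hi Hx. destruct (Gf_spec i x Hi Hx) as [G1 G2]. apply (Wf_eqn (S i)); auto; [lia|apply Gf_den; auto|].
  assert (E := Tf_exp (S i) x _ ltac:(lia) G1 Hx). rewrite G2 in E. rewrite E. field.
  destruct (Wf_facts (S i) _ x ltac:(lia) G1 Hx) as [W1 _]. intros E0. rewrite E0 in W1. simpl in W1. lra.
Qed.

(** The logarithms of the two sides differ by a period [tpi m], which is moved into the argument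
    [x]; then the point is a fixed point and uniqueness applies. *)
Lemma Gf_complete i xi x : (i < n)%nat -> strip (S i) xi -> dom x -> den1 xi <> 0%C -> (Pformula n d a (cexp xi) : C) = cexp x ->
  exists m, xi = Gf i (x + tpi m)%C.
Proof.
  intros Hi Hs Hx Nd E. apply (Wf_eqn (S i)) in E; auto; [|lia]. destruct (Wf_facts (S i) xi x ltac:(lia) Hs Hx) as [W1 _].
  assert (Wn : Wf (S i) xi x <> 0%C) by (intros E0; rewrite E0 in W1; simpl in W1; lra). destruct (eset_abs (S i) ltac:(lia)) as [_ [_ En]].
  destruct (cexp_eq (eset (S i) d * xi) (x + clog (Vf x) - kap (S i) - clog (Wf (S i) xi x))) as [m Em].
  { rewrite !cexp_sub, cexp_add, !cexp_clog by (try exact W1; apply Vf_pos, Hx). rewrite <- Yp_eq, <- E. destruct (kap_spec (S i)) as [Ek _]. rewrite <- Ek.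
    field. split; [apply cexp_neq_0|exact Wn]. }
  exists m. symmetry. apply Gf_unique; [exact Hi|apply dom_tpi, Hx|exact Hs|].
  unfold Tf. rewrite Vf_tpi. assert (Ew := Wf_tpi (S i) xi x 0 m). replace (xi + tpi 0)%C with xi in Ew by (apply Ceq_components; simpl; ring). rewrite Ew.
  replace xi with (eset (S i) d * xi / eset (S i) d)%C at 2 by (field; exact En). rewrite Em. f_equal. ring.
Qed.

Lemma Gf_inj i x y : (i < n)%nat -> dom x -> dom y -> Gf i x = Gf i y -> x = y.
Proof.
  intros Hi Hx Hy E. destruct (Gf_spec i x Hi Hx) as [_ Gx]. destruct (Gf_spec i y Hi Hy) as [_ Gy].
  assert (Ey := Gf_inverse i y Hi Hy). rewrite <- E, (Gf_inverse i x Hi Hx) in Ey.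
  destruct (cexp_eq _ _ Ey) as [m Em]. rewrite Em, <- E in *. unfold Tf in Gx, Gy. destruct (eset_abs (S i) ltac:(lia)) as [_ [_ En]].
  rewrite Vf_tpi in Gx. assert (Ew := Wf_tpi (S i) (Gf i (y + tpi m)) y 0 m). replace (Gf i (y + tpi m) + tpi 0)%C with (Gf i (y + tpi m)) in Ew by (apply Ceq_components; simpl; ring).
  rewrite Ew in Gx. rewrite <- Gy in Gx at 2.
  apply (f_equal (fun z => (eset (S i) d * z)%C)) in Gx. set (V := clog (Vf y)) in *. set (W := clog (Wf (S i) (Gf i (y + tpi m)) y)) in *.
  replace (eset (S i) d * ((y + tpi m + V - kap (S i) - W) / eset (S i) d))%C with (y + tpi m + V - kap (S i) - W)%C in Gx by (field; exact En).
  replace (eset (S i) d * ((y + V - kap (S i) - W) / eset (S i) d))%C with (y + V - kap (S i) - W)%C in Gx by (field; exact En).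
  replace (y + tpi m)%C with (y + tpi m + V - kap (S i) - W - V + kap (S i) + W)%C by ring. rewrite Gx. ring.
Qed.

(** * Expansion of the inverse branches *)

Variables M5 eps : R.
Hypothesis HR : regime n d a dm del M M5 eps.

Let Q := Qw (d 1%nat).
Let r := rw n d a.
Let th := thw n d a.
Let P (z : C) : C := Pformula n d a z.

Lemma M_ge_10 : 10 <= M.
Proof. generalize (rg_M HR). lra. Qed.

Lemma D1n : RtoC D1 <> 0%C.
Proof. apply INR_neq_0. apply (su_d H). generalize (su_n H). lia. Qed.

Lemma ring1_rw (x : C) : (NN d a (n - 1) * sprod d al 1 (n - 1) x)%C = r (cexp (- x)) /\ csumf (fun j => ldl d al 1 j x) (n - 1) = th (cexp (- x)).
Proof.
  assert (E : forall j, (1 <= j <= n - 1)%nat -> tt d al 1 j x = ((a j * cexp (- x)) ^ DD d j)%C).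
  { intros j Hj. unfold tt. destruct (Nat.ltb_spec j 1); [lia|]. rewrite cexp_nat. f_equal. unfold Cminus. rewrite cexp_add, (su_al H) by exact Hj. reflexivity. }
  split.
  - unfold r, rw. f_equal. apply Cprod_ext. intros j Hj. rewrite E by exact Hj. reflexivity.
  - unfold th, thw. apply Csum_ext. intros j Hj. unfold ldl. destruct (Nat.ltb_spec j 1); [lia|]. rewrite E by exact Hj. reflexivity.
Qed.

Lemma den1_Q (x : C) : (den1 x = D1 * cexp (D1 * x) * Q (cexp (- x)))%C.
Proof.
  assert (W : (cexp (D1 * x) * cexp (- x) ^ d 1%nat = 1)%C).
  { unfold D1. rewrite <- cexp_nat, <- cexp_add. replace (INR (d 1%nat) * x + INR (d 1%nat) * - x)%C with (RtoC 0) by ring. apply cexp_0. }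
  unfold den1, Q, Qw. fold D1. transitivity (cexp (D1 * x) * (cexp (- x) ^ d 1%nat) + (D1 - 1)%R * cexp (D1 * x))%C; [rewrite W; ring|].
  field. apply D1n.
Qed.

Lemma P_w (x : C) : den1 x <> 0%C -> let w := cexp (- x) in
  Q w <> 0%C /\ yprime n d a (cexp x) = (r w / Q w)%C /\ P (cexp x) = ((r w + C0 * Q w) / ((1 + C0) * Q w))%C.
Proof.
  intros Nd w. destruct one_C0 as [N0 _]. assert (E := den1_Q x). fold w in E.
  assert (Qn : Q w <> 0%C). { intros E0. apply Nd. rewrite E, E0. ring. }
  assert (Y : yprime n d a (cexp x) = (r w / Q w)%C).
  { rewrite (yprime_region n d a al (su_n H) (su_al H) 1 x N0) by (generalize (su_n H); lia). fold D1. change (1 + (D1 - 1)%R * cexp (D1 * x))%C with (den1 x).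
    rewrite E, kk_1. replace (eset 1 d) with D1 by (unfold eset, bsg, sgn; simpl; fold D1; ring).
    destruct (ring1_rw x) as [R1 _]. fold w in R1. rewrite <- R1. field. repeat split; [exact Qn|apply cexp_neq_0|apply D1n]. }
  split; [exact Qn|]. split; [exact Y|]. unfold P. rewrite (Pformula_of_yprime n d a _ N0), Y. fold C0. field. auto.
Qed.

Lemma inv_1_sub (z : C) : z <> 0%C -> z <> 1%C -> (/ (1 - / z) = z / (z - 1))%C.
Proof.
  intros Hz H1. assert (z - 1 <> 0)%C by (intros E; apply H1; replace z with (z - 1 + 1)%C by ring; rewrite E; ring). field. auto.
Qed.

Lemma basin_w (w : C) : w <> 1%C -> 3 / 5 <= phi M (/ (1 - w)) ->
  Cmod (1 - w) <= 2 /\ (r w - Q w <> 0)%C /\ phi M (/ (1 - w)) + / 4 <= phi M ((r w + C0 * Q w) / (r w - Q w)).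
Proof.
  intros Hw Hp. assert (N : (1 - w <> 0)%C) by (intros E; apply Hw; replace w with (1 - (1 - w))%C by ring; rewrite E; ring).
  assert (A := phi_ge_Cmod M _ ltac:(generalize (rg_M HR); lra) Hp). rewrite Cmod_inv in A by exact N.
  assert (c0 : 0 < Cmod (1 - w)) by (apply Cmod_gt_0, N).
  assert (B : Cmod (1 - w) <= 2). { assert (3 / 5 * Cmod (1 - w) <= 1) by (apply (Rmult_le_compat_r (Cmod (1 - w))) in A; [|lra]; rewrite Rinv_l in A by lra; lra). lra. }
  split; [exact B|]. apply (rg_basin HR); auto. apply (rg_pert HR w B).
Qed.

Lemma u_image (rr q : C) : (1 + C0 <> 0)%C -> q <> 0%C -> (rr - q <> 0)%C -> let y := ((rr + C0 * q) / ((1 + C0) * q))%C in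
  y <> 1%C /\ (y / (y - 1) = (rr + C0 * q) / (rr - q))%C.
Proof.
  intros N0 Qn Rn y. assert (E : (y - 1 = (rr - q) / ((1 + C0) * q))%C) by (unfold y; field; auto).
  assert (Dn : ((rr - q) / ((1 + C0) * q) <> 0)%C).
  { unfold Cdiv. apply Cmult_neq_0; [exact Rn|]. apply Cinv_neq_0, Cmult_neq_0; auto. }
  split; [intros E1; rewrite E1 in E; apply Dn; rewrite <- E; ring|]. rewrite E. unfold y. field. auto.
Qed.

Lemma trap_outer (xi : C) : den1 xi <> 0%C -> outer M (P (cexp xi)) -> outer M (cexp xi).
Proof.
  intros Nd Ho. assert (HM := rg_M HR). destruct one_C0 as [N0 _].
  destruct (Ceq_dec (cexp xi) 1) as [E1|E1]; [rewrite E1; apply outer_one|]. apply outer_phi; [lra|exact E1|].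
  apply Rnot_lt_le. intros L. destruct (P_w xi Nd) as [Qn [_ Ep]]. set (w := cexp (- xi)) in *.
  assert (Ew : w = (/ cexp xi)%C) by apply cexp_opp. assert (Hw : w <> 1%C). { intros E. apply E1. rewrite <- (Cinv_inv (cexp xi)), <- Ew, E by apply cexp_neq_0. field. }
  rewrite <- inv_1_sub, <- Ew in L by (auto; apply cexp_neq_0).
  destruct (basin_w w Hw ltac:(lra)) as [_ [B2 B3]]. destruct (u_image (r w) (Q w) N0 Qn B2) as [U1 U2].
  rewrite Ep in Ho. apply outer_phi in Ho; [|lra|exact U1]. rewrite U2 in Ho. lra.
Qed.

Lemma inner_between s : s <= LK d dm l del -> between n s.
Proof.
  intros Hs. assert (A := su_4 H). assert (Hn := su_n H). assert (N := ln_del_neg). assert (Pf := ln_pos_facts). split; [intros; lia|]. intros _.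
  assert (L := su_l H). assert (Bd := d_bounds n ltac:(lia)).
  assert (l / INR (d n) <= 0) by (apply Rle_div_l; nra). lra.
Qed.

(** [su_4], and through it the condition on the sum of the [1 / d_i], puts the inner disc so deep
    inside the last annulus that the monomial is far below [rho] when it vanishes at [0] ([n] odd)
    and at least [2] when it has a pole there ([n] even). *)
Lemma inner_lam s : s <= LK d dm l del ->
  if sgn n then lam n s <= LK d dm l del + 3 * ln del - ln 4 + INR (d n) * (s - LK d dm l del) else ln 2 <= lam n s.
Proof.
  intros Hs. assert (A := su_4 H). assert (Hn := su_n H). assert (N := ln_del_neg). assert (Pf := ln_pos_facts).
  assert (Bd := d_bounds n ltac:(lia)).
  assert (E := lam_diff n s (fst (al (n - 1)%nat))). assert (E2 := lam_circle_S (n - 1)%nat ltac:(lia)).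
  replace (S (n - 1)) with n in E2 by lia. rewrite sgn_pred in E2 by lia. rewrite E2 in E.
  assert (Q1 : INR (d n) * (LK d dm l del - fst (al (n - 1)%nat)) <= INR (d n) * ln del + l).
  { replace (INR (d n) * ln del + l) with (INR (d n) * (ln del + l / INR (d n))) by (field; lra). apply Rmult_le_compat_l; lra. }
  unfold LK in *. destruct (sgn n); unfold bsg in E; simpl in E.
  - nra.
  - destruct Lc_pos as [_ [Lc1 Lc0]]. nra.
Qed.

Lemma factor_neq i j (x : C) : (1 <= j <= n - 1)%nat -> ((1 - tt d al i j x <> 0)%C <-> (cexp x ^ DD d j <> a j ^ DD d j)%C).
Proof.
  intros Hj. assert (E := fac_split n d a al (su_al H) i j x Hj).
  assert (K : (if (j <? i)%nat then - a j ^ DD d j else cexp (INR (DD d j) * x))%C <> 0%C).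
  { destruct (j <? i)%nat; [|apply cexp_neq_0]. apply Cmod_pos_neq. rewrite Cmod_opp. apply Cmod_gt_0, Cpow_nz, a_neq_0, Hj. }
  split; intros F E2.
  - apply (Cmult_neq_0 _ _ K F). rewrite <- E, E2. ring.
  - rewrite E2, Cmult_0_r in E. apply F. replace (cexp x ^ DD d j)%C with (cexp x ^ DD d j - a j ^ DD d j + a j ^ DD d j)%C by ring. rewrite E. ring.
Qed.

Definition nonpole (x : C) : Prop := den1 x <> 0%C /\ forall j, (1 <= j <= n - 1)%nat -> sgn j = false -> (cexp x ^ DD d j <> a j ^ DD d j)%C.

Lemma trap_inner (xi : C) : nonpole xi -> fst xi <= LK d dm l del -> if sgn n then Cmod (P (cexp xi)) <= 7 / 10 * rho else 8 / 5 <= Cmod (P (cexp xi)).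
Proof.
  intros [Nd Nf] Hx. assert (B := inner_between _ Hx). assert (L := inner_lam _ Hx). assert (Hn := su_n H). assert (N := ln_del_neg). assert (Pf := ln_pos_facts).
  assert (Bd := d_bounds n ltac:(lia)). destruct (sgn n).
  - apply (zone_zero n); [lia|exact B|]. assert (INR (d n) * (fst xi - LK d dm l del) <= 0) by nra. lra.
  - apply (zone_pole n); [lia|exact B|exact L|]. intros Hp. apply factor_neq; [exact Hp|]. apply Nf; [exact Hp|]. apply sgn_pidx; lia.
Qed.

Lemma G_nonpole i x : (i < n)%nat -> dom x -> nonpole (Gf i x).
Proof.
  intros Hi Hx. split; [apply Gf_den; auto|]. intros j Hj _. apply (factor_neq (S i)); [exact Hj|].
  apply strip_tt_neq; [lia| |exact Hj]. apply Gf_spec; auto.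
Qed.

(** A branch value outside [dom] would lie in the trapping region or in the inner disc, and [P] maps
    neither of them into the target annulus. *)
Lemma G_maps i x : (i < n)%nat -> dom x -> dom (Gf i x).
Proof.
  intros Hi Hx. assert (Np := G_nonpole i x Hi Hx). assert (E : P (cexp (Gf i x)) = cexp x) by (apply Gf_inverse; auto).
  destruct (dom_bounds x Hx) as [[B1 B2] _]. destruct rho_facts as [R1 _]. split.
  - apply trap_outer; [apply Np|]. rewrite E. apply Hx.
  - apply Rnot_lt_le. intros L. assert (T := trap_inner _ Np ltac:(lra)). rewrite E in T. destruct (sgn n); lra.
Qed.

Lemma strip_of_image (xi x : C) : nonpole xi -> P (cexp xi) = cexp x -> dom x -> exists i, (i < n)%nat /\ strip (S i) xi.
Proof.
  intros [Nd Nf] E Hx. destruct (between_exists (fst xi)) as [i [Hi Hb]]. destruct (dom_bounds x Hx) as [[B1 B2] _].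
  destruct rho_facts as [R1 _]. exists (i - 1)%nat. split; [lia|]. replace (S (i - 1)) with i by lia. split.
  - apply Rnot_lt_le. intros L. destruct (zone_zero i xi Hi Hb ltac:(lra)) as [_ [_ [_ Z]]]. fold (P (cexp xi)) in Z. rewrite E in Z. lra.
  - destruct (Nat.eq_dec i 1) as [Ei|Ei]; [left; exact Ei|]. right. apply Rnot_lt_le. intros L.
    assert (Z : 8 / 5 <= Cmod (P (cexp xi))).
    { apply (zone_pole i); [lia|exact Hb|lra|]. intros Hp. apply factor_neq; [exact Hp|]. apply Nf; [exact Hp|]. apply sgn_pidx; lia. }
    rewrite E in Z. lra.
Qed.

Lemma cdiff_P_log i (xi : C) : (1 <= i <= n)%nat -> den1 xi <> 0%C -> (forall j, (1 <= j <= n - 1)%nat -> (1 - tt d al i j xi <> 0)%C) ->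
  cdiff ctrue (fun x => P (cexp x)) xi (yprime n d a (cexp xi) * Lam i xi / (1 + C0))%C.
Proof.
  intros Hi Nd Nt. destruct one_C0 as [N0 _].
  assert (A := cdiff_yprime n d a al (su_n H) (su_al H) i xi N0 Hi Nt Nd).
  eapply cdiff_ext; [| |apply (cdiff_mul ctrue _ (fun _ => (/ (1 + C0))%C) xi _ _ (cdiff_add ctrue _ (fun _ => C0) xi _ _ A (cdiff_const ctrue C0 xi)) (cdiff_const ctrue _ xi))].
  - intros z. cbv beta. unfold P. rewrite (Pformula_of_yprime n d a _ N0). reflexivity.
  - cbv beta. unfold Lam, den1, Cdiv. fold D1. ring.
Qed.

(** The logarithmic derivative of [P] at [cexp (Gf i x)], whose image is [cexp x]; [1 / Lf] is the
    derivative of the branch in the coordinate [log z]. *)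
Definition Lf (i : nat) (x : C) : C := (Yp x / ((1 + C0) * cexp x) * Lam (S i) (Gf i x))%C.

Lemma yprime_G i x : (i < n)%nat -> dom x -> yprime n d a (cexp (Gf i x)) = Yp x.
Proof. intros Hi Hx. unfold yprime. rewrite Gf_inverse by auto. reflexivity. Qed.

Lemma G_cdiff i x : (i < n)%nat -> dom x -> Lf i x <> 0%C -> cdiff dom (Gf i) x (/ Lf i x)%C.
Proof.
  intros Hi Hx HL. destruct one_C0 as [N0 _].
  assert (El : (yprime n d a (cexp (Gf i x)) * Lam (S i) (Gf i x) / (1 + C0) = cexp x * Lf i x)%C).
  { rewrite yprime_G by auto. unfold Lf. field. split; [apply cexp_neq_0|exact N0]. }
  eapply cdiff_ext; [reflexivity| |apply (inverse_cdiff dom (fun z => P (cexp z)) (Gf i) cexp x (cexp x * Lf i x)%C (cexp x))].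
  - field. split; [exact HL|apply cexp_neq_0].
  - intros y Hy. apply Gf_inverse; auto.
  - exact Hx.
  - apply Gf_ccont; auto.
  - rewrite <- El. apply cdiff_P_log; [lia|apply Gf_den; auto|].
    intros j Hj. apply (strip_tt_neq (S i)); [lia| |exact Hj]. apply Gf_spec; auto.
  - apply cdiff_cexp.
  - apply Cmult_neq_0; [apply cexp_neq_0|exact HL].
Qed.

Lemma Lf_inner i x : (1 <= i < n)%nat -> dom x -> 21 / 20 <= Cmod (Lf i x).
Proof.
  intros Hi Hx. destruct one_C0 as [N0 [C1 C2]]. destruct (Yp_bounds x Hx) as [Y1 Y2].
  destruct (Gf_spec i x ltac:(lia) Hx) as [G1 _].
  assert (L := strip_Lam (S i) _ ltac:(lia) G1). destruct (eset_abs (S i) ltac:(lia)) as [_ [E2 _]].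
  assert (c0 : 0 < Cmod (cexp x)) by (apply Cmod_gt_0, cexp_neq_0).
  assert (L2 : 11 / 10 <= Cmod (Lam (S i) (Gf i x))).
  { set (La := Lam (S i) (Gf i x)) in *. assert (Z := Cmod_sub_ge (eset (S i) d) (eset (S i) d - La)).
    replace (eset (S i) d - (eset (S i) d - La))%C with La in Z by ring. rewrite (Cmod_sub_sym (eset (S i) d)), Cmod_R in Z. lra. }
  unfold Lf. rewrite Cmod_mult, Cmod_div, Cmod_mult by (apply Cmult_neq_0; [exact N0|apply cexp_neq_0]).
  assert (Z : 97 / 100 <= Cmod (Yp x) / (Cmod (1 + C0) * Cmod (cexp x))) by (apply (Rle_div_r (97 / 100)); nra).
  apply Rle_trans with (97 / 100 * (11 / 10)); [lra|]. apply Rmult_le_compat; lra.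
Qed.

Lemma Lam_w (x : C) : den1 x <> 0%C -> Lam 1 x = (D1 + th (cexp (- x)) - (D1 - 1)%R / Q (cexp (- x)))%C.
Proof.
  intros Nd. destruct (P_w x Nd) as [Qn _]. unfold Lam. rewrite (proj2 (ring1_rw x)).
  replace (eset 1 d) with D1 by (unfold eset, bsg, sgn; simpl; fold D1; ring).
  rewrite den1_Q. field. repeat split; [exact Qn|apply cexp_neq_0|apply D1n].
Qed.

(** Two forms of the same number: the one in [w] is suited to the neighbourhood of [1], the one in
    the image [y] to the rest of the outermost annulus, where [Cmod_affine_ge] applies. *)
Lemma Lf_outer x : dom x -> let w := cexp (- Gf 0 x) in let y := cexp x in
  Lf 0 x = (r w / (r w + C0 * Q w) * (D1 + th w - (D1 - 1)%R / Q w))%C /\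
  Lf 0 x = (((1 + C0) * y - C0) / ((1 + C0) * y) * (D1 + th w - (D1 - 1)%R * ((1 + C0) * y - C0) / r w))%C /\
  y = ((r w + C0 * Q w) / ((1 + C0) * Q w))%C /\ Cmod (r w - 1) <= e1 /\ Cmod (th w) <= e1 /\ Q w <> 0%C.
Proof.
  intros Hx w y. assert (Hn := su_n H). destruct one_C0 as [N0 _].
  assert (Nd : den1 (Gf 0 x) <> 0%C) by (apply Gf_den; auto; lia).
  destruct (P_w _ Nd) as [Qn [Ey Ep]]. fold w in Qn, Ey, Ep.
  assert (E : P (cexp (Gf 0 x)) = y) by (apply Gf_inverse; auto; lia). rewrite E in Ep.
  rewrite yprime_G in Ey by (auto; lia).
  destruct (Gf_spec 0 x ltac:(lia) Hx) as [G1 _].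
  destruct (outer_ring _ G1) as [O1 O2]. destruct (ring1_rw (Gf 0 x)) as [R1 R2]. fold w in R1, R2. rewrite R1 in O1. rewrite R2 in O2.
  destruct e1_small as [[E4 E5] _]. destruct (Cmod_near_1 _ _ O1) as [O3 _].
  assert (rn : r w <> 0%C) by (apply Cmod_pos_neq; lra).
  assert (yn : y <> 0%C) by apply cexp_neq_0.
  assert (La := Lam_w _ Nd).
  assert (Sn : (r w + C0 * Q w <> 0)%C). { intros E0. apply yn. rewrite Ep, E0. unfold Cdiv. ring. }
  assert (Ey2 : ((1 + C0) * y - C0 = r w / Q w)%C) by (rewrite <- Ey; reflexivity).
  split; [|split; [|repeat split; auto]].
  - assert (A : (Yp x / ((1 + C0) * y) = r w / (r w + C0 * Q w))%C) by (rewrite Ey, Ep; field; auto). unfold Lf. fold y. rewrite La, A. reflexivity.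
  - unfold Lf. rewrite La, Ey, Ey2. replace ((D1 - 1)%R * (r w / Q w) / r w)%C with ((D1 - 1)%R / Q w)%C by (field; auto). reflexivity.
Qed.

Lemma parabolic_values : r 1%C = 1%C /\ Q 1%C = 1%C /\ th 1%C = C0.
Proof.
  destruct (rg_pert HR 1%C) as [[_ P1] [P2 _]]; [replace (1 - 1)%C with (RtoC 0) by ring; rewrite Cmod_0; lra|].
  replace (1 - 1)%C with (RtoC 0) in P1, P2 by ring. rewrite Cmod_0 in P1, P2. rewrite Cmult_0_r in P1. split; [|split].
  - apply Csub_eq_0. replace (r 1%C - 1)%C with (rw n d a 1 - 1 - 0)%C by (unfold r; ring). generalize (Cmod_ge_0 (rw n d a 1 - 1 - 0)). simpl in P1. lra.
  - unfold Q, Qw. rewrite Cpow_1_l. rewrite RtoC_minus. field. apply D1n.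
  - apply Csub_eq_0. generalize (Cmod_ge_0 (th 1%C - C0)). unfold th, C0 in *. lra.
Qed.

Lemma G_one x : dom x -> cexp (- Gf 0 x) = 1%C -> cexp x = 1%C.
Proof.
  intros Hx E. destruct (Lf_outer x Hx) as [_ [_ [Ey _]]]. rewrite E in Ey. destruct parabolic_values as [R1 [Q1 _]].
  rewrite R1, Q1 in Ey. rewrite Ey. destruct one_C0 as [N0 _]. field. exact N0.
Qed.

Lemma dom_w (xi : C) : Cmod (cexp xi - 1) = Cmod (1 - cexp (- xi)) * Cmod (cexp xi).
Proof. rewrite <- Cmod_mult, cexp_opp. f_equal. field. apply cexp_neq_0. Qed.

(** The sector condition of [rg_near] holds because the branch value lies in [outer] and
    [1 / |1 - w| >= M5 >= 5 (M + 1)]. *)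
Lemma Lf_near x : dom x -> Cmod (1 - cexp (- Gf 0 x)) <= / M5 -> 1 + Cmod (1 - cexp (- Gf 0 x)) / 8 <= Cmod (Lf 0 x).
Proof.
  intros Hx Hw. assert (Hn := su_n H). assert (HM := rg_M HR). assert (HM5 := rg_M5 HR). set (w := cexp (- Gf 0 x)) in *. destruct (Lf_outer x Hx) as [E _]. fold w in E. rewrite E.
  assert (I : / M5 <= / 2005) by (apply Rinv_le_contravar; lra). destruct (rg_pert HR w ltac:(lra)) as [P1 [P2 _]].
  apply (rg_near HR); auto. destruct (G_maps 0 x ltac:(lia) Hx) as [Ho _].
  assert (Ew : w = (/ cexp (Gf 0 x))%C) by apply cexp_opp.
  destruct (Ceq_dec (cexp (Gf 0 x)) 1) as [E1|E1].
  { rewrite Ew, E1. replace (1 - / 1)%C with (RtoC 0) by field. rewrite Cmod_0. simpl. lra. }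
  assert (c0 : 0 < Cmod (1 - w)).
  { apply Cmod_gt_0. intros E0. apply E1. rewrite <- (Cinv_inv (cexp (Gf 0 x))), <- Ew by apply cexp_neq_0. replace w with (1 - (1 - w))%C by ring. rewrite E0. replace (1 - 0)%C with (RtoC 1) by ring. field. }
  rewrite Ew. apply (outer_sector M); auto; [lra|]. rewrite <- inv_1_sub, <- Ew by (auto; apply cexp_neq_0). rewrite Cmod_inv by (apply Cmod_pos_neq, c0).
  eapply Rle_trans; [exact HM5|]. rewrite <- (Rinv_inv M5). apply Rinv_le_contravar; [exact c0|exact Hw].
Qed.

(** Measured by [|1 - 1 / z|], a point at distance at least [1 / M5] from [1] is moved by the
    outermost branch to distance at least [1 / mu], see [u_near]. The error [cc] is at most a
    sixteenth of [1 / (2 M5) ^ 2], which bounds the gain [|y - 1| ^ 2] away from [1]. *)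
Let mu := M5 + D1.
Let cc := / (64 * mu ^ 2).

Lemma mu_facts : 2005 <= M5 /\ M5 + 2 <= mu /\ 0 < cc /\ 40 * D1 * e1 <= cc /\ cc <= / (64 * 2005 * mu).
Proof.
  assert (HM := rg_M HR). assert (HM5 := rg_M5 HR). assert (B := D1_bounds). assert (C := rg_c HR).
  assert (m0 : 2005 <= mu) by (unfold mu; lra). assert (0 < 64 * mu ^ 2) by nra.
  split; [lra|]. split; [unfold mu; lra|]. split; [apply Rinv_0_lt_compat; lra|]. split.
  - unfold cc. apply (Rmult_le_reg_r (64 * mu ^ 2)); [lra|]. rewrite Rinv_l by lra. exact C.
  - unfold cc. apply Rinv_le_contravar; nra.
Qed.

Lemma Lf_affine x : dom x -> Cmod (D1 - (D1 - 1)%R * cexp x) - cc <= Cmod (Lf 0 x).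
Proof.
  intros Hx. destruct (Lf_outer x Hx) as [_ [E [_ [O1 [O2 _]]]]]. set (w := cexp (- Gf 0 x)) in *. rewrite E. destruct mu_facts as [_ [_ [_ [m4 _]]]].
  destruct e1_small as [[E4 E5] E6]. destruct C0_small as [S1 S2].
  destruct (dom_bounds x Hx) as [[B1 B2] _]. destruct rho_facts as [R1 _]. assert (d0 := su_del H).
  assert (N := n_ge). assert (de : del <= e1) by nra.
  eapply Rle_trans; [|apply (outer_annulus_expansion (d 1%nat) e1)].
  - fold D1. lra.
  - apply (su_d H). generalize (su_n H). lia.
  - lra.
  - apply cexp_neq_0.
  - exact B2.
  - lra.
  - eapply Rle_trans; [exact S1|]. apply Rmult_le_compat; lra.
  - exact O1.
  - exact O2.
Qed.

(** On the whole domain the unperturbed derivative has modulus at least [1], so at most [cc] is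
    lost; at distance more than [1 / M5] from [1] the term [|y - 1| ^ 2] of [Cmod_affine_ge]
    outweighs the errors. *)
Lemma Lf_ge x : dom x -> 1 - cc <= Cmod (Lf 0 x) /\ (/ M5 < Cmod (1 - cexp (- x)) -> 1 + cc <= Cmod (Lf 0 x)).
Proof.
  intros Hx. assert (A := Lf_affine x Hx). destruct (dom_bounds x Hx) as [_ B2]. destruct mu_facts as [m1 [m2 [m3 [m4 m5]]]].
  assert (Af := Cmod_affine_ge (d 1%nat) (cexp x) ltac:(apply (su_d H); generalize (su_n H); lia) B2). fold D1 in Af.
  set (z := Cmod (D1 - (D1 - 1)%R * cexp x)) in *. assert (z0 : 0 <= z) by apply Cmod_ge_0. assert (c0 := Cmod_ge_0 (cexp x - 1)).
  split; [nra|]. intros Hn. rewrite dom_w in Af, c0. set (q := Cmod (1 - cexp (- x))) in *. set (y := Cmod (cexp x)) in *.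
  assert (K : / (2 * M5) <= q * y).
  { rewrite Rinv_mult. destruct (Rle_lt_dec (/ 2) y) as [Y|Y]; [nra|].
    assert (Z := Cmod_sub_ge 1 (cexp x)). rewrite Cmod_1, (Cmod_sub_sym 1), dom_w in Z. fold q y in Z. assert (/ M5 <= / 2005) by (apply Rinv_le_contravar; lra). lra. }
  assert (K2 : / (2 * M5) * / (2 * M5) <= q * y * (q * y)) by (apply Rmult_le_compat; try lra; apply Rlt_le, Rinv_0_lt_compat; lra).
  assert (K3 : 16 * cc <= / (2 * M5) * / (2 * M5)).
  { unfold cc. rewrite <- Rinv_mult. replace (16 * / (64 * mu ^ 2)) with (/ (4 * mu ^ 2)) by (field; lra). apply Rinv_le_contravar; [nra|]. nra. }
  assert (cs : cc <= / 1000). { eapply Rle_trans; [exact m5|]. apply Rinv_le_contravar; nra. }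
  assert (1 + 2 * cc <= z) by nra. lra.
Qed.

Lemma Lf_neq_0 i x : (i < n)%nat -> dom x -> Lf i x <> 0%C.
Proof.
  intros Hi Hx. apply Cmod_pos_neq. destruct (Nat.eq_dec i 0) as [->|Hne].
  - destruct (Lf_ge x Hx) as [A _]. destruct mu_facts as [m1 [m2 [m3 [m4 m5]]]]. assert (cc <= / 1000) by (eapply Rle_trans; [exact m5|]; apply Rinv_le_contravar; nra). lra.
  - generalize (Lf_inner i x ltac:(lia) Hx). lra.
Qed.

Definition de (x : C) : R := Rmin 1 (Cmod (1 - cexp (- x))).

(* The extra weight near [1] absorbs the failure of expansion of the branches that map a neighbourhood of [1] away from [1]. *)
Definition wt (x : C) : R := if Rle_dec (Cmod (1 - cexp (- x))) (/ M5) then 1 + / (32 * mu) else 1.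

Lemma cexp_opp_ge (x : C) t : 0 < t -> fst x <= - ln t -> t - 1 <= Cmod (1 - cexp (- x)).
Proof.
  intros Ht Hx. assert (A := Cmod_sub_ge (cexp (- x)) 1). rewrite Cmod_1, (Cmod_sub_sym (cexp (- x))), Cmod_cexp in A. simpl in A.
  assert (t <= exp (- fst x)) by (rewrite <- (exp_ln t) at 1 by exact Ht; apply exp_le; lra). lra.
Qed.

Lemma G_inner_de i x : (1 <= i < n)%nat -> dom x -> 1 < Cmod (1 - cexp (- Gf i x)).
Proof.
  intros Hi Hx. destruct (Gf_spec i x ltac:(lia) Hx) as [G1 _]. assert (A := strip_fst (S i) _ ltac:(lia) G1).
  assert (B := ln_del_neg). assert (Z := cexp_opp_ge (Gf i x) 4 ltac:(lra)).
  lra.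
Qed.

(** In the coordinate [u] the map is a translation by [(d_1 - 1) / 2] up to [1 / 10], so one
    backward step increases [|u|] by at most [d_1]. *)
Lemma u_near x : dom x -> let w := cexp (- Gf 0 x) in w <> 1%C -> Cmod (1 - w) <= / M5 ->
  cexp x <> 1%C /\ / Cmod (1 - w) <= / Cmod (1 - cexp (- x)) + D1.
Proof.
  intros Hx w Hw1 Hw. destruct mu_facts as [m1 _]. destruct one_C0 as [N0 _]. destruct (Lf_outer x Hx) as [_ [_ [Ey [_ [_ Qn]]]]]. fold w in Ey, Qn.
  assert (/ M5 <= / 2005) by (apply Rinv_le_contravar; lra).
  destruct (rg_asym HR w C0 (r w) (proj1 (rg_pert HR w ltac:(lra))) Hw1 Hw) as [A1 A2]. destruct (u_image (r w) (Q w) N0 Qn A1) as [U1 U2].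
  fold Q in A2. rewrite <- U2 in A2. rewrite <- Ey in U1, A2. split; [exact U1|].
  assert (c0 : (1 - w <> 0)%C) by (intros E; apply Hw1; replace w with (1 - (1 - w))%C by ring; rewrite E; ring).
  assert (c1 : (1 - cexp (- x) <> 0)%C). { apply Cmod_pos_neq. assert (Z := dom_w x). assert (0 < Cmod (cexp x - 1)) by (apply Cmod_gt_0; intros E; apply U1; replace (cexp x) with (cexp x - 1 + 1)%C by ring; rewrite E; ring).
    assert (Z3 := Cmod_ge_0 (cexp x)). nra. }
  rewrite <- inv_1_sub, <- cexp_opp in A2 by (auto; apply cexp_neq_0).
  rewrite <- !Cmod_inv by assumption. set (u := (/ (1 - cexp (- x)))%C) in *. set (v := (/ (1 - w))%C) in *.
  assert (Dm : Cmod (RtoC ((D1 - 1) / 2)) = (D1 - 1) / 2) by (assert (B := D1_bounds); fold D1 in B; apply Cmod_RtoC_pos; lra).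
  replace v with (u - (((D1 - 1) / 2)%R + (u - v - ((D1 - 1) / 2)%R)))%C at 1 by ring.
  assert (B := D1_bounds).
  eapply Rle_trans; [apply Cmod_tri_sub|]. apply Rplus_le_compat_l. eapply Rle_trans; [apply Cmod_add_le; [rewrite Dm; apply Rle_refl|exact A2]|]. lra.
Qed.

(** Let [v = 1 / (32 mu)] be the extra weight. A branch entering the neighbourhood of [1] pays
    [1 + v], but lands at distance at least [1 / mu], where [Lf_near] gains at least [4 v]. A branch
    leaving it gains [v], far more than the loss [cc]. Inside and outside, [Lf_near] and [Lf_ge]
    expand by themselves, and the branches to the inner annuli expand by [21 / 20]. *)
Lemma weighted_expansion i x : (i < n)%nat -> dom x -> Cmod (/ Lf i x) * wt (Gf i x) * (1 + cc / 4 * de (Gf i x)) <= wt x.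
Proof.
  intros Hi Hx. assert (Ln := Lf_neq_0 i x Hi Hx). rewrite Cmod_inv by exact Ln. assert (L0 : 0 < Cmod (Lf i x)) by (apply Cmod_gt_0, Ln).
  destruct mu_facts as [m1 [m2 [m3 [m4 m5]]]]. set (v := / (32 * mu)) in *.
  assert (cv : cc <= v / 4000). { eapply Rle_trans; [exact m5|]. unfold v. replace (/ (32 * mu) / 4000) with (/ (32 * 4000 * mu)) by (field; lra). apply Rinv_le_contravar; nra. }
  assert (vs : v <= / 64000) by (unfold v; apply Rinv_le_contravar; nra).
  assert (Hde : 0 <= de (Gf i x) <= 1 /\ de (Gf i x) <= Cmod (1 - cexp (- Gf i x))).
  { unfold de. repeat split; [apply Rmin_glb; [lra|apply Cmod_ge_0]|apply Rmin_l|apply Rmin_r]. }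
  set (e := de (Gf i x)) in *.
  apply (Rmult_le_reg_l (Cmod (Lf i x))); [exact L0|]. rewrite <- !Rmult_assoc, Rinv_r, Rmult_1_l by lra.
  destruct (Nat.eq_dec i 0) as [->|Hne].
  - destruct (Lf_ge x Hx) as [G1 G2]. unfold wt. fold mu v.
    destruct (Rle_dec (Cmod (1 - cexp (- Gf 0 x))) (/ M5)) as [Nz|Nz]; destruct (Rle_dec (Cmod (1 - cexp (- x))) (/ M5)) as [Ny|Ny].
    + assert (A := Lf_near x Hx Nz). set (q := Cmod (1 - cexp (- Gf 0 x))) in *. rewrite (Rmult_comm (Cmod _)). apply Rmult_le_compat_l; [lra|]. nra.
    + assert (A := Lf_near x Hx Nz).
      assert (W1 : cexp (- Gf 0 x) <> 1%C).
      { intros E. assert (Ey1 := G_one x Hx E).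
        apply Ny. rewrite cexp_opp, Ey1. replace (1 - / 1)%C with (RtoC 0) by field. rewrite Cmod_0. apply Rlt_le, Rinv_0_lt_compat. lra. }
      destruct (u_near x Hx W1 Nz) as [_ U]. set (q := Cmod (1 - cexp (- Gf 0 x))) in *.
      assert (q0 : 0 < q). { apply Cmod_gt_0. intros E. apply W1. replace (cexp (- Gf 0 x)) with (1 - (1 - cexp (- Gf 0 x)))%C by ring. rewrite E. ring. }
      assert (Uy : / Cmod (1 - cexp (- x)) <= M5). { rewrite <- (Rinv_inv M5). apply Rinv_le_contravar; [apply Rinv_0_lt_compat|]; lra. }
      assert (q1 : / mu <= q). { rewrite <- (Rinv_inv q). apply Rinv_le_contravar; [apply Rinv_0_lt_compat, q0|]. unfold mu. lra. }
      assert (q2 : 4 * v <= q / 8). { unfold v. replace (4 * / (32 * mu)) with (/ mu / 8) by (field; lra). lra. }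
      rewrite Rmult_1_r. eapply Rle_trans; [|exact A]. assert (cc / 4 * e <= v) by nra. nra.
    + rewrite !Rmult_1_l. nra.
    + rewrite !Rmult_1_l, Rmult_1_r. assert (cc / 4 * e <= cc) by nra. lra.
  - assert (A := Lf_inner i x ltac:(lia) Hx). assert (B := G_inner_de i x ltac:(lia) Hx).
    assert (W : wt (Gf i x) = 1). { unfold wt. destruct Rle_dec as [N|N]; [|reflexivity]. assert (/ M5 <= / 2005) by (apply Rinv_le_contravar; lra). lra. }
    rewrite W, Rmult_1_l. assert (1 <= wt x) by (unfold wt; fold mu v; destruct Rle_dec; lra). nra.
Qed.

Lemma de_growth i x : (i < n)%nat -> dom x -> 0 < de x -> 0 < de (Gf i x) /\ / de (Gf i x) <= / de x + mu.
Proof.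
  intros Hi Hx Hd. destruct mu_facts as [m1 [m2 _]]. assert (d1 : de x <= 1) by apply Rmin_l. assert (1 <= / de x) by (rewrite <- Rinv_1; apply Rinv_le_contravar; lra).
  destruct (Rle_lt_dec (Cmod (1 - cexp (- Gf i x))) (/ M5)) as [Nz|Nz].
  - destruct (Nat.eq_dec i 0) as [->|Hne]; [|assert (B := G_inner_de i x ltac:(lia) Hx); assert (/ M5 <= / 2005) by (apply Rinv_le_contravar; lra); lra].
    assert (d2 : de x <= Cmod (1 - cexp (- x))) by apply Rmin_r.
    assert (W1 : cexp (- Gf 0 x) <> 1%C).
    { intros E. assert (Ey1 := G_one x Hx E).
      rewrite cexp_opp, Ey1 in d2. replace (1 - / 1)%C with (RtoC 0) in d2 by field. rewrite Cmod_0 in d2. lra. }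
    destruct (u_near x Hx W1 Nz) as [_ U]. set (q := Cmod (1 - cexp (- Gf 0 x))) in *.
    assert (q0 : 0 < q). { apply Cmod_gt_0. intros E. apply W1. replace (cexp (- Gf 0 x)) with (1 - (1 - cexp (- Gf 0 x)))%C by ring. rewrite E. ring. }
    assert (Eq : de (Gf 0 x) = q). { unfold de. apply Rmin_right. assert (/ M5 <= / 2005) by (apply Rinv_le_contravar; lra). lra. }
    rewrite Eq. split; [exact q0|]. assert (/ Cmod (1 - cexp (- x)) <= / de x) by (apply Rinv_le_contravar; lra). unfold mu. lra.
  - assert (i0 : 0 < / M5) by (apply Rinv_0_lt_compat; lra). assert (i1 : / M5 <= / 2005) by (apply Rinv_le_contravar; lra).
    assert (K : / M5 <= de (Gf i x)) by (apply Rmin_glb; lra). split; [lra|].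
    assert (/ de (Gf i x) <= M5) by (rewrite <- (Rinv_inv M5); apply Rinv_le_contravar; lra). lra.
Qed.

(** The base line lifts the circle [|z| = 1 / 2], which lies in the target annulus and away from
    [1]. *)
Let be := - ln 2.

Lemma dom_closed : cclosed dom.
Proof.
  intros u x Hu Hc. split.
  - destruct (classic (outer M (cexp x))) as [Q0|Hn]; [exact Q0|]. exfalso. destruct (not_outer_open M _ Hn) as [e [He Qa]].
    destruct (ccont_cexp ctrue x e He) as [t0 [Hr Q2]]. destruct (Hc t0 Hr) as [N HN]. specialize (HN N (Nat.le_refl _)).
    apply (Qa (cexp (u N))); [apply Q2; [exact I|exact HN]|apply (Hu N)].
  - replace (LK d dm l del <= fst x) with (LK d dm l del <= 1 * fst x) by (rewrite Rmult_1_l; reflexivity).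
    apply (conv_fst u x 1); [exact Hc|]. intros m. destruct (Hu m). lra.
Qed.

Lemma half_facts : exp be = / 2 /\ LK d dm l del < be /\ be < 0.
Proof.
  assert (Pf := ln_pos_facts). assert (A := su_LK H). assert (B := ln_del_neg). unfold be. rewrite exp_Ropp, exp_ln by lra. split; [reflexivity|]. lra.
Qed.

Lemma dom_of_small (x : C) : LK d dm l del <= fst x <= be -> dom x.
Proof.
  intros [A B]. destruct half_facts as [E _]. split; [|exact A]. apply outer_small; [exact M_ge_10|].
  rewrite Cmod_cexp, <- E. apply exp_le, B.
Qed.

Lemma dom_base t : dom (be, t).
Proof. apply dom_of_small. destruct half_facts. simpl. lra. Qed.

Lemma cexp_shift (x : C) (s : R) : cexp (x + s) = (exp s * cexp x)%C.
Proof. rewrite cexp_add. replace (cexp s) with (RtoC (exp s)); [ring|]. apply Ceq_components; simpl; rewrite ?cos_0, ?sin_0; ring. Qed.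

Lemma seg_shift (x : C) t : seg x (be, snd x) t = (x + (t * (be - fst x))%R)%C.
Proof. apply Ceq_components; simpl; ring. Qed.

Lemma dom_path (x : C) t : dom x -> 0 <= t <= 1 -> dom (seg x (be, snd x) t).
Proof.
  intros Hx Ht. rewrite seg_shift. destruct half_facts as [_ [L _]]. destruct (Rle_lt_dec (fst x) be) as [Qa|Qa].
  - apply dom_of_small. destruct Hx as [_ A]. simpl. nra.
  - destruct Hx as [A1 A2]. split; [|simpl; nra]. rewrite cexp_shift. apply outer_star; [exact M_ge_10|exact A1|].
    split; [left; apply exp_pos|]. rewrite <- exp_0. apply exp_le. nra.
Qed.

Lemma de_half (x : C) : fst x <= be -> de x = 1.
Proof.
  intros Hx. unfold de. apply Rmin_left. assert (A := cexp_opp_ge x 2 ltac:(lra)). unfold be in Hx. lra.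
Qed.

(** To the right of the base line, moving left by at least [t0] multiplies [z] by at most
    [exp (- t0)]; as [Re z <= 1] on [dom], the point gets away from [1]. To the left of it [de] is
    [1]. *)
Lemma de_path t0 : 0 < t0 -> exists t1, 0 < t1 /\ forall x t, dom x -> 0 <= t <= 1 -> t0 <= Cmod (seg x (be, snd x) t - x) -> t1 <= de (seg x (be, snd x) t).
Proof.
  intros Hr. assert (f1 : exp (- t0) < 1) by (rewrite <- exp_0; apply exp_increasing; lra). assert (f0 := exp_pos (- t0)).
  exists ((1 - exp (- t0)) / 2). split; [lra|]. intros x t Hx Ht Hd. rewrite seg_shift in *. destruct (Rle_lt_dec (fst x) be) as [Qa|Qa].
  - rewrite de_half; [lra|]. simpl. nra.
  - set (s := t * (be - fst x)) in *. assert (s0 : s <= 0) by (unfold s; nra).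
    replace (x + s - x)%C with (RtoC s) in Hd by ring. rewrite Cmod_R, Rabs_left1 in Hd by exact s0.
    assert (Hy := dom_path x t Hx Ht). rewrite seg_shift in Hy. fold s in Hy. destruct (dom_bounds _ Hy) as [[_ B1] _]. destruct (dom_bounds x Hx) as [_ B2].
    unfold de. apply Rmin_glb; [lra|]. assert (W := dom_w (x + s)). assert (c0 := Cmod_ge_0 (1 - cexp (- (x + s)))).
    assert (F : 1 - exp (- t0) <= Cmod (cexp (x + s) - 1)).
    { assert (F := fst_le_Cmod (cexp (x + s) - 1)). apply Rabs_le_between in F. rewrite cexp_shift in F at 2. simpl in F.
      assert (exp s <= exp (- t0)) by (apply exp_le; lra). assert (p0 := exp_pos s). simpl in B2. nra. }
    nra.
Qed.

Lemma dom_Re x : dom x -> Rabs (fst x) <= Rabs (LK d dm l del) + 1.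
Proof.
  intros Hx. destruct (dom_bounds x Hx) as [[_ B1] _]. destruct Hx as [_ A]. rewrite Cmod_cexp in B1.
  assert (fst x <= 1). { apply Rnot_lt_le. intros L. apply exp_increasing in L. generalize (exp_ineq1 1 ltac:(lra)). lra. }
  apply Rabs_le. split; [|generalize (Rabs_pos (LK d dm l del)); lra]. generalize (Rle_abs (- LK d dm l del)). rewrite Rabs_Ropp. lra.
Qed.

Theorem G_shrink : uniformly_shrinking dom Gf n.
Proof.
  destruct mu_facts as [m1 [m2 [m3 [m4 m5]]]].
  apply (branches_shrink dom n Gf (fun i x => (/ Lf i x)%C) wt de (cc / 4) mu be (Rabs (LK d dm l del) + 1) 1).
  - lra.
  - lra.
  - intros i x Hi Hx. apply G_maps; auto.
  - intros i x Hi Hx. apply G_cdiff; auto. apply Lf_neq_0; auto.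
  - intros x. unfold wt. assert (0 < / (32 * mu) <= 1). { split; [apply Rinv_0_lt_compat; lra|]. rewrite <- Rinv_1. apply Rinv_le_contravar; lra. } destruct Rle_dec; lra.
  - intros x. apply Rmin_glb; [lra|apply Cmod_ge_0].
  - intros i x Hi Hx. apply weighted_expansion; auto.
  - intros i x Hi Hx Hd. apply de_growth; auto.
  - apply dom_path.
  - apply de_path.
  - apply dom_base.
  - lra.
  - intros t. rewrite de_half; [lra|]. simpl. lra.
  - apply dom_Re.
Qed.

(** On the inner circle [|z| = |a_i|] the monomial has modulus [d_1 dm ^ 2] or [d_1 dm ^ 2 s], at
    least a factor [exp 1] away from the range allowed in the strip. A monomial of degree [d_i]
    needs the logarithmic distance [1 / d_i] for that. *)
Lemma strip_gap i (x : C) : (1 <= i <= n - 1)%nat -> strip i x -> fst (al i) + / INR dm <= fst x.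
Proof.
  intros Hi [S1 S2]. assert (Pf := ln_pos_facts). assert (N := ln_del_neg). assert (Bd := d_bounds i ltac:(lia)).
  destruct Lc_pos as [_ [Lc1 Lc0]].
  assert (Lc2 : ln 2 + 1 <= Lc d dm).
  { apply Rnot_lt_le. intros L. apply exp_increasing in L. rewrite exp_plus, exp_ln in L by lra. generalize exp_le_3. lra. }
  assert (A := lam_diff i (fst x) (fst (al i))). assert (E := lam_circle i ltac:(lia)). rewrite E in A.
  assert (K : 1 <= INR (d i) * (fst x - fst (al i))).
  { unfold LK in S1. destruct (sgn i) eqn:Es; unfold bsg in A.
    - lra.
    - destruct S2 as [->|S2]; [discriminate|]. lra. }
  assert (/ INR dm <= / INR (d i)) by (apply Rinv_le_contravar; lra).
  assert (/ INR (d i) <= fst x - fst (al i)). { apply (Rmult_le_reg_l (INR (d i))); [lra|]. rewrite Rinv_r by lra. exact K. } lra.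
Qed.

Lemma strip_separation i j (x y : C) : (1 <= i)%nat -> (i < j)%nat -> (j <= n)%nat -> strip i x -> strip j y ->
  exp (fst (al (n - 1)%nat)) * / INR dm <= Cmod (cexp x - cexp y).
Proof.
  intros Hi Hij Hj Hx Hy. assert (A := strip_gap i x ltac:(lia) Hx). destruct (strip_between j y ltac:(lia) Hy) as [_ B]. specialize (B ltac:(lia)).
  assert (N := ln_del_neg). assert (Pf := ln_pos_facts). assert (M3 := dm_ge).
  assert (C1 : fst y <= fst (al i)). { destruct (Nat.eq_dec (j - 1) i) as [E|E]; [rewrite E in B; exact B|]. generalize (gaps i (j - 1) Hi ltac:(lia) ltac:(lia)). lra. }
  assert (C2 : fst (al (n - 1)%nat) <= fst (al i)). { destruct (Nat.eq_dec (n - 1) i) as [E|E]; [rewrite E; lra|]. generalize (gaps i (n - 1) Hi ltac:(lia) ltac:(lia)). lra. }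
  eapply Rle_trans; [|apply Cmod_sub_ge]. rewrite !Cmod_cexp.
  assert (i0 : 0 < / INR dm) by (apply Rinv_0_lt_compat; lra).
  assert (E1 : exp (fst (al i)) * (1 + / INR dm) <= exp (fst x)).
  { eapply Rle_trans; [|apply exp_le, A]. rewrite exp_plus. apply Rmult_le_compat_l; [left; apply exp_pos|]. left. apply exp_ineq1. lra. }
  assert (E2 := exp_le _ _ C1). assert (E3 := exp_le _ _ C2). nra.
Qed.

Lemma nonpole_cdiff (xi : C) i : (1 <= i <= n)%nat -> nonpole xi -> strip i xi ->
  cdiff ctrue P (cexp xi) (yprime n d a (cexp xi) * Lam i xi / (1 + C0) / cexp xi)%C.
Proof.
  intros Hi [Nd _] Hs. apply cdiff_of_lift. apply cdiff_P_log; auto.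
  intros j Hj. apply strip_tt_neq; auto.
Qed.

Theorem lifted_system : exists Rb Em rho, lifted_branches dom n Gf (eZ) P 4 be Rb Em rho.
Proof.
  assert (M3 := dm_ge).
  exists (Rabs (LK d dm l del) + 1), (INR dm), (exp (fst (al (n - 1)%nat)) * / INR dm). constructor.
  - apply (su_n H).
  - apply dom_closed.
  - intros x m Hx. apply dom_tpi, Hx.
  - apply dom_base.
  - apply dom_Re.
  - intros i x Hi Hx. apply G_maps; auto.
  - intros i x Hi Hx. apply Gf_ccont; auto.
  - intros i x y Hi Hx Hy. apply Gf_inj; auto.
  - intros i x m Hi Hx. apply Gf_equiv; auto.
  - intros i x Hi Hx. apply Gf_dev; auto.
  - intros i Hi. rewrite eZ_eset. destruct (eset_abs (S i) ltac:(lia)) as [E [E2 _]]. split; [exact E2|]. rewrite E.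
    apply d_bounds; lia.
  - split; [apply Rmult_lt_0_compat; [apply exp_pos|apply Rinv_0_lt_compat; lra]|]. intros i j x y Hi Hj Hx Hy Hd.
    destruct (Gf_spec i x Hi Hx) as [Sx _]. destruct (Gf_spec j y Hj Hy) as [Sy _].
    destruct (Nat.lt_trichotomy i j) as [L|[L|L]]; [|exact L|].
    + assert (Qa := strip_separation (S i) (S j) _ _ ltac:(lia) ltac:(lia) ltac:(lia) Sx Sy). lra.
    + assert (Qa := strip_separation (S j) (S i) _ _ ltac:(lia) ltac:(lia) ltac:(lia) Sy Sx). rewrite Cmod_sub_sym in Qa. lra.
  - intros i x Hi Hx. apply Gf_inverse; auto.
  - intros i x Hi Hx. eapply cdiff_ccont. apply (nonpole_cdiff _ (S i)); [lia|apply G_nonpole; auto|].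
    apply Gf_spec; auto.
  - apply G_shrink.
Qed.

(** * The map on the sphere *)

Let F := ext (Pformula n d a).

Definition numz (z : C) : C :=
  (NN d a (n - 1) * D1 * (if sgn n then z ^ d n else 1) * cprod (fun j => if sgn j then z ^ DD d j - a j ^ DD d j else 1) (n - 1))%C.
Definition denz (z : C) : C :=
  (((D1 - 1)%R * z ^ d 1%nat + 1) * (if sgn n then 1 else z ^ d n) * cprod (fun j => if sgn j then 1 else z ^ DD d j - a j ^ DD d j) (n - 1))%C.

Lemma N0 : (1 + C0 <> 0)%C.
Proof. apply one_C0. Qed.

Lemma yprime_ratio z : yprime n d a z = (numz z / denz z)%C.
Proof.
  rewrite yprime_eq by apply N0. unfold gfun, numz, denz. fold D1.
  assert (E : cprod (fun j => cs (sgn j) (z ^ DD d j - a j ^ DD d j)%C) (n - 1) =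
    (cprod (fun j => if sgn j then z ^ DD d j - a j ^ DD d j else 1) (n - 1) / cprod (fun j => if sgn j then 1 else z ^ DD d j - a j ^ DD d j) (n - 1))%C).
  { rewrite <- cprod_div. apply Cprod_ext. intros j _. apply cs_div. }
  rewrite E, cs_div. unfold Cdiv. rewrite !Cinv_mult. ring.
Qed.

Lemma P_ratio z : denz z <> 0%C -> P z = ((numz z + C0 * denz z) / ((1 + C0) * denz z))%C.
Proof.
  intros Hd. unfold P. rewrite (Pformula_of_yprime n d a z N0), yprime_ratio. fold C0. assert (K := N0). field. auto.
Qed.

Lemma ccont_pow_id (k : nat) z : ccont ctrue (fun z => (z ^ k)%C) z.
Proof. eapply cdiff_ccont, cdiff_pow. Qed.

Lemma ccont_pow_sub (k : nat) c z : ccont ctrue (fun z => (z ^ k - c)%C) z.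
Proof. eapply cdiff_ccont, cdiff_pow_sub. Qed.

Lemma ccont_numz z : ccont ctrue numz z.
Proof.
  unfold numz. apply (ccont_mul ctrue (fun z => (NN d a (n - 1) * D1 * (if sgn n then z ^ d n else 1))%C)).
  - apply (ccont_mul ctrue (fun _ => (NN d a (n - 1) * D1)%C)); [apply ccont_const|]. destruct (sgn n); [apply ccont_pow_id|apply ccont_const].
  - apply (ccont_cprod ctrue (fun j z => if sgn j then (z ^ DD d j - a j ^ DD d j)%C else 1%C)). intros j _. destruct (sgn j); [apply ccont_pow_sub|apply ccont_const].
Qed.

Lemma ccont_denz z : ccont ctrue denz z.
Proof.
  unfold denz. apply (ccont_mul ctrue (fun z => (((D1 - 1)%R * z ^ d 1%nat + 1) * (if sgn n then 1 else z ^ d n))%C)).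
  - apply (ccont_mul ctrue (fun z => ((D1 - 1)%R * z ^ d 1%nat + 1)%C)); [|destruct (sgn n); [apply ccont_const|apply ccont_pow_id]].
    apply (ccont_add ctrue (fun z => ((D1 - 1)%R * z ^ d 1%nat)%C) (fun _ => 1%C)); [|apply ccont_const].
    apply (ccont_mul ctrue (fun _ => RtoC (D1 - 1))); [apply ccont_const|apply ccont_pow_id].
  - apply (ccont_cprod ctrue (fun j z => if sgn j then 1%C else (z ^ DD d j - a j ^ DD d j)%C)). intros j _. destruct (sgn j); [apply ccont_const|apply ccont_pow_sub].
Qed.

Lemma D1_2 : 2 <= D1 <= INR dm.
Proof. apply D1_bounds. Qed.

Lemma D1_sub_neq : RtoC (D1 - 1) <> 0%C.
Proof. apply Cmod_pos_neq. assert (B := D1_2). rewrite Cmod_R, Rabs_pos_eq; lra. Qed.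

Lemma isolated_denz z : isolated denz z.
Proof.
  assert (Hn := su_n H). unfold denz. apply (isolated_mul (fun z => (((D1 - 1)%R * z ^ d 1%nat + 1) * (if sgn n then 1 else z ^ d n))%C)).
  - apply (isolated_mul (fun z => ((D1 - 1)%R * z ^ d 1%nat + 1)%C)).
    + destruct (isolated_pow_sub (d 1%nat) (- / (D1 - 1)%R) z) as [s [Hs T]]; [generalize (su_d H 1%nat); lia|]. exists s. split; [exact Hs|]. intros u Hu E. apply (T u Hu).
      assert (K := D1_sub_neq). replace (u ^ d 1%nat - - / (D1 - 1)%R)%C with (((D1 - 1)%R * u ^ d 1%nat + 1) / (D1 - 1)%R)%C by (field; exact K). rewrite E. unfold Cdiv. ring.
    + destruct (sgn n); [exists 1; split; [lra|intros; apply C1_nz]|]. destruct (isolated_pow_sub (d n) 0 z) as [s [Hs T]]; [generalize (su_d H n); lia|].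
      exists s. split; [exact Hs|]. intros u Hu E. apply (T u Hu). rewrite E. ring.
  - apply (isolated_cprod (fun j z => if sgn j then 1%C else (z ^ DD d j - a j ^ DD d j)%C)). intros j Hj. destruct (sgn j); [exists 1; split; [lra|intros; apply C1_nz]|].
    apply isolated_pow_sub. unfold DD. generalize (su_d H j ltac:(lia)). lia.
Qed.

Lemma factor_zero_Cmod j (z : C) : (1 <= j <= n - 1)%nat -> (z ^ DD d j - a j ^ DD d j = 0)%C -> z <> 0%C /\ (forall x, z = cexp x -> fst x = fst (al j)).
Proof.
  intros Hj E. assert (E2 : (z ^ DD d j = a j ^ DD d j)%C) by (replace (z ^ DD d j)%C with (z ^ DD d j - a j ^ DD d j + a j ^ DD d j)%C by ring; rewrite E; ring).
  assert (B := DD_bounds j Hj). split.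
  - intros ->. apply (Cpow_nz (a j) (DD d j) (a_neq_0 j Hj)). rewrite <- E2. destruct (DD d j) eqn:ED; [simpl in B; lra|]. simpl. ring.
  - intros x ->. rewrite <- (su_al H j Hj), <- !cexp_nat in E2. apply (f_equal Cmod) in E2. rewrite !Cmod_cexp in E2. apply exp_inv in E2. simpl in E2.
    apply (Rmult_eq_reg_l (INR (DD d j))); lra.
Qed.

Lemma den1_zero_Cmod (x : C) : den1 x = 0%C -> ln del < fst x.
Proof.
  intros E. apply Rnot_le_lt. intros L. assert (A := den1_near x L). rewrite E in A. replace (0 - 1)%C with (- (1))%C in A by ring. rewrite Cmod_opp, Cmod_1 in A.
  destruct del_small as [_ [_ [B _]]]. lra.
Qed.

Lemma denz_0 : if sgn n then denz 0 <> 0%C /\ numz 0 = 0%C else denz 0 = 0%C /\ numz 0 <> 0%C.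
Proof.
  assert (Hn := su_n H). assert (dn := su_d H n ltac:(lia)). assert (d1 := su_d H 1%nat ltac:(lia)).
  assert (Z : forall k, (1 <= k)%nat -> (0 ^ k = 0)%C) by (intros [|k] Hk; [lia|]; simpl; ring).
  assert (Fn : forall j, (1 <= j <= n - 1)%nat -> (0 ^ DD d j - a j ^ DD d j <> 0)%C) by (intros j Hj E; apply (factor_zero_Cmod j 0%C Hj E); reflexivity).
  unfold numz, denz. destruct (sgn n).
  - split.
    + rewrite (Z (d 1%nat)) by lia. apply Cmult_neq_0; [|apply Cprod_neq_0; intros j Hj; destruct (sgn j); [apply C1_nz|apply Fn, Hj]].
      replace (((D1 - 1)%R * 0 + 1) * 1)%C with (RtoC 1) by ring. apply C1_nz.
    + rewrite (Z (d n)) by lia. ring.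
  - split; [rewrite (Z (d n)) by lia; ring|]. apply Cmult_neq_0; [|apply Cprod_neq_0; intros j Hj; destruct (sgn j); [apply Fn, Hj|apply C1_nz]].
    rewrite Cmult_1_r. apply Cmult_neq_0; [apply NN_near|apply D1n].
Qed.

Lemma denz_cexp (x : C) : denz (cexp x) <> 0%C <-> nonpole x.
Proof.
  assert (E1 : ((D1 - 1)%R * cexp x ^ d 1%nat + 1 = den1 x)%C) by (unfold den1; fold D1; unfold D1; rewrite cexp_nat; ring).
  unfold denz. rewrite E1. split.
  - intros Hd. split; [intros E; apply Hd; rewrite E; ring|]. intros j Hj Sj E. apply Hd.
    assert (K : cprod (fun j => if sgn j then 1%C else (cexp x ^ DD d j - a j ^ DD d j)%C) (n - 1) = 0%C); [|rewrite K; ring].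
    clear - Hj Sj E. induction (n - 1)%nat as [|m IH]; [lia|]. rewrite Cprod_S. destruct (Nat.eq_dec j (S m)) as [->|Hne]; [rewrite Sj, E; ring|]. rewrite IH by lia. ring.
  - intros [Nd Nf]. repeat apply Cmult_neq_0; [exact Nd|destruct (sgn n); [apply C1_nz|apply Cpow_nz, cexp_neq_0]|].
    apply Cprod_neq_0. intros j Hj. destruct (sgn j) eqn:Sj; [apply C1_nz|]. intros E. apply (Nf j Hj Sj).
    replace (cexp x ^ DD d j)%C with (cexp x ^ DD d j - a j ^ DD d j + a j ^ DD d j)%C by ring. rewrite E. ring.
Qed.

(** Away from [0] the zeros lie on circles [|z| = |a_j|] of one parity, the poles on those of the
    other parity or at roots of [1 + (d_1 - 1) z ^ d_1]. The radii [|a_j|] are distinct and at most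
    [del], the roots have larger modulus. *)
Lemma num_den_coprime z : (numz z <> 0 \/ denz z <> 0)%C.
Proof.
  destruct (Ceq_dec z 0) as [->|Hz]; [assert (A := denz_0); destruct (sgn n); tauto|].
  destruct (cexp_surj z Hz) as [x <-]. destruct (Ceq_dec (numz (cexp x)) 0) as [En|En]; [|left; exact En]. right. apply denz_cexp.
  assert (N := ln_del_neg). assert (Pf := ln_pos_facts).
  assert (exists j, (1 <= j <= n - 1)%nat /\ sgn j = true /\ fst x = fst (al j)) as [j [Hj [Sj Ej]]].
  { unfold numz in En. destruct (Ceq_dec (cprod (fun j => if sgn j then (cexp x ^ DD d j - a j ^ DD d j)%C else 1%C) (n - 1)) 0) as [E|E].
    - destruct (cprod_eq_0 _ _ E) as [j [Hj Q0]]. destruct (sgn j) eqn:Sj; [|exfalso; exact (C1_nz Q0)]. exists j. split; [exact Hj|]. split; [exact Sj|]. apply (factor_zero_Cmod j _ Hj Q0). reflexivity.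
    - exfalso. revert En. repeat apply Cmult_neq_0; [apply NN_near|apply D1n|destruct (sgn n); [apply Cpow_nz, cexp_neq_0|apply C1_nz]|exact E]. }
  assert (Sl := sg_le j Hj). split.
  - intros E. apply den1_zero_Cmod in E. lra.
  - intros k Hk Sk E. assert (E2 : (cexp x ^ DD d k - a k ^ DD d k = 0)%C) by (rewrite E; ring). destruct (factor_zero_Cmod k _ Hk E2) as [_ E3]. specialize (E3 x eq_refl).
    destruct (Nat.lt_trichotomy j k) as [L|[L|L]]; [assert (A := gaps j k ltac:(lia) L ltac:(lia)); lra|subst k; congruence|assert (A := gaps k j ltac:(lia) L ltac:(lia)); lra].
Qed.

Lemma punct_lim_F z : punct_lim (Pformula n d a) (Fin z) (hom (numz z + C0 * denz z) ((1 + C0) * denz z)).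
Proof.
  destruct (isolated_denz z) as [s [Hs T]]. assert (K := N0).
  apply (punct_lim_hom P (fun z => (numz z + C0 * denz z)%C) (fun z => ((1 + C0) * denz z)%C) z s).
  - apply (ccont_add ctrue numz); [apply ccont_numz|]. apply (ccont_mul ctrue (fun _ => C0)); [apply ccont_const|apply ccont_denz].
  - apply (ccont_mul ctrue (fun _ => (1 + C0)%C)); [apply ccont_const|apply ccont_denz].
  - destruct (Ceq_dec (denz z) 0) as [E|E].
    + left. rewrite E. destruct (num_den_coprime z) as [A|A]; [|contradiction]. replace (numz z + C0 * 0)%C with (numz z) by ring. exact A.
    + right. apply Cmult_neq_0; auto.
  - exact Hs.
  - intros u Hu. specialize (T u Hu). split; [apply Cmult_neq_0; auto|apply P_ratio, T].
Qed.

Lemma F_Fin z : F (Fin z) = hom (numz z + C0 * denz z) ((1 + C0) * denz z).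
Proof. apply ext_eq, punct_lim_F. Qed.

Lemma F_regular z : denz z <> 0%C -> F (Fin z) = Fin (P z).
Proof. intros Hd. rewrite F_Fin, hom_Fin by (apply Cmult_neq_0; [apply N0|exact Hd]). rewrite P_ratio by exact Hd. reflexivity. Qed.

Lemma F_pole z : denz z = 0%C -> F (Fin z) = None.
Proof. intros Hd. rewrite F_Fin, Hd. unfold hom. destruct Ceq_dec as [_|E]; [reflexivity|]. exfalso. apply E. ring. Qed.

Lemma rw_cont (w : C) : Cmod (1 - w) <= 2 -> ccont ctrue r w.
Proof.
  intros Hw. destruct (rg_pert HR w Hw) as [_ [_ B]]. unfold r, rw. apply (ccont_mul ctrue (fun _ => NN d a (n - 1))); [apply ccont_const|].
  apply (ccont_cprod ctrue (fun j w => cs (sgn j) (1 - (a j * w) ^ DD d j)%C)). intros j Hj.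
  assert (A : ccont ctrue (fun w => (1 - (a j * w) ^ DD d j)%C) w).
  { eapply ccont_ext; [|apply (ccont_add ctrue (fun _ => 1%C) _ w (ccont_const _ _ _) (ccont_mul ctrue (fun _ => (- (1))%C) _ w (ccont_const _ _ _)
      (ccont_pow ctrue _ w (DD d j) (ccont_mul ctrue (fun _ => a j) (fun w => w) w (ccont_const _ _ _) (ccont_id _ _)))))]. intros y. cbv beta. ring. }
  destruct (sgn j); [exact A|]. apply (ccont_inv ctrue (fun w => (1 - (a j * w) ^ DD d j)%C)); [exact A|]. specialize (B j Hj).
  apply Cmod_pos_neq. generalize (Cmod_sub_ge 1 ((a j * w) ^ DD d j)). rewrite Cmod_1. lra.
Qed.

Lemma Q_cont (w : C) : ccont ctrue Q w.
Proof.
  unfold Q, Qw. apply (ccont_mul ctrue (fun w => (w ^ d 1%nat + (D1 - 1)%R)%C) (fun _ => (/ D1)%C)); [|apply ccont_const].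
  apply (ccont_add ctrue (fun w => (w ^ d 1%nat)%C) (fun _ => RtoC (D1 - 1))); [apply ccont_pow_id|apply ccont_const].
Qed.

Lemma Q_0 : Q 0%C <> 0%C.
Proof.
  assert (B := su_d H 1%nat ltac:(generalize (su_n H); lia)).
  assert (Z : (0 ^ d 1%nat = 0)%C) by (clear - B; destruct (d 1%nat); [lia|]; simpl; ring).
  unfold Q, Qw. rewrite Z. fold D1. replace (0 + (D1 - 1)%R)%C with (RtoC (D1 - 1)) by ring.
  unfold Cdiv. apply Cmult_neq_0; [apply D1_sub_neq|]. apply Cinv_neq_0. apply D1n.
Qed.

Lemma punct_lim_inf : punct_lim (Pformula n d a) None (hom (r 0 + C0 * Q 0) ((1 + C0) * Q 0)).
Proof.
  rewrite <- Chat_inv_0. apply punct_lim_inv. destruct (isolated_cont Q 0%C (Q_cont _) Q_0) as [s [Hs T]]. assert (K := N0).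
  assert (h : Cmod (1 - 0) <= 2) by (replace (1 - 0)%C with (RtoC 1) by ring; rewrite Cmod_1; lra).
  apply (punct_lim_hom (fun w => P (/ w)%C) (fun w => (r w + C0 * Q w)%C) (fun w => ((1 + C0) * Q w)%C) 0%C s).
  - apply (ccont_add ctrue r); [apply rw_cont, h|]. apply (ccont_mul ctrue (fun _ => C0)); [apply ccont_const|apply Q_cont].
  - apply (ccont_mul ctrue (fun _ => (1 + C0)%C)); [apply ccont_const|apply Q_cont].
  - right. apply Cmult_neq_0; [exact K|apply Q_0].
  - exact Hs.
  - intros u Hu. specialize (T u Hu). split; [apply Cmult_neq_0; auto|]. assert (un : u <> 0%C) by (apply Cmod_pos_neq; replace (u - 0)%C with u in Hu by ring; lra).
    destruct (cexp_surj (/ u)%C (Cinv_neq_0 _ un)) as [x Ex]. assert (Ew : cexp (- x) = u) by (rewrite cexp_opp, Ex; apply Cinv_inv, un).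
    assert (Nd : den1 x <> 0%C). { rewrite den1_Q, Ew. apply Cmult_neq_0; [apply Cmult_neq_0; [apply D1n|apply cexp_neq_0]|exact T]. }
    destruct (P_w x Nd) as [_ [_ E]]. rewrite Ew, Ex in E. exact E.
Qed.

Lemma F_continuous : schart F.
Proof. apply ext_continuous. intros [z|]; eexists; [apply punct_lim_F|apply punct_lim_inf]. Qed.

Lemma nonpole_of_w (x : C) : Cmod (1 - cexp (- x)) <= 2 -> Q (cexp (- x)) <> 0%C -> nonpole x.
Proof.
  intros Hw HQ. split.
  - rewrite den1_Q. apply Cmult_neq_0; [apply Cmult_neq_0; [apply D1n|apply cexp_neq_0]|exact HQ].
  - intros j Hj _ E. destruct (rg_pert HR _ Hw) as [_ [_ B]]. specialize (B j Hj).
    rewrite Cpow_mult_l, <- E, <- Cpow_mult_l, <- cexp_add in B. replace (x + - x)%C with (RtoC 0) in B by ring. rewrite cexp_0, Cpow_1_l, Cmod_1 in B. lra.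
Qed.

(** The coordinate [w = 1 / z] covers infinity and the poles together with the regular points, so
    the trapping estimate in [w] applies to the map on the sphere without exceptions. *)
Lemma F_w (w : C) : Cmod (1 - w) <= 2 -> F (Chat_inv (Fin w)) = hom (r w + C0 * Q w) ((1 + C0) * Q w).
Proof.
  intros Hw. destruct (Ceq_dec w 0) as [->|Hw0]; [rewrite Chat_inv_0; apply ext_eq, punct_lim_inf|]. rewrite Chat_inv_Fin by exact Hw0.
  destruct (cexp_surj (/ w)%C (Cinv_neq_0 _ Hw0)) as [x Ex]. assert (Ew : cexp (- x) = w) by (rewrite cexp_opp, Ex; apply Cinv_inv, Hw0). rewrite <- Ex.
  destruct (Ceq_dec (Q w) 0) as [E|E].
  - rewrite E. unfold hom. destruct Ceq_dec as [_|E0]; [|exfalso; apply E0; ring]. apply F_pole. apply NNPP. intros A. apply denz_cexp in A. apply A.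
    rewrite den1_Q, Ew. rewrite E. ring.
  - assert (Np : nonpole x) by (apply nonpole_of_w; rewrite Ew; assumption). rewrite F_regular by (apply denz_cexp, Np). rewrite hom_Fin by (apply Cmult_neq_0; [apply N0|exact E]).
    f_equal. destruct (P_w x (proj1 Np)) as [_ [_ E1]]. rewrite Ew in E1. exact E1.
Qed.

(** * The Julia set *)

Definition basin (p : Chat) : Prop := match p with Some z => ~ outer M z | None => True end.

(* [upot p = 1 / (1 - 1 / p)] is the coordinate in which the parabolic point sits at infinity. *)
Definition upot (p : Chat) : C := match p with Some z => ((z : C) / (z - 1))%C | None => 1%C end.

Lemma basin_w_coord p : basin p -> exists w : C, p = Chat_inv (Fin w) /\ w <> 1%C /\ upot p = (/ (1 - w))%C /\ 3 / 5 <= phi M (upot p).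
Proof.
  assert (HM := rg_M HR). intros Hp. destruct p as [z|].
  - assert (z1 : (z : C) <> 1%C) by (intros E; apply Hp; rewrite E; apply outer_one).
    assert (z0 : (z : C) <> 0%C) by (intros E; apply Hp; rewrite E; apply outer_small; [lra|rewrite Cmod_0; lra]).
    exists (/ (z : C))%C. split; [rewrite Chat_inv_Fin by (apply Cinv_neq_0, z0); rewrite Cinv_inv by exact z0; reflexivity|]. split.
    + intros E. apply z1. rewrite <- (Cinv_inv z z0), E. field.
    + split; [unfold upot; rewrite inv_1_sub by auto; reflexivity|]. unfold upot. apply Rnot_lt_le. intros L. apply Hp. apply outer_phi; auto; lra.
  - exists 0%C. split; [rewrite Chat_inv_0; reflexivity|]. split; [intros E; symmetry in E; exact (C1_nz E)|]. split; [unfold upot; field; replace (1 - 0)%C with (RtoC 1) by ring; apply C1_nz|].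
    generalize (phi_ge_Re M (upot None)). simpl. lra.
Qed.

Lemma basin_forward p : basin p -> basin (F p) /\ phi M (upot p) + / 4 <= phi M (upot (F p)).
Proof.
  intros Hp. assert (HM := rg_M HR). destruct (basin_w_coord p Hp) as [w [Ew [Hw [Eu Hphi]]]]. rewrite Eu in *.
  destruct (basin_w w Hw Hphi) as [B1 [B2 B3]]. rewrite Ew. rewrite (F_w w B1).
  assert (K := N0). destruct (Ceq_dec (Q w) 0) as [E|E].
  - rewrite E in *. unfold hom. destruct Ceq_dec as [_|E0]; [|exfalso; apply E0; ring]. split; [exact I|]. unfold upot.
    replace ((r w + C0 * 0) / (r w - 0))%C with (RtoC 1) in B3; [exact B3|]. replace (r w - 0)%C with (r w) in B2 by ring. field. exact B2.
  - rewrite hom_Fin by (apply Cmult_neq_0; auto). destruct (u_image (r w) (Q w) K E B2) as [U1 U2]. unfold upot. rewrite U2. split; [|exact B3].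
    intros Ho. apply outer_phi in Ho; [|lra|exact U1]. rewrite U2 in Ho. lra.
Qed.

Lemma basin_iter k p : basin p -> basin (Nat.iter k F p) /\ 3 / 5 + INR k / 4 <= phi M (upot (Nat.iter k F p)).
Proof.
  intros Hp. induction k as [|k [I1 I2]].
  - simpl. split; [exact Hp|]. destruct (basin_w_coord p Hp) as [w [_ [_ [_ A]]]]. lra.
  - destruct (basin_forward _ I1) as [A B]. change (Nat.iter (S k) F p) with (F (Nat.iter k F p)). split; [exact A|]. rewrite S_INR. lra.
Qed.

Lemma phi_le_Cmod u : phi M u <= 2 * Cmod u.
Proof.
  assert (HM := rg_M HR). unfold phi. assert (A := fst_le_Cmod u). assert (B := snd_le_Cmod u). assert (A2 := Rle_abs (fst u)). assert (B2 := Rabs_pos (snd u)).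
  apply Rle_trans with (Cmod u + Cmod u); [|lra]. apply Rplus_le_compat; [lra|]. apply Rmax_lub; lra.
Qed.

(** [phi] of the coordinate [u] grows by [1 / 4] at each step, at a rate independent of the point,
    and is at most [2 |u|]. So [u] tends to infinity uniformly, which means convergence to [1]. *)
Lemma basin_attraction e : 0 < e -> exists N, forall p k, basin p -> (N <= k)%nat -> dchord (Nat.iter k F p) (Fin (RtoC 1)) < e.
Proof.
  intros He. destruct (INR_unbounded (8 * (2 + 4 / e))) as [N HN]. exists N. intros p k Hp Hk. destruct (basin_iter k p Hp) as [A B].
  assert (INR N <= INR k) by (apply le_INR; exact Hk). set (q := Nat.iter k F p) in *. assert (U := phi_le_Cmod (upot q)).
  assert (ee : 0 < 4 / e) by (apply Rdiv_lt_0_compat; lra). assert (V : 2 + 4 / e < Cmod (upot q)) by lra. destruct q as [z|]; [|unfold upot in V; rewrite Cmod_1 in V; lra].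
  unfold upot in V. assert (z1 : (z : C) <> 1%C) by (intros E; apply A; rewrite E; apply outer_one). assert (zn : ((z : C) - 1 <> 0)%C) by (intros E; apply z1; replace (z : C) with (z - 1 + 1)%C by ring; rewrite E; ring).
  assert (c0 : 0 < Cmod ((z : C) - 1)) by (apply Cmod_gt_0, zn).
  assert (W : Cmod ((z : C) / (z - 1)) <= 1 + / Cmod ((z : C) - 1)).
  { replace ((z : C) / (z - 1))%C with (1 + / (z - 1))%C by (field; exact zn). eapply Rle_trans; [apply Cmod_triangle|]. rewrite Cmod_1, Cmod_inv by exact zn. lra. }
  assert (Y : Cmod ((z : C) - 1) < e / 4).
  { rewrite <- (Rinv_inv (Cmod ((z : C) - 1))). replace (e / 4) with (/ (4 / e)) by (field; lra). apply Rinv_lt_contravar; [|lra]. apply Rmult_lt_0_compat; [exact ee|apply Rinv_0_lt_compat, c0]. }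
  eapply Rle_lt_trans; [apply dchord_le|]. lra.
Qed.

Lemma basin_open : sopen basin.
Proof.
  intros [z|] Hp.
  - destruct (not_outer_open M z Hp) as [e [He T]]. destruct (dchord_near_finite z e He) as [s [Hs V]]. exists s. split; [exact Hs|]. intros p' Hp'.
    destruct (V p' Hp') as [w [-> Hw]]. apply T, Hw.
  - exists (1 / 2). split; [lra|]. intros [z|] Hd; [|exact I]. intros Ho. apply outer_bounds in Ho.
    assert (A := dchord_sq_None z). rewrite dchord_sym in Hd. assert (c0 := Cmod_ge_0 z). assert (B := dchord_ge_0 (Fin z) None).
    assert (1 <= 4 / (1 + Cmod z ^ 2)) by (apply (Rle_div_r 1); nra). nra.
Qed.

Lemma basin_stable p : basin p -> stable_at F p.
Proof. apply (stable_of_attraction F basin (Fin (RtoC 1))); [apply F_continuous|apply basin_open|apply basin_attraction]. Qed.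

(** * The disc around the origin *)

Definition inner (p : Chat) : Prop := exists z : C, p = Fin z /\ Cmod z < rho.

Lemma rh_pos : 0 < rho /\ rho <= del.
Proof. destruct rho_facts as [A [B _]]. auto. Qed.

Lemma inner_open : sopen inner.
Proof.
  intros p [z [-> Hz]]. destruct (dchord_near_finite z (rho - Cmod z) ltac:(lra)) as [s [Hs V]]. exists s. split; [exact Hs|]. intros p' Hp'.
  destruct (V p' Hp') as [w [-> Hw]]. exists w. split; [reflexivity|]. generalize (Cmod_sub_ge w z). lra.
Qed.

Lemma fst_of_Cmod (x : C) : Cmod (cexp x) < rho -> fst x <= LK d dm l del.
Proof. rewrite Cmod_cexp. unfold rho. intros L. apply exp_lt_inv in L. lra. Qed.

Lemma inner_even p : sgn n = false -> inner p -> basin (F p).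
Proof.
  intros En [z [-> Hz]]. destruct (Ceq_dec (denz z) 0) as [E|E]; [rewrite F_pole by exact E; exact I|].
  rewrite F_regular by exact E. destruct (Ceq_dec z 0) as [->|Hz0].
  - exfalso. apply E. assert (A := denz_0). rewrite En in A. apply A.
  - destruct (cexp_surj z Hz0) as [x <-]. apply denz_cexp in E. assert (T := trap_inner x E (fst_of_Cmod x Hz)). rewrite En in T.
    intros Ho. apply outer_bounds in Ho. lra.
Qed.

Section Odd.
Hypothesis En : sgn n = true.

(** As [d_n >= 2], the monomial is bounded by a multiple of [|z| ^ 2] on the disc. That yields the
    derivative [0] at the origin and, together with [inner_Lam], a derivative of modulus at most
    [1 / 2] elsewhere. *)
Lemma inner_lam_odd (x : C) : fst x <= LK d dm l del -> lam n (fst x) <= LK d dm l del - ln 2 /\ exp (lam n (fst x)) <= del / 4 * (Cmod (cexp x) * Cmod (cexp x) / rho).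
Proof.
  intros Hx. assert (L := inner_lam _ Hx). rewrite En in L. assert (Hn := su_n H). assert (N := ln_del_neg). assert (Pf := ln_pos_facts).
  assert (Bd := d_bounds n ltac:(lia)). split; [nra|].
  assert (d0 := su_del H).
  apply Rle_trans with (exp (ln del - ln 4 + (fst x + fst x - LK d dm l del))); [apply exp_le; nra|].
  unfold Rminus. rewrite !exp_plus, !exp_Ropp, !exp_ln, Cmod_cexp by lra. unfold rho. right. field. apply Rgt_not_eq, exp_pos.
Qed.

Lemma inner_facts (x : C) : fst x <= LK d dm l del -> nonpole x /\ (forall j, (1 <= j <= n - 1)%nat -> Cmod (tt d al n j x) <= del) /\
  Cmod (yprime n d a (cexp x)) <= del / 2 * (Cmod (cexp x) * Cmod (cexp x) / rho) /\ Cmod (P (cexp x)) <= 7 / 10 * rho.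
Proof.
  intros Hx. destruct (inner_lam_odd x Hx) as [L1 L2]. assert (Hn := su_n H). assert (B := inner_between _ Hx).
  destruct (zone_zero n x ltac:(lia) B L1) as [Z1 [Z2 [_ Z4]]].
  assert (Hns : forall j, (1 <= j <= n - 1)%nat -> Cmod (tt d al n j x) <= del).
  { intros j Hj. apply tt_nonzero_small; auto; [lia| |unfold zidx; rewrite En; lia].
    destruct Lc_pos as [_ [_ Lc0]]. unfold LK in L1. destruct Lcl. assert (Pf := ln_pos_facts). lra. }
  split; [split; [exact Z1|]|split; [exact Hns|split; [|exact Z4]]].
  - intros j Hj Sj. apply (factor_neq n j x Hj), Z2; auto.
  - destruct four_n_del as [F1 F2]. assert (d0 := su_del H). destruct NN_near as [N1 _].
    destruct (cprod_split sgn (fun j => tt d al n j x) 0 (n - 1) del) as [E [HE Heq]]; [lra|lra|intros; apply Hns; auto|].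
    assert (Hs : sprod d al n (n - 1) x = E) by (unfold sprod; rewrite Heq; simpl; ring).
    destruct del_small as [_ [_ [S3 _]]].
    assert (Dn := den1_near x). assert (LKd := su_LK H). specialize (Dn ltac:(lra)).
    destruct (Cmod_near_1 _ _ Dn) as [Dl _]. destruct (Cmod_near_1 _ _ N1) as [_ Nu]. destruct (Cmod_near_1 _ _ HE) as [_ Eu].
    rewrite (yprime_abs n x) by (auto; lia). rewrite Hs. assert (t0 := exp_pos (lam n (fst x))). assert (n0 := Cmod_ge_0 (NN d a (n - 1))).
    apply Rle_div_l; [lra|]. assert (Cmod (NN d a (n - 1)) * Cmod E <= 11 / 10) by nra.
    set (t := exp (lam n (fst x))) in *. set (q := del / 2 * (Cmod (cexp x) * Cmod (cexp x) / rho)). assert (q1 : 2 * t <= q) by (unfold q; lra).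
    replace (Cmod (NN d a (n - 1)) * t * Cmod E) with (Cmod (NN d a (n - 1)) * Cmod E * t) by ring. nra.
Qed.

Lemma inner_Lam (x : C) : fst x <= LK d dm l del -> Cmod (Lam n x) <= INR dm + 2.
Proof.
  intros Hx. destruct (inner_facts x Hx) as [[Nd _] [Hns _]]. assert (Hn := su_n H). assert (d0 := su_del H). destruct del_small as [S1 [S2 [S3 [S4 [S5 _]]]]].
  assert (N2 := n_ge). assert (B := D1_bounds).
  assert (LKd := su_LK H). assert (Dn := den1_near x ltac:(lra)). destruct (Cmod_near_1 _ _ Dn) as [Dl _].
  assert (T := csumf_split (fun j => ldl d al n j x) 0 (n - 1) (2 * INR dm * (del * (9 / 8)))). simpl andb in T. cbv iota in T.
  assert (T1 : Cmod (csumf (fun j => ldl d al n j x) (n - 1) - 0) <= INR (n - 1) * (2 * INR dm * (del * (9 / 8)))).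
  { apply T; [nra|]. intros j Hj _. apply ldl_bound; [exact Hj|apply Hns, Hj|lra]. }
  assert (T2 : INR (n - 1) * (2 * INR dm * (del * (9 / 8))) <= 1).
  { assert (INR (n - 1) <= INR n) by (apply le_INR; lia). assert (0 < INR dm * del) by nra. nra. }
  unfold Lam. set (S0 := csumf (fun j => ldl d al n j x) (n - 1)) in *. replace (S0 - 0)%C with S0 in T1 by ring.
  destruct (eset_abs n ltac:(lia)) as [Ee _].
  replace (INR dm + 2) with (INR dm + 1 + 1) by ring. apply Cmod_sub_le; [apply Cmod_add_le; [rewrite Cmod_R, Ee; apply d_bounds; lia|lra]|].
  apply Rle_trans with (/ 2 / / 2); [|right; field]. apply Cmod_div_le; [|lra].
  replace ((D1 - 1)%R * D1 * cexp (D1 * x))%C with (D1 * (den1 x - 1))%C by (unfold den1; fold D1; ring).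
  apply Rle_trans with (INR dm * (INR dm * del)); [apply Cmod_mult_le; [rewrite Cmod_RtoC_pos; lra|exact Dn]|].
  nra.
Qed.

Lemma P_at_0 : P 0%C = (C0 / (1 + C0))%C /\ denz 0%C <> 0%C.
Proof.
  assert (A := denz_0). rewrite En in A. destruct A as [A1 A2]. split; [|exact A1].
  assert (E := P_ratio 0%C A1). rewrite E, A2. assert (K := N0). field. auto.
Qed.

Lemma inner_cdiff (z : C) : Cmod z < rho -> denz z <> 0%C /\ Cmod (P z) <= 7 / 10 * rho /\ exists m, cdiff ctrue P z m /\ Cmod m <= / 2.
Proof.
  intros Hz. destruct one_C0 as [K [K1 K2]]. destruct rh_pos as [r0 r1]. destruct del_small as [_ [_ [S3 [S4 _]]]].
  destruct (Ceq_dec z 0) as [->|Hz0].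
  - destruct P_at_0 as [E1 E2]. split; [exact E2|]. split.
    + rewrite E1. destruct C0_small as [S1 _].
      apply Rle_trans with (del * rho / (99 / 100)); [apply Cmod_div_le; [exact S1|lra]|]. assert (del * rho <= / 54000 * rho) by (apply Rmult_le_compat_r; lra). lra.
    (* The origin has no logarithm; the quadratic bound on [yprime] gives the derivative there
       directly. *)
    + exists 0%C. split; [|rewrite Cmod_0; lra]. intros e He. exists (Rmin rho (e * rho)). split; [apply Rmin_pos; [exact r0|apply Rmult_lt_0_compat; lra]|]. intros y _ Hy.
      replace (y - 0)%C with y in * by ring. assert (Y1 := Rlt_le_trans _ _ _ Hy (Rmin_l _ _)). assert (Y2 := Rlt_le_trans _ _ _ Hy (Rmin_r _ _)).
      destruct (Ceq_dec y 0) as [->|Hy0]; [replace (P 0%C - P 0%C - 0 * 0)%C with (RtoC 0) by ring; rewrite Cmod_0; lra|].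
      destruct (cexp_surj y Hy0) as [x Ex]. assert (Hx : fst x <= LK d dm l del) by (apply fst_of_Cmod; rewrite Ex; exact Y1).
      destruct (inner_facts x Hx) as [_ [_ [Yb _]]]. rewrite Ex in Yb.
      replace (P y - P 0%C - 0 * y)%C with (yprime n d a y / (1 + C0))%C.
      2: { rewrite E1. unfold P. rewrite (Pformula_of_yprime n d a y K). fold C0. field. exact K. }
      apply Rle_trans with (del / 2 * (Cmod y * Cmod y / rho) / (99 / 100)); [apply Cmod_div_le; [exact Yb|lra]|].
      assert (y0 := Cmod_ge_0 y). assert (Cmod y / rho <= e) by (apply Rle_div_l; lra). assert (0 <= Cmod y / rho) by (apply Rdiv_le_0_compat; lra).
      replace (del / 2 * (Cmod y * Cmod y / rho) / (99 / 100)) with (del * (50 / 99) * (Cmod y * (Cmod y / rho))) by (field; lra).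
      assert (0 <= Cmod y * (Cmod y / rho)) by (apply Rmult_le_pos; lra). nra.
  - destruct (cexp_surj z Hz0) as [x Ex]. assert (Hx : fst x <= LK d dm l del) by (apply fst_of_Cmod; rewrite Ex; exact Hz).
    destruct (inner_facts x Hx) as [Np [Hns [Yb Pb]]]. rewrite Ex in Yb, Pb. split; [rewrite <- Ex; apply denz_cexp, Np|]. split; [exact Pb|].
    exists (yprime n d a (cexp x) * Lam n x / (1 + C0) / cexp x)%C. split.
    + rewrite <- Ex. apply (cdiff_of_lift P). apply cdiff_P_log; [generalize (su_n H); lia|apply Np|].
      intros j Hj. apply Cmod_pos_neq. specialize (Hns j Hj). generalize (Cmod_sub_ge 1 (tt d al n j x)). rewrite Cmod_1. lra.
    + assert (La := inner_Lam x Hx). rewrite Ex. rewrite Cmod_div by exact Hz0. assert (z0 : 0 < Cmod z) by (apply Cmod_gt_0, Hz0). apply Rle_div_l; [exact z0|].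
      apply Rle_trans with (del / 2 * (Cmod z * Cmod z / rho) * (INR dm + 2) / (99 / 100)); [apply Cmod_div_le; [apply Cmod_mult_le; [exact Yb|exact La]|lra]|].
      assert (Cmod z / rho <= 1) by (apply Rle_div_l; lra). assert (0 <= Cmod z / rho) by (apply Rdiv_le_0_compat; lra).
      replace (del / 2 * (Cmod z * Cmod z / rho) * (INR dm + 2) / (99 / 100)) with (50 / 99 * (INR dm * del + 2 * del) * (Cmod z * (Cmod z / rho))) by (field; lra).
      assert (0 <= Cmod z * (Cmod z / rho)) by (apply Rmult_le_pos; lra). nra.
Qed.

Lemma inner_contraction (z w : C) : Cmod z < rho -> Cmod w < rho -> Cmod (P w - P z) <= / 2 * Cmod (w - z).
Proof.
  intros Hz Hw.
  assert (Hseg : forall t, 0 <= t <= 1 -> Cmod (seg z w t) < rho).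
  { intros t Ht. unfold seg. replace (z + t * (w - z))%C with ((1 - t)%R * z + t * w)%C by (rewrite RtoC_minus; ring).
    eapply Rle_lt_trans; [apply Cmod_triangle|]. rewrite !Cmod_mult, !Cmod_RtoC_pos by lra. destruct (Req_dec t 0) as [->|T]; [lra|nra]. }
  set (df := fun t => epsilon (inhabits (RtoC 0)) (fun m => cdiff ctrue P (seg z w t) m /\ Cmod m <= / 2)).
  assert (Hdf : forall t, 0 <= t <= 1 -> cdiff ctrue P (seg z w t) (df t) /\ Cmod (df t) <= / 2).
  { intros t Ht. unfold df. apply epsilon_spec. apply (inner_cdiff _ (Hseg t Ht)). }
  apply (mean_value ctrue P df z w (/ 2)); [intros; exact I| |]; intros t Ht; apply Hdf, Ht.
Qed.

Lemma inner_odd_step (z : C) : Cmod z < rho -> F (Fin z) = Fin (P z) /\ Cmod (P z) < rho.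
Proof. intros Hz. destruct (inner_cdiff z Hz) as [A [B _]]. split; [apply F_regular, A|]. destruct rh_pos. lra. Qed.

Lemma inner_iter k (z w : C) : Cmod z < rho -> Cmod w < rho -> exists z' w' : C, Nat.iter k F (Fin z) = Fin z' /\ Nat.iter k F (Fin w) = Fin w' /\
  Cmod z' < rho /\ Cmod w' < rho /\ Cmod (w' - z') <= Cmod (w - z).
Proof.
  intros Hz Hw. induction k as [|k [z' [w' [E1 [E2 [B1 [B2 B3]]]]]]]; [exists z, w; simpl; repeat split; auto; lra|].
  exists (P z'), (P w'). change (Nat.iter (S k) F (Fin z)) with (F (Nat.iter k F (Fin z))). change (Nat.iter (S k) F (Fin w)) with (F (Nat.iter k F (Fin w))). rewrite E1, E2.
  destruct (inner_odd_step z' B1) as [-> C1]. destruct (inner_odd_step w' B2) as [-> C2]. repeat split; auto. assert (A := inner_contraction z' w' B1 B2). assert (c0 := Cmod_ge_0 (w' - z')). lra.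
Qed.

Lemma inner_stable p : inner p -> stable_at F p.
Proof.
  intros [z [-> Hz]] e He. destruct (dchord_near_finite z (Rmin (rho - Cmod z) (e / 2)) ltac:(apply Rmin_pos; lra)) as [s [Hs V]]. exists s. split; [exact Hs|]. intros p' Hp' k.
  destruct (V p' Hp') as [w [-> Hw]]. assert (W1 := Rlt_le_trans _ _ _ Hw (Rmin_l _ _)). assert (W2 := Rlt_le_trans _ _ _ Hw (Rmin_r _ _)).
  destruct (inner_iter k z w Hz) as [z' [w' [E1 [E2 [_ [_ B]]]]]]; [generalize (Cmod_sub_ge w z); lra|]. rewrite E1, E2. eapply Rle_lt_trans; [apply dchord_le|]. rewrite Cmod_sub_sym. lra.
Qed.
End Odd.

(** Orbits that meet the trapping region or the inner disc; all others stay in the target annulus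
    forever and are coded. *)
Definition escaping (p : Chat) : Prop := exists k, basin (Nat.iter k F p) \/ inner (Nat.iter k F p).

Lemma escaping_fatou p : escaping p -> in_fatou F p.
Proof.
  assert (Fc := F_continuous). intros [k [Hb|Hi]].
  - exact (fatou_of_stable F basin k p Fc basin_open basin_stable Hb).
  - destruct (sgn n) eqn:En.
    + exact (fatou_of_stable F inner k p Fc inner_open (inner_stable En) Hi).
    + apply (fatou_of_stable F basin (S k) p Fc basin_open basin_stable). apply inner_even; assumption.
Qed.

Lemma dom_of_not_escaping (x : C) : ~ escaping (Fin (cexp x)) -> dom x.
Proof.
  intros Hn. split.
  - apply NNPP. intros Ho. apply Hn. exists 0%nat. left. exact Ho.
  - apply Rnot_lt_le. intros L. apply Hn. exists 0%nat. right. exists (cexp x). split; [reflexivity|]. rewrite Cmod_cexp. unfold rho. apply exp_increasing, L.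
Qed.

Lemma not_escaping_step (x : C) : ~ escaping (Fin (cexp x)) -> exists i x', (i < n)%nat /\ ~ escaping (Fin (cexp x')) /\ x = Gf i x' /\ F (Fin (cexp x)) = Fin (cexp x').
Proof.
  intros Hn.
  assert (Hn2 : ~ escaping (F (Fin (cexp x)))).
  { intros [k Hk]. apply Hn. exists (S k). replace (S k) with (k + 1)%nat by lia. rewrite iter_add. exact Hk. }
  destruct (Ceq_dec (denz (cexp x)) 0) as [E|E].
  - exfalso. apply Hn2. exists 0%nat. left. simpl. rewrite F_pole by exact E. exact I.
  - rewrite F_regular in Hn2 |- * by exact E. unfold P in Hn2 |- *. apply denz_cexp in E.
    assert (Pn : (Pformula n d a (cexp x) : C) <> 0%C).
    { intros E0. apply Hn2. exists 0%nat. right. exists 0%C. simpl. rewrite E0. split; [reflexivity|]. rewrite Cmod_0. apply rh_pos. }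
    destruct (cexp_surj _ Pn) as [y Ey]. rewrite <- Ey in Hn2. assert (Hy := dom_of_not_escaping y Hn2).
    destruct (strip_of_image x y E (eq_sym Ey) Hy) as [i [Hi Hs]].
    destruct (Gf_complete i x y Hi Hs Hy (proj1 E) (eq_sym Ey)) as [m Em].
    exists i, (y + tpi m)%C. rewrite cexp_add_tpi. split; [exact Hi|]. split; [exact Hn2|]. split; [exact Em|]. rewrite Ey. reflexivity.
Qed.

(** [not_escaping_step] chooses the lift of the image so that [x] is exactly a branch value at it,
    without a remaining period; iterating a choice function then yields a whole lifted orbit. *)
Lemma not_escaping_limset p : ~ escaping p -> exists z, p = Fin z /\ limset dom n Gf z.
Proof.
  intros Hn. destruct p as [z|]; [|exfalso; apply Hn; exists 0%nat; left; exact I]. exists z. split; [reflexivity|].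
  assert (Hz : (z : C) <> 0%C). { intros E. apply Hn. exists 0%nat. right. exists 0%C. rewrite E. split; [reflexivity|]. rewrite Cmod_0. apply rh_pos. }
  destruct (cexp_surj z Hz) as [x0 Ex]. rewrite <- Ex in *.
  set (nx := fun x : C => epsilon (inhabits (0%nat, RtoC 0)) (fun q : nat * C => (fst q < n)%nat /\ ~ escaping (Fin (cexp (snd q))) /\ x = Gf (fst q) (snd q))).
  assert (Hnx : forall x, ~ escaping (Fin (cexp x)) -> (fst (nx x) < n)%nat /\ ~ escaping (Fin (cexp (snd (nx x)))) /\ x = Gf (fst (nx x)) (snd (nx x))).
  { intros x Hx. unfold nx. apply epsilon_spec. destruct (not_escaping_step x Hx) as [i [x' [A [B [C _]]]]]. exists (i, x'). auto. }
  set (xi := fun k => Nat.iter k (fun x => snd (nx x)) x0).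
  assert (Hxi : forall k, ~ escaping (Fin (cexp (xi k)))). { induction k as [|k IH]; [exact Hn|]. exact (proj1 (proj2 (Hnx _ IH))). }
  exists (fun k => fst (nx (xi k))), xi. split; [intros k; apply (Hnx _ (Hxi k))|]. split; [intros k; apply dom_of_not_escaping, Hxi|]. split; [|reflexivity].
  intros k. exact (proj2 (proj2 (Hnx _ (Hxi k)))).
Qed.

Lemma F_G i x : (i < n)%nat -> dom x -> F (Fin (cexp (Gf i x))) = Fin (cexp x).
Proof.
  intros Hi Hx. rewrite F_regular by (apply denz_cexp, G_nonpole; auto). f_equal. apply Gf_inverse; auto.
Qed.

Lemma F_wcomp k om x : word n om -> dom x -> dom (wcomp Gf k om x) /\ Nat.iter k F (Fin (cexp (wcomp Gf k om x))) = Fin (cexp x).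
Proof.
  revert om. induction k as [|k IH]; intros om Hw Hx; [split; [exact Hx|reflexivity]|]. destruct (IH (shiftn 1 om) (word_shiftn _ _ _ Hw) Hx) as [A B].
  cbn [wcomp]. split; [apply G_maps; auto|]. replace (S k) with (k + 1)%nat by lia. rewrite iter_add.
  change (Nat.iter 1 F (Fin (cexp (Gf (om 0%nat) (wcomp Gf k (shiftn 1 om) x))))) with (F (Fin (cexp (Gf (om 0%nat) (wcomp Gf k (shiftn 1 om) x))))). rewrite F_G; auto.
Qed.

Lemma cexp_half_turn (s t : R) : cexp (s, t + PI) = (- cexp (s, t))%C.
Proof. unfold cexp. simpl. rewrite neg_cos, neg_sin. apply Ceq_components; simpl; ring. Qed.

(* The two points [(1/2) e^{it}] and [-(1/2) e^{it}] are pulled back arbitrarily close to each other. *)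
Lemma limset_julia (z : C) : limset dom n Gf z -> julia F (Fin z).
Proof.
  intros [om [xi [Hw [HX [Hrec Hz]]]]] [del0 [Hdel0 Hf]].
  specialize (Hf (Fin z)). rewrite dchord_refl in Hf. specialize (Hf Hdel0 (/ 5) ltac:(lra)). destruct Hf as [eta [Heta Hf]].
  destruct lifted_system as [Rb [Em [rr Sys]]].
  destruct (ccont_cexp ctrue (xi 0%nat) (eta / 2) ltac:(lra)) as [s [Hs T]].
  destruct (G_shrink (Rb + Rabs be + PI) (s / 2) ltac:(lra)) as [N HN].
  set (t := snd (xi N)).
  assert (K : forall t', Rabs (t' - t) <= PI -> Cmod (cexp (be, t') - cexp (xi N)) < / 2).
  { intros t' Ht'. assert (Hb : dom (be, t')) by apply (lb_base Sys).
    assert (D : Cmod ((be, t') - xi N) <= Rb + Rabs be + PI).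
    { eapply Rle_trans; [apply Cmod_le_sum|]. assert (A := lb_Re Sys (xi N) (HX N)). simpl. fold t. unfold Rminus in Ht'.
      assert (Rabs (be + - fst (xi N)) <= Rabs be + Rabs (fst (xi N))) by (eapply Rle_trans; [apply Rabs_triang|]; rewrite Rabs_Ropp; lra). lra. }
    assert (E := HN N om (be, t') (xi N) (Nat.le_refl _) Hw Hb (HX N) D). rewrite <- (orbit_wcomp Gf om xi N Hrec) in E.
    destruct (F_wcomp N om (be, t') Hw Hb) as [_ F1]. destruct (F_wcomp N om (xi N) Hw (HX N)) as [_ F2]. rewrite <- (orbit_wcomp Gf om xi N Hrec), <- Hz in F2.
    assert (E2 : dchord (Fin z) (Fin (cexp (wcomp Gf N om (be, t')))) < eta).
    { eapply Rle_lt_trans; [apply dchord_le|]. rewrite Cmod_sub_sym, Hz. assert (Cmod (cexp (wcomp Gf N om (be, t')) - cexp (xi 0%nat)) < eta / 2) by (apply T; [exact I|fold Gf in E; lra]). lra. }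
    specialize (Hf _ E2 N). rewrite F1, F2 in Hf.
    destruct (dom_bounds _ Hb) as [[_ B1] _]. destruct (dom_bounds _ (HX N)) as [[_ B2] _].
    assert (Z := dchord_ge (3 / 2) (cexp (xi N)) (cexp (be, t')) B2 B1). rewrite Cmod_sub_sym. lra. }
  assert (PI0 := PI_RGT_0). assert (A1 := K t ltac:(rewrite Rminus_diag, Rabs_R0; lra)). assert (A2 := K (t + PI) ltac:(replace (t + PI - t) with PI by ring; rewrite Rabs_pos_eq; lra)).
  rewrite cexp_half_turn in A2. set (v := cexp (be, t)) in *. set (c := cexp (xi N)) in *.
  assert (V : Cmod v = / 2). { unfold v. rewrite Cmod_cexp. simpl. unfold be. rewrite exp_Ropp, exp_ln by lra. reflexivity. }
  assert (B := Cmod_tri_sub (v - c) (- v - c)). replace (v - c - (- v - c))%C with (RtoC 2 * v)%C in B by ring. rewrite Cmod_mult, V, Cmod_RtoC_pos in B by lra. lra.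
Qed.

Theorem julia_cantor_circles : cantor_set_of_circles (julia F).
Proof.
  destruct lifted_system as [Rb [Em [rr Sys]]].
  apply (cantor_circles_iff (fun p => exists z, p = Fin z /\ limset dom n Gf z)); [|exact (limset_cantor_circles _ _ _ _ _ _ _ _ _ _ Sys)].
  intros p. split.
  - intros [z [-> Hz]]. apply limset_julia, Hz.
  - intros Hj. apply not_escaping_limset. intros He. apply Hj, escaping_fatou, He.
Qed.

(** * Multipliers and the uniqueness of the parabolic fixed point *)

Lemma F_near (z : C) : denz z <> 0%C -> exists s, 0 < s /\ forall u : C, Cmod (u - z) < s -> P u = chart_val (F (Fin u)).
Proof.
  intros Hd. destruct (ccont_denz z (Cmod (denz z)) ltac:(apply Cmod_gt_0, Hd)) as [s [Hs T]]. exists s. split; [exact Hs|]. intros u Hu.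
  rewrite F_regular; [reflexivity|]. intros E. specialize (T u I Hu). rewrite E, Cmod_sub_sym in T. replace (denz z - 0)%C with (denz z) in T by ring. lra.
Qed.

Lemma multiplier_of_cdiff (z m : C) : denz z <> 0%C -> cdiff ctrue P z m -> is_multiplier F (Fin z) m /\ forall m', is_multiplier F (Fin z) m' -> m' = m.
Proof.
  intros Hd Hm. destruct (F_near z Hd) as [s [Hs T]]. assert (A : cdiff ctrue (fun u => chart_val (F (Fin u))) z m) by (apply (cdiff_local P _ z m s Hs T Hm)). split.
  - apply Cderiv_cdiff, A.
  - intros m' Hm'. apply Cderiv_cdiff in Hm'. exact (cdiff_unique _ _ _ _ Hm' A).
Qed.

Lemma strip_multiplier i (x m : C) : (1 <= i <= n)%nat -> nonpole x -> strip i x -> is_multiplier F (Fin (cexp x)) m ->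
  m = (yprime n d a (cexp x) * Lam i x / (1 + C0) / cexp x)%C.
Proof.
  intros Hi Np Hs. apply multiplier_of_cdiff; [apply denz_cexp, Np|]. apply (nonpole_cdiff x i Hi Np Hs).
Qed.

(** At [w = 1] one has [r = Q = 1] and [Lam = d_1 + C0 - (d_1 - 1) = 1 + C0], which cancels the
    denominator [1 + C0] in the derivative of [P]. *)
Theorem parabolic_at_1 : F (Fin (RtoC 1)) = Fin (RtoC 1) /\ is_multiplier F (Fin (RtoC 1)) (RtoC 1).
Proof.
  destruct parabolic_values as [R1 [Q1 T1]]. assert (K := N0).
  assert (E0 : cexp (- 0) = 1%C) by (replace (- 0)%C with (RtoC 0) by ring; apply cexp_0).
  assert (Np : nonpole 0%C).
  { apply nonpole_of_w; rewrite E0; [replace (1 - 1)%C with (RtoC 0) by ring; rewrite Cmod_0; lra|]. rewrite Q1. apply C1_nz. }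
  assert (Dn : denz 1%C <> 0%C) by (rewrite <- cexp_0; apply denz_cexp, Np).
  destruct (P_w 0%C (proj1 Np)) as [_ [Y1 P1]]. rewrite E0, cexp_0, R1, Q1 in Y1, P1.
  split.
  - rewrite F_regular by exact Dn. assert (P2 : ((1 + C0 * 1) / ((1 + C0) * 1) = 1)%C) by (field; exact K). rewrite P2 in P1. exact (f_equal Fin P1).
  - apply (multiplier_of_cdiff 1%C 1%C Dn). assert (La := Lam_w 0%C (proj1 Np)). rewrite E0, T1, Q1 in La.
    assert (S1 : strip 1 0%C).
    { split; [|left; reflexivity]. rewrite lam_1. simpl. rewrite Rmult_0_r. assert (B := D1_bounds).
      assert (0 <= ln D1) by (rewrite <- ln_1; apply ln_le; lra). assert (A := su_LK H). assert (N := ln_del_neg). assert (Pf := ln_pos_facts). lra. }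
    assert (A := nonpole_cdiff 0%C 1 ltac:(generalize (su_n H); lia) Np S1). rewrite cexp_0, Y1, La in A.
    eapply cdiff_ext; [reflexivity| |exact A]. rewrite RtoC_minus. field. exact K.
Qed.

(** A parabolic multiplier has modulus [1]. The basin contains no fixed point since [phi] grows; the
    inner disc is contracted or mapped into the basin. At a fixed point in the annulus the
    multiplier is the logarithmic derivative [Lf], whose modulus exceeds [1] except at the point
    [1]. *)
Theorem parabolic_unique p : is_parabolic_fixed F p -> p = Fin (RtoC 1).
Proof.
  intros [Ep [m [Hm [k [Hk Em]]]]].
  assert (m1 : Cmod m = 1).
  { rewrite Defs_Cpow in Em. apply (f_equal Cmod) in Em. change (Cmod (m ^ k) = Cmod 1) in Em. rewrite Cmod_pow, Cmod_1 in Em. assert (c0 := Cmod_ge_0 m).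
    destruct (Rtotal_order (Cmod m) 1) as [L|[L|L]]; [|exact L|].
    - exfalso. assert (A := pow_lt_1_compat (Cmod m) k (conj c0 L) ltac:(lia)). lra.
    - exfalso. assert (A := Rlt_pow_R1 (Cmod m) k L ltac:(lia)). lra. }
  destruct (classic (basin p)) as [Hb|Hb]; [exfalso; destruct (basin_forward p Hb) as [_ A]; rewrite Ep in A; lra|].
  destruct p as [z|]; [|exfalso; apply Hb; exact I]. assert (Ho : outer M z) by (apply NNPP, Hb).
  destruct (Rlt_le_dec (Cmod z) rho) as [Hz|Hz].
  - exfalso. destruct (sgn n) eqn:En.
    + destruct (inner_cdiff En z Hz) as [A [_ [mm [B1 B2]]]]. rewrite (proj2 (multiplier_of_cdiff z mm A B1) m Hm) in m1. lra.
    + assert (A := inner_even (Fin z) En (ex_intro _ z (conj eq_refl Hz))). rewrite Ep in A. exact (A Ho).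
  - assert (Hz0 : (z : C) <> 0%C) by (apply Cmod_pos_neq; destruct rh_pos; lra). destruct (cexp_surj z Hz0) as [x Ex]. rewrite <- Ex in *.
    assert (Hx : dom x). { split; [exact Ho|]. apply Rnot_lt_le. intros L. rewrite Cmod_cexp in Hz. apply exp_increasing in L. unfold rho in Hz. lra. }
    destruct (Ceq_dec (denz (cexp x)) 0) as [E|E]; [exfalso; rewrite F_pole in Ep by exact E; discriminate|].
    rewrite F_regular in Ep by exact E. apply denz_cexp in E. assert (EP : (Pformula n d a (cexp x) : C) = cexp x) by exact (Fin_inj _ _ Ep).
    destruct (strip_of_image x x E EP Hx) as [i [Hi Hs]]. destruct (Gf_complete i x x Hi Hs Hx (proj1 E) EP) as [j Ej].
    set (y := (x + tpi j)%C) in *. assert (Hy : dom y) by (apply dom_tpi, Hx). assert (Ey : cexp y = cexp x) by apply cexp_add_tpi.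
    assert (Lm : @eq C m (Lf i y)).
    { rewrite (strip_multiplier (S i) x m ltac:(lia) E Hs Hm). unfold Lf. rewrite <- Ej, Ey. assert (Yx : yprime n d a (cexp x) = Yp y).
      { unfold yprime, Yp. rewrite EP, Ey. reflexivity. } rewrite Yx. assert (K := N0). field. split; [apply cexp_neq_0|exact K]. }
    rewrite Lm in m1. destruct (Nat.eq_dec i 0) as [->|Hne]; [|exfalso; assert (A := Lf_inner i y ltac:(lia) Hy); lra].
    assert (Ew : cexp (- y) = cexp (- x)) by (rewrite !cexp_opp, Ey; reflexivity).
    destruct (Rle_lt_dec (Cmod (1 - cexp (- x))) (/ M5)) as [L|L].
    + assert (A := Lf_near y Hy). rewrite <- Ej in A. assert (c0 := Cmod_ge_0 (1 - cexp (- x))).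
      assert (E1 : cexp (- x) = 1%C). { symmetry. apply Csub_eq_0. lra. } f_equal. rewrite <- (Cinv_inv (cexp x)), <- cexp_opp, E1 by apply cexp_neq_0. field.
    + exfalso. destruct (Lf_ge y Hy) as [_ A]. rewrite Ew in A. destruct mu_facts as [_ [_ [m3 _]]]. lra.
Qed.
End Dynamics.

(** * Choice of the parameters *)

Lemma dmax_ge d n i : (1 <= i <= n)%nat -> (d i <= dmax d n)%nat.
Proof.
  intros Hi. induction n as [|n IH]; [lia|]. simpl. destruct (Nat.eq_dec i (S n)) as [->|Hne]; [lia|]. lia.
Qed.

Lemma sum_f_R0_ge (f : nat -> R) N : (forall k, (k <= N)%nat -> 0 <= f k) -> 0 <= sum_f_R0 f N /\ forall i, (i <= N)%nat -> f i <= sum_f_R0 f N.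
Proof.
  induction N as [|N IH]; intros Hf.
  - split; [apply Hf; lia|]. intros i Hi. replace i with 0%nat by lia. simpl. lra.
  - destruct (IH ltac:(intros; apply Hf; lia)) as [A B]. assert (D := Hf (S N) (Nat.le_refl _)). simpl. split; [lra|].
    intros i Hi. destruct (Nat.eq_dec i (S N)) as [->|Hne]; [lra|]. specialize (B i ltac:(lia)). lra.
Qed.

(** A single degree [1], or two degrees equal to [2], would already make the sum at least [1]. *)
Lemma degrees (n : nat) (d : nat -> nat) : (2 <= n)%nat -> (forall i, (1 <= i <= n)%nat -> (0 < d i)%nat) ->
  sum_f_R0 (fun i => / INR (d (S i))) (n - 1) < 1 -> (forall i, (1 <= i <= n)%nat -> (2 <= d i <= dmax d n)%nat) /\ (3 <= dmax d n)%nat.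
Proof.
  intros Hn Hd Hs. set (f := fun i => / INR (d (S i))) in *.
  assert (Hf : forall k, (k <= n - 1)%nat -> 0 < f k) by (intros k Hk; apply Rinv_0_lt_compat, lt_0_INR, Hd; lia).
  assert (A : forall i, (1 <= i <= n)%nat -> (2 <= d i)%nat).
  { intros i Hi. destruct (le_lt_dec 2 (d i)) as [L|L]; [exact L|]. exfalso. assert (E : d i = 1%nat) by (generalize (Hd i Hi); lia).
    assert (B := proj2 (sum_f_R0_ge f (n - 1) ltac:(intros; left; apply Hf; auto)) (i - 1)%nat ltac:(lia)). unfold f in B at 1. replace (S (i - 1)) with i in B by lia. rewrite E in B. simpl in B. lra. }
  split; [intros i Hi; split; [apply A, Hi|apply dmax_ge, Hi]|].
  destruct (le_lt_dec 3 (dmax d n)) as [L|L]; [exact L|]. exfalso.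
  assert (E1 : d 1%nat = 2%nat) by (generalize (A 1%nat ltac:(lia)) (dmax_ge d n 1 ltac:(lia)); lia).
  assert (E2 : d 2%nat = 2%nat) by (generalize (A 2%nat ltac:(lia)) (dmax_ge d n 2 ltac:(lia)); lia).
  assert (B : 1 <= sum_f_R0 f (n - 1)).
  { assert (K : forall m, 1 <= sum_f_R0 f (S m) \/ (n - 1 < S m)%nat).
    { induction m as [|m [IH|IH]].
      - left. simpl. unfold f. rewrite E1, E2. simpl. lra.
      - destruct (le_lt_dec (S (S m)) (n - 1)) as [Q|Q]; [left|right; lia]. cbn [sum_f_R0] in *. generalize (Hf (S (S m)) Q). lra.
      - right. lia. }
    destruct (K (n - 2)%nat) as [Q|Q]; [|lia]. replace (S (n - 2)) with (n - 1)%nat in Q by lia. exact Q. }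
  lra.
Qed.

(** The order of choice: [M], [M5] and [eps] come from the estimates at the parabolic point and
    depend on the degrees only; [del] is chosen from them and from the constant of [pert_product].
    All are fixed before [s] and the [a_j]. *)
Lemma regime_constants (n : nat) (d : nat -> nat) : (2 <= n)%nat -> (forall i, (1 <= i <= n)%nat -> (2 <= d i <= dmax d n)%nat) -> (3 <= dmax d n)%nat ->
  exists del M M5 eps, 0 < del /\ 1000 * INR n * INR (dmax d n) ^ 3 * del <= 1 /\
    forall a al l, setup n d a al (dmax d n) l del -> regime n d a (dmax d n) del M M5 eps.
Proof.
  intros Hn Hd Hm. assert (d1 := Hd 1%nat ltac:(lia)). set (dm := dmax d n) in *.
  destruct (basin_trap (d 1%nat) ltac:(lia)) as [M [e1 [HM [He1 T1]]]].
  destruct (near_parabolic_expansion (d 1%nat) ltac:(lia)) as [Ma [e2 [HMa [He2 T2]]]].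
  destruct (asymptotic_translation (d 1%nat) ltac:(lia)) as [Mb [e3 [HMb [He3 T3]]]].
  destruct (pert_product d (n - 1)) as [K [HK T4]]. replace (S (n - 1)) with n in T4 by lia.
  set (M5 := Rmax (5 * (M + 1)) (Rmax Ma Mb)). set (eps := Rmin e1 (Rmin e2 e3)).
  assert (m1 : 5 * (M + 1) <= M5) by apply Rmax_l. assert (m2 : Ma <= M5) by (eapply Rle_trans; [apply Rmax_l|apply Rmax_r]). assert (m3 : Mb <= M5) by (eapply Rle_trans; [apply Rmax_r|apply Rmax_r]).
  assert (p1 : eps <= e1) by apply Rmin_l. assert (p2 : eps <= e2) by (eapply Rle_trans; [apply Rmin_r|apply Rmin_l]). assert (p3 : eps <= e3) by (eapply Rle_trans; [apply Rmin_r|apply Rmin_r]).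
  assert (p0 : 0 < eps) by (unfold eps; repeat apply Rmin_pos; assumption).
  assert (N2 : 2 <= INR n) by (apply (le_INR 2); lia). assert (M3 : 3 <= INR dm) by (replace 3 with (INR 3) by (simpl; ring); apply le_INR, Hm).
  assert (D2 : 2 <= INR (d 1%nat)) by (apply (le_INR 2); lia).
  set (q1 := 1000 * INR n * INR dm ^ 3). set (q2 := 40 * INR (d 1%nat) * (20 * INR n * INR dm) * (64 * (M5 + INR (d 1%nat)) ^ 2)).
  assert (q1p : 0 < q1). { unfold q1. assert (0 < INR dm ^ 3) by (apply pow_lt; lra). nra. }
  assert (q2p : 0 < q2) by (unfold q2; repeat apply Rmult_lt_0_compat; nra).
  set (del := Rmin (Rmin (/ q1) (/ q2)) (Rmin (eps / K) (/ (2 * K)))).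
  assert (c1 : del <= / q1) by (eapply Rle_trans; [apply Rmin_l|apply Rmin_l]). assert (c2 : del <= / q2) by (eapply Rle_trans; [apply Rmin_l|apply Rmin_r]).
  assert (c3 : del <= eps / K) by (eapply Rle_trans; [apply Rmin_r|apply Rmin_l]). assert (c4 : del <= / (2 * K)) by (eapply Rle_trans; [apply Rmin_r|apply Rmin_r]).
  assert (c0 : 0 < del) by (unfold del; repeat apply Rmin_pos; try apply Rinv_0_lt_compat; try lra; apply Rdiv_lt_0_compat; lra).
  assert (k1 : K * del <= eps). { apply (Rmult_le_compat_l K) in c3; [|lra]. replace (K * (eps / K)) with eps in c3 by (field; lra). exact c3. }
  assert (k2 : K * del <= / 2). { apply (Rmult_le_compat_l K) in c4; [|lra]. replace (K * / (2 * K)) with (/ 2) in c4 by (field; lra). exact c4. }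
  exists del, M, M5, eps. split; [exact c0|]. split.
  { apply (Rmult_le_compat_l q1) in c1; [|lra]. rewrite Rinv_r in c1 by lra. exact c1. }
  intros a al l HS. assert (Hb : forall j, (1 <= j <= n - 1)%nat -> Cmod (a j ^ DD d j) <= del) by (intros j Hj; apply (aD_small n d a al dm l del HS j Hj)).
  constructor; auto.
  - intros w C0 r Hp Hw Hphi. apply T1; auto. exact (pert_mono _ _ _ _ _ p1 Hp).
  - intros w C0 r Hp Hw Hs. apply T3; auto; [exact (pert_mono _ _ _ _ _ p3 Hp)|]. eapply Rle_trans; [exact Hs|]. apply Rinv_le_contravar; lra.
  - intros w C0 r th Hp Ht Hs Hf. apply T2; auto; [exact (pert_mono _ _ _ _ _ p2 Hp)| |].
    + eapply Rle_trans; [exact Ht|]. apply Rmult_le_compat_r; [apply Cmod_ge_0|exact p2].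
    + eapply Rle_trans; [exact Hs|]. apply Rinv_le_contravar; lra.
  - intros w Hw. destruct (T4 a w del Hb ltac:(lra) k2 Hw) as [A1 [A2 [_ A4]]]. split; [exact (pert_mono _ _ _ _ _ k1 A1)|]. split.
    + eapply Rle_trans; [exact A2|]. apply Rmult_le_compat_r; [apply Cmod_ge_0|exact k1].
    + intros j Hj. eapply Rle_trans; [apply A4, Hj|exact k2].
  - replace (40 * INR (d 1%nat) * (20 * INR n * INR dm * del) * (64 * (M5 + INR (d 1%nat)) ^ 2)) with (q2 * del) by (unfold q2; ring).
    apply (Rmult_le_compat_l q2) in c2; [|lra]. rewrite Rinv_r in c2 by lra. exact c2.
Qed.

Lemma setup_small (n : nat) (d : nat -> nat) (del : R) : (2 <= n)%nat -> (forall i, (1 <= i <= n)%nat -> (2 <= d i <= dmax d n)%nat) -> (3 <= dmax d n)%nat ->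
  sum_f_R0 (fun i => / INR (d (S i))) (n - 1) < 1 -> 0 < del -> 1000 * INR n * INR (dmax d n) ^ 3 * del <= 1 ->
  exists s0, 0 < s0 /\ forall (s : R) (a : nat -> C), 0 < s < s0 ->
    Cmod (a 1%nat) = Rpower (INR (dmax d n ^ 2) * s) (/ INR (d 1%nat)) ->
    (forall i, (2 <= i <= n - 1)%nat -> Cmod (a i) = Rpower s (/ INR (d i)) * Cmod (a (i - 1)%nat)) ->
    exists al l, setup n d a al (dmax d n) l del.
Proof.
  intros Hn Hd Hm Hs Hdel Hdel1. set (dm := dmax d n) in *. set (f := fun i => / INR (d (S i))) in *. set (Sg := sum_f_R0 f (n - 1)) in *.
  assert (Dp : forall i, (1 <= i <= n)%nat -> 2 <= INR (d i)) by (intros i Hi; apply (le_INR 2), Hd, Hi).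
  assert (M3 : 3 <= INR dm) by (replace 3 with (INR 3) by (simpl; ring); apply le_INR, Hm).
  assert (M9 : 0 < INR dm ^ 2) by (apply pow_lt; lra).
  (* [b1], [b2], [b3] and [b4] are the thresholds on [ln s] for [su_l], [su_s1], [su_LK] and [su_4],
     in this order. *)
  set (b1 := INR dm * ln del). set (b2 := INR (d 1%nat) * ln del - ln (INR dm ^ 2)). set (b3 := 2 * ln del - ln 4 - Lc d dm).
  set (b4 := (2 * ln del - Lc d dm - ln 4 + ln (INR dm ^ 2) / INR (d 1%nat)) / (1 - Sg)).
  exists (exp (Rmin (Rmin b1 b2) (Rmin b3 b4))). split; [apply exp_pos|]. intros s a [s0 s1] Ha1 Hai. set (l := ln s).
  assert (L : l < Rmin (Rmin b1 b2) (Rmin b3 b4)) by (unfold l; apply exp_lt_inv; rewrite exp_ln by exact s0; exact s1).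
  assert (L1 : l <= b1) by (left; eapply Rlt_le_trans; [exact L|]; eapply Rle_trans; [apply Rmin_l|apply Rmin_l]).
  assert (L2 : l <= b2) by (left; eapply Rlt_le_trans; [exact L|]; eapply Rle_trans; [apply Rmin_l|apply Rmin_r]).
  assert (L3 : l <= b3) by (left; eapply Rlt_le_trans; [exact L|]; eapply Rle_trans; [apply Rmin_r|apply Rmin_l]).
  assert (L4 : l <= b4) by (left; eapply Rlt_le_trans; [exact L|]; eapply Rle_trans; [apply Rmin_r|apply Rmin_r]).
  assert (Ha : forall j, (1 <= j <= n - 1)%nat -> Cmod (a j) = exp (ln (INR dm ^ 2) / INR (d 1%nat) + l * sum_f_R0 f (j - 1))).
  { induction j as [|j IH]; [lia|]. intros Hj. destruct (Nat.eq_dec j 0) as [->|Hne].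
    - rewrite Ha1. unfold Rpower. f_equal. rewrite pow_INR, ln_mult by lra. fold l. simpl sum_f_R0. unfold f. field. generalize (Dp 1%nat ltac:(lia)). lra.
    - rewrite Hai by lia. replace (S j - 1)%nat with j by lia. rewrite IH by lia. unfold Rpower. rewrite <- exp_plus. f_equal. fold l.
      destruct j as [|j]; [lia|]. replace (S j - 1)%nat with j by lia. cbn [sum_f_R0]. unfold f. ring. }
  set (al := fun j => epsilon (inhabits (RtoC 0)) (fun x => cexp x = a j)).
  assert (Hal : forall j, (1 <= j <= n - 1)%nat -> cexp (al j) = a j).
  { intros j Hj. unfold al. apply epsilon_spec, cexp_surj, Cmod_pos_neq. rewrite Ha by exact Hj. apply exp_pos. }
  assert (Hfst : forall j, (1 <= j <= n - 1)%nat -> fst (al j) = ln (INR dm ^ 2) / INR (d 1%nat) + l * sum_f_R0 f (j - 1)).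
  { intros j Hj. apply exp_inv. rewrite <- Cmod_cexp, Hal, Ha by exact Hj. reflexivity. }
  assert (F1 := Hfst 1%nat ltac:(lia)). simpl sum_f_R0 in F1. unfold f in F1. assert (D1 := Dp 1%nat ltac:(lia)).
  exists al, l. constructor; auto.
  - rewrite F1. field. lra.
  - intros i Hi. rewrite !Hfst by lia. destruct i as [|[|i]]; [lia|lia|]. replace (S (S i) - 1 - 1)%nat with i by lia. replace (S (S i) - 1)%nat with (S i) by lia. cbn [sum_f_R0]. unfold f at 2.
    assert (D := Dp (S (S i)) ltac:(lia)). field. lra.
  - rewrite F1. unfold b2 in L2. apply (Rmult_le_reg_l (INR (d 1%nat))); [lra|].
    replace (INR (d 1%nat) * (ln (INR dm ^ 2) / INR (d 1%nat) + l * / INR (d 1%nat))) with (ln (INR dm ^ 2) + l) by (field; lra). lra.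
  (* [ln |a_(n-1)| + l / d_n] is a constant plus [l Sg], while [LK] is a constant plus [l]. As
     [Sg < 1], the inequality holds once [l] is sufficiently negative; this is what [b4]
     expresses. *)
  - rewrite Hfst by lia. assert (ES : Sg = sum_f_R0 f (n - 1 - 1) + / INR (d n)).
    { unfold Sg. replace (n - 1)%nat with (S (n - 1 - 1)) at 1 by lia. cbn [sum_f_R0]. unfold f at 2. replace (S (S (n - 1 - 1))) with n by lia. reflexivity. }
    unfold b4 in L4. apply (Rle_div_r l) in L4; [|lra]. unfold LK, Rdiv. unfold Rdiv in L4. nra.
  - unfold LK. unfold b3 in L3. lra.
Qed.

Theorem theorem1p2 (n : nat) (d : nat -> nat) :
  (2 <= n)%nat ->
  (forall i, (1 <= i <= n)%nat -> (0 < d i)%nat) ->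
  sum_f_R0 (fun i => / INR (d (S i))) (n - 1) < 1 ->
  exists s0, 0 < s0 /\
    forall (s : R) (a : nat -> Cx), 0 < s < s0 ->
      Cnorm (a 1%nat) = Rpower (INR (dmax d n ^ 2) * s) (/ INR (d 1%nat)) ->
      (forall i, (2 <= i <= n - 1)%nat ->
         Cnorm (a i) = Rpower s (/ INR (d i)) * Cnorm (a (i - 1)%nat)) ->
      let F := ext (Pformula n d a) in
      cantor_set_of_circles (julia F) /\
      is_parabolic_fixed F (Some Cx1) /\ is_multiplier F (Some Cx1) Cx1 /\
      (forall p, is_parabolic_fixed F p -> p = Some Cx1).
Proof.
  intros Hn Hd Hs. destruct (degrees n d Hn Hd Hs) as [Hd2 Hm].
  destruct (regime_constants n d Hn Hd2 Hm) as [del [M [M5 [eps [Hdel [Hdel1 Hreg]]]]]].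
  destruct (setup_small n d del Hn Hd2 Hm Hs Hdel Hdel1) as [s0 [Hs0 Hset]].
  exists s0. split; [exact Hs0|]. intros s a Hs1 H1 Hi F.
  destruct (Hset s a Hs1) as [al [l HS]].
  { rewrite <- Cnorm_Cmod. exact H1. }
  { intros i Hi2. rewrite <- !Cnorm_Cmod. apply Hi, Hi2. }
  assert (HR := Hreg a al l HS). destruct (parabolic_at_1 n d a al (dmax d n) l del HS M M5 eps HR) as [E1 E2].
  split; [exact (julia_cantor_circles n d a al (dmax d n) l del HS M M5 eps HR)|]. split; [|split; [exact E2|]].
  - split; [exact E1|]. exists Cx1. split; [exact E2|]. exists 1%nat. split; [lia|]. rewrite Defs_Cpow. apply (Cpow_1_l 1).
  - intros p Hp. exact (parabolic_unique n d a al (dmax d n) l del HS M M5 eps HR p Hp).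
Qed.
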